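(* Let $a>0$ and let $K\in L^\infty(\Omega_0)\cap L^1(\Omega_0)$ be real-valued with $\|K\|_{L^\infty(\Omega_0)}\,a^2<\tfrac12$ and $$(\mathcal{J}_1,K\mathcal{J}_1)_f=\int_{\Omega_0}K(x)\,\mathcal{J}_1(x_2)^2 f(x)\,dx>0 .$$ Then, with $\gamma:=E_1-\inf\sigma(H_K)$, one has $\gamma>0$ and $$\big\|e^{-tH_K}\big\|_{L^2_f(\Omega_0)\to L^2_f(\Omega_0)}=e^{\gamma t}\,e^{-E_1t}\qquad\text{for each }t\ge0 .$$ Moreover, if additionally $\lim_{|x_1|\to\infty}\operatorname{ess\,sup}_{x_2\in(-a,a)}|K(x_1,x_2)|=0$, then there exists a unique non-negative normalized $\phi_0\in L^2_f(\Omega_0)$ (evaluated pointwise through its continuous representative) such that for every bounded measurable set $B\subset\Omega_0$ and every $x\in\Omega_0$ $$\lim_{t\to\infty}e^{-(\gamma-E_1)t}\,\mathbb{P}_x\big(X_t\in B,\tau_{\Omega_0}>t\big)=\phi_0(x)\int_B\phi_0(y)f(y)\,dy .$$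
   Context: $\Omega_0:=\mathbb{R}\times(-a,a)$, points are $x=(x_1,x_2)$. $K$ is represented by a measurable function with $|K|\le\|K\|_{L^\infty(\Omega_0)}$ everywhere. For each $x_1\in\mathbb{R}$, $f(x_1,\cdot)\in H^2((-a,a))$ is the solution of the Jacobi equation $\partial_2^2 f+Kf=0$ with $f(x_1,0)=1$, $\partial_2 f(x_1,0)=0$ (under the assumption $\|K\|_\infty a^2<1/2$, $f$ is bounded and uniformly positive on $\Omega_0$). $L^2_f(\Omega_0):=L^2(\Omega_0,f(x)\,dx)$ with inner product $(\cdot,\cdot)_f$ and norm $\|\cdot\|_f$; ''normalized'' means $\|\phi_0\|_f=1$. $H_K$ is the self-adjoint operator in $L^2_f(\Omega_0)$ associated with the closed quadratic form $h_K[\psi]:=\int_{\Omega_0}\big(f^{-1}|\partial_1\psi|^2+f|\partial_2\psi|^2\big)dx$ with domain $H_0^1(\Omega_0)$. $E_1:=(\pi/(2a))^2$ and $\mathcal{J}_1(x_2):=a^{-1/2}\sin\!\big(\sqrt{E_1}\,(x_2+a)\big)$ is the normalized first Dirichlet eigenfunction of $-d^2/dx_2^2$ on $(-a,a)$. Extend $f$ by $1$ to $\mathbb{R}^2$. $(X_t)_{t\ge0}$ is the conservative strong Markov process with continuous paths associated with the Dirichlet form $\int_{\mathbb{R}^2}(f^{-1}|\partial_1\psi|^2+f|\partial_2\psi|^2)dx$, $\psi\in H^1(\mathbb{R}^2)$, in $L^2(\mathbb{R}^2,f\,dx)$; $\mathbb{P}_x$ is the law started at $x$ and $\tau_{\Omega_0}$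 is the first hitting time of $\partial\Omega_0$. For $x\in\Omega_0$ and $B\subset\Omega_0$ bounded measurable, $\mathbb{P}_x(X_t\in B,\tau_{\Omega_0}>t)$ is the value at $x$ of the continuous representative of $e^{-tH_K}\chi_B$. *)

(* Defs.v *)
From HB Require Import structures.
From mathcomp Require Import all_boot all_order all_algebra.
From mathcomp Require Import all_classical all_reals all_analysis.
From mathcomp.real_closed Require Import complex.

Set Implicit Arguments.
Unset Strict Implicit.
Unset Printing Implicit Defensive.

Import Order.TTheory GRing.Theory Num.Theory numFieldNormedType.Exports.

Local Open Scope classical_set_scope.
Local Open Scope ring_scope.

(* Elements of L^2 are represented by functions that are only relevant on D
   and up to almost-everywhere equality there. *)

Notation leb R := (@lebesgue_measure R).
Notation leb2 R := (@lebesgue_measure R \x @lebesgue_measure R)%E.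

Section FunctionSpaces.
Context {R : realType}.
Local Notation plane := (R * R)%type.
Local Notation field := (R * R -> R[i]).

Definition strip (a : R) : set plane := [set x | - a < x.2 < a].

Definition fiber (a : R) : set R := [set x2 | - a < x2 < a].

Definition boundary {T : topologicalType} (D : set T) : set T :=
  closure D `\` interior D.

(* C_c^oo(D): every iterated directional derivative is differentiable. *)
Definition test_function {V : normedModType R} (D : set V) (phi : V -> R) :=
  (forall (s : seq V) (x : V),
     differentiable (foldr (fun v g => 'D_v g) phi s) x) /\
  (exists A : set V, [/\ compact A, A `<=` D & forall x, ~ A x -> phi x = 0]).

Definition sqnormc (z : R[i]) : R := complex.Re z ^+ 2 + complex.Im z ^+ 2.

Definition cintegral (D : set plane) (F : field) : R[i] :=
  Complex (\int[leb2 R]_(x in D) complex.Re (F x))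
          (\int[leb2 R]_(x in D) complex.Im (F x)).

(* L^2(D, w dx) *)
Definition L2 (D : set plane) (w : plane -> R) (u : field) : Prop :=
  [/\ measurable_fun D (fun x => complex.Re (u x)),
      measurable_fun D (fun x => complex.Im (u x)) &
      (\int[leb2 R]_(x in D) (sqnormc (u x) * w x)%:E < +oo)%E].

Definition inner (D : set plane) (w : plane -> R) (u v : field) : R[i] :=
  cintegral D (fun x => ((u x)^*)%C * v x * ((w x)%:C)%C).

Definition norm2 (D : set plane) (w : plane -> R) (u : field) : R :=
  Num.sqrt (\int[leb2 R]_(x in D) (sqnormc (u x) * w x)).

(* [h] is the weak derivative of [u] on D in the direction v. *)
Definition weak_partial (D : set plane) (v : plane) (u h : field) : Prop :=
  forall phi : plane -> R, test_function D phi ->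
    cintegral D (fun x => u x * (('D_v phi x)%:C)%C) =
    - cintegral D (fun x => h x * ((phi x)%:C)%C).

Definition e1 : plane := (1, 0).
Definition e2 : plane := (0, 1).

(* u belongs to H^1(D) and has weak gradient (g.1, g.2). *)
Definition H1 (D : set plane) (u : field) (g : field * field) : Prop :=
  [/\ L2 D (cst 1) u, L2 D (cst 1) g.1, L2 D (cst 1) g.2,
      weak_partial D e1 u g.1 & weak_partial D e2 u g.2].

Definition ctest_function (D : set plane) (phi : field) : Prop :=
  test_function D (fun x => complex.Re (phi x)) /\
  test_function D (fun x => complex.Im (phi x)).

Definition cpartial (v : plane) (phi : field) : field := fun x =>
  Complex ('D_v (fun y => complex.Re (phi y)) x)
          ('D_v (fun y => complex.Im (phi y)) x).

(* H^1_0(D), the closure of C_c^oo(D) in H^1(D). *)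
Definition H10 (D : set plane) (u : field) (g : field * field) : Prop :=
  H1 D u g /\
  forall eps : R, 0 < eps -> exists phi : field,
    [/\ ctest_function D phi,
        norm2 D (cst 1) (u \- phi) < eps,
        norm2 D (cst 1) (g.1 \- cpartial e1 phi) < eps &
        norm2 D (cst 1) (g.2 \- cpartial e2 phi) < eps].

(* \int_D (w^-1 |d_1 psi|^2 + w |d_2 psi|^2), polarized, in terms of the weak
   gradients g and k of the two arguments. *)
Definition jacobi_form (D : set plane) (w : plane -> R)
    (g k : field * field) : R[i] :=
  inner D (fun x => (w x)^-1) g.1 k.1 + inner D w g.2 k.2.

(* Graph of the operator in L^2(D, w dx) associated with [jacobi_form D w] on
   the form domain dom (given with weak gradients). *)
Definition form_operator (D : set plane) (w : plane -> R)
    (dom : field -> field * field -> Prop) (psi eta : field) : Prop :=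
  L2 D w eta /\
  exists2 k, dom psi k &
    forall phi g, dom phi g -> jacobi_form D w g k = inner D w phi eta.

End FunctionSpaces.

Section OperatorTheory.
Context {R : realType}.
Local Notation plane := (R * R)%type.
Local Notation field := (R * R -> R[i]).
Variables (D : set plane) (w : plane -> R).

(* An unbounded operator in L^2(D, w dx) is given by its graph G. *)
Definition resolvent_set (G : field -> field -> Prop) : set R[i] :=
  [set z | exists c : R, forall eta, L2 D w eta ->
     exists psi, [/\ G psi (fun x => eta x + z * psi x),
       norm2 D w psi <= c * norm2 D w eta &
       forall psi', G psi' (fun x => eta x + z * psi' x) ->
         ae_eq (leb2 R) D psi' psi]].

Definition spectrum (G : field -> field -> Prop) : set R[i] :=
  ~` resolvent_set G.

(* Meant for operators with real spectrum. *)
Definition inf_spectrum (G : field -> field -> Prop) : R :=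
  inf [set complex.Re z | z in spectrum G].

Definition operator_norm (A : field -> field) : \bar R :=
  ereal_sup [set (norm2 D w (A u))%:E |
             u in [set u | L2 D w u /\ norm2 D w u <= 1]].

(* (T t)_{t >= 0} is (e^{-tG})_{t >= 0}: a strongly continuous semigroup of
   bounded linear operators on L^2(D, w dx) whose generator is -G. *)
Record semigroup_exp (G : field -> field -> Prop)
    (T : R -> field -> field) : Prop := {
  semigroup_L2 : forall t u, 0 <= t -> L2 D w u -> L2 D w (T t u) ;
  semigroup_linear : forall t (c : R[i]) u v, 0 <= t -> L2 D w u -> L2 D w v ->
    ae_eq (leb2 R) D (T t (fun x => c * u x + v x))
                     (fun x => c * T t u x + T t v x) ;
  semigroup_bounded : forall t, 0 <= t -> exists c : R, forall u, L2 D w u ->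
    norm2 D w (T t u) <= c * norm2 D w u ;
  semigroup_0 : forall u, L2 D w u -> ae_eq (leb2 R) D (T 0 u) u ;
  semigroup_D : forall s t u, 0 <= s -> 0 <= t -> L2 D w u ->
    ae_eq (leb2 R) D (T (s + t) u) (T s (T t u)) ;
  semigroup_cvg : forall u, L2 D w u ->
    norm2 D w (T t u \- u) @[t --> 0^'+] --> (0 : R) ;
  semigroup_generator : forall u v, L2 D w u -> L2 D w v ->
    (G u v <->
     norm2 D w (fun x => ((t^-1)%:C)%C * (u x - T t u x) - v x)
       @[t --> 0^'+] --> (0 : R)) ;
}.

End OperatorTheory.

Section Strip.
Context {R : realType}.
Local Notation plane := (R * R)%type.
Local Notation field := (R * R -> R[i]).

Definition Linfty_strip (a : R) (K : plane -> R) : \bar R :=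
  'N[leb2 R]_+oo[EFin \o patch (cst (0 : R)%R) (strip a) K]%E.

Definition slice_sup (a : R) (K : plane -> R) (x1 : R) : \bar R :=
  'N[leb R]_+oo[EFin \o patch (cst (0 : R)%R) (fiber a) (fun x2 => K (x1, x2))]%E.

Definition L2_1d (I : set R) (u : R -> R) : Prop :=
  measurable_fun I u /\ (\int[leb R]_(y in I) (u y ^+ 2)%:E < +oo)%E.

Definition weak_deriv_1d (I : set R) (u h : R -> R) : Prop :=
  forall eta : R -> R, test_function I eta ->
    \int[leb R]_(y in I) (u y * derive1 eta y) =
    - \int[leb R]_(y in I) (h y * eta y).

(* u is the continuous representative of an element of H^2(I), with continuous
   first derivative u1 and weak second derivative u2. *)
Definition H2_1d (I : set R) (u u1 u2 : R -> R) : Prop :=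
  [/\ [/\ L2_1d I u, L2_1d I u1 & L2_1d I u2],
      weak_deriv_1d I u u1, weak_deriv_1d I u1 u2,
      {in I, continuous u} & {in I, continuous u1}].

Definition jacobi_solution (a : R) (K f : plane -> R) : Prop :=
  forall x1 : R, exists u1 u2 : R -> R,
    [/\ H2_1d (fiber a) (fun y => f (x1, y)) u1 u2,
        ae_eq (leb R) (fiber a) (fun y => u2 y + K (x1, y) * f (x1, y)) (cst 0),
        f (x1, 0) = 1 & u1 0 = 0].

Definition extend1 (a : R) (f : plane -> R) : plane -> R :=
  fun x => if x \in strip a then f x else 1.

Definition H_K (a : R) (f : plane -> R) : field -> field -> Prop :=
  form_operator (strip a) f (H10 (strip a)).

Definition H_plane (a : R) (f : plane -> R) : field -> field -> Prop :=
  form_operator setT (extend1 a f) (H1 setT).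

Definition E1 (a : R) : R := (pi / (2 * a)) ^+ 2.

Definition J1 (a x2 : R) : R :=
  (Num.sqrt a)^-1 * sin (Num.sqrt (E1 a) * (x2 + a)).

Definition cindic (B : set plane) : field := fun x => ((\1_B x : R)%:C)%C.

End Strip.

Section Process.
Context {R : realType} {d : measure_display} {W : measurableType d}.
Local Notation plane := (R * R)%type.
Variables (P : R.-pker plane ~> W) (X : R -> W -> plane).

Definition natural_filtration (t : R) : set (set W) :=
  <<s [set A | exists s B, [/\ 0 <= s <= t, measurable B & A = X s @^-1` B]] >>.

Definition stopping_time (S : W -> \bar R) : Prop :=
  (forall w, 0 <= S w)%E /\
  forall t, 0 <= t -> natural_filtration t [set w | (S w <= t%:E)%E].

Definition stopped_sigma_algebra (S : W -> \bar R) : set (set W) :=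
  [set A | measurable A /\ forall t, 0 <= t ->
     natural_filtration t (A `&` [set w | (S w <= t%:E)%E])].

(* Conservative: X takes its values in the plane for all times. *)
Record continuous_strong_markov : Prop := {
  process_measurable : forall t, 0 <= t -> measurable_fun setT (X t) ;
  process_continuous : forall w, {within `[0, +oo[, continuous (X ^~ w)} ;
  process_start : forall x, P x [set w | X 0 w = x] = 1%E ;
  process_markov : forall x S A s B, stopping_time S ->
    stopped_sigma_algebra S A -> 0 <= s -> measurable B ->
    P x (A `&` [set w | (S w < +oo)%E /\ B (X (fine (S w) + s) w)]) =
    (\int[P x]_(w in A `&` [set w | S w < +oo])
       P (X (fine (S w)) w) (X s @^-1` B))%E ;
}.

Definition hitting_time (C : set plane) (w : W) : \bar R :=
  ereal_inf [set s%:E | s in [set s | 0 <= s /\ C (X s w)]].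

(* P_x(X_t \in B, tau > t), tau being the hitting time of the boundary. *)
Definition survival_prob (a : R) (t : R) (B : set plane) (x : plane) : \bar R :=
  P x [set w | B (X t w) /\ (t%:E < hitting_time (boundary (strip a)) w)%E].

(* The transition function is a version of the L^2(R^2, f dx)-semigroup of the
   Dirichlet form on H^1(R^2), with f extended by 1. *)
Definition associated_process (a : R) (f : plane -> R) : Prop :=
  exists2 S, semigroup_exp setT (extend1 a f) (H_plane a f) S &
    forall t (B : set plane), 0 <= t -> measurable B -> bounded_set B ->
      ae_eq (leb2 R) setT
        (fun x => ((fine (P x (X t @^-1` B)))%:C)%C) (S t (cindic B)).

(* Inside the strip, P_x(X_t \in B, tau > t) is the value at x of the
   continuous representative of e^{-t H_K} \chi_B, for every x; T t stands for
   e^{-t H_K}. *)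
Definition killed_semigroup (a : R) (T : R -> (plane -> R[i]) -> plane -> R[i]) :
    Prop :=
  forall t (B : set plane), 0 < t ->
    measurable B -> bounded_set B -> B `<=` strip a ->
    exists u : plane -> R,
      [/\ {in strip a, continuous u},
          ae_eq (leb2 R) (strip a) (fun x => ((u x)%:C)%C) (T t (cindic B)) &
          forall x, strip a x -> survival_prob a t B x = (u x)%:E].

(* phi is the continuous representative of a nonnegative normalized element of
   L^2_f for which the limit holds, with rate r. *)
Definition limit_profile (a : R) (f : plane -> R) (r : R) (phi : plane -> R) :
    Prop :=
  [/\ {in strip a, continuous phi},
      forall x, strip a x -> 0 <= phi x,
      L2 (strip a) f (fun x => ((phi x)%:C)%C),
      norm2 (strip a) f (fun x => ((phi x)%:C)%C) = 1 &
      forall (B : set plane) (x : plane),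
        measurable B -> bounded_set B -> B `<=` strip a -> strip a x ->
        (expR (- r * t) * fine (survival_prob a t B x)) @[t --> +oo] -->
        phi x * \int[leb2 R]_(y in B) (phi y * f y)].

End Process.

(* Main.v *)
(* Idea. Let m be the bottom of the form h_K. Testing with zeta(x_1 / n) J_1(x_2) and using
   f'' = - K f, the value of h_K - E_1 |.|_f^2 tends to - (J_1, K J_1)_f / 2 < 0, so m < E_1;
   e^{-tH} has norm e^{-mt} since m is also the bottom of the spectrum.

   If K vanishes at infinity then f tends to 1 there, and the Poincare inequality on the
   slices shows that near-minimizers keep a definite part of their mass in a bounded
   region. A Nash inequality makes e^{-tH} bounded from L^2 to L^infinity, which gives
   continuous versions of e^{-tH} v for every v from those of the indicators; so weakly null
   near-minimizers are impossible and e^{t(m-H)} converges strongly to a nonzero projection.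
   Its range is spanned by a positive function phi_0: it is stable under v -> |v|, and a
   nonnegative fixed function with a zero on the boundary of its positivity set would
   contradict P_x(X_0 = x) = 1 and the continuity of paths. Applying one more smoothing step
   turns the strong limit into the pointwise one. *)
Require Import Defs.
From HB Require Import structures.
From mathcomp Require Import all_boot all_order all_algebra.
From mathcomp Require Import all_classical all_reals all_analysis.
From mathcomp Require Import measurable_realfun ess_sup_inf hoelder.
From mathcomp.real_closed Require Import complex.
From mathcomp Require Import ring lra.
Import Order.TTheory GRing.Theory Num.Theory numFieldNormedType.Exports.
Local Open Scope classical_set_scope.
Local Open Scope ring_scope.
Set Implicit Arguments.
Unset Strict Implicit.
Unset Printing Implicit Defensive.

(** * Real Hilbert spaces *)

(** The semigroup is known only through its axioms and the operator only through its form, so there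
    is no spectral calculus to start from. Two identities for a symmetric contraction semigroup
    replace it: [|T (t / 2) u|^2 = ip u (T t u)], which gives the lower bound of the norm and the
    existence of the limit, and the derivative of [|T t u|^2], which gives decay. Regularity theory
    is absent as well: [f] solves an equation on each slice only, so its joint measurability has to
    be proved, and continuous versions are given only for images of indicators. Null functions are
    never quotiented out: identities between vectors are tested against all vectors and turned into
    almost everywhere equalities where needed. Complex fields are pairs of real functions with
    multiplication by i as a rotation, so the Hilbert space arguments are all real. With kappa the
    supremum of |K|, the condition kappa a^2 < 1/2 gives 1 - 2 kappa a^2 <= f <= 2, which makes f
    and 1/f admissible weights. *)

Lemma cvg_sqrt0 (R : realType) (T : Type) (F : set_system T) (FF : Filter F)
    (g : T -> R) : g n @[n --> F] --> (0 : R) -> Num.sqrt (g n) @[n --> F] --> (0 : R).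
Proof.
move=> h; have := cvg_comp _ _ h (@sqrt_continuous R 0).
by rewrite sqrtr0.
Qed.

(** [b (t v + u) (t v + u)] is a nonnegative polynomial in [t]: its minimum gives the bound, and
    when [b v v = 0] it is affine, so its slope vanishes. Definiteness is not assumed, since this is
    also applied to [q - m ip], which degenerates on minimizers. *)
Lemma psd_CS2 (R : realType) (V : lmodType R) (b : V -> V -> R) u v :
  (forall x y, b x y = b y x) ->
  (forall c x y z, b (c *: x + y) z = c * b x z + b y z) ->
  (forall x, 0 <= b x x) -> b u v ^+ 2 <= b u u * b v v.
Proof.
move=> bC bl b0.
have h (t : R) : 0 <= b u u + 2 * t * b u v + t ^+ 2 * b v v.
  have := b0 (t *: v + u); rewrite bl [b v _]bC [b u _]bC !bl [b v u]bC.
  by move=> h; apply: le_trans h _; rewrite le_eqVlt; apply/orP; left; apply/eqP; ring.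
have uu := b0 u; have vv := b0 v.
have [v0|v0] := eqVneq (b v v) 0.
  rewrite v0 mulr0.
  have [->|uv0] := eqVneq (b u v) 0; first by rewrite expr0n.
  have := h (- (b u u + 1) / (2 * b u v)); rewrite v0 mulr0 addr0.
  have -> : 2 * (- (b u u + 1) / (2 * b u v)) * b u v = - (b u u + 1).
    by field.
  lra.
have := h (- b u v / b v v).
have -> : b u u + 2 * (- b u v / b v v) * b u v + (- b u v / b v v) ^+ 2 * b v v
   = (b u u * b v v - b u v ^+ 2) / b v v by field.
have vp : 0 < b v v by rewrite lt_neqAle eq_sym v0.
by rewrite pmulr_lge0 ?invr_gt0// subr_ge0.
Qed.

Section Hilbert.
Context {R : realType} {V : lmodType R}.

(* Elements are not identified when their difference has norm 0. *)
Record hilbert (ip : V -> V -> R) : Prop := {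
  ipC : forall u v, ip u v = ip v u ;
  ip_lin : forall c u v w, ip (c *: u + v) w = c * ip u w + ip v w ;
  ip_ge0 : forall u, 0 <= ip u u ;
  ip_complete : forall u_ : nat -> V,
    (forall e, 0 < e -> exists N : nat, forall m n, (N <= m)%N -> (N <= n)%N ->
       ip (u_ m - u_ n) (u_ m - u_ n) <= e) ->
    exists l, ip (u_ n - l) (u_ n - l) @[n --> \oo] --> (0 : R) }.

Variable ip : V -> V -> R.
Hypothesis H : hilbert ip.

Definition ipn (u : V) : R := Num.sqrt (ip u u).
Local Notation nrm := ipn.

Lemma ip0l v : ip 0 v = 0.
Proof.
have := ip_lin H 1 0 0 v; rewrite scaler0 addr0 mul1r => h; lra.
Qed.
Lemma ipDl u v w : ip (u + v) w = ip u w + ip v w.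
Proof. by have := ip_lin H 1 u v w; rewrite scale1r mul1r. Qed.
Lemma ipZl c u w : ip (c *: u) w = c * ip u w.
Proof. by have := ip_lin H c u 0 w; rewrite addr0 ip0l addr0. Qed.
Lemma ipNl u w : ip (- u) w = - ip u w.
Proof. by rewrite -scaleN1r ipZl mulN1r. Qed.
Lemma ipBl u v w : ip (u - v) w = ip u w - ip v w.
Proof. by rewrite ipDl ipNl. Qed.
Lemma ip0r v : ip v 0 = 0. Proof. by rewrite (ipC H) ip0l. Qed.
Lemma ipDr u v w : ip w (u + v) = ip w u + ip w v.
Proof. by rewrite !(ipC H w) ipDl. Qed.
Lemma ipZr c u w : ip w (c *: u) = c * ip w u.
Proof. by rewrite !(ipC H w) ipZl. Qed.
Lemma ipNr u w : ip w (- u) = - ip w u.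
Proof. by rewrite !(ipC H w) ipNl. Qed.
Lemma ipBr u v w : ip w (u - v) = ip w u - ip w v.
Proof. by rewrite !(ipC H w) ipBl. Qed.
Definition ipE := (ipDl, ipDr, ipNl, ipNr, ipZl, ipZr).

Lemma ip_CS2 u v : ip u v ^+ 2 <= ip u u * ip v v.
Proof. by apply: psd_CS2; [exact: ipC H|exact: ip_lin H|exact: ip_ge0 H]. Qed.

Lemma ipn_ge0 u : 0 <= nrm u. Proof. exact: sqrtr_ge0. Qed.
Lemma sqr_ipn u : nrm u ^+ 2 = ip u u.
Proof. by rewrite sqr_sqrtr// (ip_ge0 H). Qed.
Lemma ip_CS u v : `|ip u v| <= nrm u * nrm v.
Proof.
rewrite -(@ler_pXn2r _ 2)// ?nnegrE ?mulr_ge0 ?ipn_ge0//.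
by rewrite exprMn !sqr_ipn real_normK ?num_real// ip_CS2.
Qed.
Lemma ip_le u v : ip u v <= nrm u * nrm v.
Proof. exact: le_trans (ler_norm _) (ip_CS u v). Qed.
Lemma ipn_triangle u v : nrm (u + v) <= nrm u + nrm v.
Proof.
rewrite -(@ler_pXn2r _ 2)// ?nnegrE ?addr_ge0 ?ipn_ge0//.
rewrite sqr_ipn sqrrD !sqr_ipn !ipE (ipC H v u).
have := ip_le u v; lra.
Qed.
Lemma ipnZ c u : nrm (c *: u) = `|c| * nrm u.
Proof.
by rewrite /ipn ipZl ipZr mulrA -expr2 sqrtrM ?sqr_ge0// sqrtr_sqr.
Qed.
Lemma ipnN u : nrm (- u) = nrm u.
Proof. by rewrite -scaleN1r ipnZ normrN1 mul1r. Qed.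
Lemma ipn0 : nrm 0 = 0. Proof. by rewrite /ipn ip0l sqrtr0. Qed.
Lemma ipnB u v : nrm (u - v) = nrm (v - u).
Proof. by rewrite -opprB ipnN. Qed.
Lemma ip_sub_sq r u v :
  ip (u - r *: v) (u - r *: v) = ip u u - 2 * r * ip u v + r ^+ 2 * ip v v.
Proof. by rewrite !ipE (ipC H v u); ring. Qed.
Lemma ipn_triangleB u v w : nrm (u - w) <= nrm (u - v) + nrm (v - w).
Proof. have -> : u - w = (u - v) + (v - w) by rewrite addrA subrK.
exact: ipn_triangle. Qed.
Lemma ipn_leB u v : `|nrm u - nrm v| <= nrm (u - v).
Proof.
have h1 := ipn_triangle (u - v) v; have h2 := ipn_triangle (v - u) u.
by rewrite !subrK in h1 h2; rewrite ipnB in h2; rewrite ler_norml; lra.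
Qed.
Lemma ipn_eq0 u : (forall v, ip u v = 0) -> nrm u = 0.
Proof. by rewrite /ipn => ->; rewrite sqrtr0. Qed.
Lemma ipn0_ip u v : nrm u = 0 -> ip u v = 0.
Proof.
move=> u0; have := ip_CS u v; rewrite u0 mul0r normr_le0 => /eqP //.
Qed.
Lemma ipn0_ipB u u' v : nrm (u - u') = 0 -> ip u v = ip u' v.
Proof. by move=> /ipn0_ip - /(_ v); rewrite ipBl => /subr0_eq. Qed.
Lemma ipn_ip u v : (forall g, ip u g = ip v g) -> nrm u = nrm v.
Proof. by move=> h; rewrite /ipn h (ipC H) h. Qed.
Lemma ipn_dual u (c : R) : 0 <= c -> (forall g, ip u g <= c * nrm g) -> nrm u <= c.
Proof.
move=> c0 /(_ u); rewrite -sqr_ipn expr2 => h.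
have [->//|u0] := eqVneq (nrm u) 0.
by rewrite -(ler_pM2r (x := nrm u)) // lt_neqAle eq_sym u0 ipn_ge0.
Qed.

Lemma ipn_complete (u_ : nat -> V) :
  (forall e, 0 < e -> exists N : nat, forall m n, (N <= m)%N -> (N <= n)%N ->
       nrm (u_ m - u_ n) <= e) ->
  exists l, nrm (u_ n - l) @[n --> \oo] --> (0 : R).
Proof.
move=> h; have [|l hl] := ip_complete H (u_ := u_).
  move=> e e0; have [N hN] := h (Num.sqrt e) ltac:(by rewrite sqrtr_gt0).
  exists N => m n hm hn; rewrite -sqr_ipn.
  by rewrite -(sqr_sqrtr (ltW e0)) ler_pXn2r ?nnegrE ?ipn_ge0 ?sqrtr_ge0// hN.
by exists l; exact: cvg_sqrt0.
Qed.

Lemma cvg_ipl (T : Type) (F : set_system T) (FF : Filter F) (u : T -> V) l v :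
  nrm (u n - l) @[n --> F] --> (0 : R) -> ip (u n) v @[n --> F] --> ip l v.
Proof.
move=> h; apply/cvgrPdist_le => e e0.
have v0 : 0 < nrm v + 1 by rewrite ltr_wpDl ?ipn_ge0.
have /cvgrPdist_le := h; move=> /(_ (e / (nrm v + 1)) (divr_gt0 e0 v0)).
apply: filterS => n; rewrite sub0r normrN ger0_norm ?ipn_ge0// => hn.
rewrite -ipBl -normrN -ipNl opprB; apply: le_trans (ip_CS _ _) _.
have := ipn_ge0 v; have := ipn_ge0 (u n - l) => a1 a2.
rewrite ler_pdivlMr// in hn; apply: le_trans hn.
by apply: ler_wpM2l => //; rewrite lerDl.
Qed.

Lemma cvg_ipn (T : Type) (F : set_system T) (FF : Filter F) (u : T -> V) l :
  nrm (u n - l) @[n --> F] --> (0 : R) -> nrm (u n) @[n --> F] --> nrm l.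
Proof.
move=> /cvgrPdist_le h; apply/cvgrPdist_le => e e0.
apply: filterS (h e e0) => n; rewrite sub0r normrN ger0_norm ?ipn_ge0//.
by apply: le_trans; rewrite distrC; exact: ipn_leB.
Qed.

(* The representing vector minimizes [ip u u / 2 - l u]. *)
Lemma riesz (l : V -> R) (c : R) :
  (forall k u v, l (k *: u + v) = k * l u + l v) ->
  (forall u, `|l u| <= c * nrm u) -> exists r, forall v, l v = ip r v.
Proof.
move=> ll lc.
pose J u := ip u u / 2 - l u.
have l0 : l 0 = 0 by have := ll 1 0 0; rewrite scaler0 addr0 mul1r; lra.
have lZ k u : l (k *: u) = k * l u by have := ll k u 0; rewrite addr0 l0 addr0.
have lD u v : l (u + v) = l u + l v.
  by have := ll 1 u v; rewrite scale1r mul1r.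
have Jlb u : - (c ^+ 2) / 2 <= J u.
  rewrite /J -sqr_ipn; have := lc u; have := ler_norm (l u).
  have := sqr_ge0 (nrm u - c); rewrite sqrrB; nra.
pose A := [set J u | u in [set: V]].
have Ai : has_inf A.
  split; first by exists (J 0), 0.
  by exists (- c ^+ 2 / 2) => _ [u _ <-].
pose m : R := inf A.
have mlb u : m <= J u by apply: ge_inf; [exact: (proj2 Ai)|exists u].
have /choice[u_ hu] (n : nat) : exists u, J u < m + n.+1%:R^-1.
  have n0 : 0 < n.+1%:R^-1 :> R by rewrite invr_gt0 ltr0n.
  have [_ [u _ <-] hu] := inf_adherent n0 Ai.
  by exists u.
clearbody m.
(* Parallelogram law for [J]: two values within [e / 8] of the infimum [m], with a midpoint value at
   least [m], leave [ip (u - v) (u - v)] at most [e]. *)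
have par (u v : V) : ip (u - v) (u - v) = 4 * J u + 4 * J v - 8 * J (2^-1 *: (u + v)).
  by rewrite /J lZ lD !ipE (ipC H v u); field.
have [|r hr] := ip_complete H (u_ := u_).
  move=> e e0; have [N hN] : exists N : nat, N.+1%:R^-1 < e / 8.
    have e8 : 0 < e / 8 by rewrite divr_gt0.
    have /cvgrPdist_lt/(_ _ e8)[N _ hN] := @cvg_harmonic R.
    exists N; have := hN N (leqnn N); rewrite /= sub0r normrN.
    by rewrite ger0_norm.
  exists N => p n hp hn; rewrite par.
  have := mlb (2^-1 *: (u_ p + u_ n)).
  have h k : (N <= k)%N -> J (u_ k) < m + e / 8.
    move=> hk; apply: lt_trans (hu k) _; rewrite ltrD2l.
    apply: le_lt_trans hN; rewrite lef_pV2 ?posrE ?ltr0n// ler_nat//.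
  have := h _ hp; have := h _ hn; lra.
have hr' : nrm (u_ n - r) @[n --> \oo] --> (0 : R).
  exact: cvg_sqrt0.
exists r => v.
(* J (u_ n + t v) >= m gives | t (ip (u_ n) v - l v) | <= t^2/2 |v|^2 + 1/(n+1) *)
have key (t : R) : 0 <= t * (ip r v - l v) + t ^+ 2 / 2 * ip v v.
  have hc : t * (ip (u_ n) v - l v) + t ^+ 2 / 2 * ip v v + n.+1%:R^-1
     @[n --> \oo] --> t * (ip r v - l v) + t ^+ 2 / 2 * ip v v + 0.
    apply: cvgD; last exact: cvg_harmonic.
    apply: cvgD; last exact: cvg_cst.
    apply: cvgMr; apply: cvgB; last exact: cvg_cst.
    exact: cvg_ipl.
  rewrite addr0 in hc; rewrite -(cvg_lim _ hc)//.
  apply: limr_ge; first by apply/cvg_ex; eexists; exact: hc.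
  apply: nearW => n.
  have JE : J (u_ n + t *: v) = J (u_ n) + (t * (ip (u_ n) v - l v) + t ^+ 2 / 2 * ip v v).
    by rewrite /J lD lZ !ipE (ipC H v (u_ n)); field.
  have := mlb (u_ n + t *: v); rewrite JE; have := hu n.
  move: (J (u_ n)) (t * _ + _) (n.+1%:R^-1) => {}a {}b {}h; lra.
have vv := ip_ge0 H v.
set d := ip r v - l v in key *.
suff : d = 0 by rewrite /d => h; lra.
have [//|d0] := eqVneq d 0.
(* The step [- d / q] is close to the minimizer of the quadratic in [t]; the added 1 keeps the
   denominator positive when [v] is null. *)
pose q := ip v v + 1.
have q0 : 0 < q by rewrite /q; lra.
have := key (- d / q).
have -> : - d / q * d + (- d / q) ^+ 2 / 2 * ip v v
    = - (d ^+ 2 / q ^+ 2) * (q / 2 + 2^-1).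
  by rewrite /q; field; rewrite gt_eqF.
have d2 : 0 < d ^+ 2 by rewrite exprn_even_gt0.
have : 0 < d ^+ 2 / q ^+ 2 by rewrite divr_gt0// exprn_gt0.
nra.
Qed.

Lemma geometric_step (K th : R) (u_ : nat -> V) : 0 <= th < 1 -> 0 <= K ->
  (forall n, nrm (u_ n.+1 - u_ n) <= K * th ^+ n) ->
  forall n k, nrm (u_ (n + k)%N - u_ n) <= K * th ^+ n / (1 - th).
Proof.
move=> /andP[t0 t1] K0 h n k.
have t1' : 0 < 1 - th by lra.
suff : nrm (u_ (n + k)%N - u_ n) <= K * th ^+ n * (1 - th ^+ k) / (1 - th).
  move=> /le_trans; apply; rewrite ler_pM2r ?invr_gt0//.
  rewrite ler_piMr ?mulr_ge0 ?exprn_ge0//.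
  by rewrite gerBl exprn_ge0.
elim: k => [|k ih].
  by rewrite addn0 subrr ipn0 expr0 subrr mulr0 mul0r.
apply: le_trans (ipn_triangleB _ (u_ (n + k)%N) _) _.
rewrite addnS; apply: le_trans (lerD (h _) ih) _.
rewrite le_eqVlt; apply/orP; left; apply/eqP.
by rewrite exprD exprS; field; rewrite gt_eqF.
Qed.

Lemma geometric_cvg (K th : R) (u_ : nat -> V) : 0 <= th < 1 -> 0 <= K ->
  (forall n, nrm (u_ n.+1 - u_ n) <= K * th ^+ n) ->
  exists l, nrm (u_ n - l) @[n --> \oo] --> (0 : R).
Proof.
move=> t01 K0 h; apply: ipn_complete => e e0.
have /andP[t0 t1] := t01.
have t1' : 0 < 1 - th by lra.
have : K * th ^+ n / (1 - th) @[n --> \oo] --> K * 0 / (1 - th).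
  apply: cvgMl; apply: cvgMr; apply: cvg_expr; rewrite ger0_norm//.
rewrite mulr0 mul0r => /cvgrPdist_le/(_ (e / 2)) => /(_ ltac:(lra))[N _ hN].
exists N => m n hm hn.
have hh k : (N <= k)%N -> nrm (u_ k - u_ N) <= e / 2.
  move=> hk; rewrite -(subnKC hk); apply: le_trans (geometric_step _ _ h _ _) _ => //.
  have := hN N (leqnn N); rewrite /= sub0r normrN; apply: le_trans.
  exact: ler_norm.
apply: le_trans (ipn_triangleB _ (u_ N) _) _.
rewrite (ipnB (u_ N)); have := hh _ hm; have := hh _ hn; lra.
Qed.

Lemma geometric_lim (K th : R) (u_ : nat -> V) l : 0 <= th < 1 -> 0 <= K ->
  (forall n, nrm (u_ n.+1 - u_ n) <= K * th ^+ n) ->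
  nrm (u_ n - l) @[n --> \oo] --> (0 : R) ->
  nrm (u_ 0%N - l) <= K / (1 - th).
Proof.
move=> t01 K0 h hl; apply/ler_addgt0Pr => e e0.
have /cvgrPdist_le/(_ e e0)[N _ hN] := hl.
have := hN N (leqnn N); rewrite /= sub0r normrN ger0_norm ?ipn_ge0// => hN'.
apply: le_trans (ipn_triangleB _ (u_ N) _) _; apply: lerD => //.
by rewrite ipnB; have := geometric_step t01 K0 h 0 N; rewrite expr0 mulr1.
Qed.

(** [B] need not be symmetric, since the shift by a complex number adds a skew term. With
    [B x y = ip (A x) y] by Riesz, the map [x -> x - rho (A x - r)] for [rho = d / C'^2] contracts
    by [sqrt (1 - d^2 / C'^2)], and its fixed point is the solution. *)
Lemma lax_milgram (B : V -> V -> R) (C d : R) (l : V -> R) (cl : R) :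
  (forall c u v w, B (c *: u + v) w = c * B u w + B v w) ->
  (forall c u v w, B w (c *: u + v) = c * B w u + B w v) ->
  (forall u v, `|B u v| <= C * nrm u * nrm v) -> 0 < d ->
  (forall u, d * ip u u <= B u u) ->
  (forall k u v, l (k *: u + v) = k * l u + l v) ->
  (forall u, `|l u| <= cl * nrm u) ->
  exists x, forall y, B x y = l y.
Proof.
move=> B1 B2 BC d0 Bd l1 l2.
have [r hr] := riesz l1 l2.
have /choice[A hA] (x : V) : exists r, forall y, B x y = ip r y.
  by apply: (riesz (c := C * nrm x)) => // c u v; exact: B2.
(* Enlarging the bound beyond [d] puts [1 - d ^+ 2 / C' ^+ 2] strictly between 0 and 1. *)
pose C' := `|C| + d + 1.
have C'd : d < C' by rewrite /C'; have := normr_ge0 C; lra.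
have C'0 : 0 < C' by lra.
have BC' u v : `|B u v| <= C' * nrm u * nrm v.
  apply: le_trans (BC u v) _; rewrite -!mulrA ler_wpM2r ?mulr_ge0 ?ipn_ge0//.
  by rewrite /C'; have := ler_norm C; lra.
have BB x x' y : B x y - B x' y = B (x - x') y.
  by have := B1 (-1) x' x y; rewrite scaleN1r mulN1r [- x' + x]addrC => ->; rewrite addrC.
have AB x x' y : ip (A x - A x') y = B (x - x') y.
  by rewrite ipBl -!hA BB.
have AC x x' : nrm (A x - A x') <= C' * nrm (x - x').
  apply: ipn_dual; first by rewrite mulr_ge0 ?ipn_ge0// ltW.
  by move=> g; rewrite AB; exact: le_trans (ler_norm _) (BC' _ _).
pose rho := d / C' ^+ 2.
pose u_ := fix F (n : nat) := if n is k.+1 then F k - rho *: (A (F k) - r) else 0.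
have uS n : u_ n.+1 - u_ n = - (rho *: (A (u_ n) - r)).
  by rewrite /= addrAC subrr add0r.
pose th := Num.sqrt (1 - d ^+ 2 / C' ^+ 2).
have q01 : 0 < d ^+ 2 / C' ^+ 2 < 1.
  rewrite divr_gt0 ?exprn_gt0//= ltr_pdivrMr ?exprn_gt0// mul1r.
  by rewrite ltr_pXn2r ?nnegrE// ltW.
have th01 : 0 <= th < 1.
  by rewrite sqrtr_ge0/= -sqrtr1 ltr_sqrt//; lra.
have step n : nrm (u_ n.+2 - u_ n.+1) <= th * nrm (u_ n.+1 - u_ n).
  set D := u_ n.+1 - u_ n.
  have -> : u_ n.+2 - u_ n.+1 = D - rho *: (A (u_ n.+1) - A (u_ n)).
    rewrite /D uS uS -opprD -scalerDr; congr (- (rho *: _)).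
    by rewrite [RHS]addrC addrA subrK.
  set E := A (u_ n.+1) - A (u_ n).
  have thE : th ^+ 2 = 1 - d ^+ 2 / C' ^+ 2 by rewrite /th sqr_sqrtr//; lra.
  rewrite -(@ler_pXn2r _ 2) ?nnegrE ?mulr_ge0 ?ipn_ge0 ?sqrtr_ge0//.
  rewrite exprMn thE !sqr_ipn ip_sub_sq (ipC H D E).
  have ED : ip E D = B D D by rewrite /E AB.
  have EE : ip E E <= C' ^+ 2 * ip D D.
    rewrite -!sqr_ipn -exprMn ler_pXn2r ?nnegrE ?mulr_ge0 ?ipn_ge0 ?(ltW C'0)//.
    exact: AC.
  rewrite ED; have := Bd D => h1.
  have r0 : 0 < rho by rewrite divr_gt0 ?exprn_gt0.
  have e1 : rho * (d * ip D D) <= rho * B D D by rewrite ler_pM2l.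
  have e2 : rho ^+ 2 * ip E E <= rho ^+ 2 * (C' ^+ 2 * ip D D).
    by rewrite ler_pM2l// exprn_gt0.
  have e3 : rho * d = d ^+ 2 / C' ^+ 2 by rewrite /rho; field; rewrite gt_eqF.
  have e4 : rho ^+ 2 * C' ^+ 2 = d ^+ 2 / C' ^+ 2 by rewrite /rho; field; rewrite gt_eqF.
  rewrite mulrA e3 in e1; rewrite mulrA e4 in e2; nra.
have geo n : nrm (u_ n.+1 - u_ n) <= nrm (u_ 1%N - u_ 0%N) * th ^+ n.
  elim: n => [|n ih]; first by rewrite expr0 mulr1.
  apply: le_trans (step n) _; rewrite exprS mulrCA.
  by apply: ler_wpM2l ih; case/andP: th01.
have [x hx] := geometric_cvg th01 (ipn_ge0 _) geo.
exists x => y; rewrite hr.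
have h1 : ip (A (u_ n) - r) y @[n --> \oo] --> ip 0 y.
  apply: cvg_ipl.
  have : nrm (u_ 1%N - u_ 0%N) * th ^+ n / rho @[n --> \oo] --> nrm (u_ 1%N - u_ 0%N) * 0 / rho.
    apply: cvgMl; apply: cvgMr; apply: cvg_expr.
    by case/andP: th01 => a1 a2; rewrite ger0_norm.
  rewrite mulr0 mul0r => hb; apply: (squeeze_cvgr _ (cvg_cst 0) hb).
  have r0 : 0 < rho by rewrite divr_gt0 ?exprn_gt0.
  apply: nearW => n; rewrite ipn_ge0/= subr0 ler_pdivlMr//.
  by apply: le_trans (geo n); rewrite uS ipnN ipnZ gtr0_norm// mulrC.
have h2 : B (u_ n) y @[n --> \oo] --> B x y.
  have : ip (A (u_ n) - A x) y @[n --> \oo] --> ip 0 y.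
    apply: cvg_ipl.
    have : C' * nrm (u_ n - x) @[n --> \oo] --> C' * 0 by apply: cvgMr.
    rewrite mulr0 => hb; apply: (squeeze_cvgr _ (cvg_cst 0) hb).
    by apply: nearW => n; rewrite ipn_ge0/= subr0.
  rewrite ip0l => /(cvgD (cvg_cst (B x y))); rewrite addr0; apply: cvg_trans.
  apply: near_eq_cvg; apply: nearW => n /=.
  by rewrite fctE ipBl -!hA addrC subrK.
have h3 : B (u_ n) y @[n --> \oo] --> ip r y.
  have h3 : ip (A (u_ n) - r) y + ip r y @[n --> \oo] --> 0 + ip r y.
    by apply: cvgD; [rewrite -(ip0l y)|exact: cvg_cst].
  rewrite add0r in h3; apply: cvg_trans h3; apply: near_eq_cvg; apply: nearW => n /=.
  by rewrite hA ipBl subrK.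
exact: (cvg_unique _ h2 h3).
Qed.

(* Gliding hump: the increments [w] are chosen so small that they cannot spoil
   the large values obtained at the previous steps. *)
Lemma uniform_boundedness (p : nat -> V -> R) :
  (forall n u v, p n (u + v) <= p n u + p n v) ->
  (forall n c u, p n (c *: u) = `|c| * p n u) ->
  (forall n, exists c, forall u, p n u <= c * nrm u) ->
  (forall u, exists C, forall n, p n u <= C) ->
  exists M, forall n u, p n u <= M * nrm u.
Proof.
move=> pD pZ /choice[c hc] pw; apply: contrapT => /forallNP hM.
have big (D e : R) : 0 < D -> 0 < e -> exists n w, nrm w <= e /\ D < p n w.
  move=> D0 e0; have /existsNP[n /existsNP[u /negP]] := hM (D / e).
  rewrite -ltNge => hu; exists n.
  have u0 : 0 < nrm u.
    rewrite lt_neqAle eq_sym ipn_ge0 andbT; apply: contraTneq hu => u0.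
    by rewrite u0 mulr0 -leNgt (le_trans (hc n u))// u0 mulr0.
  exists ((e / nrm u) *: u); rewrite ipnZ pZ gtr0_norm ?divr_gt0// divfK ?gt_eqF//; split; first exact: lexx.
  rewrite mulrAC ltr_pdivlMr//.
  have -> : D * nrm u = e * (D / e * nrm u) by field; rewrite gt_eqF.
  by rewrite ltr_pM2l.
pose P k (s : V * R) (z : nat * V * R) := 0 < s.2 ->
  [/\ 0 < z.2, z.2 <= s.2 / 2, nrm (z.1.2 - s.1) <= s.2,
     k%:R < p z.1.1 z.1.2 & `|c z.1.1| * z.2 <= 1].
have /choice[F hF] (ks : nat * (V * R)) : exists z, P ks.1 ks.2 z.
  case: ks => k [x e] /=.
  have [e0|e0] := boolP (0 < e); last by exists (0%N, x, e); rewrite /P/= (negbTE e0).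
  have [n [w [we wk]]] := big (k%:R + 1) e ltac:(by rewrite ltr_wpDl) e0.
  have wk' : k%:R < p n w by apply: lt_trans wk; rewrite ltrDl.
  (* Halving makes all later increments sum to at most [2 e']; the second bound then limits their
     effect on [p n] to 2, whence [C + 2] below. *)
  pose e' := Num.min (e / 2) (`|c n| + 1)^-1.
  have c0 : 0 < `|c n| + 1 by rewrite ltr_wpDl.
  have e'0 : 0 < e' by rewrite lt_min divr_gt0//= invr_gt0.
  have ce : `|c n| * e' <= 1.
    apply: (@le_trans _ _ ((`|c n| + 1) * (`|c n| + 1)^-1)).
      apply: ler_pM => //; first exact: ltW.
        by rewrite lerDl.
      by rewrite /e' ge_min lexx orbT.
    by rewrite divff// gt_eqF.
  (* As [2 w = (x + w) - (x - w)], one of [x + w] and [x - w] has a value of [p n] at least [p n w];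
     the sign of the increment is chosen accordingly. *)
  have [h|h] := leP (p n w) (p n (x + w)).
    exists (n, x + w, e') => _ /=; split => //.
    - by rewrite ge_min lexx.
    - by rewrite addrAC subrr add0r.
    - exact: lt_le_trans wk' h.
  exists (n, x - w, e') => _ /=; split => //.
  - by rewrite ge_min lexx.
  - by rewrite addrAC subrr add0r ipnN.
  - apply: lt_trans wk' _.
    have := pD n (x + w) (- (x - w)).
    have -> : x + w - (x - w) = 2%:R *: w.
      by rewrite opprB addrC addrA subrK scaler_nat mulr2n.
    rewrite [p n (- (x - w))](_ : _ = p n (x - w)); last first.
      by rewrite -scaleN1r pZ normrN1 mul1r.
    rewrite pZ normr_nat; lra.
pose s := fix G (k : nat) : V * R :=
  if k is k'.+1 then ((F (k', G k')).1.2, (F (k', G k')).2) else (0, 1).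
have s0 k : 0 < (s k).2.
  elim: k => [|k ih] /=; first exact: ltr01.
  by have [] := hF (k, s k) ih.
have sk k : [/\ (s k.+1).2 <= (s k).2 / 2, nrm ((s k.+1).1 - (s k).1) <= (s k).2,
   k%:R < p (F (k, s k)).1.1 (s k.+1).1 & `|c (F (k, s k)).1.1| * (s k.+1).2 <= 1].
  by have [] := hF (k, s k) (s0 k).
have sdec k j : (s (k + j)%N).2 <= (s k).2 * 2^-1 ^+ j.
  elim: j => [|j ih]; first by rewrite addn0 expr0 mulr1.
  rewrite addnS; have [h _ _ _] := sk (k + j)%N; apply: le_trans h _.
  by rewrite exprSr mulrA ler_pM2r// invr_gt0.
have geo k j : nrm ((s (k + j.+1)%N).1 - (s (k + j)%N).1) <= (s k).2 * 2^-1 ^+ j.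
  rewrite addnS; have [_ h _ _] := sk (k + j)%N; exact: le_trans h (sdec _ _).
have h01 : 0 <= (2^-1 : R) < 1 by lra.
have [x hx] : exists l, nrm ((s n).1 - l) @[n --> \oo] --> (0 : R).
  by apply: (geometric_cvg h01 (ltW (s0 0%N))) => j; exact: (geo 0%N j).
have [C hC] := pw x.
have [k hk] : exists k : nat, C + 2 < k%:R.
  exists (Num.truncn `|C + 2|).+1; apply: le_lt_trans (ler_norm _) _.
  exact: truncnS_gt.
have [_ _ h3 h4] := sk k.
have hx' : nrm ((s (k.+1 + n)%N).1 - x) @[n --> \oo] --> (0 : R).
  move: hx; rewrite -(cvg_shiftn k.+1); apply: cvg_trans; apply: near_eq_cvg.
  by apply: nearW => n /=; rewrite addnC.
have := geometric_lim h01 (ltW (s0 k.+1)) (geo k.+1) hx'.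
rewrite addn0 => d1.
set n := (F (k, s k)).1.1 in h3 h4 *.
have := pD n x ((s k.+1).1 - x); rewrite addrC subrK => d2.
have := hC n => d3.
have := hc n ((s k.+1).1 - x) => d4.
have d5 : c n * nrm ((s k.+1).1 - x) <= `|c n| * ((s k.+1).2 / (1 - 2^-1)).
  apply: le_trans (ler_norm _) _; rewrite normrM.
  by rewrite ler_wpM2l// ger0_norm ?ipn_ge0.
have e2 : (1 - 2^-1 : R) = 2^-1 by lra.
rewrite e2 invrK mulrA in d5; lra.
Qed.

End Hilbert.

(** * Operators of quadratic forms *)

Section FormOperator.
Context {R : realType} {V W : lmodType R}.
Variables (ip : V -> V -> R) (H : hilbert ip).
Variables (pi : W -> V) (q : W -> W -> R).
Local Notation nrm := (ipn ip).

(** The domain [W] is a space of its own, mapped to [V] by [pi]: its elements will carry their weak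
    gradients along with the function. [form_closed] is completeness for the form norm. *)
Record form : Prop := {
  formC : forall x y, q x y = q y x ;
  form_lin : forall c x y z, q (c *: x + y) z = c * q x z + q y z ;
  form_ge0 : forall x, 0 <= q x x ;
  form_pi : forall c x y, pi (c *: x + y) = c *: pi x + pi y ;
  form_closed : hilbert (fun x y => q x y + ip (pi x) (pi y)) }.

Hypothesis F : form.

(* [pi x] belongs to the domain of the operator of [q], with image [v]. *)
Definition form_op (x : W) (v : V) := forall y, q x y = ip v (pi y).

Definition form_bottom (m : R) :=
  (forall x, m * ip (pi x) (pi x) <= q x x) /\
  (forall e, 0 < e -> exists x, ip (pi x) (pi x) = 1 /\ q x x <= m + e).

Lemma formZl c x y : q (c *: x) y = c * q x y.
Proof.
have q0 z : q 0 z = 0.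
  by have := form_lin F 1 0 0 z; rewrite scaler0 addr0 mul1r; lra.
by have := form_lin F c x 0 y; rewrite addr0 q0 addr0.
Qed.
Lemma formZ c x y : q (c *: x) (c *: y) = c ^+ 2 * q x y.
Proof. by rewrite formZl (formC F) formZl (formC F) expr2 mulrA. Qed.

Lemma form_pi0 : pi 0 = 0.
Proof.
have := form_pi F (-1) 0 0; rewrite scaler0 addr0 => e.
by rewrite [LHS]e scaleN1r addNr.
Qed.
Lemma form_piZ c x : pi (c *: x) = c *: pi x.
Proof. by have := form_pi F c x 0; rewrite addr0 form_pi0 addr0. Qed.
Lemma form_piB x y : pi (x - y) = pi x - pi y.
Proof. by have := form_pi F (-1) y x; rewrite !scaleN1r !(addrC (- _)). Qed.

Lemma form_bottom_exists : (exists x, 0 < ip (pi x) (pi x)) ->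
  exists2 m, 0 <= m & form_bottom m.
Proof.
move=> [x0 hx0].
have nz x : 0 < ip (pi x) (pi x) -> exists k, ip (pi (k *: x)) (pi (k *: x)) = 1
    /\ q (k *: x) (k *: x) = q x x / ip (pi x) (pi x).
  move=> hx; exists (nrm (pi x))^-1.
  rewrite form_piZ (ipZl H) (ipZr H) formZ mulrA -expr2 exprVn (sqr_ipn H).
  by rewrite mulVf ?gt_eqF// mulrC.
pose A := [set q x x | x in [set x | ip (pi x) (pi x) = 1]].
have Ai : has_inf A.
  split; first by have [k [hk _]] := nz _ hx0; exists (q (k *: x0) (k *: x0)), (k *: x0).
  by exists 0 => _ [u _ <-]; exact: form_ge0.
exists (inf A).
  by apply: lb_le_inf (proj1 Ai) _ => _ [u _ <-]; exact: form_ge0.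
split => [x|e e0].
  have [p0|p0] := eqVneq (ip (pi x) (pi x)) 0.
    by rewrite p0 mulr0; exact: form_ge0.
  have pp : 0 < ip (pi x) (pi x) by rewrite lt_neqAle eq_sym p0 (ip_ge0 H).
  have [k [k1 k2]] := nz x pp; rewrite -ler_pdivlMr// -k2.
  by apply: ge_inf; [exact: (proj2 Ai)|exists (k *: x)].
have [_ [u u1 <-] hu] := inf_adherent e0 Ai.
by exists u; split => //; exact: ltW.
Qed.

Section Bottom.
Variable m : R.
Hypothesis m0 : 0 <= m.
Hypothesis hm : form_bottom m.

(** Lax-Milgram for [q - a ip - b ip (J _) _]. With [J] the multiplication by i this solves
    [(H - z) x = eta] for [z = a + i b]. The skew term drops out of the diagonal, so neither the
    coercivity nor the bound [(m - a)^-1] depends on [b]. *)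
Lemma form_resolvent (J : V -> V) (a b : R) :
  (forall c u v, J (c *: u + v) = c *: J u + J v) ->
  (forall u v, ip (J u) v = - ip u (J v)) ->
  (forall u, nrm (J u) <= nrm u) -> a < m ->
  forall eta, exists x, [/\ form_op x (eta + (a *: pi x + b *: J (pi x))),
    nrm (pi x) <= (m - a)^-1 * nrm eta &
    forall x', form_op x' (eta + (a *: pi x' + b *: J (pi x'))) -> nrm (pi x' - pi x) = 0].
Proof.
move=> Jl Ja Jn am eta.
have am0 : 0 < m - a by lra.
pose q1 x y := q x y + ip (pi x) (pi y).
have Hq1 : hilbert q1 := form_closed F.
pose B x y := q x y - a * ip (pi x) (pi y) - b * ip (J (pi x)) (pi y).
have Jx u : ip (J u) u = 0 by have := Ja u u; rewrite (ipC H u); lra.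
have B1 c u v w : B (c *: u + v) w = c * B u w + B v w.
  by rewrite /B (form_lin F) (form_pi F) Jl !(ip_lin H); ring.
have B2 c u v w : B w (c *: u + v) = c * B w u + B w v.
  rewrite /B !(formC F w) (form_lin F) (form_pi F) !(ipDr H) !(ipZr H); ring.
have q1q x : q x x <= q1 x x by rewrite /q1 lerDl (ip_ge0 H).
have q1p x : ip (pi x) (pi x) <= q1 x x by rewrite /q1 lerDr (form_ge0 F).
have pn x : nrm (pi x) <= ipn q1 x by rewrite /ipn ler_sqrt// (ip_ge0 Hq1).
have qb x y : `|q x y| <= ipn q1 x * ipn q1 y.
  rewrite -(@ler_pXn2r _ 2) ?nnegrE ?mulr_ge0 ?ipn_ge0//.
  rewrite real_normK ?num_real// exprMn !(sqr_ipn Hq1).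
  apply: le_trans (psd_CS2 x y (formC F) (form_lin F) (form_ge0 F)) _.
  by apply: ler_pM => //; exact: form_ge0.
have BC x y : `|B x y| <= (1 + `|a| + `|b|) * ipn q1 x * ipn q1 y.
  rewrite /B; apply: le_trans (ler_normB _ _) _.
  apply: le_trans (lerD (ler_normB _ _) (lexx _)) _.
  rewrite !normrM !mulrDl mul1r.
  apply: lerD; first apply: lerD; first exact: qb.
    rewrite -mulrA ler_wpM2l//; apply: le_trans (ip_CS H _ _) _.
    by apply: ler_pM => //; exact: ipn_ge0.
  rewrite -mulrA ler_wpM2l//; apply: le_trans (ip_CS H _ _) _.
  apply: ler_pM => //; try exact: ipn_ge0.
  exact: le_trans (Jn _) (pn _).
have Bx x : B x x = q x x - a * ip (pi x) (pi x) by rewrite /B Jx mulr0 subr0.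
(* With [Q >= m p], the bound [d (Q + p) <= Q - a p] follows from [d <= 1] and
   [d (1 + m) <= m - a]. *)
pose d := Num.min 1 ((m - a) / (1 + m)).
have m1 : 0 < 1 + m by rewrite ltr_pwDl.
have d0 : 0 < d by rewrite lt_min ltr01 divr_gt0.
have d1 : d <= 1 by rewrite /d ge_min lexx.
have d2 : d * (1 + m) <= m - a by rewrite -ler_pdivlMr// /d ge_min lexx orbT.
have Bd x : d * q1 x x <= B x x.
  rewrite Bx /q1; have := proj1 hm x; have := ip_ge0 H (pi x).
  move: (q x x) (ip _ _) => Q p p0 hQ.
  have e1 : 0 <= (1 - d) * (Q - m * p) by rewrite mulr_ge0//; lra.
  have e2 : 0 <= p * (m - a - d * (1 + m)) by rewrite mulr_ge0//; lra.
  nra.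
have [x hx] := lax_milgram Hq1 B1 B2 BC d0 Bd
   (l := fun y => ip eta (pi y)) (cl := nrm eta)
   (fun c u v => etrans (congr1 (ip eta) (form_pi F c u v))
      (etrans (ipDr H _ _ _) (congr1 (fun z => z + _) (ipZr H _ _ _))))
   (fun u => le_trans (ip_CS H _ _) (ler_wpM2l (ipn_ge0 ip eta) (pn u))).
have opB x' : form_op x' (eta + (a *: pi x' + b *: J (pi x'))) <->
    forall y, B x' y = ip eta (pi y).
  by split => h y; have := h y; rewrite /B !(ipDl H) !(ipZl H); lra.
have est x' : (m - a) * nrm (pi x') ^+ 2 <= B x' x'.
  by rewrite Bx (sqr_ipn H) mulrBl; have := proj1 hm x'; lra.
exists x; split; first exact/opB.
  have := est x; rewrite hx => h.
  have [z0|z0] := eqVneq (nrm (pi x)) 0.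
    by rewrite z0 mulr_ge0 ?ipn_ge0// invr_ge0 ltW.
  rewrite ler_pdivlMl//.
  have zp : 0 < nrm (pi x) by rewrite lt_neqAle eq_sym z0 ipn_ge0.
  rewrite -(ler_pM2r zp) -mulrA -expr2; apply: le_trans h _.
  exact: ip_le.
move=> x' /opB hx'.
have := est (x' - x); rewrite form_piB.
have -> : B (x' - x) (x' - x) = 0.
  have := B1 (-1) x x' (x' - x); rewrite scaleN1r addrC hx hx' => ->; ring.
move=> h; apply/eqP; rewrite -sqrf_eq0 -[_ == 0]orbF.
by rewrite eq_le sqr_ge0 andbT orbF; rewrite pmulr_rle0 in h.
Qed.

(** Cauchy-Schwarz for the nonnegative form [q' = q - m ip]. A bounded solution [x] of
    [(H - m) x = x0], for a unit near-minimizer [x0], satisfies [q' x x0 = 1], while [q' x x <= c']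
    and [q' x0 x0 <= c'^-1 / 2]. *)
Lemma form_bottom_spectrum :
  ~ (exists c, forall eta, exists x, form_op x (eta + m *: pi x) /\ nrm (pi x) <= c * nrm eta).
Proof.
move=> [c hc].
pose q' x y := q x y - m * ip (pi x) (pi y).
have q'C x y : q' x y = q' y x by rewrite /q' (formC F) (ipC H).
have q'l k x y z : q' (k *: x + y) z = k * q' x z + q' y z.
  by rewrite /q' (form_lin F) (form_pi F) (ip_lin H); ring.
have q'0 x : 0 <= q' x x by rewrite subr_ge0; exact: (proj1 hm).
pose c' := `|c| + 1.
have c'0 : 0 < c' by rewrite ltr_wpDl.
have c'2 : 0 < c'^-1 / 2 by rewrite divr_gt0// invr_gt0.
have [x0 [n0 hx0]] := proj2 hm _ c'2.
have [x [ox nx]] := hc (pi x0).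
have q'x y : q' x y = ip (pi x0) (pi y).
  by rewrite /q' ox !(ipDl H) (ipZl H); ring.
have := psd_CS2 x x0 q'C q'l q'0; rewrite !q'x n0 expr1n => h.
have h1 : ip (pi x0) (pi x) <= c'.
  have n1 : nrm (pi x0) = 1 by rewrite /ipn n0 sqrtr1.
  apply: le_trans (ip_le H _ _) _; rewrite n1 mul1r; apply: le_trans nx _.
  by rewrite n1 mulr1 /c'; apply: le_trans (ler_norm _) _; rewrite lerDl.
have h2 : q' x0 x0 <= c'^-1 / 2 by rewrite /q' n0; lra.
have h3 : ip (pi x0) (pi x) * q' x0 x0 <= c' * (c'^-1 / 2).
  by apply: ler_pM => //; rewrite -q'x.
by rewrite mulrA divff ?gt_eqF// in h3; lra.
Qed.

(** The witness is the Yosida regularization [s (H + s)^-1 x]. It moves near-minimizers of the form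
    into the domain of the operator, where the semigroup can be differentiated. *)
Lemma form_regularize x (s : R) : 0 < s ->
  exists w, [/\ form_op w (s *: (pi x - pi w)), q w w <= q x x &
    s * ip (pi x - pi w) (pi x - pi w) <= q x x].
Proof.
move=> s0.
have sm : - s < m by apply: lt_le_trans m0; rewrite oppr_lt0.
have J1 : forall (c : R) (u v : V), 0 = c *: 0 + 0 :> V by move=> c u v; rewrite scaler0 addr0.
have J2 u v : ip 0 v = - ip u 0 by rewrite (ip0l H) (ip0r H) oppr0.
have J3 u : nrm 0 <= nrm u by rewrite (ipn0 H) ipn_ge0.
have [w [ow _ _]] := @form_resolvent (fun _ => 0) (- s) 0 J1 J2 J3 sm (s *: pi x).
have qw y : q w y = s * ip (pi x - pi w) (pi y).
  rewrite ow scaler0 addr0 scaleNr -scalerBr (ipZl H) //.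
have q1 : q (w - x) w = q w w - q w x.
  by have := form_lin F (-1) x w w; rewrite scaleN1r addrC (formC F x w) => ->; ring.
have q2 : q (w - x) x = q w x - q x x.
  by have := form_lin F (-1) x w x; rewrite scaleN1r addrC => ->; ring.
have q3 : q (w - x) (w - x) = q w w - 2 * q w x + q x x.
  have := form_lin F (-1) x w (w - x); rewrite scaleN1r addrC => ->.
  by rewrite (formC F x) (formC F w) q1 q2; ring.
have q4 : q w w - q w x = - (s * ip (pi x - pi w) (pi x - pi w)).
  by rewrite -q1 (formC F) qw form_piB -mulrN -(ipNr H) opprB.
have q5 := form_ge0 F (w - x).
have q6 : 0 <= s * ip (pi x - pi w) (pi x - pi w) by rewrite mulr_ge0 ?(ip_ge0 H)// ltW.
exists w; split.
- by move=> y; rewrite qw (ipZl H).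
- by rewrite q3 in q5; lra.
- by rewrite q3 in q5; have := form_ge0 F w; lra.
Qed.

(** Regularization with [s = Q / dl^2] displaces the near-minimizer by at most [dl], and [dl] is so
    small that normalizing again raises the form value by at most [e / 2]. *)
Lemma form_op_bottom (e : R) : 0 < e -> exists w v, [/\ form_op w v, nrm (pi w) = 1 & q w w <= m + e].
Proof.
move=> e0; pose Q := m + e / 2.
have Q0 : 0 < Q by rewrite /Q ltr_wpDl// divr_gt0.
have [x [x1 hx]] := proj2 hm (e / 2) (divr_gt0 e0 (ltr0n _ 2)).
pose dl := Num.min 2^-1 (e / (4 * (m + e))).
have me0 : 0 < m + e by rewrite ltr_wpDl.
have dl0 : 0 < dl by rewrite lt_min invr_gt0 ltr0n divr_gt0// mulr_gt0.
have dl1 : dl <= 2^-1 by rewrite /dl ge_min lexx.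
have dl2 : dl * (4 * (m + e)) <= e.
  by rewrite -ler_pdivlMr ?mulr_gt0// /dl ge_min lexx orbT.
have dd : 0 < dl ^+ 2 by rewrite exprn_gt0.
have [w [ow qw dw]] := form_regularize x (divr_gt0 Q0 dd).
have dw' : nrm (pi x - pi w) <= dl.
  rewrite -(@ler_pXn2r _ 2) ?nnegrE ?ipn_ge0 ?(ltW dl0)// (sqr_ipn H).
  have : Q / dl ^+ 2 * ip (pi x - pi w) (pi x - pi w) <= Q by apply: le_trans dw hx.
  by rewrite mulrAC ler_pdivrMr// ler_pM2l.
have n1 : nrm (pi x) = 1 by rewrite /ipn x1 sqrtr1.
have nw : 1 - dl <= nrm (pi w).
  by have := ipn_triangle H (pi x - pi w) (pi w); rewrite subrK n1; lra.
have nw0 : 0 < nrm (pi w) by lra.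
exists ((nrm (pi w))^-1 *: w), ((nrm (pi w))^-1 *: (Q / dl ^+ 2 *: (pi x - pi w))); split.
- by move=> y; rewrite formZl (ipZl H) -ow.
- by rewrite form_piZ (ipnZ H) gtr0_norm ?invr_gt0// mulVf// gt_eqF.
- rewrite formZ exprVn ler_pdivrMl ?exprn_gt0//.
  apply: le_trans qw _; apply: le_trans hx _.
  have : (1 - dl) ^+ 2 <= nrm (pi w) ^+ 2.
    by rewrite ler_pXn2r ?nnegrE//; lra.
  move=> h; apply: le_trans (ler_wpM2r (ltW me0) h).
  have := sqr_ge0 dl; nra.
Qed.

End Bottom.
End FormOperator.

(** * Symmetric contraction semigroups *)

Section RealLemmas.
Context {R : realType}.
Implicit Types (F C : R -> R) (P : R -> Prop).

Lemma near_rightP P : (\forall t \near 0^'+, P t) <->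
  exists2 d : R, 0 < d & forall t, 0 < t < d -> P t.
Proof.
split => [[e /= e0 he]|[d d0 hd]].
  exists e => // t /andP[t0 te]; apply: he => //=.
  by rewrite sub0r normrN gtr0_norm.
exists d => //= t /=; rewrite sub0r normrN => td t0.
by apply: hd; rewrite t0/=; apply: le_lt_trans (ler_norm t) td.
Qed.

Lemma cvg0_right F : F t @[t --> 0^'+] --> (0 : R) ->
  forall e, 0 < e -> exists2 d, 0 < d & forall t, 0 < t < d -> F t <= e.
Proof.
move=> /cvgrPdist_le h e e0; have /near_rightP[d d0 hd] := h e e0.
exists d => // t td; have := hd t td; rewrite sub0r normrN; apply: le_trans.
exact: ler_norm.
Qed.

Lemma cvg0_rightI F : (forall t, 0 < t -> 0 <= F t) ->
  (forall e, 0 < e -> exists2 d, 0 < d & forall t, 0 < t < d -> F t <= e) ->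
  F t @[t --> 0^'+] --> (0 : R).
Proof.
move=> F0 h; apply/cvgrPdist_le => e e0; apply/near_rightP.
have [d d0 hd] := h e e0; exists d => // t td; rewrite sub0r normrN ger0_norm.
  exact: hd.
by apply: F0; case/andP: td.
Qed.

(** A mean value inequality without differentiability: only forward increments are controlled,
    uniformly for small steps, which is what a semigroup provides. Increments over [n + 1] equal
    steps are added up. *)
Lemma le_of_increments F (t : R) : 0 <= t ->
  (forall e, 0 < e -> exists2 r0, 0 < r0 & forall s r,
     0 <= s -> 0 < r < r0 -> s + r <= t -> F (s + r) - F s <= e * r) ->
  F t <= F 0.
Proof.
rewrite le_eqVlt => /orP[/eqP<-//|t0] h.
apply/ler_addgt0Pr => e e0.
have [r0 r00 hr] := h (e / t) (divr_gt0 e0 t0).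
have [n hn] : exists n : nat, t / r0 < n.+1%:R.
  by exists (Num.truncn (t / r0)); exact: truncnS_gt.
pose r := t / n.+1%:R.
have rr : 0 < r < r0.
  by rewrite divr_gt0//= ltr_pdivrMr// mulrC -ltr_pdivrMr.
have rn : r * n.+1%:R = t by rewrite /r divfK.
have step k : (k <= n.+1)%N -> F (k%:R * r) - F 0 <= e / t * (k%:R * r).
  elim: k => [|k ih kn]; first by rewrite mul0r subrr mulr0.
  have := ih (ltnW kn) => h1.
  have kr : 0 <= k%:R * r by rewrite mulr_ge0// ltW//; case/andP: rr.
  have := hr (k%:R * r) r kr rr.
  rewrite -addn1 natrD mulrDl mul1r => h2.
  have : k%:R * r + r <= t.
    rewrite -{2}[r]mul1r -mulrDl -rn [r * _]mulrC ler_pM2r; last by case/andP: rr.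
    by rewrite -(natrD _ k 1) addn1 ler_nat.
  move=> /h2; rewrite mulrDr; lra.
have := step n.+1 (leqnn _); rewrite mulrC rn divfK ?gt_eqF//; lra.
Qed.

Lemma mvt_le F (dF : R -> R) (x K : R) : 0 <= x ->
  (forall s, 0 <= s <= x -> is_derive s (1 : R) F (dF s)) ->
  (forall s, 0 <= s <= x -> dF s <= K) -> F x - F 0 <= K * x.
Proof.
rewrite le_eqVlt => /orP[/eqP<-|x0] hF hK; first by rewrite subrr mulr0.
have [||c cx] := @MVT R F dF 0 x x0.
- by move=> s; rewrite in_itv/= => /andP[s0 sx]; apply: hF; rewrite !ltW.
- apply: derivable_within_continuous => s; rewrite in_itv/= => sx.
  by have [] := hF s sx.
- move=> ->; rewrite subr0 ler_pM2r//; apply: hK.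
  by move: cx; rewrite in_itv/= => /andP[c0 cx]; rewrite !ltW.
Qed.

Lemma mvt_eq F (x : R) : 0 <= x ->
  (forall s, 0 <= s <= x -> is_derive s (1 : R) F 0) -> F x = F 0.
Proof.
move=> x0 h; apply/eqP; rewrite eq_le; apply/andP; split.
  by have := mvt_le x0 h (K := 0) (fun _ _ => lexx _); lra.
have h' s : 0 <= s <= x -> is_derive s (1 : R) (- F) (- 0).
  by move=> sx; have := h s sx => ?; exact: is_deriveN.
have := @mvt_le (- F) (fun=> - 0) x 0 x0 h'.
have le0 s : 0 <= s <= x -> - 0 <= (0 : R) by rewrite oppr0.
by move=> /(_ le0); rewrite fctE; lra.
Qed.

Lemma antiderivative (c : R -> R) : continuous c ->
  exists2 C : R -> R, C 0 = 0 & forall x : R, 0 <= x -> is_derive x (1 : R) C (c x).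
Proof.
move=> cc.
(* Starting the integral at -1 makes 0 an interior point, so that the derivative exists there
   too. *)
pose C0 x := (\int[@lebesgue_measure R]_(t in `[-1, x]) c t)%R.
exists (fun x => C0 x - C0 0); first by rewrite subrr.
move=> x x0.
have [] := @continuous_FTC1_closed R c (-1) x (x + 1) _ _ _ _.
- by rewrite ltrDl.
- apply: continuous_compact_integrable; first exact: segment_compact.
  exact: continuous_subspaceT.
- by apply: lt_le_trans x0; rewrite oppr_lt0.
- exact: cc.
move=> dC eC.
have iC : is_derive x (1 : R) C0 (c x).
  by split; [exact: dC|rewrite -derive1E; exact: eC].
by rewrite -[c x]subr0; apply: is_deriveB.
Qed.

End RealLemmas.

(** * Strongly continuous semigroups and their generators *)

Section Semigroup.
Context {R : realType} {V : lmodType R}.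
Variables (ip : V -> V -> R) (H : hilbert ip).
Local Notation nrm := (ipn ip).

(** The generator is [-G]. The algebraic laws are tested against a vector [g], because [T t u] is
    meaningful only up to null vectors. *)
Record sgroup (T : R -> V -> V) (G : V -> V -> Prop) : Prop := {
  sgL : forall t c u v g, 0 <= t ->
    ip (T t (c *: u + v)) g = c * ip (T t u) g + ip (T t v) g ;
  sgB : forall t, 0 <= t -> exists c, forall u, nrm (T t u) <= c * nrm u ;
  sg0 : forall u g, ip (T 0 u) g = ip u g ;
  sgD : forall s t u g, 0 <= s -> 0 <= t ->
    ip (T (s + t) u) g = ip (T s (T t u)) g ;
  sgC : forall u, nrm (T t u - u) @[t --> 0^'+] --> (0 : R) ;
  sgG : forall u v, G u v <->
    nrm (t^-1 *: (u - T t u) - v) @[t --> 0^'+] --> (0 : R) }.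

Variables (T : R -> V -> V) (G : V -> V -> Prop).
Hypothesis S : sgroup T G.

Lemma sgBl t u v g : 0 <= t -> ip (T t (u - v)) g = ip (T t u - T t v) g.
Proof.
by move=> t0; rewrite addrC -scaleN1r (sgL S)// (ipBl H); ring.
Qed.
Lemma sgZl t c u g : 0 <= t -> ip (T t (c *: u)) g = ip (c *: T t u) g.
Proof.
move=> t0; have z : ip (T t 0) g = 0.
  by have := sgL S 1 0 0 g t0; rewrite scaler0 addr0 mul1r; lra.
by have := sgL S c u 0 g t0; rewrite addr0 z addr0 (ipZl H).
Qed.
Lemma sg_ipnB t u v : 0 <= t -> nrm (T t (u - v)) = nrm (T t u - T t v).
Proof. by move=> t0; apply: (ipn_ip H) => g; exact: sgBl. Qed.
Lemma sg_eqv t u v g : 0 <= t -> (forall h, ip u h = ip v h) ->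
  ip (T t u) g = ip (T t v) g.
Proof.
move=> t0 uv; apply: (ipn0_ipB H); rewrite -sg_ipnB//.
have [c hc] := sgB S t0; apply/eqP; rewrite -[_ == _]orbF orbF eq_le ipn_ge0 andbT.
apply: le_trans (hc _) _; rewrite (ipn_eq0 (u := u - v)) ?mulr0//.
by move=> h; rewrite (ipBl H) uv subrr.
Qed.
Lemma sgDn s t u : 0 <= s -> 0 <= t -> nrm (T (s + t) u) = nrm (T s (T t u)).
Proof. by move=> s0 t0; apply: (ipn_ip H) => g; exact: (sgD S). Qed.
Lemma sg_comm s t u g : 0 <= s -> 0 <= t -> ip (T s (T t u)) g = ip (T t (T s u)) g.
Proof. by move=> s0 t0; rewrite -!(sgD S)// addrC. Qed.

(** Otherwise some operators [T t] with [t] at most [1 / (n + 1)] have norms beyond every bound,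
    while strong continuity at 0 bounds each orbit along these times; this contradicts uniform
    boundedness. *)
Lemma sg_local_bound : exists d M, 0 < d /\
  forall t u, 0 <= t <= d -> nrm (T t u) <= M * nrm u.
Proof.
apply: contrapT => /forallNP h.
have /choice[z hz] (n : nat) : exists z : R * V, 0 <= z.1 <= n.+1%:R^-1 /\
    n%:R * nrm z.2 < nrm (T z.1 z.2).
  have /forallNP/(_ n%:R) := h n.+1%:R^-1.
  move=> /not_andP[|]; first by rewrite invr_gt0 ltr0n.
  move=> /existsNP[t /existsNP[u /not_implyP[ht /negP]]].
  by rewrite -ltNge => hu; exists (t, u).
have z0 n : 0 <= (z n).1 by have [/andP[]] := hz n.
have [||||M hM] := uniform_boundedness H (p := fun n u => nrm (T (z n).1 u)).
- move=> n u v; rewrite -{1}[v]opprK sg_ipnB//.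
  have -> : nrm (T (z n).1 v) = nrm (- T (z n).1 (- v)).
    apply: (ipn_ip H) => g; rewrite -[in RHS]scaleN1r -[- v]scaleN1r (ipZl H) sgZl//.
    by rewrite (ipZl H); ring.
  exact: ipn_triangle.
- move=> n c u; rewrite -(ipnZ H); apply: (ipn_ip H) => g; exact: sgZl.
- by move=> n; exact: (sgB S).
- move=> u.
  have [d d0 hd] := cvg0_right (sgC S u) ltr01.
  have [N hN] : exists N : nat, N.+1%:R^-1 < d.
    have /cvgrPdist_lt/(_ _ d0)[N _ hN] := @cvg_harmonic R.
    by exists N; have := hN N (leqnn N); rewrite /= sub0r normrN ger0_norm.
  exists (nrm u + 1 + \sum_(i < N) nrm (T (z i).1 u)) => n.
  have sge : 0 <= \sum_(i < N) nrm (T (z i).1 u).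
    by apply: sumr_ge0 => i _; exact: ipn_ge0.
  have [nN|Nn] := ltnP n N.
    rewrite (bigD1 (Ordinal nN))//= addrCA lerDl addr_ge0//.
      by rewrite addr_ge0// ipn_ge0.
    by apply: sumr_ge0 => i _; exact: ipn_ge0.
  apply: (@le_trans _ _ (nrm u + 1)); last by rewrite lerDl.
  have [/eqP z00|zn0] := boolP ((z n).1 == 0).
    by rewrite z00 (ipn_ip H (v := u)) ?lerDl// => g; exact: (sg0 S).
  have zd : 0 < (z n).1 < d.
    rewrite lt_neqAle eq_sym zn0 z0/=.
    have [/andP[_ zn] _] := hz n; apply: le_lt_trans zn _.
    by apply: le_lt_trans hN; rewrite lef_pV2 ?posrE// ler_nat.
  have := hd _ zd; have := ipn_triangle H (T (z n).1 u - u) u.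
  by rewrite subrK; lra.
pose n := (Num.truncn `|M|).+1.
have [_ hn] := hz n.
have Mn : M <= n%:R.
  by apply: le_trans (ler_norm _) _; apply: ltW; exact: truncnS_gt.
have := le_trans (hM n (z n).2) (ler_wpM2r (ipn_ge0 ip (z n).2) Mn).
by rewrite leNgt hn.
Qed.

Lemma sg_bound (L : R) : 0 <= L -> exists2 M, 1 <= M &
  forall t u, 0 <= t <= L -> nrm (T t u) <= M * nrm u.
Proof.
move=> L0; have [d [M [d0 hM]]] := sg_local_bound.
pose M1 := Num.max 1 M.
have M11 : 1 <= M1 by rewrite le_max lexx.
have hM1 t u : 0 <= t <= d -> nrm (T t u) <= M1 * nrm u.
  move=> td; apply: le_trans (hM t u td) _.
  by rewrite ler_wpM2r ?ipn_ge0// le_max lexx orbT.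
have it (k : nat) t u : 0 <= t <= k%:R * d -> nrm (T t u) <= M1 ^+ k * nrm u.
  elim: k t u => [|k ih] t u.
    rewrite mul0r => t0; have -> : t = 0 by apply/eqP; rewrite eq_le andbC.
    by rewrite expr0 mul1r (ipn_ip H (v := u))// => g; exact: (sg0 S).
  move=> /andP[t0 tk].
  have [td|td] := leP t d.
    apply: le_trans (hM1 t u _) _; first by rewrite t0.
    rewrite ler_wpM2r ?ipn_ge0// exprS ler_peMr ?exprn_ege1//.
    exact: le_trans M11.
  rewrite -[t](subrK d) addrC sgDn; [|exact: ltW|by rewrite subr_ge0 ltW].
  apply: le_trans (hM1 _ _ _) _; first by rewrite lexx ltW.
  rewrite exprS -mulrA ler_wpM2l ?(le_trans _ M11)//.
  apply: ih; rewrite subr_ge0 ltW//=.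
  by move: tk; rewrite -addn1 natrD mulrDl mul1r; lra.
have [k hk] : exists k : nat, L <= k%:R * d.
  exists (Num.truncn (L / d)).+1; rewrite -ler_pdivrMr// ltW//.
  exact: truncnS_gt.
exists (M1 ^+ k); first exact: exprn_ege1.
move=> t u /andP[t0 tL]; apply: it; rewrite t0/=; exact: le_trans hk.
Qed.

Lemma sg_cont_unif (L : R) u (e : R) : 0 <= L -> 0 < e ->
  exists2 r0, 0 < r0 & forall s r, 0 <= s <= L -> 0 <= r < r0 ->
    nrm (T (s + r) u - T s u) <= e.
Proof.
move=> L0 e0; have [M M1 hM] := sg_bound L0.
have M0 : 0 < M by apply: lt_le_trans M1.
have [d d0 hd] := cvg0_right (sgC S u) (divr_gt0 e0 M0).
exists d => // s r sL /andP[r0 rd]; have s0 : 0 <= s by case/andP: sL.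
have -> : nrm (T (s + r) u - T s u) = nrm (T s (T r u - u)).
  by apply: (ipn_ip H) => g; rewrite sgBl// !(ipBl H) (sgD S).
apply: le_trans (hM _ _ sL) _; rewrite mulrC -ler_pdivlMr//.
move: r0; rewrite le_eqVlt => /orP[/eqP <-|r0]; last by apply: hd; rewrite r0.
rewrite (ipn_eq0 (u := T 0 u - u)); first by rewrite divr_ge0// ltW.
by move=> g; rewrite (ipBl H) (sg0 S) subrr.
Qed.

Lemma sg_graph_step t r u v : 0 <= t -> 0 < r ->
  nrm (r^-1 *: (T t u - T (t + r) u) - T t v) = nrm (T t (r^-1 *: (u - T r u) - v)).
Proof.
move=> t0 r0; apply: (ipn_ip H) => g.
rewrite sgBl// !(ipBl H); congr (_ - _).
by rewrite sgZl// !(ipZl H) sgBl// !(ipBl H) (sgD S)// ltW.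
Qed.

Lemma sg_graph_T t u v : 0 <= t -> G u v -> G (T t u) (T t v).
Proof.
move=> t0 /(sgG S) h; apply/(sgG S).
have [c hc] := sgB S t0.
have hc' u' : nrm (T t u') <= (`|c| + 1) * nrm u'.
  apply: le_trans (hc _) _; rewrite ler_wpM2r ?ipn_ge0//.
  by apply: le_trans (ler_norm _) _; rewrite lerDl.
have : (`|c| + 1) * nrm (r^-1 *: (u - T r u) - v) @[r --> 0^'+] --> (`|c| + 1) * 0.
  exact: cvgMr.
rewrite mulr0 => hb; apply: (squeeze_cvgr _ (cvg_cst 0) hb).
apply/near_rightP; exists 1 => // r /andP[r0 _].
rewrite ipn_ge0/=; apply: le_trans (hc' _); rewrite -sg_graph_step//.
rewrite le_eqVlt; apply/orP; left; apply/eqP; apply: (ipn_ip H) => g.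
by rewrite !(ipBl H) !(ipZl H) !(ipBl H) (sgD S)// ?ltW// sg_comm// ltW.
Qed.

Lemma sg_diff_unif (L : R) u v (e : R) : G u v -> 0 <= L -> 0 < e ->
  exists2 r0, 0 < r0 & forall s r, 0 <= s <= L -> 0 < r < r0 ->
    nrm (r^-1 *: (T s u - T (s + r) u) - T s v) <= e.
Proof.
move=> /(sgG S) h L0 e0; have [M M1 hM] := sg_bound L0.
have M0 : 0 < M by apply: lt_le_trans M1.
have [d d0 hd] := cvg0_right h (divr_gt0 e0 M0).
exists d => // s r sL rd; have s0 : 0 <= s by case/andP: sL.
rewrite sg_graph_step//; last by case/andP: rd.
apply: le_trans (hM _ _ sL) _; rewrite mulrC -ler_pdivlMr//; exact: hd.
Qed.

(** The derivative of [|T s u|^2] is [- 2 ip (T s v) (T s u)]. Its difference quotients converge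
    uniformly on [[0, t]], so [le_of_increments] integrates the inequality. *)
Lemma sg_dissip u v t rho : G u v -> 0 <= t ->
  (forall s, 0 <= s <= t -> rho <= ip (T s v) (T s u)) ->
  nrm (T t u) ^+ 2 <= nrm u ^+ 2 - 2 * rho * t.
Proof.
move=> Guv t0 hrho.
pose F s := nrm (T s u) ^+ 2 + 2 * rho * s.
have [M M1 hM] := sg_bound t0.
have M0 : 0 < M by apply: lt_le_trans M1.
have -> : nrm u = nrm (T 0 u) by apply: (ipn_ip H) => g; rewrite (sg0 S).
suff : F t <= F 0 by rewrite /F; lra.
apply: le_of_increments => // e e0.
pose K := M * nrm v + 2 * M * nrm u + 1.
have un := ipn_ge0 ip u; have vn := ipn_ge0 ip v.
have K1 : 0 <= M * nrm v by rewrite mulr_ge0// ltW.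
have K2 : 0 <= M * nrm u by rewrite mulr_ge0// ltW.
have K0 : 0 < K by rewrite /K; lra.
have [r1 r10 h1] := sg_diff_unif Guv t0 (divr_gt0 e0 K0).
have [r2 r20 h2] := sg_cont_unif u t0 (divr_gt0 e0 K0).
exists (Num.min r1 r2); first by rewrite lt_min r10.
move=> s r s0 /andP[r0]; rewrite lt_min => /andP[rr1 rr2] srt.
have st : 0 <= s <= t by rewrite s0/=; lra.
have srt' : 0 <= s + r <= t by rewrite srt andbT; lra.
have := h1 s r st; rewrite r0 rr1 => /(_ isT).
have := h2 s r st; rewrite (ltW r0) rr2 => /(_ isT).
have := hM s v st; have := hM s u st; have := hM (s + r) u srt'; have := hrho s st.
rewrite /F !(sqr_ipn H).
set A := T s u; set A' := T s v; set B := T (s + r) u.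
set E := _ - A'.
have Kn0 : K != 0 by rewrite gt_eqF.
  move: (e / K) (divr_gt0 e0 K0) (divfK Kn0 e).
move=> e' e'0 eK hr hB hA hA' hBA hE.
have AB : A - B = r *: (A' + E).
  by rewrite /E [A' + _]addrC subrK scalerA divff ?gt_eqF// scale1r.
have y1 : ip A A - ip B B = ip (A - B) (A + B).
  by rewrite !(ipBl H) !(ipDr H) (ipC H B A); ring.
have y2 : ip A' (A + B) = 2 * ip A' A + ip A' (B - A).
  by rewrite (ipDr H) (ipBr H); ring.
have y3 : - (M * nrm v * e') <= ip A' (B - A).
  have := ip_CS H A' (B - A); rewrite ler_norml => /andP[h _].
  apply: le_trans h; rewrite lerN2; apply: ler_pM => //; exact: ipn_ge0.
have y4 : - (e' * (2 * M * nrm u)) <= ip E (A + B).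
  have := ip_CS H E (A + B); rewrite ler_norml => /andP[h _].
  apply: le_trans h; rewrite lerN2; apply: ler_pM => //; try exact: ipn_ge0.
  by apply: le_trans (ipn_triangle H _ _) _; lra.
rewrite AB (ipZl H) (ipDl H) y2 in y1.
have : r * (2 * rho - e) <= ip A A - ip B B.
  rewrite y1 ler_pM2l//; rewrite -eK /K.
  nra.
lra.
Qed.

Hypothesis Gsym : forall u v u' v', G u v -> G u' v' -> ip v u' = ip u v'.
Hypothesis Gpos : forall u v, G u v -> 0 <= ip v u.

Lemma sg_contract_dom t u v : G u v -> 0 <= t -> nrm (T t u) <= nrm u.
Proof.
move=> Guv t0; rewrite -(@ler_pXn2r _ 2) ?nnegrE ?ipn_ge0//.
have := @sg_dissip u v t 0 Guv t0.
rewrite mulr0 mul0r subr0; apply => s /andP[s0 _].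
exact/Gpos/sg_graph_T.
Qed.

(** The function [s -> ip (T s u) (T (t - s) u')] has zero derivative by symmetry of [G]; its values
    at [t] and at 0 are the two sides. *)
Lemma sg_sym_dom t u v u' v' : G u v -> G u' v' -> 0 <= t ->
  ip (T t u) u' = ip u (T t u').
Proof.
move=> Gu Gu' t0.
pose F s := ip (T s u) (T (t - s) u').
have [M M1 hM] := sg_bound t0.
have M0 : 0 < M by apply: lt_le_trans M1.
have un := ipn_ge0 ip u; have vn := ipn_ge0 ip u'.
have K1 : 0 <= M * nrm u by rewrite mulr_ge0// ltW.
have K2 : 0 <= M * nrm u' by rewrite mulr_ge0// ltW.
pose K := M * nrm u + M * nrm u' + 1.
have K0 : 0 < K by rewrite /K; lra.
have key e : 0 < e -> exists2 r0, 0 < r0 & forall s r,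
     0 <= s -> 0 < r < r0 -> s + r <= t -> `|F (s + r) - F s| <= e * r.
  move=> e0.
  have [r1 r10 h1] := sg_diff_unif Gu t0 (divr_gt0 e0 K0).
  have [r2 r20 h2] := sg_diff_unif Gu' t0 (divr_gt0 e0 K0).
  exists (Num.min r1 r2); first by rewrite lt_min r10.
  move=> s r s0 /andP[r0]; rewrite lt_min => /andP[rr1 rr2] srt.
  have st : 0 <= s <= t by rewrite s0/=; lra.
  have tsr0 : 0 <= t - (s + r) by rewrite subr_ge0.
  have st' : 0 <= t - (s + r) <= t by rewrite tsr0/=; lra.
  have := h1 s r st; rewrite r0 rr1 => /(_ isT).
  have := h2 (t - (s + r)) r st'; rewrite r0 rr2 => /(_ isT).
  have := hM s u st; have := hM (t - (s + r)) u' st'.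
  have -> : t - (s + r) + r = t - s by rewrite opprD addrA subrK.
  have := Gsym (sg_graph_T s0 Gu) (sg_graph_T tsr0 Gu').
  rewrite /F.
  set A := T s u; set A' := T s v; set A1 := T (s + r) u.
  set B := T (t - (s + r)) u'; set B' := T (t - (s + r)) v'; set B1 := T (t - s) u'.
  set E1 := _ - A'; set E2 := _ - B'.
  have Kn0 : K != 0 by rewrite gt_eqF.
  move: (e / K) (divr_gt0 e0 K0) (divfK Kn0 e).
  move=> e' e'0 eK hs hB hA hE2 hE1.
  have A1E : A1 = A - r *: (A' + E1).
    by rewrite /E1 [A' + _]addrC subrK scalerA divff ?gt_eqF// scale1r opprB addrC subrK.
  have B1E : B1 = B - r *: (B' + E2).
    by rewrite /E2 [B' + _]addrC subrK scalerA divff ?gt_eqF// scale1r opprB addrC subrK.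
  have -> : ip A1 B - ip A B1 = r * (ip A E2 - ip E1 B).
    rewrite A1E B1E (ipBl H) (ipBr H) (ipZl H) (ipZr H) (ipDl H) (ipDr H) hs; ring.
  rewrite normrM gtr0_norm// mulrC ler_pM2r//.
  apply: le_trans (ler_normB _ _) _; rewrite -eK /K.
  have z1 : `|ip A E2| <= M * nrm u * e'.
    apply: le_trans (ip_CS H _ _) _; apply: ler_pM => //; exact: ipn_ge0.
  have z2 : `|ip E1 B| <= e' * (M * nrm u').
    apply: le_trans (ip_CS H _ _) _; apply: ler_pM => //; exact: ipn_ge0.
  nra.
have FE : F 0 = ip u (T t u') by rewrite /F subr0 (sg0 S).
have -> : ip (T t u) u' = F t.
  by rewrite /F subrr (ipC H) -(sg0 S) (ipC H).
rewrite -FE; apply/eqP; rewrite eq_le; apply/andP; split.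
  apply: le_of_increments => // e e0; have [r0 r00 hr] := key e e0.
  exists r0 => // s r s0 rr sr; apply: le_trans (ler_norm _) _; exact: hr.
rewrite -lerN2; apply: (@le_of_increments R (fun s => - F s)) => // e e0.
have [r0 r00 hr] := key e e0.
exists r0 => // s r s0 rr sr; rewrite -opprD; apply: le_trans (ler_norm _) _.
by rewrite normrN; exact: hr.
Qed.

(* [A] is the integral of [T s eta] over [0, x], defined by duality. *)
Lemma sg_average eta (x : R) : 0 < x -> exists A, G A (eta - T x eta) /\
  forall g K, (forall s, 0 <= s <= x -> ip (T s eta) g <= K) -> ip A g <= K * x.
Proof.
move=> x0.
have cont (g : V) : continuous (fun s : R => ip (T `|s| eta) g : R).
  move=> s; apply/cvgrPdist_le => e e0.
  have gp : 0 < nrm g + 1 by rewrite ltr_wpDl ?ipn_ge0.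
  have s10 : 0 <= `|s| + 1 by rewrite addr_ge0.
  have [r0 r00 hr] := sg_cont_unif eta s10 (divr_gt0 e0 gp).
  have mp : 0 < Num.min r0 1 by rewrite lt_min r00 ltr01.
  near=> r.
  have rs : `|s - r| < Num.min r0 1 by near: r; exact: cvgr_dist_lt.
  move: rs; rewrite lt_min => /andP[rs1 rs2].
  have ab : `| `|s| - `|r| | <= `|s - r| := ler_dist_dist _ _.
  rewrite -(ipBl H); apply: le_trans (ip_CS H _ _) _.
  have : nrm (T `|s| eta - T `|r| eta) <= e / (nrm g + 1).
    have [h|h] := leP `|s| `|r|.
      have rE : `|r| = `|s| + (`|r| - `|s|) :> R by rewrite addrC subrK.
      rewrite (ipnB H) rE; apply: hr.
        by rewrite normr_ge0 lerDl ler01.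
      rewrite subr_ge0 h/=; apply: le_lt_trans rs1; apply: le_trans ab.
      by rewrite distrC ler_norm.
    have rE : `|s| = `|r| + (`|s| - `|r|) :> R by rewrite addrC subrK.
    rewrite [in T `|s| eta]rE; apply: hr.
      rewrite normr_ge0/=; apply: ltW; apply: lt_trans h _.
      by rewrite ltrDl.
    rewrite subr_ge0 ltW//=; apply: le_lt_trans rs1; apply: le_trans ab.
    by rewrite ler_norm.
  rewrite ler_pdivlMr// => h; apply: le_trans h.
  by apply: ler_wpM2l; rewrite ?ipn_ge0// lerDl.
have /choice[C hC] : forall g, exists C : R -> R, C 0 = 0 /\
    forall s : R, 0 <= s -> is_derive s (1 : R) C (ip (T `|s| eta) g).
  by move=> g; have [C C0 dC] := antiderivative (cont g); exists C.
have C0 g : C g 0 = 0 by have [] := hC g.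
have dC g (s : R) : 0 <= s -> is_derive s (1 : R) (C g) (ip (T s eta) g).
  by move=> s0; have [_ /(_ s s0)] := hC g; rewrite ger0_norm.
have [M M1 hM] := sg_bound (ltW x0).
have Cle g K : (forall s, 0 <= s <= x -> ip (T s eta) g <= K) -> C g x <= K * x.
  move=> hK; have := @mvt_le _ (C g) (fun s => ip (T s eta) g) x K (ltW x0).
  rewrite C0 subr0; apply; last exact: hK.
  by move=> s /andP[s0 _]; exact: dC.
have Clin k u v : C (k *: u + v) x = k * C u x + C v x.
  have := @mvt_eq _ (C (k *: u + v) - (k *: C u + C v)) x (ltW x0).
  move=> h; have {h} := h _; rewrite !fctE/= !C0 scaler0 addr0 subrr.
  rewrite /GRing.scale/= => h; apply/eqP; rewrite -subr_eq0; apply/eqP; apply: h.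
  move=> s /andP[s0 _].
  have d1 := dC (k *: u + v) s s0; have d2 := dC u s s0; have d3 := dC v s s0.
  have -> : 0 = ip (T s eta) (k *: u + v) - (k *: ip (T s eta) u + ip (T s eta) v).
    by rewrite (ipDr H) (ipZr H) subrr.
  by apply: is_deriveB.
have Cbd g : C g x <= M * nrm eta * x * nrm g.
  rewrite mulrAC; apply: Cle => s sx; apply: le_trans (ip_le H _ _) _.
  by rewrite ler_wpM2r ?ipn_ge0//; exact: hM.
have CN g : C (- g) x = - C g x.
  have := Clin (-1) g 0; rewrite addr0 scaleN1r mulN1r => ->.
  have := Clin 0 0 0; rewrite scale0r addr0 mul0r add0r => z.
  have := Clin 1 0 0; rewrite scaler0 addr0 mul1r; lra.
have [A hA] : exists A, forall g, C g x = ip A g.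
  apply: (riesz H (c := M * nrm eta * x)) => // g.
  by rewrite ler_norml Cbd andbT; have := Cbd (- g); rewrite CN (ipnN H); lra.
exists A; split; last by move=> g K /Cle; rewrite hA.
apply/(sgG S); apply: cvg0_rightI; first by move=> *; exact: ipn_ge0.
move=> e e0.
have e2 : 0 < e / 2 by rewrite divr_gt0.
have [d d0 hd] := sg_cont_unif eta (ltW x0) e2.
exists d => // r /andP[r0 rd].
apply: (ipn_dual H (ltW e0)) => g.
have [c hc] := sgB S (ltW r0).
(* [g'] is the adjoint of [T r] applied to [g]: it turns the pairing of [T r A] with [g] into an
   integral of the shifted orbit, [C g (x + r) - C g r]. *)
have [g' hg'] : exists g', forall w, ip (T r w) g = ip g' w.
  apply: (riesz H (c := (`|c| * nrm g))).
    by move=> k u v; rewrite (sgL S)// ltW.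
  move=> u; apply: le_trans (ip_CS H _ _) _; rewrite mulrAC ler_wpM2r ?ipn_ge0//.
  apply: le_trans (hc u) _; rewrite ler_wpM2r ?ipn_ge0//; exact: ler_norm.
have Cr : C g' x = C g (x + r) - C g r.
  have := @mvt_eq _ (fun s => C g' s - C g (s + r)) x (ltW x0).
  rewrite add0r C0 => h; have {h} := h _.
  suff h : forall s : R, 0 <= s <= x -> is_derive s (1 : R) (fun s => C g' s - C g (s + r)) 0.
    move=> /(_ h); lra.
  move=> s /andP[s0 _].
  have -> : 0 = ip (T s eta) g' - ip (T (s + r) eta) g *: (1 : R).
    by rewrite /GRing.scale/= mulr1 (ipC H _ g') -hg' (addrC s r) (sgD S eta g (ltW r0) s0) subrr.
  have d1 := dC g' s s0.
  have sr0 : 0 <= s + r by rewrite addr_ge0// ltW.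
  have d2 := dC g (s + r) sr0.
  apply: is_deriveB; apply: is_derive1_comp.
  by rewrite -[X in is_derive _ _ _ X]addr0; apply: is_deriveD.
rewrite (ipBl H) (ipZl H) (ipBl H) hg' (ipC H g') -!hA Cr (ipBl H).
(* The difference quotient of [A] is the average of [T s eta - T (x + s) eta] over [[0, r]], which
   is close to [eta - T x eta]. *)
have key : (C g r - C g (x + r)) - (C g 0 - C g (x + 0)) <=
    (ip eta g - ip (T x eta) g + e * nrm g) * r.
  apply: (@mvt_le _ (fun s => C g s - C g (x + s))
     (fun s => ip (T s eta) g - ip (T (x + s) eta) g *: (1 : R)) r _ (ltW r0)).
    move=> s /andP[s0 _]; have d1 := dC g s s0.
    have sr0 : 0 <= x + s by rewrite addr_ge0// ltW.
    have d2 := dC g (x + s) sr0.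
    apply: is_deriveB; apply: is_derive1_comp.
    by rewrite -[X in is_derive _ _ _ X]add0r; apply: is_deriveD.
  move=> s /andP[s0 sr]; rewrite /GRing.scale/= mulr1.
  have sd : 0 <= s < d by rewrite s0 (le_lt_trans sr).
  have h0 : ((0 : R) <= (0 : R)) && ((0 : R) <= x) by rewrite lexx ltW.
  have hx : 0 <= x <= x by rewrite lexx ltW.
  have k1 := hd 0 s h0 sd; have k2 := hd x s hx sd.
  rewrite add0r in k1.
  have : ip (T s eta) g - ip eta g <= e / 2 * nrm g.
    rewrite -(sg0 S eta g) -(ipBl H); apply: le_trans (ip_le H _ _) _.
    by rewrite ler_wpM2r// ipn_ge0.
  have : ip (T x eta) g - ip (T (x + s) eta) g <= e / 2 * nrm g.
    rewrite -(ipBl H); apply: le_trans (ip_le H _ _) _.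
    by rewrite ler_wpM2r// ?ipn_ge0// (ipnB H).
  lra.
rewrite C0 addr0 in key.
have : r^-1 * (C g x - (C g (x + r) - C g r)) <= ip eta g - ip (T x eta) g + e * nrm g.
  by rewrite ler_pdivrMl// [r * _]mulrC; apply: le_trans key; lra.
lra.
Unshelve. all: by end_near.
Qed.

Lemma sg_graphZ c u v : G u v -> G (c *: u) (c *: v).
Proof.
move=> /(sgG S) h; apply/(sgG S).
have : `|c| * nrm (t^-1 *: (u - T t u) - v) @[t --> 0^'+] --> `|c| * 0 by exact: cvgMr.
rewrite mulr0; apply: cvg_trans; apply: near_eq_cvg; apply/near_rightP.
exists 1 => // t /andP[t0 _]; rewrite -(ipnZ H); apply: (ipn_ip H) => g.
rewrite (ipZl H) !(ipBl H) !(ipZl H) !(ipBl H) sgZl ?(ltW t0)// !(ipZl H); ring.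
Qed.

(** Averages of an orbit over a short interval. Besides lying in the domain close to [eta], they
    inherit every linear upper bound that holds along the orbit, which is what the Nash argument
    needs. *)
Lemma sg_approx eta (e : R) : 0 < e -> exists A v, [/\ G A v, nrm (A - eta) <= e &
  forall g K, (forall s, 0 <= s -> ip (T s eta) g <= K) -> ip A g <= K].
Proof.
move=> e0; have [d d0 hd] := sg_cont_unif eta (lexx 0) e0.
pose x := d / 2; have x0 : 0 < x by rewrite divr_gt0.
have xd : x < d by rewrite /x; lra.
have [A [GA hA]] := sg_average eta x0.
exists (x^-1 *: A), (x^-1 *: (eta - T x eta)); split; first exact: sg_graphZ.
  apply: (ipn_dual H (ltW e0)) => g; rewrite (ipBl H) (ipZl H).
  have : ip A g <= (ip eta g + e * nrm g) * x.
    apply: hA => s /andP[s0 sx].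
    have h0 : ((0 : R) <= (0 : R)) && ((0 : R) <= (0 : R)) by rewrite lexx.
    have sd : 0 <= s < d by rewrite s0 (le_lt_trans sx).
    have := hd 0 s h0 sd; rewrite add0r => k1.
    have : ip (T s eta) g - ip eta g <= e * nrm g.
      rewrite -(sg0 S eta g) -(ipBl H); apply: le_trans (ip_le H _ _) _.
      by rewrite ler_wpM2r// ipn_ge0.
    lra.
  by rewrite -ler_pdivrMr// mulrC; lra.
move=> g K hK; rewrite (ipZl H) ler_pdivrMl// mulrC; apply: hA => s /andP[s0 _].
exact: hK.
Qed.

Lemma sg_contract t u : 0 <= t -> nrm (T t u) <= nrm u.
Proof.
move=> t0; apply/ler_addgt0Pr => e e0.
have [c hc] := sgB S t0.
have c0 : 0 < `|c| + 1 by rewrite ltr_wpDl.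
have c2 : 0 < `|c| + 2 by rewrite ltr_wpDl.
have [A [v [GA hA _]]] := sg_approx u (divr_gt0 e0 c2).
have h1 := sg_contract_dom GA t0.
have h2 : nrm (T t u) <= nrm (T t (u - A)) + nrm (T t A).
  by rewrite sg_ipnB//; have := ipn_triangle H (T t u - T t A) (T t A); rewrite subrK.
have h3 : nrm (T t (u - A)) <= `|c| * nrm (A - u).
  apply: le_trans (hc _) _; rewrite (ipnB H) ler_wpM2r ?ipn_ge0//; exact: ler_norm.
have h4 : nrm A <= nrm u + nrm (A - u).
  by have := ipn_triangle H (A - u) u; rewrite subrK addrC.
have h5 : `|c| * nrm (A - u) + nrm (A - u) <= e.
  apply: (@le_trans _ _ ((`|c| + 2) * nrm (A - u))).
    by have := ipn_ge0 ip (A - u); lra.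
  by rewrite mulrC -ler_pdivlMr.
lra.
Qed.

Lemma sg_sym t u v : 0 <= t -> ip (T t u) v = ip u (T t v).
Proof.
move=> t0.
apply/eqP; rewrite -subr_eq0 -normr_le0; apply/ler_addgt0Pr => e e0; rewrite add0r.
pose K := nrm u + nrm v + 1.
have K0 : 0 < K by have := ipn_ge0 ip u; have := ipn_ge0 ip v; rewrite /K; lra.
pose d := Num.min 1 (e / (4 * K)).
have d0 : 0 < d by rewrite lt_min ltr01 divr_gt0// mulr_gt0.
have d1 : d <= 1 by rewrite /d ge_min lexx.
have d2 : d * (4 * K) <= e by rewrite -ler_pdivlMr ?mulr_gt0// /d ge_min lexx orbT.
have [A [Av [GA hA _]]] := sg_approx u d0.
have [B [Bv [GB hB _]]] := sg_approx v d0.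
have sAB := sg_sym_dom GA GB t0.
have -> : ip (T t u) v - ip u (T t v) =
   (ip (T t (u - A)) v + ip (T t A) (v - B)) - (ip (u - A) (T t v) + ip A (T t (v - B))).
  rewrite sgBl// (ipC H A) sgBl// !(ipBl H) (ipBr H) (ipC H _ A) (ipC H _ A) sAB; ring.
have nA : nrm A <= nrm u + d.
  by have := ipn_triangle H (A - u) u; rewrite subrK; lra.
have uA : nrm (u - A) <= d by rewrite (ipnB H).
have vB : nrm (v - B) <= d by rewrite (ipnB H).
have un := ipn_ge0 ip u; have vn := ipn_ge0 ip v.
have cs x y a b : nrm x <= a -> nrm y <= b -> `|ip x y| <= a * b.
  by move=> h1 h2; apply: le_trans (ip_CS H _ _) _; apply: ler_pM => //; exact: ipn_ge0.
have k1 := cs _ _ _ _ (le_trans (sg_contract (u - A) t0) uA) (lexx (nrm v)).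
have k2 := cs _ _ _ _ (le_trans (sg_contract A t0) nA) vB.
have k3 := cs _ _ _ _ uA (sg_contract v t0).
have k4 := cs _ _ _ _ nA (le_trans (sg_contract (v - B) t0) vB).
apply: le_trans (ler_normB _ _) _.
have := ler_normD (ip (T t (u - A)) v) (ip (T t A) (v - B)).
have := ler_normD (ip (u - A) (T t v)) (ip A (T t (v - B))).
rewrite /K in d2; nra.
Qed.

Lemma sg_half t u : 0 <= t -> nrm (T (t / 2) u) ^+ 2 = ip u (T t u).
Proof.
move=> t0; have t2 : 0 <= t / 2 by rewrite divr_ge0.
by rewrite (sqr_ipn H) -sg_sym// -(sgD S)// -splitr sg_sym.
Qed.

(** Iterating [|T (t / 2) u|^2 = ip u (T t u) <= |T t u|] bounds [|T t u|] below by the power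
    [2 ^ n] of [|T r u|], with [r = t / 2 ^ n]; for small [r] the generator gives
    [|T r u| >= 1 - r (q + e / 2)]. This replaces Jensen's inequality for the spectral measure. *)
Lemma sg_lower_bound t u v : G u v -> nrm u = 1 -> 0 <= t ->
  expR (- (ip v u * t)) <= nrm (T t u).
Proof.
move=> Gu n1; rewrite le_eqVlt => /orP[/eqP<-|t0].
  by rewrite mulr0 oppr0 expR0 (ipn_ip H (v := u)) ?n1// => g; rewrite (sg0 S).
have q0 := Gpos Gu; set q := ip v u in q0 *.
suff h e : 0 < e -> expR (- ((q + e) * t)) <= nrm (T t u).
  have hc : expR (- ((q + e) * t)) @[e --> 0^'+] --> expR (- (q * t)).
    apply: cvg_at_right_filter.
    have -> : q * t = (q + 0) * t by rewrite addr0.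
    apply: continuous_cvg; first exact: continuous_expR.
    by apply: cvgN; apply: cvgMl; apply: cvgD; [exact: cvg_cst|exact: cvg_id].
  rewrite -(cvg_lim _ hc)//; apply: limr_le; first by apply/cvg_ex; eexists; exact: hc.
  by apply/near_rightP; exists 1 => // e /andP[e0 _]; exact: h.
move=> e0.
have dyadic n : nrm (T (t / 2 ^+ n) u) ^+ (2 ^ n) <= nrm (T t u).
  elim: n => [|n ih]; first by rewrite expr0 divr1 expr1.
  apply: le_trans ih; rewrite expnS exprM ler_pXn2r ?nnegrE ?exprn_ge0 ?ipn_ge0 ?expn_gt0//.
  have -> : t / 2 ^+ n.+1 = t / 2 ^+ n / 2 by rewrite exprS invfM mulrA mulrAC.
  rewrite sg_half; last by rewrite divr_ge0 ?exprn_ge0// ltW.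
  by apply: le_trans (ip_le H _ _) _; rewrite n1 mul1r.
have e2 : 0 < e / 2 by rewrite divr_gt0.
have [d d0 hd] := cvg0_right (proj1 (sgG S u v) Gu) e2.
(* The second bound absorbs the quadratic term of [expR (- y) <= 1 - y + y ^+ 2] at
   [y = (q + e) * r]. *)
pose d' := Num.min d (e / 2 / (q + e) ^+ 2).
have qe : 0 < q + e by rewrite ltr_wpDl.
have d'0 : 0 < d' by rewrite lt_min d0 divr_gt0// exprn_gt0.
have [n hn] : exists n : nat, t / 2 ^+ n < d'.
  have [n hn] : exists n : nat, t / d' < n%:R.
    by exists (Num.truncn (t / d')).+1; exact: truncnS_gt.
  exists n; rewrite ltr_pdivrMr ?exprn_gt0// mulrC -ltr_pdivrMr//.
  by apply: lt_le_trans hn _; rewrite -natrX ler_nat ltnW// ltn_expl.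
apply: le_trans (dyadic n).
pose r := t / 2 ^+ n.
have r0 : 0 < r by rewrite divr_gt0// exprn_gt0.
have -> : - ((q + e) * t) = (- ((q + e) * r)) * (2 ^ n)%:R.
  by rewrite /r natrX; field; rewrite expf_neq0.
rewrite mulrC expRM_natl.
rewrite ler_pXn2r ?nnegrE ?expR_ge0 ?ipn_ge0 ?expn_gt0// -/r.
move: hn; rewrite -/r lt_min => /andP[rd rd'].
have := hd r; rewrite r0 rd => /(_ isT) hr.
have h1 : 1 - r * (q + e / 2) <= nrm (T r u).
  have k1 : ip (r^-1 *: (u - T r u) - v) u <= e / 2.
    by apply: le_trans (ip_le H _ _) _; rewrite n1 mulr1.
  rewrite (ipBl H) (ipZl H) (ipBl H) -/q -(sqr_ipn H) n1 expr1n in k1.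
  have k2 : ip (T r u) u <= nrm (T r u).
    by apply: le_trans (ip_le H _ _) _; rewrite n1 mulr1.
  have : r^-1 * (1 - ip (T r u) u) <= q + e / 2 by lra.
  rewrite ler_pdivrMl//; lra.
apply: le_trans h1.
have y0 : 0 <= (q + e) * r by rewrite mulr_ge0// ltW.
have ex : expR (- ((q + e) * r)) <= 1 - (q + e) * r + ((q + e) * r) ^+ 2.
  rewrite expRN -[leRHS]invrK lef_pV2 ?posrE ?expR_gt0//; last first.
    by rewrite invr_gt0; have := sqr_ge0 ((q + e) * r - 2^-1); rewrite sqrrB; lra.
  apply: le_trans (expR_ge1Dx _).
  have p : 0 < 1 - (q + e) * r + ((q + e) * r) ^+ 2.
    by have := sqr_ge0 ((q + e) * r - 2^-1); rewrite sqrrB; lra.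
  rewrite -[leLHS]mul1r ler_pdivrMr//.
  move: ((q + e) * r) y0 {p} => y y0.
  have : 0 <= y ^+ 3 by rewrite exprn_ge0.
  rewrite (_ : (1 + y) * _ = 1 + y ^+ 3); [lra|ring].
apply: le_trans ex _.
have h2 : r * (q + e) ^+ 2 <= e / 2 by rewrite -ler_pdivlMr ?exprn_gt0// ltW.
have : r * (r * (q + e) ^+ 2) <= r * (e / 2) by rewrite ler_pM2l.
by rewrite exprMn; lra.
Qed.

(** As [ip (T m u) (T n u) = |T ((m + n) / 2) u|^2] and the norms decrease, the squared distance of
    [T m u] and [T n u] is controlled by the tail of a convergent sequence, so integer times give a
    Cauchy sequence. Invariance of the limit and contractivity extend the convergence to real
    times. *)
Lemma sg_limit u : exists P, nrm (T t u - P) @[t --> +oo] --> (0 : R) /\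
  forall s g, 0 <= s -> ip (T s P) g = ip P g.
Proof.
pose y n := nrm (T n%:R u) ^+ 2.
have ymono m n : (m <= n)%N -> y n <= y m.
  move=> mn; rewrite /y ler_pXn2r ?nnegrE ?ipn_ge0//.
  by rewrite -(subnK mn) natrD sgDn// sg_contract.
have ycv : cvgn y.
  apply: nonincreasing_is_cvgn => //; exists 0 => _ [n _ <-]; exact: sqr_ge0.
have diff m n : nrm (T m%:R u - T n%:R u) ^+ 2 = y m + y n - 2 * nrm (T ((m + n)%:R / 2) u) ^+ 2.
  rewrite sg_half// (sqr_ipn H) !(ipBl H) !(ipBr H) /y !(sqr_ipn H).
  have -> : ip u (T (m + n)%:R u) = ip (T m%:R u) (T n%:R u).
    by rewrite (ipC H) natrD (sgD S)// sg_sym// (ipC H).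
  rewrite (ipC H (T n%:R u)); ring.
have h2 m n N : (N <= m)%N -> (N <= n)%N -> limn y <= nrm (T ((m + n)%:R / 2) u) ^+ 2.
  move=> hm hn; apply: (@le_trans _ _ (y (m + n)%N)).
    by apply: nonincreasing_cvgn_ge.
  rewrite /y ler_pXn2r ?nnegrE ?ipn_ge0// [X in T X u]splitr sgDn ?divr_ge0//.
  by rewrite sg_contract// divr_ge0.
have [P hP] : exists l, nrm (T n%:R u - l) @[n --> \oo] --> (0 : R).
  apply: (ipn_complete H (u_ := fun n => T n%:R u)) => e e0.
  have e2 : 0 < e ^+ 2 / 2 by rewrite divr_gt0// exprn_gt0.
  have /cvgrPdist_le/(_ _ e2)[N _ hN] := ycv.
  exists N => m n hm hn; rewrite -(@ler_pXn2r _ 2) ?nnegrE ?ipn_ge0 ?(ltW e0)// diff.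
  have := hN m hm; have := hN n hn; have := h2 m n N hm hn.
  rewrite !ler_norml => a1 /andP[b1 b2] /andP[c1 c2]; lra.
have inv s g : 0 <= s -> ip (T s P) g = ip P g.
  move=> s0.
  have c1 : ip (T n%:R u) (T s g) @[n --> \oo] --> ip P (T s g) by exact: cvg_ipl.
  rewrite sg_sym//; suff c2 : ip (T n%:R u) (T s g) @[n --> \oo] --> ip P g.
    exact: (cvg_unique _ c1 c2).
  have c3 : nrm (T (n%:R + s) u - P) @[n --> \oo] --> (0 : R).
    have hb : nrm (T n%:R u - P) + nrm (T s (T n%:R u) - T n%:R u) @[n --> \oo] --> (0 : R).
      rewrite -[0]addr0; apply: cvgD => //.
      apply/cvgrPdist_le => e e0.
      have e2 : 0 < e ^+ 2 / 2 by rewrite divr_gt0// exprn_gt0.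
      have /cvgrPdist_le/(_ _ e2)[N _ hN] := ycv.
      (* The time [n + s / 2] comes before the integer time [n + k], where the squared norm is at
         least the limit. *)
      pose k := (Num.truncn s).+1.
      exists N => // n hn /=; rewrite sub0r normrN ger0_norm ?ipn_ge0//.
      rewrite -(@ler_pXn2r _ 2) ?nnegrE ?ipn_ge0 ?(ltW e0)//.
      have -> : nrm (T s (T n%:R u) - T n%:R u) ^+ 2 =
          nrm (T (n%:R + s) u) ^+ 2 + y n - 2 * nrm (T (n%:R + s / 2) u) ^+ 2.
        rewrite (sqr_ipn H) !(ipBl H) !(ipBr H) /y -!(sqr_ipn H).
        have -> : nrm (T s (T n%:R u)) = nrm (T (n%:R + s) u) by rewrite addrC sgDn.
        have -> : nrm (T (n%:R + s / 2) u) = nrm (T (s / 2) (T n%:R u)).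
          by rewrite addrC sgDn// divr_ge0.
        by rewrite sg_half// (ipC H (T s _)); ring.
      have k1 : nrm (T (n%:R + s) u) ^+ 2 <= y n.
        by rewrite /y ler_pXn2r ?nnegrE ?ipn_ge0// addrC sgDn// sg_contract.
      have k2 : limn y <= nrm (T (n%:R + s / 2) u) ^+ 2.
        apply: (@le_trans _ _ (y (n + k)%N)).
          by apply: nonincreasing_cvgn_ge.
        have sk : 0 <= k%:R - s / 2.
          have : s < k%:R by exact: truncnS_gt.
          lra.
        rewrite /y ler_pXn2r ?nnegrE ?ipn_ge0//.
        have -> : (n + k)%:R = (k%:R - s / 2) + (n%:R + s / 2) :> R by rewrite natrD; ring.
        have ns : 0 <= n%:R + s / 2 by rewrite addr_ge0// divr_ge0.
        by rewrite sgDn// sg_contract.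
      have := hN n hn; rewrite ler_norml => /andP[b1 b2]; lra.
    apply: (squeeze_cvgr _ (cvg_cst 0) hb); apply: nearW => n.
    rewrite ipn_ge0/=; apply: le_trans (ipn_triangleB H _ (T n%:R u) _) _.
    rewrite addrC lerD2l le_eqVlt; apply/orP; left; apply/eqP; apply: (ipn_ip H) => h.
    by rewrite !(ipBl H) (addrC n%:R) (sgD S).
  have : ip (T (n%:R + s) u) g @[n --> \oo] --> ip P g by exact: cvg_ipl.
  apply: cvg_trans; apply: near_eq_cvg; apply: nearW => n /=.
  by rewrite -sg_sym// addrC (sgD S).
exists P; split => //.
apply/cvgrPdist_le => e e0; have /cvgrPdist_le/(_ e e0)[N _ hN] := hP.
exists N%:R; split; first exact: num_real.
move=> t tN; rewrite sub0r normrN ger0_norm ?ipn_ge0//.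
have := hN N (leqnn N); rewrite /= sub0r normrN ger0_norm ?ipn_ge0//; apply: le_trans.
have tN0 : 0 <= t - N%:R by rewrite subr_ge0 ltW.
apply: le_trans (sg_contract _ tN0).
rewrite le_eqVlt; apply/orP; left; apply/eqP; apply: (ipn_ip H) => g.
by rewrite sgBl// !(ipBl H) inv// -(sgD S)// subrK.
Qed.

(* Nash's argument: [z t := kappa t |T t A|^2] satisfies z(t)^2 <= 2 z(t/2),
   so z > 2 would propagate to arbitrarily small times. *)
Lemma sg_nash (Gam : V -> Prop) (N kap : R) : 0 < kap ->
  (forall g t, Gam g -> 0 <= t -> Gam (T t g)) ->
  (forall B v, G B v -> (forall g, Gam g -> ip B g <= N) ->
     kap * ip B B ^+ 2 <= ip v B) ->
  forall eta, (forall g, Gam g -> ip eta g <= N) ->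
  forall t, 0 < t -> nrm (T t eta) ^+ 2 <= 2 / (kap * t).
Proof.
move=> k0 GT hk.
have TN B t : 0 <= t -> (forall g, Gam g -> ip B g <= N) ->
    forall g, Gam g -> ip (T t B) g <= N.
  by move=> t0 hB g gg; rewrite sg_sym//; apply/hB/GT.
have mono u s t : 0 <= s -> 0 <= t -> nrm (T (s + t) u) <= nrm (T t u).
  by move=> s0 t0; rewrite sgDn// sg_contract.
have step B v t : G B v -> (forall g, Gam g -> ip B g <= N) -> 0 <= t ->
    2 * kap * t * (nrm (T t B) ^+ 2) ^+ 2 <= nrm B ^+ 2.
  move=> GB hB t0.
  have := @sg_dissip B v t (kap * (nrm (T t B) ^+ 2) ^+ 2) GB t0.
  suff h : forall s, 0 <= s <= t -> kap * (nrm (T t B) ^+ 2) ^+ 2 <= ip (T s v) (T s B).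
    by move=> /(_ h); have := sqr_ge0 (nrm (T t B)); lra.
  move=> s /andP[s0 st].
  apply: le_trans (hk _ _ (sg_graph_T s0 GB) (TN _ _ s0 hB)).
  rewrite ler_pM2l// -(sqr_ipn H) !ler_pXn2r ?nnegrE ?exprn_ge0 ?ipn_ge0//.
  by rewrite -[t](subrK s) mono// subr_ge0.
have dom B v t : G B v -> (forall g, Gam g -> ip B g <= N) -> 0 < t ->
    nrm (T t B) ^+ 2 <= 2 / (kap * t).
  move=> GB hB t0.
  have kt0 : 0 < kap * t by rewrite mulr_gt0.
  rewrite leNgt; apply/negP; rewrite ltr_pdivrMr// mulrC.
  pose z (s : R) := kap * s * nrm (T s B) ^+ 2; rewrite -/(z t) => z2.
  have zh s : 0 < s -> z s ^+ 2 <= 2 * z (s / 2).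
    move=> s0; have s20 : 0 <= s / 2 by rewrite divr_ge0// ltW.
    have := step _ _ _ (sg_graph_T s20 GB) (TN _ _ s20 hB) s20.
    rewrite -sgDn// -splitr => h; rewrite /z.
    have ks : 0 <= kap * s by rewrite mulr_ge0// ltW.
    have := ler_wpM2l ks h; move: (nrm (T s B)) (nrm (T (s / 2) B)) => a b; lra.
  have zn n : z t <= z (t / 2 ^+ n).
    elim: n => [|n ih]; first by rewrite expr0 divr1.
    have tn : 0 < t / 2 ^+ n by rewrite divr_gt0// exprn_gt0.
    have := zh _ tn; rewrite -mulrA -invfM -exprSr.
    move: (z (t / 2 ^+ n)) (z (t / 2 ^+ n.+1)) ih => a b ih h; nra.
  (* For this [n] contractivity alone keeps [z (t / 2 ^+ n)] from exceeding the threshold 2. *)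
  have [n hn] : exists n : nat, kap * t * nrm B ^+ 2 <= n%:R.
    by exists (Num.truncn (kap * t * nrm B ^+ 2)).+1; rewrite ltW// truncnS_gt.
  have := zn n; rewrite leNgt => /negP; apply; apply: le_lt_trans z2.
  have tn : 0 < t / 2 ^+ n by rewrite divr_gt0// exprn_gt0.
  apply: (@le_trans _ _ (kap * (t / 2 ^+ n) * nrm B ^+ 2)).
    have p0 : 0 <= kap * (t / 2 ^+ n) by rewrite mulr_ge0// ltW.
    rewrite ler_wpM2l//.
    by rewrite ler_pXn2r ?nnegrE ?ipn_ge0// sg_contract// ltW.
  rewrite (_ : _ * _ = kap * t * nrm B ^+ 2 / 2 ^+ n); last by field; rewrite expf_neq0.
  rewrite ler_pdivrMr ?exprn_gt0//; apply: le_trans hn _.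
  apply: (@le_trans _ _ (2 ^+ n)); first by rewrite -natrX ler_nat ltnW// ltn_expl.
  by rewrite ler_peMl ?exprn_ge0// ler1n.
move=> eta he t t0.
have b0 : 0 <= 2 / (kap * t) by rewrite divr_ge0// mulr_ge0// ltW.
rewrite -[leRHS]sqr_sqrtr// ler_pXn2r ?nnegrE ?ipn_ge0 ?sqrtr_ge0//.
apply/ler_addgt0Pr => e e0.
have [A [v [GA hA hg]]] := sg_approx eta e0.
have hAN g : Gam g -> ip A g <= N.
  by move=> gg; apply: hg => s s0; exact: TN.
have := dom A v t GA hAN t0.
rewrite -[leRHS]sqr_sqrtr// ler_pXn2r ?nnegrE ?ipn_ge0 ?sqrtr_ge0// => h.
have h2 : nrm (T t (eta - A)) <= e.
  by apply: le_trans (sg_contract _ (ltW t0)) _; rewrite (ipnB H).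
rewrite sg_ipnB ?(ltW t0)// in h2.
by have := ipn_triangle H (T t eta - T t A) (T t A); rewrite subrK; lra.
Qed.

End Semigroup.

Section Shift.
Context {R : realType} {V : lmodType R}.
Variables (ip : V -> V -> R) (H : hilbert ip).
Variables (T : R -> V -> V) (G : V -> V -> Prop) (m : R).
Local Notation nrm := (ipn ip).

(** Subtracting the bottom [m] makes the operator nonnegative, so that contractivity and the limit
    theorem apply to [expR (m * t) *: T t]. *)
Lemma sgroup_shift : sgroup ip T G ->
  sgroup ip (fun t u => expR (m * t) *: T t u) (fun u v => G u (v + m *: u)).
Proof.
move=> S; split.
- by move=> t c u v g t0; rewrite !(ipZl H) (sgL S)//; ring.
- move=> t t0; have [c hc] := sgB S t0; exists (expR (m * t) * c) => u.
  by rewrite (ipnZ H) ger0_norm ?expR_ge0// -mulrA ler_pM2l ?expR_gt0.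
- by move=> u g; rewrite mulr0 expR0 scale1r (sg0 S).
- move=> s t u g s0 t0; rewrite !(ipZl H) (sgZl H S)// (ipZl H) (sgD S)//.
  by rewrite mulrA -expRD mulrDr.
- move=> u.
  have h1 : `|expR (m * t)| * nrm (T t u - u) + `|expR (m * t) - 1| * nrm u
      @[t --> 0^'+] --> `|expR (m * 0)| * 0 + `|expR (m * 0) - 1| * nrm u.
    have he : expR (m * t) @[t --> 0^'+] --> expR (m * 0).
      apply: cvg_at_right_filter; apply: continuous_cvg; first exact: continuous_expR.
      by apply: cvgMr; exact: cvg_id.
    apply: cvgD; first by apply: cvgM; [exact: cvg_norm|exact: (sgC S)].
    by apply: cvgMl; apply: cvg_norm; apply: cvgB => //; exact: cvg_cst.
  rewrite mulr0 mulr0 expR0 subrr normr0 mul0r addr0 in h1.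
  apply: (squeeze_cvgr _ (cvg_cst 0) h1); apply: nearW => t.
  rewrite ipn_ge0/=.
  have -> : expR (m * t) *: T t u - u = expR (m * t) *: (T t u - u) + (expR (m * t) - 1) *: u.
    by rewrite scalerBr scalerBl scale1r addrA subrK.
  by apply: le_trans (ipn_triangle H _ _) _; rewrite !(ipnZ H).
- move=> u v.
  (* The error of the difference quotient of [expR (m * t)] at 0; the two generator conditions
     differ by a term in [d t] and one in [T t u - u]. *)
  pose d (t : R) := t^-1 * (expR (m * t) - 1) - m.
  have hd : d t @[t --> 0^'+] --> (0 : R).
    have /cvgB : t^-1 * (expR (m * t) - 1) @[t --> 0^'+] --> m.
      have dm : is_derive (0 : R) (1 : R) (fun t => expR (m * t)) m.
        have dm' : is_derive (0 : R) (1 : R) (expR \o (fun t => m * t)) (expR (m * 0) *: (m *: (1 : R))).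
          apply: is_derive1_comp.
        by move: dm'; rewrite mulr0 expR0 scale1r /GRing.scale/= mulr1.
      have [dm1 dm2] := dm.
      have := dm1; rewrite /derivable => /cvg_ex[l hl].
      have hl' : l = m.
        by rewrite -dm2 /derive; apply/esym/cvg_lim => //; exact: hl.
      rewrite hl' in hl.
      have hl2 := cvg_dnbhs_at_right hl; apply: cvg_trans hl2.
      apply: near_eq_cvg; near=> t.
      by rewrite /= /GRing.scale/= mulr1 addr0 mulr0 expR0.
    move=> /(_ _ _ (cvg_cst m)); rewrite subrr; exact.
  have hT : nrm (T t u) @[t --> 0^'+] --> nrm u by apply: (cvg_ipn H); exact: (sgC S).
  have diff (t : R) : 0 < t ->
      nrm ((t^-1 *: (u - T t u) - (v + m *: u)) - (t^-1 *: (u - expR (m * t) *: T t u) - v))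
      = nrm (d t *: T t u + m *: (T t u - u)).
    move=> t0; apply: (ipn_ip H) => g.
    by rewrite !(ipBl H, ipDl H, ipNl H, ipZl H) /d; field; rewrite gt_eqF.
  have lim0 : nrm (d t *: T t u + m *: (T t u - u)) @[t --> 0^'+] --> (0 : R).
    have h1 : `|d t| * nrm (T t u) + `|m| * nrm (T t u - u) @[t --> 0^'+] -->
        `|(0 : R)| * nrm u + `|m| * 0.
      apply: cvgD; first by apply: cvgM => //; exact: cvg_norm.
      by apply: cvgMr; exact: (sgC S).
    rewrite normr0 mul0r mulr0 addr0 in h1.
    apply: (squeeze_cvgr _ (cvg_cst 0) h1); apply: nearW => t.
    by rewrite ipn_ge0/=; apply: le_trans (ipn_triangle H _ _) _; rewrite !(ipnZ H).
  have sq (f g : R -> V) : (forall t, 0 < t -> nrm (f t - g t) = nrm (d t *: T t u + m *: (T t u - u))) ->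
      nrm (g t) @[t --> 0^'+] --> (0 : R) -> nrm (f t) @[t --> 0^'+] --> (0 : R).
    move=> hfg hg.
    have h1 : nrm (d t *: T t u + m *: (T t u - u)) + nrm (g t) @[t --> 0^'+] --> (0 + 0 : R).
      exact: cvgD.
    rewrite addr0 in h1.
    apply: (squeeze_cvgr _ (cvg_cst 0) h1); apply/near_rightP; exists 1 => // t /andP[t0 _].
    rewrite ipn_ge0/= -hfg//.
    by have := ipn_triangle H (f t - g t) (g t); rewrite subrK.
  split => [/(sgG S) h|h].
    by apply: sq h => t t0; rewrite (ipnB H) diff.
  by apply/(sgG S); apply: sq h => t t0; rewrite diff.
Unshelve. all: by end_near.
Qed.

End Shift.

(** * Smooth functions *)

Section Smooth.
Context {R : realType}.

Definition smooth {V : normedModType R} (f : V -> R) :=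
  forall (s : seq V) (x : V), differentiable (foldr (fun v g => 'D_v g) f s) x.

Section Generic.
Context {V : normedModType R}.
Implicit Types f g : V -> R.

(** Coinduction for smoothness: a class of differentiable functions that is stable under directional
    derivatives consists of smooth functions. It replaces formulas for iterated derivatives. *)
Lemma smooth_coind (P : (V -> R) -> Prop) :
  (forall f, P f -> (forall x, differentiable f x) /\ (forall v, P ('D_v f))) ->
  forall f, P f -> smooth f.
Proof.
move=> hP f Pf s x.
suff : P (foldr (fun v g => 'D_v g) f s) by move/hP => [].
by elim: s => //= v s ih; exact: (proj2 (hP _ ih)).
Qed.

Lemma smooth_diff f x : smooth f -> differentiable f x.
Proof. by move=> /(_ [::] x). Qed.

Lemma smooth_D f v : smooth f -> smooth ('D_v f).
Proof. by move=> sf s x; have := sf (rcons s v) x; rewrite foldr_rcons. Qed.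

Lemma smooth_derivable f x v : smooth f -> derivable f x v.
Proof. by move=> sf; exact/diff_derivable/smooth_diff. Qed.

Lemma smooth_is_derive f x v : smooth f -> is_derive x v f ('D_v f x).
Proof. by move=> sf; exact/derivableP/smooth_derivable. Qed.

Lemma smooth_continuous f : smooth f -> continuous f.
Proof. by move=> sf x; exact/differentiable_continuous/smooth_diff. Qed.

Lemma smooth_cst (c : R) : smooth (fun _ : V => c).
Proof.
apply: (@smooth_coind (fun f => exists c, f = fun=> c)); last by exists c.
move=> f [k ->]; split => [x|v]; first exact: differentiable_cst.
by exists 0; apply/funext => x; exact: derive_cst.
Qed.

Lemma smooth_add f g : smooth f -> smooth g -> smooth (fun x => f x + g x).
Proof.
move=> sf sg.
apply: (@smooth_coind (fun h => exists f g, [/\ smooth f, smooth g & h = fun x => f x + g x]));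
  last by exists f, g.
move=> {sf sg}_ [{}f [{}g [sf sg ->]]]; split => [x|v].
  by apply: (@differentiableD _ _ _ f g); exact: smooth_diff.
exists ('D_v f), ('D_v g); split; [exact: smooth_D|exact: smooth_D|].
by apply/funext => x; apply: (@deriveD _ _ _ f g); exact: smooth_derivable.
Qed.

(** By the Leibniz rule the derivative of a product is a sum of two products, so the class stable
    under derivation has to contain sums. *)
Inductive prod_sum : (V -> R) -> Prop :=
  | ps_prod f g : smooth f -> smooth g -> prod_sum (fun x => f x * g x)
  | ps_add f g : prod_sum f -> prod_sum g -> prod_sum (fun x => f x + g x).

Lemma smooth_mul f g : smooth f -> smooth g -> smooth (fun x => f x * g x).
Proof.
move=> sf sg; apply: (@smooth_coind prod_sum); last exact: ps_prod.
move=> h; elim=> {h sf sg} [{}f {}g sf sg|{}f {}g _ [df Df] _ [dg Dg]]; split.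
- by move=> x; apply: (@differentiableM _ _ f g); exact: smooth_diff.
- move=> v.
  have -> : 'D_v (fun x => f x * g x) = fun x => (f x * 'D_v g x) + (g x * 'D_v f x).
    by apply/funext => x; apply: (@deriveM _ _ f g); exact: smooth_derivable.
  apply: ps_add; apply: ps_prod => //; exact: smooth_D.
- by move=> x; apply: (@differentiableD _ _ _ f g).
- move=> v.
  have -> : 'D_v (fun x => f x + g x) = fun x => 'D_v f x + 'D_v g x.
    by apply/funext => x; apply: (@deriveD _ _ _ f g); exact: diff_derivable.
  exact: ps_add.
Qed.

Lemma smooth_scale c f : smooth f -> smooth (fun x => c * f x).
Proof. by move=> sf; apply: smooth_mul => //; exact: smooth_cst. Qed.

Lemma smooth_opp f : smooth f -> smooth (fun x => - f x).
Proof.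
move=> /(smooth_scale (-1)); congr smooth.
by apply/funext => x; rewrite mulN1r.
Qed.

Lemma smooth_sub f g : smooth f -> smooth g -> smooth (fun x => f x - g x).
Proof. by move=> sf sg; apply: smooth_add => //; exact: smooth_opp. Qed.

Lemma smooth_exp f n : smooth f -> smooth (fun x => f x ^+ n).
Proof.
move=> sf; elim: n => [|n ih].
  have -> : (fun x => f x ^+ 0) = (fun=> 1) by apply/funext => x; rewrite expr0.
  exact: smooth_cst.
have -> : (fun x => f x ^+ n.+1) = (fun x => f x * f x ^+ n).
  by apply/funext => x; rewrite exprS.
exact: smooth_mul.
Qed.

Lemma derive_comp1 (h : R -> R) f x v : differentiable f x -> derivable h (f x) 1 ->
  'D_v (fun x => h (f x)) x = 'D_1 h (f x) * 'D_v f x.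
Proof.
move=> df /derivable1_diffP dh.
rewrite deriveE; last exact: (@differentiable_comp _ _ _ _ f h).
rewrite (@diff_comp _ _ _ _ f h)//= !deriveE//.
by rewrite -[X in 'd h _ X]mulr1 linearZ/= mulrC.
Qed.

End Generic.

Section Composition.
Context {V : normedModType R}.
Implicit Types f g : V -> R.

(** The extra factor [g] collects the inner derivatives, so that [h (f x) * g x] differentiates into
    terms of the same shape. *)
Inductive comp_sum : (V -> R) -> Prop :=
  | cs_comp (h : R -> R) f g : smooth h -> smooth f -> smooth g ->
      comp_sum (fun x => h (f x) * g x)
  | cs_add f g : comp_sum f -> comp_sum g -> comp_sum (fun x => f x + g x).

Lemma smooth_comp (h : R -> R) f : smooth h -> smooth f -> smooth (fun x => h (f x)).
Proof.
move=> sh sf; apply: (@smooth_coind V comp_sum); last first.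
  have -> : (fun x => h (f x)) = (fun x => h (f x) * 1) by apply/funext => x; rewrite mulr1.
  by apply: cs_comp => //; exact: smooth_cst.
move=> k; elim=> {k h sh sf} [h {}f g sh sf sg|{}f g _ [df Df] _ [dg Dg]].
  have dhf x : differentiable (fun x => h (f x)) x.
    apply: (@differentiable_comp _ _ _ _ f h); first exact: smooth_diff.
    exact: (sh [::] (f x)).
  split => [x|v].
    by apply: (@differentiableM _ _ (fun x => h (f x)) g) => //; exact: smooth_diff.
  have -> : 'D_v (fun x => h (f x) * g x) =
      fun x => (h (f x) * 'D_v g x) + ('D_1 h (f x) * (g x * 'D_v f x)).
    apply/funext => x; rewrite (@deriveM _ _ (fun x => h (f x)) g).
    - have dh : derivable h (f x) 1 by apply/derivable1_diffP; exact: (sh [::] (f x)).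
      rewrite (derive_comp1 v (smooth_diff x sf) dh).
      by rewrite /GRing.scale/=; ring.
    - exact: diff_derivable.
    - exact: smooth_derivable.
  apply: cs_add.
    by apply: (@cs_comp h f ('D_v g)) => //; exact: smooth_D.
  apply: (@cs_comp ('D_1 h) f (fun x => g x * 'D_v f x)) => //.
    have xx v0 := smooth_D v0 sh; exact: (xx _).
  by apply: smooth_mul => //; exact: smooth_D.
split => [x|v]; first by apply: (@differentiableD _ _ _ f g).
have -> : 'D_v (fun x => f x + g x) = fun x => 'D_v f x + 'D_v g x.
  by apply/funext => x; apply: (@deriveD _ _ _ f g); exact: diff_derivable.
exact: cs_add.
Qed.

(** Terms [f / w ^ n] differentiate into terms of the same shape with exponents [n] and [n + 1]. *)
Inductive inv_sum (w : V -> R) : (V -> R) -> Prop :=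
  | is_inv f n : smooth f -> inv_sum w (fun x => f x * (w x)^-1 ^+ n)
  | is_add f g : inv_sum w f -> inv_sum w g -> inv_sum w (fun x => f x + g x).

Lemma smooth_inv (w : V -> R) : smooth w -> (forall x, w x != 0) -> smooth (fun x => (w x)^-1).
Proof.
move=> sw w0; apply: (@smooth_coind V (inv_sum w)); last first.
  have -> : (fun x => (w x)^-1) = (fun x => 1 * (w x)^-1 ^+ 1).
    by apply/funext => x; rewrite mul1r expr1.
  by apply: is_inv; exact: smooth_cst.
have dw n x : differentiable (fun x => (w x)^-1 ^+ n) x.
  have di : differentiable (fun x => (w x)^-1) x.
    by apply: differentiableV => //; exact: smooth_diff.
  elim: n => [|n ih]; first exact: differentiable_cst.
  have -> : (fun x => (w x)^-1 ^+ n.+1) = (fun x => (w x)^-1) * (fun x => (w x)^-1 ^+ n).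
    by apply/funext => y; rewrite exprS.
  exact: differentiableM.
move=> k; elim=> {k} [f n sf|f g _ [df Df] _ [dg Dg]].
  split => [x|v].
    by apply: (@differentiableM _ _ f (fun x => (w x)^-1 ^+ n)) => //; exact: smooth_diff.
  have -> : 'D_v (fun x => f x * (w x)^-1 ^+ n) =
     fun x => ('D_v f x * (w x)^-1 ^+ n) + (- n%:R * f x * 'D_v w x) * (w x)^-1 ^+ n.+1.
    apply/funext => x.
    have dV : is_derive x v (fun y => (w y)^-1) (- (w x) ^- 2 *: 'D_v w x).
      by split; [apply: derivableV => //|apply: deriveV => //]; exact: smooth_derivable.
    have dX := @is_deriveX _ _ (fun y => (w y)^-1) n x v _ dV.
    have dF := smooth_is_derive x v sf.
    have [_] := @is_deriveM _ _ f ((fun y => (w y)^-1) ^+ n) x v _ _ dF dX.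
    have -> : f * (fun y => (w y)^-1) ^+ n = (fun x => f x * (w x)^-1 ^+ n).
      by apply/funext => y /=; rewrite fctE /=; congr (_ * _); elim: (n) => //= k ih; rewrite !exprS -ih.
    move=> ->; rewrite /GRing.scale/=.
    case: n {dX} => [|n].
      by rewrite !mul0r mulr0 add0r oppr0 !mul0r addr0 !expr0 mulr1 [X in X * _](_ : _ = 1)// mul1r.
    have -> : ((fun y => (w y)^-1) ^+ n.+1) x = (w x)^-1 ^+ n.+1.
      by elim: (n.+1) => //= k ih; rewrite !exprS -ih.
    rewrite !exprS /=; set y := (w x)^-1 ^+ n; have := w0 x.
    by rewrite expr0 => h; field.
  apply: is_add; apply: is_inv; first exact: smooth_D.
  by apply: smooth_mul; [apply: smooth_scale|exact: smooth_D].
split => [x|v]; first by apply: (@differentiableD _ _ _ f g).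
have -> : 'D_v (fun x => f x + g x) = fun x => 'D_v f x + 'D_v g x.
  by apply/funext => x; apply: (@deriveD _ _ _ f g); exact: diff_derivable.
exact: is_add.
Qed.

End Composition.

Lemma smooth_id : smooth (fun x : R => x).
Proof.
apply: (@smooth_coind R (fun f => f = id \/ exists c, f = fun=> c)); last by left.
move=> f [->|[c ->]]; split.
- by move=> x; exact/derivable1_diffP/derivable_id.
- by move=> v; right; exists v; apply/funext => x; exact: derive_id.
- by move=> x; exact: differentiable_cst.
- by move=> v; right; exists 0; apply/funext => x; exact: derive_cst.
Qed.

Lemma fst_continuous : continuous (fst : R * R -> R).
Proof. by move=> x; exact: cvg_fst. Qed.
Lemma snd_continuous : continuous (snd : R * R -> R).
Proof. by move=> x; exact: cvg_snd. Qed.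

Lemma smooth_linear (l : {linear (R * R)%type -> R}) : continuous l -> smooth (l : R * R -> R).
Proof.
move=> cl; apply: (@smooth_coind _ (fun f => f = l \/ exists c, f = fun=> c)); last by left.
move=> f [->|[c ->]]; split.
- by move=> x; exact: linear_differentiable.
- move=> v; right; exists (l v); apply/funext => x.
  by rewrite deriveE ?diff_lin//; exact: linear_differentiable.
- by move=> x; exact: differentiable_cst.
- by move=> v; right; exists 0; apply/funext => x; exact: derive_cst.
Qed.

Lemma smooth_fst : smooth (fst : R * R -> R).
Proof. by apply: (@smooth_linear fst); exact: fst_continuous. Qed.
Lemma smooth_snd : smooth (snd : R * R -> R).
Proof. by apply: (@smooth_linear snd); exact: snd_continuous. Qed.

Lemma derive_dir1 (f : R -> R) (x v : R) : differentiable f x -> 'D_v f x = v * 'D_1 f x.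
Proof. by move=> df; rewrite !deriveE// -[X in 'd f x X]mulr1 linearZ. Qed.

(** In one variable the derivative in direction [v] is [v] times that in direction 1; stability
    under scaling takes care of the other directions. *)
Lemma smooth_coind1 (P : (R -> R) -> Prop) :
  (forall f, P f -> exists2 g, P g & forall x : R, is_derive x (1 : R) f (g x)) ->
  (forall c f, P f -> P (fun x => c * f x)) ->
  forall f, P f -> smooth f.
Proof.
move=> hP hZ; apply: smooth_coind => f /hP[g Pg fg].
have df x : differentiable f x by apply/derivable1_diffP; have [] := fg x.
split => // v; have -> : 'D_v f = fun x => v * g x; last exact: hZ.
by apply/funext => x; rewrite derive_dir1//; have [_ ->] := fg x.
Qed.

Lemma is_derive_affine (k b x : R) : is_derive x (1 : R) (fun x => k * x + b) k.
Proof.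
have h1 : is_derive x (1 : R) (k \*: (@id R)) (k *: 1) by exact: is_deriveZ.
have h := @is_deriveD _ _ _ _ _ x 1 _ _ h1 (is_derive_cst b x 1).
by apply: (is_derive_eq h); rewrite addr0 /GRing.scale/= mulr1.
Qed.

Lemma smooth_trig (A B k b : R) : smooth (fun x => A * sin (k * x + b) + B * cos (k * x + b)).
Proof.
apply: (@smooth_coind1 (fun f => exists A B, f = fun x => A * sin (k * x + b) + B * cos (k * x + b)));
  last by exists A, B.
- move=> _ [A' [B' ->]]; exists (fun x => (- (k * B')) * sin (k * x + b) + (k * A') * cos (k * x + b)).
    by eexists; eexists.
  move=> x; have d0 := is_derive_affine k b x.
  have d1 : is_derive x (1 : R) (sin \o (fun x => k * x + b)) (cos (k * x + b) * k).
    exact: is_derive1_comp.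
  have d2 : is_derive x (1 : R) (cos \o (fun x => k * x + b)) (- sin (k * x + b) * k).
    exact: is_derive1_comp.
  have d3 := @is_deriveZ _ _ _ _ A' x 1 _ d1.
  have d4 := @is_deriveZ _ _ _ _ B' x 1 _ d2.
  have h := @is_deriveD _ _ _ _ _ x 1 _ _ d3 d4.
  by apply: (is_derive_eq h); rewrite /GRing.scale/=; ring.
- move=> c _ [A' [B' ->]]; exists (c * A'), (c * B'); apply/funext => x; ring.
Qed.

(** The functions p(1/x) exp(-1/x), extended by 0, are flat at 0 and form a class stable under
    differentiation, which replaces p by X^2 (p - p'). *)
Definition flat (p : {poly R}) (x : R) : R :=
  if 0 < x then p.[x^-1] * expR (- x^-1) else 0.

Lemma poly_exp_bound (p : {poly R}) : exists2 C, 0 <= C &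
  forall y, 0 < y -> `|p.[y]| * expR (- y) <= C / y.
Proof.
exists (\sum_(i < size p) `|p`_i| * (i.+1)`!%:R).
  by apply: sumr_ge0 => i _; rewrite mulr_ge0.
move=> y y0; rewrite horner_coef mulr_suml.
apply: le_trans (ler_wpM2r (expR_ge0 _) (ler_norm_sum _ _ _)) _.
rewrite mulr_suml; apply: ler_sum => i _; rewrite normrM -!mulrA ler_wpM2l//.
rewrite ger0_norm ?exprn_ge0 ?(ltW y0)// expRN ler_pdivlMr// mulrAC.
rewrite ler_pdivrMr ?expR_gt0// -exprSr.
have := expR_ge1Dxn i (ltW y0).
have f0 : 0 < (i.+1)`!%:R :> R by rewrite ltr0n fact_gt0.
move=> h; rewrite mulrC -ler_pdivrMr//; lra.
Qed.

Lemma flat_bound p : exists2 C, 0 <= C & forall x, `|flat p x| <= C * `|x|.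
Proof.
have [C C0 hC] := poly_exp_bound p; exists C => // x; rewrite /flat.
case: ifPn => [x0|_]; last by rewrite normr0 mulr_ge0.
rewrite normrM (ger0_norm (expR_ge0 _)); have := hC x^-1.
by rewrite invr_gt0 x0 invrK (gtr0_norm x0) => ->.
Qed.

Lemma is_derive_flat p (x : R) : is_derive x (1 : R) (flat p) (flat ('X^2 * (p - p^`())) x).
Proof.
have [x0|x0|x0] := ltgtP x 0.
- rewrite /flat (ltNge 0 x) (ltW x0)/=.
  apply: (@near_eq_is_derive _ _ _ (cst 0)) => //.
  near=> y; rewrite ltNge ifF//; apply/negbF/ltW; near: y.
  exact: lt_nbhsl.
- rewrite /flat x0.
  have dV : is_derive x (1 : R) (fun y : R => y^-1) (- x ^- 2 *: 1).
    have h := is_derive_id x (1 : R).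
    split; first by apply: derivableV; rewrite ?gt_eqF.
    by rewrite deriveV ?gt_eqF// derive_id.
  have d1 : is_derive x (1 : R) ((horner p) \o (fun y : R => y^-1)) (p^`().[x^-1] * (- x ^- 2 *: 1)).
    exact: is_derive1_comp.
  have dN : is_derive x (1 : R) (- (fun y : R => y^-1)) (- (- x ^- 2 *: 1)).
    exact: is_deriveN.
  have d2 : is_derive x (1 : R) (expR \o (- (fun y : R => y^-1))) (expR (- x^-1) * - (- x ^- 2 *: 1)).
    exact: is_derive1_comp.
  have := @is_deriveM _ _ _ _ x 1 _ _ d1 d2 => d3.
  apply: (@near_eq_is_derive _ _ _ (((horner p) \o (fun y : R => y^-1)) * (expR \o (- (fun y : R => y^-1))))).
    near=> y; rewrite ifT//; near: y; exact: lt_nbhsr.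
  apply: is_derive_eq d3 _.
  rewrite /GRing.scale/= !hornerE/= fctE/=.
  by field; rewrite gt_eqF.
- rewrite x0.
  have -> : flat ('X^2 * (p - p^`())) 0 = 0 by rewrite /flat ltxx.
  have f0 q : flat q 0 = 0 by rewrite /flat ltxx.
  (* The difference quotient of [flat p] at 0 is [flat ('X * p)], which tends to 0 at a linear
     rate. *)
  have [C C0 hC] := flat_bound ('X * p).
  have lim0 : h^-1 *: ((flat p \o shift 0) (h *: (1 : R)) - flat p 0) @[h --> 0^'] --> (0 : R).
    rewrite f0; apply/cvgrPdist_le => e e0; near=> h.
    have h0 : h != 0 by near: h; exact: nbhs_dnbhs_neq.
    rewrite sub0r normrN subr0 /= addr0 /GRing.scale/= mulr1.
    have -> : h^-1 * flat p h = flat ('X * p) h.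
      by rewrite /flat; case: ifP => _; rewrite ?mulr0// hornerM hornerX mulrA.
    have hh : `|h| <= e / (C + 1).
      by near: h; apply: dnbhs0_le; rewrite divr_gt0// ltr_wpDl.
    apply: le_trans (hC h) _; rewrite ler_pdivlMr ?ltr_wpDl// in hh.
    apply: le_trans hh; rewrite mulrC ler_wpM2l// lerDl ler01 //.
  split; first by apply/cvg_ex; exists 0.
  exact: (cvg_lim _ lim0).
Unshelve. all: by end_near.
Qed.

Lemma smooth_flat p : smooth (flat p).
Proof.
apply: (@smooth_coind1 (fun f => exists p, f = flat p)); last by exists p.
- by move=> _ [q ->]; exists (flat ('X^2 * (q - q^`()))); [eexists|exact: is_derive_flat].
- move=> c _ [q ->]; exists (c *: q); apply/funext => x; rewrite /flat.
  by case: ifP => _; rewrite ?mulr0// hornerZ mulrA.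
Qed.

(** The standard smooth step, 0 up to 0 and 1 from 1 on; the denominator is positive everywhere. The
    cutoffs below are built from it. *)
Definition stp (x : R) : R := flat 1 x * (flat 1 x + flat 1 (1 - x))^-1.

Lemma flat1_gt0 x : 0 < x -> 0 < flat 1 x.
Proof. by move=> x0; rewrite /flat x0 hornerC mul1r expR_gt0. Qed.
Lemma flat1_ge0 x : 0 <= flat 1 x.
Proof. by rewrite /flat; case: ifP => //; rewrite hornerC mul1r expR_ge0. Qed.
Lemma flat1_eq0 x : x <= 0 -> flat 1 x = 0.
Proof. by rewrite /flat leNgt => /negbTE ->. Qed.

Lemma stp_denom x : 0 < flat 1 x + flat 1 (1 - x).
Proof.
have [x0|x0] := ltP 0 x; first by rewrite ltr_pwDl ?flat1_gt0 ?flat1_ge0.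
by rewrite ltr_wpDl ?flat1_ge0// flat1_gt0//; lra.
Qed.

Lemma smooth_affine (k b : R) : smooth (fun x : R => k * x + b).
Proof.
apply: smooth_add; last exact: smooth_cst.
by apply: smooth_scale; exact: smooth_id.
Qed.

Lemma smooth_stp : smooth stp.
Proof.
apply: smooth_mul; first exact: smooth_flat.
apply: smooth_inv => [|x]; last by rewrite gt_eqF ?stp_denom.
apply: smooth_add; first exact: smooth_flat.
apply: (@smooth_comp R^o (flat 1) (fun x => 1 - x)); first exact: smooth_flat.
by apply: smooth_sub; [exact: smooth_cst|exact: smooth_id].
Qed.

Lemma stp0 x : x <= 0 -> stp x = 0.
Proof. by move=> x0; rewrite /stp flat1_eq0// mul0r. Qed.
Lemma stp1 x : 1 <= x -> stp x = 1.
Proof.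
move=> x1; rewrite /stp (flat1_eq0 (x := 1 - x)); last lra.
by rewrite addr0 divff// gt_eqF// flat1_gt0//; lra.
Qed.
Lemma stp_ge0 x : 0 <= stp x.
Proof. by rewrite /stp mulr_ge0 ?flat1_ge0// invr_ge0 ltW// stp_denom. Qed.
Lemma stp_le1 x : stp x <= 1.
Proof. by rewrite /stp ler_pdivrMr ?stp_denom// mul1r lerDl flat1_ge0. Qed.

Lemma smooth_supp_derive {V : normedModType R} (f : V -> R) (A : set V) v :
  closed A -> (forall x, ~ A x -> f x = 0) -> forall x, ~ A x -> 'D_v f x = 0.
Proof.
move=> cA fA x Ax; rewrite (@near_eq_derive _ _ _ f (cst 0)) ?derive_cst//.
have oA : open (~` A) by exact: closed_openC.
have := open_nbhs_nbhs (conj oA Ax); apply: filterS => y; exact: fA.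
Qed.

Definition dstp : R -> R := 'D_1 stp.

Lemma dstp_out x : ~ (0 <= x <= 1) -> dstp x = 0.
Proof.
move=> /negP; rewrite negb_and -!ltNge => /orP[x0|x1].
  rewrite /dstp (@near_eq_derive _ _ _ stp (cst 0)) ?derive_cst//.
  by near=> y; rewrite stp0// ltW//; near: y; exact: lt_nbhsl.
rewrite /dstp (@near_eq_derive _ _ _ stp (cst 1)) ?derive_cst//.
by near=> y; rewrite stp1// ltW//; near: y; exact: lt_nbhsr.
Unshelve. all: by end_near.
Qed.

Lemma continuous_supp_bounded (g : R -> R) (a b : R) : continuous g ->
  (forall x, ~ (a <= x <= b) -> g x = 0) -> exists2 M, 0 <= M & forall x, `|g x| <= M.
Proof.
move=> cg g0; have [ab|ab] := leP a b; last first.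
  exists 0 => // x; rewrite g0 ?normr0// => /andP[h1 h2].
  by have := le_trans h1 h2; rewrite leNgt ab.
have cn : {within `[a, b], continuous (fun x => `|g x|)}.
  apply: continuous_subspaceT => x; apply: continuous_comp; first exact: cg.
  exact: norm_continuous.
have [c cab hc] := EVT_max ab cn.
exists `|g c| => // x; have [xab|xab] := boolP (a <= x <= b).
  by apply: hc; rewrite in_itv.
by rewrite g0 ?normr0//; exact/negP.
Qed.

Lemma dstp_bounded : exists2 M, 0 <= M & forall x, `|dstp x| <= M.
Proof.
apply: (@continuous_supp_bounded _ 0 1); last exact: dstp_out.
exact/smooth_continuous/smooth_D/smooth_stp.
Qed.

End Smooth.

(** * Square integrable functions *)

Section L2Space.
Context d (T : measurableType d) (R : realType) (mu : {measure set T -> \bar R}).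
Variables (D : set T) (mD : measurable D).
Implicit Types (u v w : T -> R).

Definition l2 u := measurable_fun D u /\ (\int[mu]_(x in D) (u x ^+ 2)%:E < +oo)%E.

Lemma l2_meas u : l2 u -> measurable_fun D u. Proof. by case. Qed.

Lemma l2_sqr_int u : l2 u -> mu.-integrable D (EFin \o (fun x => u x ^+ 2)).
Proof.
move=> [mu_ ui]; apply/integrableP; split.
  by apply/measurable_EFinP; exact: measurable_funX.
by under eq_integral do rewrite /= ger0_norm ?sqr_ge0//.
Qed.

Lemma int_le_integrable (f g : T -> R) : measurable_fun D f ->
  (forall x, D x -> `|f x| <= g x) -> mu.-integrable D (EFin \o g) ->
  mu.-integrable D (EFin \o f).
Proof.
move=> mf fg ig; apply: (le_integrable mD _ _ ig); first exact/measurable_EFinP.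
by move=> x Dx /=; rewrite lee_fin; apply: le_trans (fg x Dx) (ler_norm _).
Qed.

Lemma int_add (f g : T -> R) : mu.-integrable D (EFin \o f) -> mu.-integrable D (EFin \o g) ->
  mu.-integrable D (EFin \o (fun x => f x + g x)).
Proof. by move=> hf hg; exact: (integrableD mD hf hg). Qed.
Lemma int_scale (c : R) (f : T -> R) : mu.-integrable D (EFin \o f) ->
  mu.-integrable D (EFin \o (fun x => c * f x)).
Proof. by move=> hf; exact: (integrableZl mD c hf). Qed.
Lemma int_sub (f g : T -> R) : mu.-integrable D (EFin \o f) -> mu.-integrable D (EFin \o g) ->
  mu.-integrable D (EFin \o (fun x => f x - g x)).
Proof. by move=> hf hg; exact: (integrableB mD hf hg). Qed.

Lemma l2_mul_int u v : l2 u -> l2 v -> mu.-integrable D (EFin \o (fun x => u x * v x)).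
Proof.
move=> hu hv; apply: (@int_le_integrable _ (fun x => u x ^+ 2 + v x ^+ 2)).
- by apply: measurable_funM; apply: l2_meas.
- move=> x _; rewrite normrM -(real_normK (num_real (u x))) -(real_normK (num_real (v x))).
  have := sqr_ge0 (`|u x| - `|v x|); rewrite sqrrB.
  have := mulr_ge0 (normr_ge0 (u x)) (normr_ge0 (v x)); lra.
- by apply: int_add; exact: l2_sqr_int.
Qed.

Lemma l2P u : measurable_fun D u -> mu.-integrable D (EFin \o (fun x => u x ^+ 2)) -> l2 u.
Proof.
move=> mu_ /integrableP[_ h]; split=> //.
by move: h; under eq_integral do rewrite /= ger0_norm ?sqr_ge0//.
Qed.

Lemma l2_le u v : measurable_fun D u -> l2 v -> (forall x, D x -> `|u x| <= `|v x|) -> l2 u.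
Proof.
move=> mu_ hv h; apply: l2P => //.
apply: (@int_le_integrable _ (fun x => v x ^+ 2)); last exact: l2_sqr_int.
  exact: measurable_funX.
move=> x Dx; rewrite normrX -[leRHS](real_normK (num_real _)).
by rewrite ler_pXn2r ?nnegrE ?normr_ge0//; exact: h.
Qed.

Lemma l2_lin (c : R) u v : l2 u -> l2 v -> l2 (fun x => c * u x + v x).
Proof.
move=> hu hv; have [mu_ _] := hu; have [mv _] := hv.
have mm : measurable_fun D (fun x => c * u x + v x).
  by apply: measurable_funD => //; exact: measurable_funM.
apply: l2P => //.
apply: (@int_le_integrable _ (fun x => 2 * c ^+ 2 * u x ^+ 2 + 2 * v x ^+ 2)).
- exact: measurable_funX.
- move=> x _; rewrite ger0_norm ?sqr_ge0//; have := sqr_ge0 (c * u x - v x).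
  rewrite sqrrB sqrrD exprMn; lra.
- by apply: int_add; apply: int_scale; exact: l2_sqr_int.
Qed.

Lemma l2_0 : l2 (fun=> 0).
Proof.
split; first exact: measurable_cst.
by under eq_integral do rewrite expr0n/=; rewrite integral0 ltry.
Qed.
Lemma l2_scale c u : l2 u -> l2 (fun x => c * u x).
Proof. by move=> hu; have := l2_lin c hu l2_0; under eq_fun do rewrite addr0. Qed.
Lemma l2_add u v : l2 u -> l2 v -> l2 (fun x => u x + v x).
Proof. by move=> hu hv; have := l2_lin 1 hu hv; under eq_fun do rewrite mul1r. Qed.
Lemma l2_opp u : l2 u -> l2 (fun x => - u x).
Proof. by move=> /(l2_scale (-1)); under eq_fun do rewrite mulN1r. Qed.
Lemma l2_sub u v : l2 u -> l2 v -> l2 (fun x => u x - v x).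
Proof. by move=> hu hv; apply: l2_add => //; exact: l2_opp. Qed.

Lemma l2_bdd_mul w u C : measurable_fun D w -> (forall x, D x -> `|w x| <= C) ->
  l2 u -> l2 (fun x => u x * w x).
Proof.
move=> mw hw hu; apply: (@l2_le _ (fun x => `|C| * u x)); last first.
- move=> x Dx; rewrite !normrM normr_id mulrC ler_wpM2r//.
  exact: le_trans (hw x Dx) (ler_norm _).
- exact: l2_scale.
- by apply: measurable_funM => //; exact: l2_meas.
Qed.

Lemma l2_wint w u v C : measurable_fun D w -> (forall x, D x -> `|w x| <= C) ->
  l2 u -> l2 v -> mu.-integrable D (EFin \o (fun x => u x * v x * w x)).
Proof.
move=> mw hw hu hv; have := l2_mul_int hu (l2_bdd_mul mw hw hv).
by apply: eq_integrable => // x _ /=; rewrite mulrA.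
Qed.

Lemma EFin_int (f : T -> R) : mu.-integrable D (EFin \o f) ->
  (\int[mu]_(x in D) (f x)%:E)%E = (\int[mu]_(x in D) f x)%:E.
Proof. by move=> hf; rewrite fineK//; exact: integrable_fin_num. Qed.

Lemma geometric_cauchy (v : nat -> R) (K th : R) : 0 <= th < 1 -> 0 <= K ->
  (forall n, `|v n.+1 - v n| <= K * th ^+ n) -> cvgn v.
Proof.
move=> /andP[t0 t1] K0 h.
have hs : cvgn (series (telescope v)).
  apply: normed_cvg; apply: (series_le_cvg _ _ (fun n => h n)).
  - by move=> n; exact: normr_ge0.
  - by move=> n; rewrite mulr_ge0// exprn_ge0.
  - by apply: is_cvg_geometric_series; rewrite ger0_norm.
have -> : v = (fun n => v 0%N + series (telescope v) n).
  by apply/funext => n; rewrite -eq_sum_telescope.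
by apply: is_cvgD => //; exact: is_cvg_cst.
Qed.

(** Riesz-Fischer. Along a subsequence the differences have squared norm at most [8^-1 ^+ k]; the
    squares weighted by [2 ^+ k] still sum to an integrable function, so at almost every point they
    decay geometrically and the subsequence converges. Fatou's lemma bounds the distance to the
    limit. *)
Lemma l2_complete (u_ : nat -> T -> R) : (forall n, l2 (u_ n)) ->
  (forall e, 0 < e -> exists N : nat, forall m n, (N <= m)%N -> (N <= n)%N ->
     \int[mu]_(x in D) ((u_ m x - u_ n x) ^+ 2) <= e) ->
  exists2 l, l2 l & forall e, 0 < e -> exists N : nat, forall n, (N <= n)%N ->
     \int[mu]_(x in D) ((u_ n x - l x) ^+ 2) <= e.
Proof.
move=> hu hc.
have dint m n : mu.-integrable D (EFin \o (fun x => (u_ m x - u_ n x) ^+ 2)).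
  by apply: l2_sqr_int; exact: l2_sub.
have /choice[N0 hN0] (k : nat) : exists N : nat, (k <= N)%N /\ forall m n,
    (N <= m)%N -> (N <= n)%N -> \int[mu]_(x in D) ((u_ m x - u_ n x) ^+ 2) <= 8^-1 ^+ k.
  have k0 : 0 < 8^-1 ^+ k :> R by rewrite exprn_gt0// invr_gt0 ltr0n.
  have [N hN] := hc _ k0; exists (maxn N k); split; first exact: leq_maxr.
  by move=> m n; rewrite !geq_max => /andP[hm _] /andP[hn _]; exact: hN.
have N0k k := proj1 (hN0 k); have {}hN0 k := proj2 (hN0 k).
(* The maximum makes the indices nondecreasing, so that [n_ k] and [n_ k.+1] are both at least
   [N0 k]. *)
pose n_ k := (\max_(j < k.+1) N0 j)%N.
have nN k : (N0 k <= n_ k)%N by apply: (leq_bigmax (ord_max : 'I_k.+1)).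
have nS k : (N0 k <= n_ k.+1)%N.
  exact: (leq_bigmax (widen_ord (leqnSn _) ord_max : 'I_k.+2)).
have ngt k j : (j <= k)%N -> (N0 j <= n_ k)%N.
  by move=> jk; exact: (leq_bigmax (Ordinal (jk : (j < k.+1)%N))).
pose dd k x := u_ (n_ k.+1) x - u_ (n_ k) x.
pose h x := (\sum_(k <oo) (2 ^+ k * dd k x ^+ 2)%:E)%E.
have mdd k : measurable_fun D (dd k).
  by apply: measurable_funB; apply: l2_meas.
have mterm k : measurable_fun D (fun x => (2 ^+ k * dd k x ^+ 2)%:E).
  by apply/measurable_EFinP; apply: measurable_funM => //; exact: measurable_funX.
have t0 k x : (0 <= (2 ^+ k * dd k x ^+ 2)%:E)%E.
  by rewrite lee_fin; apply: mulr_ge0; [exact: exprn_ge0|exact: sqr_ge0].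
have inth : (\int[mu]_(x in D) h x < +oo)%E.
  rewrite integral_nneseries//.
  apply: (@le_lt_trans _ _ (\sum_(k <oo) ((4^-1 : R) ^+ k)%:E)%E).
    apply: lee_nneseries => [k _ _|k _].
      by apply: integral_ge0 => x _; exact: t0.
    under eq_integral do rewrite EFinM.
    rewrite ge0_integralZl ?lee_fin ?exprn_ge0//; last 2 first.
    - by apply/measurable_EFinP; exact: measurable_funX.
    - by move=> x _; rewrite lee_fin sqr_ge0.
    rewrite EFin_int; last by apply: dint.
    rewrite -EFinM lee_fin.
    have := hN0 k (n_ k.+1) (n_ k) (nS k) (nN k) => hh.
    apply: le_trans (ler_wpM2l _ hh) _; first by rewrite exprn_ge0.
    by rewrite -exprMn (_ : 2 * 8^-1 = 4^-1 :> R)//; field.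
  have gs : cvgn (series (fun k => (4^-1 : R) ^+ k)).
    have := @is_cvg_geometric_series R 1 4^-1; rewrite /geometric /=.
    under eq_fun do rewrite mul1r; apply; rewrite ger0_norm; lra.
  move/cvg_ex: gs => [l hl].
  have -> : (\sum_(k <oo) ((4^-1 : R) ^+ k)%:E)%E = l%:E; last exact: ltry.
  apply/cvg_lim => //.
  have -> : (fun n => \sum_(0 <= i < n) ((4^-1 : R) ^+ i)%:E)%E = EFin \o series (fun k => (4^-1 : R) ^+ k).
    by apply/funext => n /=; rewrite /series/= -sumEFin.
  by apply: cvg_EFin => //; exact: nearW.
have h0 x : (0 <= h x)%E by apply: nneseries_ge0 => k _ _; exact: t0.
have mh : measurable_fun D h.
  exact: (ge0_emeasurable_sum (P := xpredT)).
have hint : mu.-integrable D h.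
  by apply/integrableP; split => //; under eq_integral do rewrite gee0_abs//.
(* An upper limit is measurable without removing a null set; almost everywhere it is the limit. *)
pose l x := fine (limn_esup (fun k => (u_ (n_ k) x)%:E)).
have ml : measurable_fun D l.
  apply: measurableT_comp => //; apply: measurable_fun_limn_esup => k.
  exact/measurable_EFinP/l2_meas.
have good : {ae mu, forall x, D x -> u_ (n_ k) x @[k --> \oo] --> l x}.
  have := integrable_ae mD hint; apply: filterS => x hx Dx.
  have {}hx := hx Dx.
  have cv : cvgn (fun k => u_ (n_ k) x).
    have s01 : 0 <= Num.sqrt (2^-1 : R) < 1.
      by rewrite sqrtr_ge0/= -[X in _ < X]sqrtr1 ltr_sqrt ?ltr01// invf_lt1 ?ltr0n// ltr1n.
    apply: (@geometric_cauchy _ (Num.sqrt (fine (h x))) (Num.sqrt 2^-1)) => //.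
    move=> k; rewrite -(@ler_pXn2r _ 2) ?nnegrE ?mulr_ge0 ?exprn_ge0 ?sqrtr_ge0//.
    rewrite real_normK ?num_real// exprMn sqr_sqrtr; last exact/fine_ge0.
    rewrite -exprM mulnC exprM sqr_sqrtr; last lra.
    have : ((2 ^+ k * dd k x ^+ 2)%:E <= h x)%E.
      apply: le_trans (nneseries_lim_ge k.+1 (fun j _ _ => t0 j x)).
      by rewrite big_nat_recr//= leeDr// sume_ge0.
    move=> hk; rewrite exprVn ler_pdivlMr ?exprn_gt0// mulrC.
    by rewrite -lee_fin fineK.
  have cE : (u_ (n_ k) x)%:E @[k --> \oo] --> (limn (fun k => u_ (n_ k) x))%:E.
    by apply: cvg_EFin; [exact: nearW|exact: cv].
  have [_ e] := cvg_limn_einf_sup cE.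
  by rewrite /l e; exact: cv.
have fat e n N : (forall k, (N <= k)%N -> \int[mu]_(x in D) ((u_ n x - u_ (n_ k) x) ^+ 2) <= e) ->
    (\int[mu]_(x in D) ((u_ n x - l x) ^+ 2)%:E <= e%:E)%E.
  move=> hN.
  have mf k : measurable_fun D (fun x => ((u_ n x - u_ (n_ k) x) ^+ 2)%:E).
    by apply/measurable_EFinP; apply: measurable_funX; apply: measurable_funB; exact: l2_meas.
  have -> : (\int[mu]_(x in D) ((u_ n x - l x) ^+ 2)%:E =
      \int[mu]_(x in D) limn_einf (fun k => ((u_ n x - u_ (n_ k) x) ^+ 2)%:E))%E.
    apply: ge0_ae_eq_integral => //.
    - apply/measurable_EFinP; apply: measurable_funX; apply: measurable_funB => //; exact: l2_meas.
    - rewrite /limn_einf; apply: measurableT_comp => //; apply: measurable_fun_limn_esup => k.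
      by apply: measurableT_comp.
    - by move=> x _; rewrite lee_fin sqr_ge0.
    - move=> x _; rewrite limn_einf_lim; apply: lime_ge; first exact: is_cvg_einfs.
      apply: nearW => k; apply: le_ereal_inf_tmp => _ [j _ <-].
      by rewrite lee_fin sqr_ge0.
    - apply: filterS good => x hx Dx; have {}hx := hx Dx.
      have cE : ((u_ n x - u_ (n_ k) x) ^+ 2)%:E @[k --> \oo] --> ((u_ n x - l x) ^+ 2)%:E.
        apply: cvg_EFin; first exact: nearW.
        by rewrite expr2; apply: cvgM; apply: cvgB => //; exact: cvg_cst.
      by have [-> _] := cvg_limn_einf_sup cE.
  have F0 k x : D x -> (0 <= ((u_ n x - u_ (n_ k) x) ^+ 2)%:E)%E.
    by move=> _; rewrite lee_fin sqr_ge0.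
  apply: le_trans (@fatou _ _ _ mu D mD _ mf F0) _.
  rewrite limn_einf_lim; apply: lime_le; first exact: is_cvg_einfs.
  exists N => // k Nk; apply: ereal_inf_le.
  exists (\int[mu]_(x in D) ((u_ n x - u_ (n_ k) x) ^+ 2)%:E)%E; first by exists k => //=.
  by rewrite EFin_int// lee_fin; exact: hN.
have lim e : 0 < e -> exists N : nat, forall n, (N <= n)%N ->
    (\int[mu]_(x in D) ((u_ n x - l x) ^+ 2)%:E <= e%:E)%E.
  move=> e0; have [N hN] := hc e e0; exists N => n hn.
  apply: (@fat e n N) => k hk; apply: hN => //.
  exact: (leq_trans hk (leq_trans (N0k k) (nN k))).
have l2l : l2 l.
  have [N hN] := lim 1 ltr01.
  have h1 : l2 (fun x => u_ N x - l x).
    split; first by apply: measurable_funB => //; exact: l2_meas.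
    by apply: le_lt_trans (hN N (leqnn N)) _; exact: ltry.
  have := l2_sub (hu N) h1; congr l2; apply/funext => x; ring.
exists l => // e e0; have [N hN] := lim e e0; exists N => n hn.
have := hN n hn; rewrite EFin_int ?lee_fin//.
by apply: l2_sqr_int; exact: l2_sub.
Qed.

Definition wip w u v : R := \int[mu]_(x in D) (u x * v x * w x).

Section Weight.
Variables (w : T -> R) (c C : R).
Hypothesis (mw : measurable_fun D w) (c0 : 0 < c) (hw : forall x, D x -> c <= w x <= C).

Lemma weight_le x : D x -> `|w x| <= C.
Proof.
by move=> Dx; have /andP[h1 h2] := hw Dx; rewrite ger0_norm// (le_trans _ h1)// ltW.
Qed.

Lemma wip_int u v : l2 u -> l2 v -> mu.-integrable D (EFin \o (fun x => u x * v x * w x)).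
Proof. exact: l2_wint mw weight_le. Qed.

Lemma wipC u v : wip w u v = wip w v u.
Proof. by apply: eq_Rintegral => x _; rewrite (mulrC (u x)). Qed.

Lemma wip_lin k u v z : l2 u -> l2 v -> l2 z ->
  wip w (fun x => k * u x + v x) z = k * wip w u z + wip w v z.
Proof.
move=> hu hv hz; rewrite /wip -RintegralZl//; last exact: wip_int.
rewrite -RintegralD//; [|exact/int_scale/wip_int|exact: wip_int].
by apply: eq_Rintegral => x _; ring.
Qed.

Lemma wip_ge0 u : 0 <= wip w u u.
Proof.
apply: Rintegral_ge0 => x Dx; have /andP[h1 _] := hw Dx.
rewrite -expr2; apply: mulr_ge0; [exact: sqr_ge0|exact: le_trans (ltW c0) h1].
Qed.

Lemma wip_lb u : l2 u -> c * \int[mu]_(x in D) (u x ^+ 2) <= wip w u u.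
Proof.
move=> hu; rewrite -RintegralZl//; last exact: l2_sqr_int.
apply: le_Rintegral => //; [exact/int_scale/l2_sqr_int|exact: wip_int|].
move=> x Dx; have /andP[h1 _] := hw Dx; rewrite -expr2 mulrC ler_wpM2l ?sqr_ge0//.
Qed.

Lemma wip_ub u : l2 u -> wip w u u <= C * \int[mu]_(x in D) (u x ^+ 2).
Proof.
move=> hu; rewrite -RintegralZl//; last exact: l2_sqr_int.
apply: le_Rintegral => //; [exact: wip_int|exact/int_scale/l2_sqr_int|].
move=> x Dx; have /andP[_ h1] := hw Dx; rewrite -expr2 mulrC ler_wpM2r ?sqr_ge0//.
Qed.

End Weight.

End L2Space.

Section PlaneMeasurability.
Context {R : realType}.
Local Notation plane := (R * R)%type.

(** The measurable structure of the plane is the product one; an open set is a countable union of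
    boxes with rational corners. *)
Lemma open_measurable_plane (A : set plane) : open A -> measurable A.
Proof.
move=> oA.
pose box (q : rat * rat * (rat * rat)) : set plane :=
  `]ratr q.1.1, ratr q.1.2[%classic `*` `]ratr q.2.1, ratr q.2.2[%classic.
have -> : A = \bigcup_q (if `[< box q `<=` A >] then box q else set0).
  apply/seteqP; split => [x Ax|x [q _]]; last first.
    by case: ifPn => // /asboolP; exact.
  have [e /= e0 he] := (proj1 (nbhs_ballP _ _)) (open_nbhs_nbhs (conj oA Ax)).
  have [a [ha1 ha2]] : exists a : rat, x.1 - e < ratr a /\ ratr a < x.1.
    have [a] := @rat_in_itvoo R (x.1 - e) x.1 ltac:(by rewrite ltrBlDr ltrDl).
    by rewrite in_itv/= => /andP[]; exists a.
  have [b [hb1 hb2]] : exists b : rat, x.1 < ratr b /\ ratr b < x.1 + e.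
    have [b] := @rat_in_itvoo R x.1 (x.1 + e) ltac:(by rewrite ltrDl).
    by rewrite in_itv/= => /andP[]; exists b.
  have [a' [ha1' ha2']] : exists a : rat, x.2 - e < ratr a /\ ratr a < x.2.
    have [a'] := @rat_in_itvoo R (x.2 - e) x.2 ltac:(by rewrite ltrBlDr ltrDl).
    by rewrite in_itv/= => /andP[]; exists a'.
  have [b' [hb1' hb2']] : exists b : rat, x.2 < ratr b /\ ratr b < x.2 + e.
    have [b'] := @rat_in_itvoo R x.2 (x.2 + e) ltac:(by rewrite ltrDl).
    by rewrite in_itv/= => /andP[]; exists b'.
  exists ((a, b), (a', b')) => //; rewrite ifT.
    by split; rewrite /= in_itv/= ?ha2 ?hb1 ?ha2' ?hb1'.
  apply/asboolP => y [] /=; rewrite !in_itv/= => /andP[y1 y2] /andP[y3 y4].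
  apply: he; split; rewrite /ball/= ltr_norml; apply/andP; split; lra.
apply: countable_bigcupT_measurable; first exact: countableP.
move=> q; case: ifP => _; last exact: measurable0.
by apply: measurableX => //; exact: measurable_itv.
Qed.

Lemma continuous_measurable_plane (D : set plane) (f : plane -> R) :
  open D -> {in D, continuous f} -> measurable_fun D f.
Proof.
move=> oD cf; apply: (measurability _ (RGenOpens.measurableE R)).
move=> _ [_ [a [b ->] <-]]; apply: open_measurable_plane.
rewrite openE => x [Dx /= fx]; apply: filterI; first exact: open_nbhs_nbhs.
apply: cf; first exact: mem_set.
by apply: open_nbhs_nbhs; split => //; exact: interval_open.
Qed.

End PlaneMeasurability.

(** * Test functions on the plane *)

Section TestFunctions.
Context {R : realType}.
Local Notation plane := (R * R)%type.
Local Notation mu := (leb2 R).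

Lemma test_smooth {V : normedModType R} (D : set V) (p : V -> R) : test_function D p -> smooth p.
Proof. by case. Qed.

Lemma test_lin {V : normedModType R} (D : set V) (c : R) (p q : V -> R) : hausdorff_space V ->
  test_function D p -> test_function D q -> test_function D (fun x => c * p x + q x).
Proof.
move=> hV [sp [A [cA AD pA]]] [sq [B [cB BD qB]]]; split.
  by apply: smooth_add => //; exact: smooth_scale.
exists (A `|` B); split; first exact: compactU.
  by move=> x [/AD|/BD].
by move=> x /not_orP[/pA -> /qB ->]; rewrite mulr0 addr0.
Qed.

Lemma test_mul {V : normedModType R} (D : set V) (p q : V -> R) :
  test_function D p -> smooth q -> test_function D (fun x => p x * q x).
Proof.
move=> [sp [A [cA AD pA]]] sq; split; first exact: smooth_mul.
by exists A; split => // x /pA ->; rewrite mul0r.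
Qed.

Lemma test_D {V : normedModType R} (D : set V) (p : V -> R) v : hausdorff_space V ->
  test_function D p -> test_function D ('D_v p).
Proof.
move=> hV [sp [A [cA AD pA]]]; split; first exact: smooth_D.
exists A; split => // x Ax; apply: (smooth_supp_derive (A := A)) => //.
exact: compact_closed.
Qed.

Lemma plane_hausdorff : hausdorff_space plane.
Proof. exact: norm_hausdorff. Qed.
Lemma line_hausdorff : hausdorff_space R.
Proof. exact: norm_hausdorff. Qed.

Lemma growth_slice1 (p : plane -> R) (s y : R) :
  (fun h : R => h^-1 *: ((((fun s => p (s, y)) : R -> R) \o shift s) (h *: (1 : R)) - p (s, y))) =
  (fun h : R => h^-1 *: ((p \o shift (s, y)) (h *: e1) - p (s, y))).
Proof.
apply/funext => h /=; congr (_ *: (p _ - _)).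
have -> : h *: (e1 : plane) + (s, y) = (h *: (1 : R) + s, h *: (0 : R) + y) by [].
by rewrite scaler0 add0r.
Qed.
Lemma derive_slice1 (p : plane -> R) (s y : R) :
  'D_1 (fun s => p (s, y)) s = 'D_e1 p (s, y).
Proof. by rewrite /derive growth_slice1. Qed.
Lemma derivable_slice1 (p : plane -> R) (s y : R) : derivable p (s, y) e1 ->
  derivable (fun s => p (s, y)) s 1.
Proof. by rewrite /derivable growth_slice1. Qed.

Lemma growth_slice2 (p : plane -> R) (s y : R) :
  (fun h : R => h^-1 *: ((((fun y => p (s, y)) : R -> R) \o shift y) (h *: (1 : R)) - p (s, y))) =
  (fun h : R => h^-1 *: ((p \o shift (s, y)) (h *: e2) - p (s, y))).
Proof.
apply/funext => h /=; congr (_ *: (p _ - _)).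
have -> : h *: (e2 : plane) + (s, y) = (h *: (0 : R) + s, h *: (1 : R) + y) by [].
by rewrite scaler0 add0r.
Qed.
Lemma derive_slice2 (p : plane -> R) (s y : R) :
  'D_1 (fun y => p (s, y)) y = 'D_e2 p (s, y).
Proof. by rewrite /derive growth_slice2. Qed.
Lemma derivable_slice2 (p : plane -> R) (s y : R) : derivable p (s, y) e2 ->
  derivable (fun y => p (s, y)) y 1.
Proof. by rewrite /derivable growth_slice2. Qed.

Lemma test_box (D : set plane) (p : plane -> R) : test_function D p ->
  exists b M : R, [/\ 0 < b, 0 <= M, forall x, `|p x| <= M &
    forall x, ~ (`|x.1| <= b /\ `|x.2| <= b) -> p x = 0].
Proof.
move=> [sp [A [cA AD pA]]].
have [b0 [_ hb0]] := compact_bounded cA.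
pose b := `|b0| + 1.
have b0b : b0 < b by rewrite /b; apply: le_lt_trans (ler_norm _) _; rewrite ltrDl.
have hb := hb0 b b0b.
have cp : compact (p @` A).
  apply: continuous_compact => //; apply: continuous_subspaceT.
  exact: smooth_continuous.
have [m0 [_ hm0]] := compact_bounded cp.
pose m := `|m0| + 1.
have m0m : m0 < m by rewrite /m; apply: le_lt_trans (ler_norm _) _; rewrite ltrDl.
have hm := hm0 m m0m.
exists b, m; split.
- by rewrite ltr_wpDl.
- by rewrite addr_ge0.
- move=> x; have [Ax|Ax] := pselect (A x); first by apply: hm; exists x.
  by rewrite pA// normr0 addr_ge0.
- move=> x hx; apply: pA => Ax; apply: hx.
  have := hb x Ax; rewrite /= prod_normE /= ge_max => /andP[]; split => //.
Qed.

Section Strip.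
Variable a : R.
Hypothesis a0 : 0 < a.
Local Notation D := (strip a).

Lemma strip_open : open D.
Proof.
have -> : D = snd @^-1` `]- a, a[%classic.
  by apply/seteqP; split => x; rewrite /strip /= in_itv/=.
by apply: open_comp; [move=> x _; exact: snd_continuous|exact: interval_open].
Qed.

Lemma strip_measurable : measurable D.
Proof. apply: open_measurable_plane; exact: strip_open. Qed.

Definition box (b : R) : set plane := [set x : plane | `|x.1| <= b /\ `|x.2| <= b].

Lemma box_finite (b : R) : (mu (box b) < +oo)%E.
Proof.
have -> : box b = `[- b, b]%classic `*` `[- b, b]%classic.
  by apply/seteqP; split => x; rewrite /box /= !in_itv/= !ler_norml => -[].
rewrite product_measure1E; [|exact: measurable_itv|exact: measurable_itv].
have h : (leb R `[(- b)%R, b]%classic < +oo)%E.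
  by rewrite lebesgue_measure_itv/=; case: ifP => _; rewrite ?ltry// -EFinD ltry.
by apply: lte_mul_pinfty; rewrite ?measure_ge0// ge0_fin_numE// measure_ge0.
Qed.

Lemma measurable_continuous (p : plane -> R) (B : set plane) : measurable B ->
  continuous p -> measurable_fun B p.
Proof.
move=> mB cp; apply: (@measurable_funS _ _ _ _ setT) => //.
by apply: continuous_measurable_plane; [exact: openT|move=> x _; exact: cp].
Qed.

Lemma l2_box (B : set plane) (p : plane -> R) (b M : R) : measurable B -> measurable_fun B p ->
  (forall x, B x -> `|p x| <= M) -> (forall x, B x -> ~ (`|x.1| <= b /\ `|x.2| <= b) -> p x = 0) ->
  l2 mu B p.
Proof.
move=> mB mp pM pb; split => //.
pose Q := box b.
have mQ : measurable Q.
  have -> : Q = `[- b, b]%classic `*` `[- b, b]%classic.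
    by apply/seteqP; split => x; rewrite /Q /box /= !in_itv/= !ler_norml => -[].
  by apply: measurableX; exact: measurable_itv.
apply: (@le_lt_trans _ _ (\int[mu]_(x in B) ((M ^+ 2) * \1_Q x)%:E)%E).
  apply: ge0_le_integral => //.
  - by move=> x _; rewrite lee_fin sqr_ge0.
  - by apply/measurable_EFinP; exact: measurable_funX.
  - apply/measurable_EFinP; apply: measurable_funM => //.
  - move=> x Bx; rewrite lee_fin indicE; have [xQ|xQ] := boolP (x \in Q).
      rewrite mulr1 -(real_normK (num_real (p x))) ler_pXn2r ?nnegrE ?pM//.
      exact: le_trans (pM x Bx).
    by rewrite pb ?expr0n ?mulr0// => h; move/negP: xQ; apply; exact: mem_set.
under eq_integral do rewrite EFinM.
rewrite ge0_integralZl ?lee_fin ?sqr_ge0//; last first.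
  by apply/measurable_EFinP; exact: measurable_indic.
rewrite integral_indic//; apply: lte_mul_pinfty => //; first by rewrite lee_fin sqr_ge0.
by apply: le_lt_trans (box_finite b); apply: le_measure; rewrite ?inE//; exact: measurableI.
Qed.

Lemma test_l2 (B : set plane) (p : plane -> R) : measurable B -> test_function D p -> l2 mu B p.
Proof.
move=> mB tp; have [b [M [_ _ pM pb]]] := test_box tp.
apply: (@l2_box _ _ b M) => //; last by move=> x _; exact: pb.
apply: measurable_continuous => //; apply: smooth_continuous; exact: test_smooth tp.
Qed.

Lemma test_int (B : set plane) (p : plane -> R) : measurable B -> test_function D p ->
  mu.-integrable B (EFin \o p).
Proof.
move=> mB tp; have [b [M [b0 _ pM pb]]] := test_box tp.
pose Q := box b.
have mQ : measurable Q.
  have -> : Q = `[- b, b]%classic `*` `[- b, b]%classic.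
    by apply/seteqP; split => x; rewrite /Q /box /= !in_itv/= !ler_norml => -[].
  by apply: measurableX; exact: measurable_itv.
have l1 : l2 mu B (\1_Q : plane -> R).
  apply: (@l2_box B _ b 1 mB (measurable_indic mQ)).
    by move=> x _; rewrite indicE; case: (x \in Q); rewrite ?normr1 ?normr0.
  move=> x _ xQ; rewrite indicE; case: (boolP (x \in Q)) => // /set_mem //.
have := l2_mul_int _ (test_l2 mB tp) l1 => /(_ mB).
apply: eq_integrable => // x _ /=; rewrite indicE; have [xQ|xQ] := boolP (x \in Q).
  by rewrite mulr1.
by rewrite pb ?mul0r// => h; move/negP: xQ; apply; exact: mem_set.
Qed.

Lemma strip_int_setT (p : plane -> R) : test_function D p ->
  \int[mu]_(x in D) p x = \int[mu]_x p x.
Proof.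
move=> [_ [A [_ AD pA]]]; rewrite Rintegral_mkcond; apply: eq_Rintegral => x _.
rewrite patchE; case: ifPn => // /negP xD; rewrite pA// => Ax; apply: xD.
by apply: mem_set; exact: AD.
Qed.

Lemma int_deriv0 (g : R -> R) (b : R) : 0 < b -> smooth g ->
  (forall s, ~ (`|s| <= b) -> g s = 0) -> (\int[leb R]_s ('D_1 g s)%:E = 0)%E.
Proof.
move=> b0 sg g0.
have c1 : b < b + 1 by rewrite ltrDl.
have d0 s : ~ (`|s| <= b) -> 'D_1 g s = 0.
  apply: (smooth_supp_derive (A := [set s : R | `|s| <= b])) => //.
  have -> : [set s : R | `|s| <= b] = `[- b, b]%classic.
    by apply/seteqP; split => x; rewrite /= in_itv/= ler_norml.
  exact: interval_closed.
have -> : (\int[leb R]_s ('D_1 g s)%:E = \int[leb R]_(s in `[(- (b + 1))%R, (b + 1)%R]) ('D_1 g s)%:E)%E.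
  rewrite [RHS]integral_mkcond; apply: eq_integral => s _; rewrite patchE.
  case: ifPn => // /negP hs; rewrite d0// => h; apply: hs; apply: mem_set.
  by rewrite /= in_itv/= -ler_norml (le_trans h)// ltW.
have cg := smooth_continuous sg.
rewrite (@continuous_FTC2 _ _ g); first 1 last.
- by rewrite gtrN// addr_gt0.
- by apply: continuous_subspaceT; apply: smooth_continuous; exact: smooth_D.
- split.
  + by move=> x _; exact: smooth_derivable.
  + by apply: cvg_at_right_filter; exact: cg.
  + by apply: cvg_at_left_filter; exact: cg.
- by move=> x _; rewrite derive1E.
have hn : `|b + 1| = b + 1 by rewrite ger0_norm// addr_ge0// ltW.
by rewrite !g0 ?normrN ?hn -?EFinB ?subrr// => h; lra.
Qed.

(** Fubini in the order that integrates the derivative along its own direction first, where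
    [int_deriv0] applies on every line. *)
Lemma test_int_derive (p : plane -> R) (v : plane) : test_function D p -> v = e1 \/ v = e2 ->
  \int[mu]_(x in D) 'D_v p x = 0.
Proof.
move=> tp hv.
have tdp w : test_function D ('D_w p) by apply: test_D => //; exact: plane_hausdorff.
rewrite strip_int_setT// /Rintegral.
have [b [M [b0 M0 pM pb]]] := test_box tp.
have sp := test_smooth tp.
have sl1 (y : R) : smooth (fun s : R => p (s, y)).
  apply: (@smooth_coind1 R (fun f => exists q, smooth q /\ f = fun s : R => q (s, y))); last by exists p.
  - move=> _ [q [sq ->]]; exists (fun s => 'D_e1 q (s, y)).
      by exists ('D_e1 q); split => //; exact: smooth_D.
    move=> s; split; last exact: derive_slice1.
    by apply: derivable_slice1; exact: smooth_derivable.
  - by move=> c _ [q [sq ->]]; exists (fun x => c * q x); split => //; exact: smooth_scale.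
have sl2 (s : R) : smooth (fun y : R => p (s, y)).
  apply: (@smooth_coind1 R (fun f => exists q, smooth q /\ f = fun y : R => q (s, y))); last by exists p.
  - move=> _ [q [sq ->]]; exists (fun y => 'D_e2 q (s, y)).
      by exists ('D_e2 q); split => //; exact: smooth_D.
    move=> y; split; last exact: derive_slice2.
    by apply: derivable_slice2; exact: smooth_derivable.
  - by move=> c _ [q [sq ->]]; exists (fun x => c * q x); split => //; exact: smooth_scale.
case: hv => ->.
  rewrite -(integral21_prod_meas1 (test_int measurableT (tdp e1))).
  under eq_integral => y _.
    rewrite /fubini_G; under eq_integral do rewrite /= -derive_slice1.
    rewrite (@int_deriv0 _ b)//; last by move=> s hs; apply: pb => -[/hs].
    over.
  by rewrite integral0.
rewrite -(integral12_prod_meas1 (test_int measurableT (tdp e2))).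
under eq_integral => y _.
  rewrite /fubini_F; under eq_integral do rewrite /= -derive_slice2.
  rewrite (@int_deriv0 _ b)//; last by move=> s hs; apply: pb => -[_ /hs].
  over.
by rewrite integral0.
Qed.

Lemma test_by_parts (p q : plane -> R) (v : plane) : test_function D p -> test_function D q ->
  v = e1 \/ v = e2 ->
  \int[mu]_(x in D) (p x * 'D_v q x) = - \int[mu]_(x in D) ('D_v p x * q x).
Proof.
move=> tp tq hv.
have sp := test_smooth tp; have sq := test_smooth tq.
have tpq : test_function D (fun x => p x * q x) by exact: test_mul.
have := test_int_derive tpq hv.
have -> : 'D_v (fun x => p x * q x) = fun x => p x * 'D_v q x + 'D_v p x * q x.
  apply/funext => x; rewrite (@deriveM _ _ p q)/GRing.scale/=; first by ring.
    exact: smooth_derivable.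
  exact: smooth_derivable.
have mD := strip_measurable.
have i1 : mu.-integrable D (EFin \o (fun x => p x * 'D_v q x)).
  by apply: test_int => //; apply: test_mul => //; exact: smooth_D.
have i2 : mu.-integrable D (EFin \o (fun x => 'D_v p x * q x)).
  apply: test_int => //; apply: test_mul => //; apply: test_D => //; exact: plane_hausdorff.
rewrite RintegralD//; lra.
Qed.

End Strip.

End TestFunctions.

(** * The form of the strip *)

Section RealSpaces.
Context {R : realType}.
Variable a : R.
Local Notation plane := (R * R)%type.
Local Notation mu := (leb2 R).
Local Notation D := (strip a).
Local Notation E := (plane -> R).

(** The identity function makes measurability of [D] be read in the sigma-algebra that carries
    [mu]. *)
Let mD := (fun d (T : measurableType d) (_ : {measure set T -> \bar R}) (A : set T)
  (h : measurable A) => h) _ _ mu D (strip_measurable a).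

Lemma Rint0 (A : set plane) : \int[mu]_(x in A) (0 : R) = 0.
Proof. by rewrite /Rintegral integral0. Qed.

(** Square integrable functions are packaged as a submodule of all functions, so that the abstract
    Hilbert space lemmas apply. Functions that agree only almost everywhere on [D] stay distinct. *)
Definition l2pred : {pred E} := fun u => `[< l2 mu D u >].
Lemma l2predP u : reflect (l2 mu D u) (u \in l2pred).
Proof. exact: asboolP. Qed.
Fact l2pred_closed : submod_closed l2pred.
Proof.
split; first by apply/l2predP; exact: l2_0.
by move=> c u v /l2predP hu /l2predP hv; apply/l2predP; exact: (l2_lin mD c hu hv).
Qed.
HB.instance Definition _ := GRing.isSubmodClosed.Build R E l2pred l2pred_closed.
Record L2r := MkL2r { l2val :> E ; l2valP : l2val \in l2pred }.
HB.instance Definition _ := [isSub for l2val].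
HB.instance Definition _ := [Choice of L2r by <:].
HB.instance Definition _ := [SubChoice_isSubLmodule of L2r by <:].

Definition mkL (u : E) (h : l2 mu D u) : L2r := MkL2r (introT (l2predP u) h).
Lemma L2rP (u : L2r) : l2 mu D u. Proof. by apply/l2predP; exact: l2valP. Qed.
Lemma L2r_lin (c : R) (u v : L2r) : ((c *: u + v : L2r) : E) = fun x => c * u x + v x.
Proof. by []. Qed.
Lemma L2rB (u v : L2r) : ((u - v : L2r) : E) = fun x => u x - v x.
Proof. by []. Qed.
Lemma L2r_inj (u v : L2r) : (u : E) = v -> u = v.
Proof. by move=> h; apply: val_inj. Qed.

Section Weighted.
Variables (w : plane -> R) (c C : R).
Hypothesis (mw : measurable_fun D w) (c0 : 0 < c) (hw : forall x, D x -> c <= w x <= C).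

Definition ipw (u v : L2r) : R := wip mu D w u v.

Lemma ipw_lb (u : L2r) : c * \int[mu]_(x in D) (u x ^+ 2) <= ipw u u.
Proof. by apply: (@wip_lb _ _ _ mu D _ w c C) => //; exact: L2rP. Qed.
Lemma ipw_ub (u : L2r) : ipw u u <= C * \int[mu]_(x in D) (u x ^+ 2).
Proof. by apply: (@wip_ub _ _ _ mu D _ w c C) => //; exact: L2rP. Qed.

Lemma hilbert_ipw : hilbert ipw.
Proof.
split.
- by move=> u v; exact: wipC.
- move=> k u v z; exact: (wip_lin mD mw c0 hw k (L2rP u) (L2rP v) (L2rP z)).
- by move=> u; apply: (wip_ge0 mu c0 hw).
- move=> u_ hc.
  have [|l hl hlim] := @l2_complete _ _ _ mu D mD u_ (fun n => L2rP (u_ n)).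
    move=> e e0; have [N hN] := hc (c * e) (mulr_gt0 c0 e0).
    exists N => m n hm hn; have := hN m n hm hn; move=> h.
    have := le_trans (ipw_lb (u_ m - u_ n)) h.
    by rewrite ler_pM2l.
  exists (mkL hl); apply/cvgrPdist_le => e e0.
  have C0 : 0 < `|C| + 1 by rewrite ltr_wpDl.
  have [N hN] := hlim (e / (`|C| + 1)) (divr_gt0 e0 C0).
  exists N => // n hn; rewrite sub0r normrN ger0_norm; last exact: (wip_ge0 mu c0 hw).
  apply: le_trans (ipw_ub _) _.
  have := hN n hn; rewrite ler_pdivlMr// => h; apply: le_trans h.
  rewrite mulrC ler_wpM2l//; first by apply: Rintegral_ge0 => x _; exact: sqr_ge0.
  by apply: le_trans (ler_norm _) _; rewrite lerDl.
Qed.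

End Weighted.

Definition n2 (u : E) : R := \int[mu]_(x in D) (u x ^+ 2).

Lemma n2_ge0 u : 0 <= n2 u.
Proof. by apply: Rintegral_ge0 => x _; exact: sqr_ge0. Qed.
Lemma n2_ip (u : L2r) : n2 u = ipw (cst 1) u u.
Proof. by apply: eq_Rintegral => x _; rewrite mulr1 expr2. Qed.
Lemma hilbert1 : hilbert (ipw (cst 1)).
Proof. by apply: (@hilbert_ipw (cst 1) 1 1) => // x _; rewrite lexx. Qed.

Lemma n2_lin (c : R) u v : l2 mu D u -> l2 mu D v ->
  n2 (fun x => c * u x + v x) <= 2 * c ^+ 2 * n2 u + 2 * n2 v.
Proof.
move=> hu hv; rewrite /n2 -!RintegralZl//; try exact: l2_sqr_int.
have iu := @int_scale _ _ _ mu D mD (2 * c ^+ 2) _ (l2_sqr_int hu).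
have iv := @int_scale _ _ _ mu D mD 2 _ (l2_sqr_int hv).
rewrite -RintegralD//; apply: le_Rintegral => //.
- by apply: l2_sqr_int; exact: (l2_lin mD c hu hv).
- exact: int_add.
- by move=> x _ /=; have := sqr_ge0 (c * u x - v x); rewrite sqrrB sqrrD exprMn; lra.
Qed.

Lemma n2_tri u v z : l2 mu D u -> l2 mu D v -> l2 mu D z ->
  n2 (fun x => u x - z x) <= 2 * n2 (fun x => u x - v x) + 2 * n2 (fun x => v x - z x).
Proof.
move=> hu hv hz; have := n2_lin 1 (l2_sub mD hu hv) (l2_sub mD hv hz).
rewrite expr1n mulr1; apply: le_trans; rewrite le_eqVlt; apply/orP; left; apply/eqP.
by apply: eq_Rintegral => x _; congr (_ ^+ 2); ring.
Qed.

Definition wpart (v : plane) (u h : E) := forall phi : E, test_function D phi ->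
  \int[mu]_(x in D) (u x * 'D_v phi x) = - \int[mu]_(x in D) (h x * phi x).

Definition h10 (u g1 g2 : E) :=
  [/\ l2 mu D u, l2 mu D g1, l2 mu D g2, wpart e1 u g1 & wpart e2 u g2] /\
  forall eps : R, 0 < eps -> exists2 phi : E, test_function D phi &
    n2 (fun x => u x - phi x) + n2 (fun x => g1 x - 'D_e1 phi x) +
    n2 (fun x => g2 x - 'D_e2 phi x) <= eps.

Lemma test_l2D (phi : E) : test_function D phi -> l2 mu D phi.
Proof. exact: test_l2. Qed.
Lemma test_Dl2 (phi : E) v : test_function D phi -> l2 mu D ('D_v phi).
Proof. by move=> h; apply: test_l2D; apply: test_D => //; exact: plane_hausdorff. Qed.
Lemma test_Dlin (c : R) (p q : E) v : test_function D p -> test_function D q ->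
  'D_v (fun x => c * p x + q x) = fun x => c * 'D_v p x + 'D_v q x.
Proof.
move=> /test_smooth sp /test_smooth sq; apply/funext => x.
rewrite (@deriveD _ _ _ (fun x => c * p x) q); last 2 first.
- by apply: smooth_derivable; exact: smooth_scale.
- exact: smooth_derivable.
by rewrite (@deriveZ _ _ _ p); last exact: smooth_derivable.
Qed.

Lemma wpart_lin (c : R) v u h u' h' : l2 mu D u -> l2 mu D h -> l2 mu D u' -> l2 mu D h' ->
  wpart v u h -> wpart v u' h' ->
  wpart v (fun x => c * u x + u' x) (fun x => c * h x + h' x).
Proof.
move=> lu lh lu' lh' hw hw' p tp.
have e (y z b : E) : l2 mu D y -> l2 mu D z -> l2 mu D b ->
    \int[mu]_(x in D) ((c * y x + z x) * b x) =
    c * \int[mu]_(x in D) (y x * b x) + \int[mu]_(x in D) (z x * b x).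
  move=> hy hz hb; rewrite -RintegralZl//; last exact: l2_mul_int.
  rewrite -RintegralD//; last exact: l2_mul_int.
    by apply: eq_Rintegral => x _; ring.
  by apply: int_scale => //; exact: l2_mul_int.
have lp := test_l2D tp; have lDp := test_Dl2 v tp.
by rewrite !e// hw// hw'//; ring.
Qed.

Lemma h10_lin_arith (c e A A1 A2 B B1 B2 Z0 Z1 Z2 : R) : 0 <= A -> 0 <= A1 -> 0 <= A2 ->
  Z0 <= 2 * c ^+ 2 * A + 2 * B -> Z1 <= 2 * c ^+ 2 * A1 + 2 * B1 ->
  Z2 <= 2 * c ^+ 2 * A2 + 2 * B2 -> A + A1 + A2 <= e / 2 / (2 * c ^+ 2 + 1) ->
  B + B1 + B2 <= e / 4 -> Z0 + Z1 + Z2 <= e.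
Proof.
move=> a1 a2 a3 h0 h1 h2.
have k0 : 0 < 2 * c ^+ 2 + 1 by rewrite ltr_wpDl// mulr_ge0// sqr_ge0.
rewrite ler_pdivlMr// mulrDr mulr1 (mulrC (A + A1 + A2)) => hA hB.
by rewrite !mulrDr in hA; lra.
Qed.

Lemma h10_lin (c : R) u g1 g2 u' g1' g2' : h10 u g1 g2 -> h10 u' g1' g2' ->
  h10 (fun x => c * u x + u' x) (fun x => c * g1 x + g1' x) (fun x => c * g2 x + g2' x).
Proof.
move=> [[lu lg1 lg2 w1 w2] ap] [[lu' lg1' lg2' w1' w2'] ap']; split.
  by split; [exact: l2_lin|exact: l2_lin|exact: l2_lin|exact: wpart_lin|exact: wpart_lin].
move=> eps e0.
have k0 : 0 < 2 * c ^+ 2 + 1 by rewrite ltr_wpDl// mulr_ge0// sqr_ge0.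
have e1_ : 0 < eps / 2 / (2 * c ^+ 2 + 1) by rewrite !divr_gt0.
have e2_ : 0 < eps / 4 by rewrite divr_gt0.
have [p tp hp] := ap _ e1_; have [p' tp' hp'] := ap' _ e2_.
pose pp : E := fun x => c * p x + p' x.
have ed v y y' : n2 (fun x => c * y x + y' x - 'D_v pp x) =
    n2 (fun x => c * y x + y' x - (c * 'D_v p x + 'D_v p' x)).
  apply: eq_Rintegral => x _; congr ((_ - _) ^+ 2).
  exact: (congr1 (fun g : E => g x) (test_Dlin c v tp tp')).
exists pp; first by apply: test_lin => //; exact: plane_hausdorff.
rewrite (ed e1) (ed e2).
have st (y z y' z' : E) : l2 mu D y -> l2 mu D z -> l2 mu D y' -> l2 mu D z' ->
    n2 (fun x => c * y x + y' x - (c * z x + z' x)) <=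
    2 * c ^+ 2 * n2 (fun x => y x - z x) + 2 * n2 (fun x => y' x - z' x).
  move=> hy hz hy' hz'; have := n2_lin c (l2_sub mD hy hz) (l2_sub mD hy' hz').
  apply: le_trans; rewrite le_eqVlt; apply/orP; left; apply/eqP.
  by apply: eq_Rintegral => x _; congr (_ ^+ 2); ring.
have h0 := st _ _ _ _ lu (test_l2D tp) lu' (test_l2D tp').
have h1 := st _ _ _ _ lg1 (test_Dl2 e1 tp) lg1' (test_Dl2 e1 tp').
have h2 := st _ _ _ _ lg2 (test_Dl2 e2 tp) lg2' (test_Dl2 e2 tp').
exact: (h10_lin_arith (n2_ge0 _) (n2_ge0 _) (n2_ge0 _) h0 h1 h2 hp hp').
Qed.

Lemma h10_0 : h10 (fun=> 0) (fun=> 0) (fun=> 0).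
Proof.
have t0 : test_function D (fun=> 0 : R).
  split; first exact: smooth_cst.
  exists set0; split => //; exact: compact0.
have w0 v : wpart v (fun=> 0) (fun=> 0).
  by move=> p _; under eq_Rintegral do rewrite mul0r;
     under [in RHS]eq_Rintegral do rewrite mul0r; rewrite Rint0 oppr0.
split; first by split => //; exact: l2_0.
move=> e e0; exists (fun=> 0) => //.
rewrite /n2; under eq_Rintegral do rewrite subr0 expr0n/=.
under [X in _ + X + _]eq_Rintegral do rewrite derive_cst subr0 expr0n/=.
under [X in _ + _ + X]eq_Rintegral do rewrite derive_cst subr0 expr0n/=.
by rewrite !Rint0 !addr0 ltW.
Qed.

Lemma h10_test (p : E) : test_function D p -> h10 p ('D_e1 p) ('D_e2 p).
Proof.
move=> tp; split.
  split; [exact: test_l2D|exact: test_Dl2|exact: test_Dl2| |].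
    by move=> q tq; apply: test_by_parts => //; left.
  by move=> q tq; apply: test_by_parts => //; right.
move=> e e0; exists p => //.
rewrite /n2; under eq_Rintegral do rewrite subrr expr0n/=.
under [X in _ + X + _]eq_Rintegral do rewrite subrr expr0n/=.
under [X in _ + _ + X]eq_Rintegral do rewrite subrr expr0n/=.
by rewrite !Rint0 !addr0 ltW.
Qed.

Definition h10pred : {pred E * (E * E)} := fun x => `[< h10 x.1 x.2.1 x.2.2 >].
Lemma h10predP x : reflect (h10 x.1 x.2.1 x.2.2) (x \in h10pred).
Proof. exact: asboolP. Qed.
Fact h10pred_closed : submod_closed h10pred.
Proof.
split; first by apply/h10predP; exact: h10_0.
by move=> c u v /h10predP hu /h10predP hv; apply/h10predP; exact: (h10_lin c hu hv).
Qed.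
HB.instance Definition _ := GRing.isSubmodClosed.Build R (E * (E * E))%type h10pred h10pred_closed.
(** An element is a function with a chosen weak gradient; the form and the linearity of the gradient
    then need no uniqueness of weak derivatives. *)
Record H10r := MkH10r { h10val :> E * (E * E) ; h10valP : h10val \in h10pred }.
HB.instance Definition _ := [isSub for h10val].
HB.instance Definition _ := [Choice of H10r by <:].
HB.instance Definition _ := [SubChoice_isSubLmodule of H10r by <:].

Lemma H10rP (x : H10r) : h10 (h10val x).1 (h10val x).2.1 (h10val x).2.2.
Proof. by apply/h10predP; exact: h10valP. Qed.
Definition mkH u g1 g2 (h : h10 u g1 g2) : H10r := MkH10r (introT (h10predP (u, (g1, g2))) h).

Definition Hpi (x : H10r) : L2r := mkL (let: conj (And5 h _ _ _ _) _ := H10rP x in h).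
Definition Hd1 (x : H10r) : L2r := mkL (let: conj (And5 _ h _ _ _) _ := H10rP x in h).
Definition Hd2 (x : H10r) : L2r := mkL (let: conj (And5 _ _ h _ _) _ := H10rP x in h).

Lemma Hpi_lin c x y : Hpi (c *: x + y) = c *: Hpi x + Hpi y.
Proof. exact: L2r_inj. Qed.
Lemma Hd1_lin c x y : Hd1 (c *: x + y) = c *: Hd1 x + Hd1 y.
Proof. exact: L2r_inj. Qed.
Lemma Hd2_lin c x y : Hd2 (c *: x + y) = c *: Hd2 x + Hd2 y.
Proof. exact: L2r_inj. Qed.
Lemma HpiB x y : Hpi (x - y) = Hpi x - Hpi y.
Proof. exact: L2r_inj. Qed.
Lemma Hd1B x y : Hd1 (x - y) = Hd1 x - Hd1 y.
Proof. exact: L2r_inj. Qed.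
Lemma Hd2B x y : Hd2 (x - y) = Hd2 x - Hd2 y.
Proof. exact: L2r_inj. Qed.

(** Both sides of the defining identity are inner products with a fixed test function, hence
    continuous in L^2. *)
Lemma wpart_lim v (u_ h_ : nat -> L2r) (u h : L2r) : (forall n, wpart v (u_ n) (h_ n)) ->
  n2 (u_ n - u : L2r) @[n --> \oo] --> (0 : R) -> n2 (h_ n - h : L2r) @[n --> \oo] --> (0 : R) ->
  wpart v u h.
Proof.
move=> hw cu ch p tp.
have H := hilbert1.
have ipE (y : L2r) (q : E) (lq : l2 mu D q) : \int[mu]_(x in D) (y x * q x) = ipw (cst 1) y (mkL lq).
  by apply: eq_Rintegral => x _; rewrite /= mulr1.
rewrite (ipE _ _ (test_Dl2 v tp)) (ipE _ _ (test_l2D tp)).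
have cv (y_ : nat -> L2r) (y g : L2r) : n2 (y_ n - y : L2r) @[n --> \oo] --> (0 : R) ->
    ipw (cst 1) (y_ n) g @[n --> \oo] --> ipw (cst 1) y g.
  move=> hy; apply: (@cvg_ipl _ _ _ H) => //.
  by apply: cvg_sqrt0 => //; move: hy; under eq_fun do rewrite n2_ip.
have c1 := cv _ _ (mkL (test_Dl2 v tp)) cu.
have c2 : - ipw (cst 1) (h_ n) (mkL (test_l2D tp)) @[n --> \oo] -->
    - ipw (cst 1) h (mkL (test_l2D tp)) by apply: cvgN; exact: cv.
have e : (fun n => ipw (cst 1) (u_ n) (mkL (test_Dl2 v tp))) =
    (fun n => - ipw (cst 1) (h_ n) (mkL (test_l2D tp))).
  by apply/funext => n; rewrite -!ipE hw.
by rewrite e in c1; exact: (cvg_unique _ c1 c2).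
Qed.

Lemma h10_lim_arith (e X0 X1 X2 Y0 Y1 Y2 Z0 Z1 Z2 : R) : Z0 <= 2 * X0 + 2 * Y0 -> Z1 <= 2 * X1 + 2 * Y1 ->
  Z2 <= 2 * X2 + 2 * Y2 -> X0 <= e / 8 -> X1 <= e / 8 -> X2 <= e / 8 ->
  Y0 + Y1 + Y2 <= e / 8 -> Z0 + Z1 + Z2 <= e.
Proof. lra. Qed.

Lemma h10_lim (x_ : nat -> H10r) (u g1 g2 : L2r) :
  n2 (Hpi (x_ n) - u : L2r) @[n --> \oo] --> (0 : R) ->
  n2 (Hd1 (x_ n) - g1 : L2r) @[n --> \oo] --> (0 : R) ->
  n2 (Hd2 (x_ n) - g2 : L2r) @[n --> \oo] --> (0 : R) -> h10 u g1 g2.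
Proof.
move=> c0 c1 c2; split.
  split; [exact: L2rP|exact: L2rP|exact: L2rP| |].
    by apply: wpart_lim c0 c1 => n; have [[]] := H10rP (x_ n).
  by apply: wpart_lim c0 c2 => n; have [[]] := H10rP (x_ n).
move=> e e0; have e8 : 0 < e / 8 by rewrite divr_gt0.
have [n [h0 h1 h2]] : exists n, [/\ n2 (Hpi (x_ n) - u : L2r) <= e / 8,
    n2 (Hd1 (x_ n) - g1 : L2r) <= e / 8 & n2 (Hd2 (x_ n) - g2 : L2r) <= e / 8].
  have [N0 _ h0] := (proj1 (cvgrPdist_le _ _)) c0 _ e8.
  have [N1 _ h1] := (proj1 (cvgrPdist_le _ _)) c1 _ e8.
  have [N2 _ h2] := (proj1 (cvgrPdist_le _ _)) c2 _ e8.
  pose n := maxn N0 (maxn N1 N2).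
  have ab (y : L2r) : `|0 - n2 y| = n2 y by rewrite sub0r normrN ger0_norm// n2_ge0.
  exists n; split; rewrite -ab.
  - by apply: h0; rewrite /n /= leq_maxl.
  - by apply: h1; rewrite /n /= !leq_max leqnn !orbT.
  - by apply: h2; rewrite /n /= !leq_max leqnn !orbT.
have [_ /(_ _ e8)[p tp hp]] := H10rP (x_ n); exists p => //.
have st (y z : L2r) (b : E) : l2 mu D b -> n2 (fun x => z x - b x) <=
    2 * n2 (y - z : L2r) + 2 * n2 (fun x => y x - b x).
  move=> lb; have := n2_tri (L2rP z) (L2rP y) lb.
  rewrite (_ : n2 (fun x => z x - y x) = n2 (y - z : L2r))//.
  by apply: eq_Rintegral => x _; rewrite L2rB -sqrrN opprB.
have s0 := st (Hpi (x_ n)) u _ (test_l2D tp).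
have s1 := st (Hd1 (x_ n)) g1 _ (test_Dl2 e1 tp).
have s2 := st (Hd2 (x_ n)) g2 _ (test_Dl2 e2 tp).
exact: (h10_lim_arith (e := e) s0 s1 s2 h0 h1 h2 hp).
Qed.

(** * The weighted form and its closedness *)

Section JacobiForm.
Variables (f : plane -> R) (c C : R).
Hypothesis (mf : measurable_fun D f) (c0 : 0 < c) (hf : forall x, D x -> c <= f x <= C).
Local Notation fV := (fun x => (f x)^-1).

Hypothesis C0 : 0 < C.

Lemma mfV : measurable_fun D fV.
Proof.
apply: (measurable_comp (F := [set y : R | 0 < y])) => //.
- rewrite (_ : [set y : R | 0 < y] = `]0, +oo[%classic); first exact: measurable_itv.
  by apply/seteqP; split => x; rewrite /= in_itv/= andbT.
- by move=> _ [x Dx <-] /=; have /andP[h _] := hf Dx; exact: lt_le_trans h.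
- apply: open_continuous_measurable_fun.
    rewrite (_ : [set y : R | 0 < y] = `]0, +oo[%classic); first exact: interval_open.
    by apply/seteqP; split => x; rewrite /= in_itv/= andbT.
  move=> x /set_mem /= x0; apply: inv_continuous; exact: lt0r_neq0.
Qed.

Lemma hfV x : D x -> C^-1 <= fV x <= c^-1.
Proof.
move=> Dx; have /andP[h1 h2] := hf Dx; have Cp : 0 < C by apply: lt_le_trans c0 (le_trans h1 h2).
by rewrite !lef_pV2 ?posrE// ?h1 ?h2// (lt_le_trans c0 h1).
Qed.

Definition qf (x y : H10r) : R := ipw fV (Hd1 x) (Hd1 y) + ipw f (Hd2 x) (Hd2 y).

Let mw : measurable_fun D fV := mfV.
Let C'0 : 0 < C^-1. Proof. by rewrite invr_gt0. Qed.
Let H : hilbert (ipw f) := hilbert_ipw mf c0 hf.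
Let HV : hilbert (ipw fV) := hilbert_ipw mw C'0 hfV.

Lemma Dist0 (w : plane -> R) (b B : R) : measurable_fun D w -> 0 < b ->
  (forall x, D x -> b <= w x <= B) -> forall (x_ : nat -> L2r) l,
  ipw w (x_ n - l) (x_ n - l) @[n --> \oo] --> (0 : R) -> n2 (x_ n - l : L2r) @[n --> \oo] --> (0 : R).
Proof.
move=> mw' b0 hw x_ l hx.
have h : b^-1 * ipw w (x_ n - l) (x_ n - l) @[n --> \oo] --> (b^-1 * 0 : R) by apply: cvgM => //; exact: cvg_cst.
rewrite mulr0 in h; apply: (squeeze_cvgr _ (cvg_cst 0) h); apply: nearW => n.
have k : b * n2 (x_ n - l : L2r) <= ipw w (x_ n - l) (x_ n - l) := ipw_lb mw' b0 hw _.
by rewrite n2_ge0/= ler_pdivlMl.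
Qed.

Lemma le_sum1 (x y z : R) : 0 <= y -> 0 <= z -> x <= x + y + z. Proof. lra. Qed.
Lemma le_sum2 (x y z : R) : 0 <= x -> 0 <= z -> y <= x + y + z. Proof. lra. Qed.
Lemma le_sum3 (x y z : R) : 0 <= x -> 0 <= y -> z <= x + y + z. Proof. lra. Qed.

(** As [f] and its inverse lie between positive constants, a Cauchy sequence for the form norm
    converges in plain L^2 together with its gradients, and [h10] is stable under such limits. *)
Lemma jacobi_formP : form (ipw f) Hpi qf.
Proof.
split.
- by move=> x y; rewrite /qf (ipC HV) (ipC H).
- by move=> k x y z; rewrite /qf Hd1_lin Hd2_lin (ip_lin HV) (ip_lin H); ring.
- by move=> x; apply: addr_ge0; [exact: (ip_ge0 HV)|exact: (ip_ge0 H)].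
- exact: Hpi_lin.
- split.
  + by move=> x y; rewrite /qf !(ipC HV (Hd1 x)) !(ipC H (Hd2 x)) !(ipC H (Hpi x)).
  + by move=> k x y z; rewrite /qf Hd1_lin Hd2_lin Hpi_lin !(ip_lin HV) !(ip_lin H); ring.
  + by move=> x; rewrite !addr_ge0 ?(ip_ge0 HV) ?(ip_ge0 H).
  + move=> x_ hc.
    have p1 y := ip_ge0 HV (Hd1 y); have p2 y := ip_ge0 H (Hd2 y); have p0 y := ip_ge0 H (Hpi y).
    have [|g1 hg1] := ip_complete HV (u_ := fun n => Hd1 (x_ n)).
      move=> e e0; have [N hN] := hc e e0; exists N => m n hm hn; rewrite -Hd1B.
      exact: le_trans (le_sum1 _ (p2 _) (p0 _)) (hN m n hm hn).
    have [|g2 hg2] := ip_complete H (u_ := fun n => Hd2 (x_ n)).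
      move=> e e0; have [N hN] := hc e e0; exists N => m n hm hn; rewrite -Hd2B.
      exact: le_trans (le_sum2 _ (p1 _) (p0 _)) (hN m n hm hn).
    have [|u hu] := ip_complete H (u_ := fun n => Hpi (x_ n)).
      move=> e e0; have [N hN] := hc e e0; exists N => m n hm hn; rewrite -HpiB.
      exact: le_trans (le_sum3 _ (p1 _) (p2 _)) (hN m n hm hn).
    have hl : h10 u g1 g2.
      apply: (h10_lim (x_ := x_)).
      * exact: (Dist0 mf c0 hf).
      * exact: (Dist0 mw C'0 hfV).
      * exact: (Dist0 mf c0 hf).
    exists (mkH hl).
    have e1 : (fun n => qf (x_ n - mkH hl) (x_ n - mkH hl) + ipw f (Hpi (x_ n - mkH hl)) (Hpi (x_ n - mkH hl))) =
      (fun n => ipw fV (Hd1 (x_ n) - g1) (Hd1 (x_ n) - g1) + ipw f (Hd2 (x_ n) - g2) (Hd2 (x_ n) - g2) +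
        ipw f (Hpi (x_ n) - u) (Hpi (x_ n) - u)) by [].
    rewrite e1.
    have : ipw fV (Hd1 (x_ n) - g1) (Hd1 (x_ n) - g1) + ipw f (Hd2 (x_ n) - g2) (Hd2 (x_ n) - g2) +
        ipw f (Hpi (x_ n) - u) (Hpi (x_ n) - u) @[n --> \oo] --> (0 + 0 + 0 : R).
      by apply: cvgD => //; exact: cvgD.
    by rewrite !addr0.
Qed.

End JacobiForm.

End RealSpaces.

(** * Complex fields as pairs of real ones *)

Section AlmostEverywhere.
Context d (T : measurableType d) (R : realType) (mu : {measure set T -> \bar R}).

Lemma ae_imp (P Q : T -> Prop) : (forall x, P x -> Q x) -> {ae mu, forall x, P x} -> {ae mu, forall x, Q x}.
Proof. by move=> h; apply: filterS => x; exact: h. Qed.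

Lemma ae_imp2 (P P' Q : T -> Prop) : (forall x, P x -> P' x -> Q x) ->
  {ae mu, forall x, P x} -> {ae mu, forall x, P' x} -> {ae mu, forall x, Q x}.
Proof. by move=> h; apply: filterS2 => x; exact: h. Qed.

End AlmostEverywhere.

(** * Complexification as a pair of real spaces *)

Section ProductForm.
Context {R : realType} {V W : lmodType R}.
Variables (ip : V -> V -> R) (H : hilbert ip).

Definition ip2 (u v : V * V) : R := ip u.1 v.1 + ip u.2 v.2.

Lemma hilbert_ip2 : hilbert ip2.
Proof.
split.
- by move=> u v; rewrite /ip2 !(ipC H v.1) !(ipC H v.2).
- by move=> c u v w; rewrite /ip2 !(ip_lin H); ring.
- by move=> u; apply: addr_ge0; exact: (ip_ge0 H).
- move=> u_ hc.
  have [|l1 h1] := ip_complete H (u_ := fun n => (u_ n).1).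
    move=> e e0; have [N hN] := hc e e0; exists N => m n hm hn.
    by apply: le_trans (hN m n hm hn); rewrite lerDl (ip_ge0 H).
  have [|l2 h2] := ip_complete H (u_ := fun n => (u_ n).2).
    move=> e e0; have [N hN] := hc e e0; exists N => m n hm hn.
    by apply: le_trans (hN m n hm hn); rewrite lerDr (ip_ge0 H).
  exists (l1, l2).
  have : ip ((u_ n).1 - l1) ((u_ n).1 - l1) + ip ((u_ n).2 - l2) ((u_ n).2 - l2)
      @[n --> \oo] --> (0 + 0 : R) by exact: cvgD.
  by rewrite addr0.
Qed.

(** Multiplication by i on pairs of real and imaginary parts; it is the skew contraction [J] of
    [form_resolvent]. *)
Definition rot (u : V * V) : V * V := (- u.2, u.1).

Lemma rot_lin c u v : rot (c *: u + v) = c *: rot u + rot v.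
Proof. by rewrite /rot /=; congr pair; rewrite /= opprD scalerN. Qed.
Lemma rot_skew u v : ip2 (rot u) v = - ip2 u (rot v).
Proof. by rewrite /ip2 /= (ipNl H) (ipNr H); ring. Qed.
Lemma rot_nrm u : ipn ip2 (rot u) = ipn ip2 u.
Proof. by rewrite /ipn /ip2 /= (ipNl H) (ipNr H) opprK addrC. Qed.

Lemma ip2_nrm0 u v : ipn ip2 (u - v) = 0 -> ipn ip (u.1 - v.1) = 0 /\ ipn ip (u.2 - v.2) = 0.
Proof.
move=> h; have h0 : ip (u.1 - v.1) (u.1 - v.1) + ip (u.2 - v.2) (u.2 - v.2) = 0.
  by have := sqr_ipn hilbert_ip2 (u - v); rewrite h expr0n/= => /esym.
have p1 := ip_ge0 H (u.1 - v.1); have p2 := ip_ge0 H (u.2 - v.2).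
by split; apply/eqP; rewrite sqrtr_eq0; lra.
Qed.

Variables (pi : W -> V) (q : W -> W -> R).
Definition pi2 (x : W * W) : V * V := (pi x.1, pi x.2).
Definition q2 (x y : W * W) : R := q x.1 y.1 + q x.2 y.2.

Lemma form2 : form ip pi q -> form ip2 pi2 q2.
Proof.
move=> F; split.
- by move=> x y; rewrite /q2 (formC F x.1) (formC F x.2).
- by move=> c x y z; rewrite /q2 !(form_lin F); ring.
- by move=> x; apply: addr_ge0; exact: (form_ge0 F).
- by move=> c x y; rewrite /pi2 !(form_pi F).
- have -> : (fun x y => q2 x y + ip2 (pi2 x) (pi2 y)) =
    fun x y => (q x.1 y.1 + ip (pi x.1) (pi y.1)) + (q x.2 y.2 + ip (pi x.2) (pi y.2)).
    by apply/funext => x; apply/funext => y; rewrite /q2 /ip2/=; ring.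
  have HF := form_closed F; split.
  + by move=> u v; rewrite (ipC HF u.1) (ipC HF u.2).
  + by move=> c u v w; rewrite !(ip_lin HF); ring.
  + by move=> u; apply: addr_ge0; exact: (ip_ge0 HF).
  + move=> u_ hc.
    have [|l1 h1] := ip_complete HF (u_ := fun n => (u_ n).1).
      move=> e e0; have [N hN] := hc e e0; exists N => m n hm hn.
      by apply: le_trans (hN m n hm hn); rewrite lerDl (ip_ge0 HF).
    have [|l2 h2] := ip_complete HF (u_ := fun n => (u_ n).2).
      move=> e e0; have [N hN] := hc e e0; exists N => m n hm hn.
      by apply: le_trans (hN m n hm hn); rewrite lerDr (ip_ge0 HF).
    exists (l1, l2); set A := (fun n => _).
    rewrite -[X in _ --> X](addr0 0) /A; apply: cvgD; [exact: h1|exact: h2].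
Qed.

Lemma form_bottom2 m : form ip pi q -> form_bottom ip pi q m -> form_bottom ip2 pi2 q2 m.
Proof.
move=> F [h1 h2]; split.
  by move=> x; rewrite /ip2 /q2 /= mulrDr lerD.
move=> e e0; have [x [nx qx]] := h2 e e0; exists (x, 0).
have z : q 0 0 = 0 by have := formZ F 0 0 0; rewrite expr0n/= mul0r scaler0.
by rewrite /ip2 /q2 /= (form_pi0 F) (ip0l H) z !addr0.
Qed.

End ProductForm.

Section ComplexTranslation.
Context {R : realType}.
Variable a : R.
Local Notation plane := (R * R)%type.
Local Notation mu := (leb2 R).
Local Notation D := (strip a).
Local Notation field := (plane -> R[i]).
Local Notation L := (L2r a).

Let mD := (fun d (T : measurableType d) (_ : {measure set T -> \bar R}) (A : set T)
  (h : measurable A) => h) _ _ mu D (strip_measurable a).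

Definition toF (u : L * L) : field := fun x => Complex (u.1 x) (u.2 x).
Definition reF (F : field) : plane -> R := fun x => complex.Re (F x).
Definition imF (F : field) : plane -> R := fun x => complex.Im (F x).

Lemma Re_mulr (z : R[i]) (r : R) : complex.Re (z * (r%:C)%C) = complex.Re z * r.
Proof. by case: z => x y; rewrite /= mulr0 subr0. Qed.
Lemma Im_mulr (z : R[i]) (r : R) : complex.Im (z * (r%:C)%C) = complex.Im z * r.
Proof. by case: z => x y; rewrite /= mulr0 add0r. Qed.

Lemma L2_l2 (w : plane -> R) (b B : R) F : measurable_fun D w -> 0 < b ->
  (forall x, D x -> b <= w x <= B) -> L2 D w F <-> l2 mu D (reF F) /\ l2 mu D (imF F).
Proof.
move=> mw b0 hw; split.
- move=> [m1 m2 fin].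
  have ms : measurable_fun D (fun x => sqnormc (F x) * w x).
    by apply: measurable_funM => //; apply: measurable_funD; exact: measurable_funX.
  have is_ : mu.-integrable D (EFin \o (fun x => sqnormc (F x) * w x)).
    apply/integrableP; split; first exact/measurable_EFinP.
    apply: le_lt_trans fin; apply: ge0_le_integral => //.
    - by apply: measurableT_comp => //; exact/measurable_EFinP.
    - exact/measurable_EFinP.
    - move=> x Dx /=; rewrite lee_fin ger0_norm//; have /andP[h _] := hw x Dx.
      by rewrite mulr_ge0 ?addr_ge0 ?sqr_ge0// (le_trans (ltW b0)).
  have ib := @int_scale _ _ _ mu D mD b^-1 _ is_.
  have key (r s ww : R) : b <= ww -> `|r ^+ 2| <= b^-1 * ((r ^+ 2 + s ^+ 2) * ww).
    move=> hb; rewrite ger0_norm ?sqr_ge0// ler_pdivlMl// mulrC.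
    by apply: ler_pM; rewrite ?sqr_ge0 ?(ltW b0)// lerDl sqr_ge0.
  split; apply: l2P => //; apply: (int_le_integrable mD _ _ ib).
  + exact: measurable_funX.
  + by move=> x Dx; have /andP[h _] := hw x Dx; exact: key.
  + exact: measurable_funX.
  + by move=> x Dx; have /andP[h _] := hw x Dx; rewrite /sqnormc addrC; exact: key.
- move=> [h1 h2]; split; [exact: l2_meas h1|exact: l2_meas h2|].
  have i1 := wip_int mD mw b0 hw h1 h1; have i2 := wip_int mD mw b0 hw h2 h2.
  have := int_add mD i1 i2 => /integrableP[_].
  apply: le_lt_trans; apply: ge0_le_integral => //.
  + move=> x Dx; rewrite lee_fin; have /andP[h _] := hw x Dx.
    by rewrite mulr_ge0 ?addr_ge0 ?sqr_ge0// (le_trans (ltW b0)).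
  + apply/measurable_EFinP; apply: measurable_funM => //.
    by apply: measurable_funD; apply: measurable_funX; [exact: l2_meas h1|exact: l2_meas h2].
  + apply: measurableT_comp => //; apply/measurable_EFinP; apply: measurable_funD; apply: measurable_funM => //;
      apply: measurable_funM; by [exact: l2_meas h1|exact: l2_meas h2].
  + move=> x Dx /=; rewrite lee_fin; apply: le_trans (ler_norm _).
    by rewrite mulrDl !expr2.
Qed.

Lemma toF_L2 (w : plane -> R) (b B : R) u : measurable_fun D w -> 0 < b ->
  (forall x, D x -> b <= w x <= B) -> L2 D w (toF u).
Proof. by move=> mw b0 hw; apply/(L2_l2 _ mw b0 hw); split; exact: L2rP. Qed.

(** A part that is not square integrable is replaced by 0; [mkCK] covers the case of interest. *)
Definition mkC (F : field) : L * L := (insubd 0 (reF F), insubd 0 (imF F)).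

Lemma mkCK F : l2 mu D (reF F) -> l2 mu D (imF F) -> toF (mkC F) = F.
Proof.
move=> h1 h2; apply/funext => x; rewrite /toF /mkC /=.
rewrite -![l2val _]/(\val _) !insubdK; last 2 first.
- exact/l2predP.
- exact/l2predP.
by rewrite /reF /imF; case: (F x).
Qed.

Lemma scale_complex (c x y : R) : (c%:C)%C * Complex x y = Complex (c * x) (c * y).
Proof. by apply/eqP; rewrite eq_complex /=; apply/andP; split; apply/eqP; ring. Qed.
Lemma i_complex (x y : R) : Complex 0 1 * Complex x y = Complex (- y) x.
Proof. by apply/eqP; rewrite eq_complex /=; apply/andP; split; apply/eqP; ring. Qed.

Lemma toF_lin (c : R) u v : toF (c *: u + v) = fun x => (c%:C)%C * toF u x + toF v x.
Proof.
by apply/funext => x; rewrite /toF scale_complex.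
Qed.

Lemma toFB u v : toF (u - v) = fun x => toF u x - toF v x.
Proof. by []. Qed.

Lemma toFZ (c : R) u : toF (c *: u) = fun x => (c%:C)%C * toF u x.
Proof.
by apply/funext => x; rewrite /toF scale_complex.
Qed.

Lemma toF_rot u : toF (rot u) = fun x => Complex 0 1 * toF u x.
Proof.
by apply/funext => x; rewrite /toF i_complex.
Qed.

Section Weight.
Variables (w : plane -> R) (b B : R).
Hypothesis (mw : measurable_fun D w) (b0 : 0 < b) (hw : forall x, D x -> b <= w x <= B).
Let H := hilbert_ipw mw b0 hw.

Lemma norm2_toF u : norm2 D w (toF u) = ipn (ip2 (ipw w)) u.
Proof.
rewrite /norm2 /ipn /ip2 /ipw /wip; congr Num.sqrt.
rewrite -RintegralD//; last 2 first.
- exact: (wip_int mD mw b0 hw (L2rP _) (L2rP _)).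
- exact: (wip_int mD mw b0 hw (L2rP _) (L2rP _)).
by apply: eq_Rintegral => x _; rewrite /sqnormc /= mulrDl !expr2.
Qed.

(** The inner product is conjugate linear in its first argument, so its imaginary part is the real
    inner product with [i u] in place of [u]. *)
Lemma inner_toF u v : inner D w (toF u) (toF v) =
  Complex (ip2 (ipw w) u v) (ip2 (ipw w) (rot u) v).
Proof.
rewrite /inner /cintegral; congr Complex; rewrite /ip2 /ipw /wip.
- rewrite -RintegralD//; last 2 first.
  + exact: (wip_int mD mw b0 hw (L2rP _) (L2rP _)).
  + exact: (wip_int mD mw b0 hw (L2rP _) (L2rP _)).
  by apply: eq_Rintegral => x _; rewrite Re_mulr /=; ring.
- rewrite -RintegralD//; last 2 first.
  + exact: (wip_int mD mw b0 hw (L2rP _) (L2rP _)).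
  + exact: (wip_int mD mw b0 hw (L2rP _) (L2rP _)).
  apply: eq_Rintegral => x _; rewrite Im_mulr /=.
  by transitivity ((- u.2 x) * v.1 x * w x + u.1 x * v.2 x * w x); first by ring.
Qed.

Lemma ipw_ae (u v g : L) : {ae mu, forall x, D x -> u x = v x} -> ipw w u g = ipw w v g.
Proof.
move=> h; rewrite /ipw /wip /Rintegral; congr fine; apply: ae_eq_integral => //.
- apply/measurable_EFinP; apply: measurable_funM => //; apply: measurable_funM; exact: (l2_meas (L2rP _)).
- apply/measurable_EFinP; apply: measurable_funM => //; apply: measurable_funM; exact: (l2_meas (L2rP _)).
- by apply: (ae_imp _ h) => x hx Dx /=; rewrite hx.
Qed.

Lemma ip2_ae u v g : ae_eq mu D (toF u) (toF v) -> ip2 (ipw w) u g = ip2 (ipw w) v g.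
Proof.
move=> h; rewrite /ip2; congr (_ + _); apply: ipw_ae; apply: (ae_imp _ h) => x hx Dx.
  by have := congr1 (@complex.Re R) (hx Dx).
by have := congr1 (@complex.Im R) (hx Dx).
Qed.

Lemma ipw0_ae (u v : L) : ipn (ipw w) (u - v) = 0 -> {ae mu, forall x, D x -> u x = v x}.
Proof.
move=> h.
have h0 : ipw w (u - v) (u - v) = 0 by rewrite -(sqr_ipn H) h expr0n.
have hn2 : n2 a (u - v : L) = 0.
  apply/eqP; rewrite eq_le n2_ge0 andbT; have : b * n2 a (u - v : L) <= ipw w (u - v) (u - v) := ipw_lb mw b0 hw _.
  by rewrite h0 pmulr_rle0.
have hl2 : l2 mu D (u - v : L) := L2rP _.
have mz : measurable_fun D (fun x => ((u - v : L) x ^+ 2)%:E).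
  by apply/measurable_EFinP; apply: measurable_funX; exact: l2_meas hl2.
have hE : (\int[mu]_(x in D) `|(((u - v : L) x ^+ 2)%:E)| = 0)%E.
  under eq_integral => x _ do rewrite gee0_abs ?lee_fin ?sqr_ge0//.
  have := EFin_int mD (l2_sqr_int hl2); rewrite -/(n2 a (u - v : L)) hn2; exact.
have [h1 _] := ae_eq_integral_abs mu mD mz.
apply: (ae_imp _ (h1 hE)) => x hx Dx.
have := hx Dx => /eqP; rewrite eqe sqrf_eq0 => /eqP hh.
by apply/eqP; rewrite -subr_eq0; apply/eqP.
Qed.

End Weight.

Lemma weak_partialP v F h : weak_partial D v F h <->
  wpart a v (reF F) (reF h) /\ wpart a v (imF F) (imF h).
Proof.
have e G (p : plane -> R) : cintegral D (fun x => G x * ((p x)%:C)%C) =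
   Complex (\int[mu]_(x in D) (reF G x * p x)) (\int[mu]_(x in D) (imF G x * p x)).
  by rewrite /cintegral; congr Complex; apply: eq_Rintegral => x _; rewrite ?Re_mulr ?Im_mulr.
split.
- move=> hw; split=> p tp; have := hw p tp; rewrite !e.
    by move=> /(congr1 (@complex.Re R)).
  by move=> /(congr1 (@complex.Im R)).
- by move=> [h1 h2] p tp; rewrite !e h1// h2.
Qed.

Lemma h10_toF F g : H10 D F g <->
  h10 a (reF F) (reF g.1) (reF g.2) /\ h10 a (imF F) (imF g.1) (imF g.2).
Proof.
have L2P G := @L2_l2 (cst 1) 1 1 G (measurable_cst _) ltr01 (fun x _ => ltac:(by rewrite /= lexx)).
have sq (G : field) : l2 mu D (reF G) -> l2 mu D (imF G) ->
    norm2 D (cst 1) G ^+ 2 = n2 a (reF G) + n2 a (imF G).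
  move=> h1 h2; rewrite sqr_sqrtr; last first.
    by apply: Rintegral_ge0 => x _; rewrite mulr1 addr_ge0 ?sqr_ge0.
  rewrite /n2 -RintegralD//; try exact: l2_sqr_int.
  by apply: eq_Rintegral => x _; rewrite mulr1.
have n0 G : 0 <= norm2 D (cst 1) G by exact: sqrtr_ge0.
split.
- move=> [[/L2P[r0 i0] /L2P[r1 i1] /L2P[r2 i2] /weak_partialP[wr1 wi1] /weak_partialP[wr2 wi2]] ap].
  have key e : 0 < e -> exists phi : field, [/\ ctest_function D phi,
      n2 a (fun x => reF F x - reF phi x) + n2 a (fun x => imF F x - imF phi x) <= e / 3,
      n2 a (fun x => reF g.1 x - 'D_e1 (reF phi) x) + n2 a (fun x => imF g.1 x - 'D_e1 (imF phi) x) <= e / 3 &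
      n2 a (fun x => reF g.2 x - 'D_e2 (reF phi) x) + n2 a (fun x => imF g.2 x - 'D_e2 (imF phi) x) <= e / 3].
    move=> e0; have e3 : 0 < e / 3 by rewrite divr_gt0.
    have [|phi [[t1 t2] h0 h1 h2]] := ap (Num.sqrt (e / 3)); first by rewrite sqrtr_gt0.
    have le_ (G : field) (X : R) : norm2 D (cst 1) G ^+ 2 = X -> norm2 D (cst 1) G < Num.sqrt (e / 3) -> X <= e / 3.
      move=> <- h; rewrite -(sqr_sqrtr (ltW e3)) ler_pXn2r ?nnegrE ?sqrtr_ge0//; exact: ltW.
    exists phi; split => //.
    + apply: le_ h0; rewrite sq.
      * by congr (_ + _); apply: eq_Rintegral => x _; rewrite /reF /imF/=; case: (F x); case: (phi x).
      * have := l2_sub mD r0 (test_l2D t1); congr l2; apply/funext => x.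
        by rewrite /reF /=; case: (F x); case: (phi x).
      * have := l2_sub mD i0 (test_l2D t2); congr l2; apply/funext => x.
        by rewrite /imF /=; case: (F x); case: (phi x).
    + apply: le_ h1; rewrite sq.
      * by congr (_ + _); apply: eq_Rintegral => x _; rewrite /reF /imF/=; case: (g.1 x).
      * have := l2_sub mD r1 (test_Dl2 e1 t1); congr l2; apply/funext => x.
        by rewrite /reF /=; case: (g.1 x).
      * have := l2_sub mD i1 (test_Dl2 e1 t2); congr l2; apply/funext => x.
        by rewrite /imF /=; case: (g.1 x).
    + apply: le_ h2; rewrite sq.
      * by congr (_ + _); apply: eq_Rintegral => x _; rewrite /reF /imF/=; case: (g.2 x).
      * have := l2_sub mD r2 (test_Dl2 e2 t1); congr l2; apply/funext => x.
        by rewrite /reF /=; case: (g.2 x).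
      * have := l2_sub mD i2 (test_Dl2 e2 t2); congr l2; apply/funext => x.
        by rewrite /imF /=; case: (g.2 x).
  have ar (X X' Y Y' Z Z' e : R) : 0 <= X -> 0 <= X' -> 0 <= Y -> 0 <= Y' -> 0 <= Z -> 0 <= Z' ->
     X + X' <= e / 3 -> Y + Y' <= e / 3 -> Z + Z' <= e / 3 -> X + Y + Z <= e /\ X' + Y' + Z' <= e.
    clear; move=> *; split; lra.
  split; split => //.
  + move=> e e0; have [phi [[t1 t2] h0 h1 h2]] := key e e0; exists (reF phi) => //.
    by have [] := ar _ _ _ _ _ _ _ (n2_ge0 _ _) (n2_ge0 _ _) (n2_ge0 _ _) (n2_ge0 _ _) (n2_ge0 _ _) (n2_ge0 _ _) h0 h1 h2.
  + move=> e e0; have [phi [[t1 t2] h0 h1 h2]] := key e e0; exists (imF phi) => //.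
    by have [] := ar _ _ _ _ _ _ _ (n2_ge0 _ _) (n2_ge0 _ _) (n2_ge0 _ _) (n2_ge0 _ _) (n2_ge0 _ _) (n2_ge0 _ _) h0 h1 h2.
- move=> [[[r0 r1 r2 wr1 wr2] apr] [[i0 i1 i2 wi1 wi2] api]]; split.
    by split; [exact/L2P|exact/L2P|exact/L2P|exact/weak_partialP|exact/weak_partialP].
  move=> e e0; have e3 : 0 < e ^+ 2 / 3 by rewrite divr_gt0// exprn_gt0.
  have [p tp hp] := apr _ e3; have [p' tp' hp'] := api _ e3.
  exists (fun x => Complex (p x) (p' x)).
  have le_ (G : field) (X Y : R) : norm2 D (cst 1) G ^+ 2 = X + Y -> X <= e ^+ 2 / 3 -> Y <= e ^+ 2 / 3 ->
      norm2 D (cst 1) G < e.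
    move=> h hX hY; rewrite -(@ltr_pXn2r _ 2) ?nnegrE ?(ltW e0)// h.
    have : 0 < e ^+ 2 by rewrite exprn_gt0.
    by move: hX hY; clear; move=> *; lra.
  have ar (X Y Z e' : R) : 0 <= X -> 0 <= Y -> 0 <= Z -> X + Y + Z <= e' -> [/\ X <= e', Y <= e' & Z <= e'].
    by clear; move=> *; split; lra.
  have [x0 x1 x2] := ar _ _ _ _ (n2_ge0 _ _) (n2_ge0 _ _) (n2_ge0 _ _) hp.
  have [y0 y1 y2] := ar _ _ _ _ (n2_ge0 _ _) (n2_ge0 _ _) (n2_ge0 _ _) hp'.
  split => //.
  + apply: le_ x0 y0; rewrite sq.
    * by congr (_ + _); apply: eq_Rintegral => x _; rewrite /reF /imF/=; case: (F x).
    * have := l2_sub mD r0 (test_l2D tp); congr l2; apply/funext => x.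
      by rewrite /reF /=; case: (F x).
    * have := l2_sub mD i0 (test_l2D tp'); congr l2; apply/funext => x.
      by rewrite /imF /=; case: (F x).
  + apply: le_ x1 y1; rewrite sq.
    * by congr (_ + _); apply: eq_Rintegral => x _; rewrite /reF /imF/=; case: (g.1 x).
    * have := l2_sub mD r1 (test_Dl2 e1 tp); congr l2; apply/funext => x.
      by rewrite /reF /=; case: (g.1 x).
    * have := l2_sub mD i1 (test_Dl2 e1 tp'); congr l2; apply/funext => x.
      by rewrite /imF /=; case: (g.1 x).
  + apply: le_ x2 y2; rewrite sq.
    * by congr (_ + _); apply: eq_Rintegral => x _; rewrite /reF /imF/=; case: (g.2 x).
    * have := l2_sub mD r2 (test_Dl2 e2 tp); congr l2; apply/funext => x.
      by rewrite /reF /=; case: (g.2 x).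
    * have := l2_sub mD i2 (test_Dl2 e2 tp'); congr l2; apply/funext => x.
      by rewrite /imF /=; case: (g.2 x).
Qed.

Lemma toF_inj u v : toF u = toF v -> u = v.
Proof.
case: u v => u1 u2 [v1 v2] h; congr pair; apply: L2r_inj; apply/funext => x.
  by have := congr1 (fun F : field => complex.Re (F x)) h.
by have := congr1 (fun F : field => complex.Im (F x)) h.
Qed.

Lemma field_eta (F : field) : F = fun x => Complex (reF F x) (imF F x).
Proof. by apply/funext => x; rewrite /reF /imF; case: (F x). Qed.

(** * The complex operator of the strip in real terms *)

Section FormTranslation.
Variables (f : plane -> R) (c C : R).
Hypothesis (mf : measurable_fun D f) (c0 : 0 < c) (hf : forall x, D x -> c <= f x <= C) (C0 : 0 < C).
Local Notation fV := (fun x => (f x)^-1).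
Local Notation ipf := (ipw (a := a) f).
Let H := hilbert_ipw mf c0 hf.
Let C'0 : 0 < C^-1. Proof. by rewrite invr_gt0. Qed.
Let mfV' := mfV mf c0 hf.
Let hfV' := hfV c0 hf.
Let HV := hilbert_ipw mfV' C'0 hfV'.
Let F := jacobi_formP mf c0 hf C0.
Local Notation W := (H10r a).

Definition Hd12 (x : W * W) : L * L := (Hd1 x.1, Hd1 x.2).
Definition Hd22 (x : W * W) : L * L := (Hd2 x.1, Hd2 x.2).

Lemma jacobi_toF (x y : W * W) :
  jacobi_form D f (toF (Hd12 x), toF (Hd22 x)) (toF (Hd12 y), toF (Hd22 y)) =
  Complex (q2 (qf f) x y) (q2 (qf f) (rot x) y).
Proof.
rewrite /jacobi_form /= (inner_toF mfV' C'0 hfV') (inner_toF mf c0 hf).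
have e z : Hd1 (- z : W) = - Hd1 z by exact: L2r_inj.
have e' z : Hd2 (- z : W) = - Hd2 z by exact: L2r_inj.
apply/eqP; rewrite eq_complex; apply/andP; split; apply/eqP.
  by rewrite /q2 /qf /ip2 /Hd12 /Hd22 /=; ring.
by rewrite /q2 /qf /ip2 /Hd12 /Hd22 /rot /= e e'; ring.
Qed.

(** Only real parts of the defining identity have to be tested: the form domain is stable under
    multiplication by i, and testing with [rot y] recovers the imaginary part. *)
Lemma H_KP psi eta : H_K a f psi eta <-> exists x v,
  [/\ psi = toF (pi2 (@Hpi R a) x), eta = toF v & form_op (ip2 ipf) (pi2 (@Hpi R a)) (q2 (qf f)) x v].
Proof.
have dom_toF (x : W * W) : H10 D (toF (pi2 (@Hpi R a) x)) (toF (Hd12 x), toF (Hd22 x)).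
  by apply/h10_toF; split; exact: H10rP.
have dom_inv phi (g : field * field) : H10 D phi g -> exists x : W * W,
    [/\ phi = toF (pi2 (@Hpi R a) x), g.1 = toF (Hd12 x) & g.2 = toF (Hd22 x)].
  move=> /h10_toF[h1 h2]; exists (mkH h1, mkH h2).
  by split; rewrite [LHS]field_eta.
split.
- move=> [/(L2_l2 _ mf c0 hf)[l1 l2]] [k /dom_inv[x [-> k1 k2]] hk].
  exists x, (mkC eta); rewrite mkCK//; split => // y.
  have := hk _ _ (dom_toF y); rewrite (surjective_pairing k) k1 k2 jacobi_toF.
  rewrite -{1}(mkCK l1 l2) (inner_toF mf c0 hf) => /(congr1 (@complex.Re R))/=.
  by rewrite (formC (form2 F)) (ipC (hilbert_ip2 H)).
- move=> [x [v [-> -> hx]]]; split; first exact: (toF_L2 _ mf c0 hf).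
  exists (toF (Hd12 x), toF (Hd22 x)); first exact: dom_toF.
  move=> phi g /dom_inv[y [-> g1 g2]]; rewrite (surjective_pairing g) g1 g2 jacobi_toF (inner_toF mf c0 hf).
  have e z : Hpi (- z : W) = - Hpi z by exact: L2r_inj.
  have e' : pi2 (@Hpi R a) (rot y) = rot (pi2 (@Hpi R a) y) by rewrite /pi2 /rot /= e.
  by rewrite !(formC (form2 F) _ x) !hx e' !(ipC (hilbert_ip2 H) v).
Qed.

Definition G2 (u v : L * L) := H_K a f (toF u) (toF v).

Lemma G2P u v : G2 u v <-> exists2 x, u = pi2 (@Hpi R a) x & form_op (ip2 ipf) (pi2 (@Hpi R a)) (q2 (qf f)) x v.
Proof.
rewrite /G2 H_KP; split.
- by move=> [x [v' [/toF_inj -> /toF_inj -> h]]]; exists x.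
- by move=> [x -> h]; exists x, v.
Qed.

Lemma toF_affine (v u : L * L) (y b : R) :
  toF (v + (y *: u + b *: rot u)) = fun t => toF v t + Complex y b * toF u t.
Proof.
apply/funext => t.
have -> : toF (v + (y *: u + b *: rot u)) t =
  Complex (v.1 t + (y * u.1 t + b * - u.2 t)) (v.2 t + (y * u.2 t + b * u.1 t)) by [].
by apply/eqP; rewrite eq_complex /=; apply/andP; split; apply/eqP; ring.
Qed.

Lemma nrm2_ae (u v : L * L) : ipn (ip2 ipf) (u - v) = 0 -> ae_eq mu D (toF u) (toF v).
Proof.
move=> h; have H2 := hilbert_ip2 H.
have [z1 z2] := ip2_nrm0 H h.
apply: (ae_imp2 _ (ipw0_ae mf c0 hf z1) (ipw0_ae mf c0 hf z2)) => x h1 h2 Dx.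
by rewrite /toF h1// h2.
Qed.

Section Bottom.
Variables (m : R) (m0 : 0 <= m) (hm : form_bottom ipf (@Hpi R a) (qf f) m).

(** Every [z] with real part below [m] lies in the resolvent set, by [form_resolvent] with
    [J = rot], while [m] itself does not; so the infimum is attained at [m]. *)
Lemma bottom_spectrum : inf_spectrum D f (H_K a f) = m.
Proof.
have H2 := hilbert_ip2 H; have F2 := form2 F; have hm2 := form_bottom2 H F hm.
have nF u : norm2 D f (toF u) = ipn (ip2 ipf) u by exact: (norm2_toF mf c0 hf).
have res z : complex.Re z < m -> resolvent_set D f (H_K a f) z.
  case: z => y b /= ym; exists ((m - y)^-1) => eta /(L2_l2 _ mf c0 hf)[l1 l2].
  have [x [ox nx ux]] := form_resolvent H2 F2 m0 hm2 (J := @rot _ _) b (@rot_lin _ _)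
    (rot_skew H) (fun u => (ltac:(by rewrite rot_nrm))) ym (mkC eta).
  have Ez u : (fun t => eta t + Complex y b * toF u t) = toF (mkC eta + (y *: u + b *: rot u)).
    by rewrite toF_affine mkCK.
  exists (toF (pi2 (@Hpi R a) x)); split.
  - by apply/H_KP; exists x; eexists; split; [by []|exact: Ez|].
  - by rewrite nF -[X in norm2 _ _ X](mkCK l1 l2) nF.
  - move=> psi' /H_KP[x' [v' [-> + ox']]]; rewrite Ez => /toF_inj e.
    by apply: nrm2_ae; apply: ux; rewrite e.
have inm : spectrum D f (H_K a f) (Complex m 0).
  move=> [k hk]; apply: (form_bottom_spectrum H2 F2 hm2); exists k => eta.
  have [psi [/H_KP[x [v [-> + ox]]] nx _]] := hk _ (toF_L2 eta mf c0 hf).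
  rewrite -toF_affine scale0r addr0 => /toF_inj e.
  by exists x; rewrite e -!nF.
rewrite /inf_spectrum; apply/eqP; rewrite eq_le; apply/andP; split.
- apply: ge_inf; last by exists (Complex m 0).
  exists m => _ [z hz <-]; rewrite leNgt; apply/negP => h; exact: hz (res _ h).
- apply: lb_le_inf; first by exists m; exists (Complex m 0).
  by move=> _ [z hz <-]; rewrite leNgt; apply/negP => h; exact: hz (res _ h).
Qed.

Variable T : R -> field -> field.
Hypothesis hT : semigroup_exp D f (H_K a f) T.

Definition T2 (t : R) (u : L * L) : L * L := mkC (T t (toF u)).

Lemma T2K t u : 0 <= t -> toF (T2 t u) = T t (toF u).
Proof.
move=> t0; have /(L2_l2 _ mf c0 hf)[l1 l2] := semigroup_L2 hT t0 (toF_L2 u mf c0 hf).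
exact: mkCK.
Qed.

Lemma sgroup_T2 : sgroup (ip2 ipf) T2 G2.
Proof.
have H2 := hilbert_ip2 H.
have tL u := toF_L2 u mf c0 hf.
have nF u : norm2 D f (toF u) = ipn (ip2 ipf) u by exact: (norm2_toF mf c0 hf).
have ae u v g : ae_eq mu D (toF u) (toF v) -> ip2 ipf u g = ip2 ipf v g by exact: ip2_ae.
split.
- move=> t k u v g t0; rewrite -(ip_lin H2); apply: ae; rewrite toF_lin !T2K// toF_lin.
  exact: semigroup_linear hT _ _ _ _ t0 (tL _) (tL _).
- move=> t t0; have [k hk] := semigroup_bounded hT t0; exists k => u.
  by rewrite -!nF T2K//; exact: hk.
- by move=> u g; apply: ae; rewrite T2K//; exact: (semigroup_0 hT).
- move=> s t u g s0 t0; apply: ae; rewrite !T2K ?addr_ge0//.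
  exact: (semigroup_D hT).
- move=> u; have := semigroup_cvg hT (tL u); apply: cvg_trans.
  apply: near_eq_cvg; apply/near_rightP; exists 1 => // t /andP[t0 _].
  by rewrite -nF toFB T2K ?ltW.
- move=> u v; rewrite /G2 (semigroup_generator hT (tL u) (tL v)).
  have e : \forall t \near 0^'+, norm2 D f (fun x => ((t^-1)%:C)%C * (toF u x - T t (toF u) x) - toF v x) =
     ipn (ip2 ipf) (t^-1 *: (u - T2 t u) - v).
    apply/near_rightP; exists 1 => // t /andP[t0 _].
    by rewrite -nF toFB toFZ toFB T2K ?ltW.
  split; apply: cvg_trans; apply: near_eq_cvg => //.
  by apply: filterS e => t ->.
Qed.

Lemma G2_sym u v u' v' : G2 u v -> G2 u' v' -> ip2 ipf v u' = ip2 ipf u v'.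
Proof.
have H2 := hilbert_ip2 H.
move=> /G2P[x -> hx] /G2P[y -> hy]; rewrite -hx (formC (form2 F)) hy.
by rewrite (ipC H2).
Qed.

Lemma G2_pos u v : G2 u v -> 0 <= ip2 ipf v u.
Proof. by move=> /G2P[x -> hx]; rewrite -hx; exact: (form_ge0 (form2 F)). Qed.

Lemma G2_shift_pos u v : G2 u (v + m *: u) -> 0 <= ip2 ipf v u.
Proof.
have H2 := hilbert_ip2 H; have [hm2 _] := form_bottom2 H F hm.
move=> /G2P[x -> hx]; have := hm2 x; rewrite hx (ipDl H2) (ipZl H2).
by rewrite lerDr.
Qed.

(** Upper bound: [expR (m * t)] times the semigroup is a contraction. Lower bound: unit vectors in
    the operator domain with form value at most [m + e] contribute [expR (- (m + e) * t)], and [e]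
    is arbitrary. *)
Lemma operator_norm_T (t : R) : 0 <= t -> operator_norm D f (T t) = (expR (- m * t))%:E.
Proof.
move=> t0; have H2 := hilbert_ip2 H; have F2 := form2 F; have hm2 := form_bottom2 H F hm.
have nF u : norm2 D f (toF u) = ipn (ip2 ipf) u by exact: (norm2_toF mf c0 hf).
have S := sgroup_T2; have S' := sgroup_shift H2 m S.
apply/eqP; rewrite eq_le; apply/andP; split.
- apply: ge_ereal_sup => _ [u [/(L2_l2 _ mf c0 hf)[l1 l2] nu] <-]; rewrite lee_fin.
  rewrite -(mkCK l1 l2) nF in nu; rewrite -(mkCK l1 l2) -T2K// nF.
  have := sg_contract H2 S' G2_shift_pos (mkC u) t0.
  rewrite (ipnZ H2) ger0_norm ?expR_ge0// mulNr expRN mulrC -ler_pdivlMr ?expR_gt0//.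
  move=> h; apply: le_trans h _; rewrite ler_pdivrMr ?expR_gt0// mulVf ?gt_eqF ?expR_gt0//.
- have key e : 0 < e -> ((expR (- (m + e) * t))%:E <= operator_norm D f (T t))%E.
    move=> e0; have [w [v [ow nw qw]]] := form_op_bottom H2 F2 m0 hm2 e0.
    have Gw : G2 (pi2 (@Hpi R a) w) v by apply/G2P; exists w.
    have := sg_lower_bound H2 S G2_sym G2_pos Gw nw t0.
    rewrite -ow => h; apply: (@le_trans _ _ (ipn (ip2 ipf) (T2 t (pi2 (@Hpi R a) w)))%:E).
      rewrite lee_fin; apply: le_trans h; rewrite ler_expR mulNr lerN2; exact: ler_wpM2r.
    apply: ereal_sup_ubound; exists (toF (pi2 (@Hpi R a) w)).
      by split; [exact: toF_L2 mf c0 hf|rewrite nF nw].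
    by rewrite -T2K// nF.
  case e : (operator_norm D f (T t)) key => [r| |] key; last 2 first.
  + exact: leey.
  + by have := key 1 ltr01.
  have key' d : 0 < d -> expR (- (m + d) * t) <= r by move=> d0; rewrite -lee_fin; exact: key.
  rewrite lee_fin; apply/ler_addgt0Pr => d d0; set E := expR (- m * t).
  have E0 : 0 < E by exact: expR_gt0.
  have Et : 0 < E * t + 1 by rewrite ltr_wpDl// mulr_ge0// ltW.
  (* With this [k] the loss [E * (1 - expR (- (k * t)))] is at most [E * t * k], hence at most
     [d]. *)
  have k0 : 0 < d / (E * t + 1) by rewrite divr_gt0.
  have := key' _ k0; set k := d / (E * t + 1) in k0 *.
  have -> : - (m + k) * t = - m * t + - (k * t) by ring.
  rewrite expRD -/E => h.
  have h1 : E * (1 + - (k * t)) <= E * expR (- (k * t)).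
    by rewrite ler_wpM2l ?(ltW E0)//; exact: expR_ge1Dx.
  have h2 : E * t * k <= d.
    have -> : d = (E * t + 1) * k by rewrite /k mulrC divfK// gt_eqF.
    by rewrite ler_wpM2r ?(ltW k0)// lerDl.
  clearbody E k; rewrite mulrDr mulr1 mulrN in h1.
  have h3 : E * (k * t) = E * t * k by ring.
  rewrite h3 in h1; lra.
Qed.

End Bottom.

End FormTranslation.

End ComplexTranslation.

(** * Weak solutions on an interval *)

(** The argument [mu] selects the measurable structure in which [A] is measurable. *)
Definition measurable_for d (T : measurableType d) (R : realType) (mu : {measure set T -> \bar R})
  (A : set T) := measurable A.

Section IntegralLemmas.
Context d (T : measurableType d) (R : realType) (mu : {measure set T -> \bar R}).
Variables (D : set T) (mD : measurable D).

Lemma int_dct (f_ : nat -> T -> R) (f g : T -> R) :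
  (forall n, measurable_fun D (f_ n)) -> measurable_fun D f ->
  (forall x, D x -> f_ n x @[n --> \oo] --> f x) ->
  (forall n x, D x -> `|f_ n x| <= g x) -> mu.-integrable D (EFin \o g) ->
  \int[mu]_(x in D) f_ n x @[n --> \oo] --> \int[mu]_(x in D) f x.
Proof.
move=> mf_ mf cf bf ig.
have [|||||i _ h] := @dominated_convergence _ _ _ mu D mD (fun n => EFin \o f_ n) (EFin \o f) (EFin \o g).
- by move=> n; exact/measurable_EFinP.
- exact/measurable_EFinP.
- by apply: aeW => x Dx; apply: cvg_EFin; [exact: nearW|exact: cf].
- exact: ig.
- by apply: aeW => x n Dx /=; rewrite lee_fin; exact: bf.
have e n : (\int[mu]_(x in D) (EFin \o f_ n) x)%E = (\int[mu]_(x in D) f_ n x)%:E.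
  by apply: EFin_int => //; apply: (int_le_integrable mD _ _ ig) => //; exact: bf.
rewrite (_ : [sequence _]_n = (fun n => (\int[mu]_(x in D) f_ n x)%:E)) in h; last by apply/funext => n; exact: e.
rewrite (EFin_int mD i) in h.
by have /fine_cvg := h.
Qed.

Lemma int_cst (B : R) : (mu D < +oo)%E -> mu.-integrable D (EFin \o (fun=> B)).
Proof.
move=> fD; apply/integrableP; split; first exact/measurable_EFinP/measurable_cst.
by rewrite /= integral_cst// lte_mul_pinfty.
Qed.

Lemma int_bounded (h : T -> R) (B : R) : (mu D < +oo)%E -> measurable_fun D h ->
  (forall x, D x -> `|h x| <= B) -> mu.-integrable D (EFin \o h).
Proof.
move=> fD mh hB; apply: (int_le_integrable mD mh hB).
exact: int_cst.
Qed.

Lemma int_abs_le (h : T -> R) (B : R) : 0 <= B -> (mu D < +oo)%E -> mu.-integrable D (EFin \o h) ->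
  {ae mu, forall x, D x -> `|h x| <= B} -> `|\int[mu]_(x in D) h x| <= B * fine (mu D).
Proof.
move=> B0 fD ih hB; apply: le_trans (le_normr_Rintegral mD ih) _.
have ic : mu.-integrable D (EFin \o (fun=> B)) by exact: int_cst.
have ia : mu.-integrable D (EFin \o (fun x => `|h x|)).
  have /integrableP[mh _] := ih; apply: (le_integrable mD _ _ ih).
    by apply/measurable_EFinP; apply: measurableT_comp => //; exact/measurable_EFinP.
  by move=> x Dx /=; rewrite normr_id.
rewrite -(Rintegral_cst mu mD) -lee_fin -!EFin_int//.
apply: ae_ge0_le_integral => //.
- by have /integrableP[] := ia.
Qed.

Lemma l2_bounded (h : T -> R) (B : R) : (mu D < +oo)%E -> measurable_fun D h ->
  (forall x, D x -> `|h x| <= B) -> l2 mu D h.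
Proof.
move=> fD mh hB; apply: l2P => //; apply: (@int_bounded _ (B ^+ 2)) => //.
  exact: measurable_funX.
move=> x Dx; rewrite normrX ler_pXn2r ?nnegrE ?normr_ge0// ?hB//.
exact: le_trans (hB x Dx).
Qed.

End IntegralLemmas.

Section WeakDerivative.
Context {R : realType}.
Variable a : R.
Local Notation mu := (leb R).
Local Notation I := (fiber a).

Lemma fiberE : I = `]- a, a[%classic.
Proof. by apply/seteqP; split => x; rewrite /fiber /= in_itv/=. Qed.
Lemma fiber_measurable : measurable I. Proof. by rewrite fiberE; exact: measurable_itv. Qed.
Let mI := (fun d (T : measurableType d) (_ : {measure set T -> \bar R}) (A : set T)
  (h : measurable A) => h) _ _ mu I fiber_measurable.
Lemma itv_finite (i : interval R) (x y : R) : ([set` i] `<=` `[x, y]%classic) -> (mu [set` i] < +oo)%E.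
Proof.
move=> h; apply: (@le_lt_trans _ _ (mu `[x, y]%classic)).
  by apply: le_measure; rewrite ?inE//; exact: measurable_itv.
by rewrite lebesgue_measure_itv/=; case: ifP => _; rewrite ?ltry// -EFinD ltry.
Qed.
Let fI : (mu I < +oo)%E.
Proof.
rewrite fiberE; apply: (@itv_finite _ (- a) a) => x.
by rewrite /= !in_itv/= => /andP[h1 h2]; rewrite !ltW.
Qed.

(** For [k > 0] a step rising from 0 at [c] to 1 at [c + k^-1]; for [k < 0] it goes from 1 at
    [c + k^-1] down to 0 at [c]. *)
Definition bump (k c y : R) := stp (k * y + - (k * c)).

Lemma smooth_bump k c : smooth (bump k c).
Proof. exact: (smooth_comp smooth_stp (smooth_affine k (- (k * c)))). Qed.

Lemma derive_bump k c y : 'D_1 (bump k c) y = k * dstp (k * y + - (k * c)).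
Proof.
have h1 : is_derive y (1 : R) (fun y => k * y + - (k * c)) k by exact: is_derive_affine.
have h2 : is_derive (k * y + - (k * c)) (1 : R) stp (dstp (k * y + - (k * c))).
  exact: smooth_is_derive smooth_stp.
have h3 : is_derive y (1 : R) (stp \o (fun y => k * y + - (k * c))) (dstp (k * y + - (k * c)) *: k).
  exact: is_derive1_comp.
by have [_ ->] := h3; rewrite /GRing.scale/= mulrC.
Qed.

Lemma bump_out k c y : 0 < k -> ~ (c <= y <= c + k^-1) -> 'D_1 (bump k c) y = 0.
Proof.
move=> k0 h; rewrite derive_bump dstp_out ?mulr0// => /andP[h1 h2]; apply: h.
rewrite -mulrBr in h1 h2; rewrite pmulr_rge0// in h1.
rewrite mulrC -ler_pdivlMr// div1r in h2; lra.
Qed.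

(** The derivative of the bump has integral 1, lives on an interval of length [e0 / (n + 1)] to the
    right of [c], and is bounded by a constant over that length: an approximate identity at [c]. *)
Lemma bump_lim (u : R -> R) (c e0 : R) : l2 mu I u -> {in I, continuous u} -> 
  - a < c -> 0 < e0 -> c + e0 < a ->
  \int[mu]_(y in I) (u y * 'D_1 (bump (n.+1%:R / e0) c) y) @[n --> \oo] --> u c.
Proof.
move=> hu cu ac e00 ca.
have [B B0 hB] := @dstp_bounded R.
have Ic : I c by rewrite /fiber /=; apply/andP; split; lra.
pose k n : R := n.+1%:R / e0.
have k0 n : 0 < k n by rewrite divr_gt0.
have kV n : (k n)^-1 = e0 / n.+1%:R by rewrite /k invf_div.
have kV0 n : 0 < (k n)^-1 by rewrite invr_gt0.
have ke n : c + (k n)^-1 < a.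
  apply: le_lt_trans ca; rewrite lerD2l kV ler_pdivrMr// ler_peMr ?(ltW e00)//.
  by rewrite ler1n.
have sub n : `[c, c + (k n)^-1]%classic `<=` I.
  move=> y; rewrite /= in_itv/= /fiber /= => /andP[h1 h2]; have := ke n => h3; lra.
have cD n : continuous ('D_1 (bump (k n) c)) by apply/smooth_continuous/smooth_D/smooth_bump.
have mDb n : measurable_fun I ('D_1 (bump (k n) c)).
  by apply: measurable_funS (continuous_measurable_fun (cD n)).
have lD n : l2 mu I ('D_1 (bump (k n) c)).
  apply: (@l2_bounded _ _ _ mu I mI ('D_1 (bump (k n) c)) (k n * B) fI (mDb n)) => y _.
  by rewrite derive_bump normrM gtr0_norm// ler_pM2l.
have iD n : mu.-integrable I (EFin \o 'D_1 (bump (k n) c)).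
  apply: (@int_bounded _ _ _ mu I mI ('D_1 (bump (k n) c)) (k n * B) fI (mDb n)) => y _.
  by rewrite derive_bump normrM gtr0_norm// ler_pM2l.
have iuD n : mu.-integrable I (EFin \o (fun y => u y * 'D_1 (bump (k n) c) y)) by exact: l2_mul_int.
have e1 n : \int[mu]_(y in I) 'D_1 (bump (k n) c) y = 1.
  have -> : \int[mu]_(y in I) 'D_1 (bump (k n) c) y = \int[mu]_(y in `[c, c + (k n)^-1]%classic) 'D_1 (bump (k n) c) y.
    rewrite [LHS]Rintegral_mkcond [RHS]Rintegral_mkcond; apply: eq_Rintegral => y _.
    rewrite !patchE; have [h|h] := boolP (y \in `[c, c + (k n)^-1]%classic).
      by rewrite ifT//; apply: mem_set; apply: (sub n); exact: set_mem.
    rewrite bump_out ?if_same// => h'; move/negP: h; apply; apply: mem_set.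
    by rewrite /= in_itv.
  rewrite /Rintegral (@continuous_FTC2 _ _ (bump (k n) c)) ?ltrDl//.
  - rewrite -EFinB /= /bump -!mulrBr subrr mulr0 addrAC subrr add0r divff ?gt_eqF// stp1// stp0//.
    by rewrite subr0.
  - exact: continuous_subspaceT.
  - have cb := smooth_continuous (smooth_bump (k n) c); split.
    + by move=> y _; apply: smooth_derivable; exact: smooth_bump.
    + by apply: cvg_at_right_filter; exact: cb.
    + by apply: cvg_at_left_filter; exact: cb.
  - by move=> y _; rewrite derive1E.
apply/cvgrPdist_le => e e_0.
have B1 : 0 < B + 1 by rewrite ltr_wpDl.
have := cu c (mem_set Ic) => /cvgrPdist_le /(_ (e / (B + 1)) (divr_gt0 e_0 B1)).
move=> /nbhs_ballP[dl /= dl0 hdl].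
have [N hN] : exists N : nat, e0 / dl < N%:R.
  by exists (Num.Def.archi_bound (e0 / dl)); apply: archi_boundP; rewrite divr_ge0// ltW.
exists N => // n /= Nn.
have kd : (k n)^-1 < dl.
  rewrite kV ltr_pdivrMr// mulrC -ltr_pdivrMr//; apply: lt_trans hN _.
  by rewrite ltr_nat ltnS.
have -> : u c = \int[mu]_(y in I) (u c * 'D_1 (bump (k n) c) y) by rewrite RintegralZl// e1 mulr1.
have iz : mu.-integrable I (EFin \o (fun y => u c * 'D_1 (bump (k n) c) y - u y * 'D_1 (bump (k n) c) y)).
  by apply: int_sub => //; exact: int_scale.
rewrite -(RintegralB mI (int_scale mI (u c) (iD n)) (iuD n)).
set J := `[c, c + (k n)^-1]%classic.
have mJ : measurable_for mu J by exact: measurable_itv.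
have JI : J `<=` I by exact: sub.
have -> : \int[mu]_(y in I) (u c * 'D_1 (bump (k n) c) y - u y * 'D_1 (bump (k n) c) y) =
    \int[mu]_(y in J) (u c * 'D_1 (bump (k n) c) y - u y * 'D_1 (bump (k n) c) y).
  rewrite [LHS]Rintegral_mkcond [RHS]Rintegral_mkcond; apply: eq_Rintegral => y _.
  rewrite !patchE; have [h|h] := boolP (y \in J).
    by rewrite ifT//; apply: mem_set; apply: JI; exact: set_mem.
  rewrite bump_out ?mulr0 ?subrr ?if_same// => h'; move/negP: h; apply; apply: mem_set.
  by rewrite /J /= in_itv.
have lJ : mu J = ((k n)^-1)%:E.
  by rewrite /J lebesgue_measure_itv/= lte_fin ltrDl kV0 -EFinD addrAC subrr add0r.
have fJ : (mu J < +oo)%E by rewrite lJ ltry.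
apply: le_trans (@int_abs_le _ _ _ mu J mJ _ (e / (B + 1) * (k n * B)) _ fJ _ _) _.
- by apply: mulr_ge0; [apply: divr_ge0; exact: ltW|apply: mulr_ge0 => //; exact: ltW].
- exact: integrableS iz.
- apply: aeW => y; rewrite /J /= in_itv/= => /andP[y1 y2].
  rewrite -mulrBl normrM; apply: ler_pM => //.
    apply: hdl; rewrite /ball /= ltr_norml; apply/andP; split; lra.
  by rewrite derive_bump normrM gtr0_norm// ler_pM2l.
- have fl : fine (mu J) = (k n)^-1 by rewrite lJ.
  rewrite [fine _]fl; have kn0 := gt_eqF (k0 n).
  have -> : e / (B + 1) * (k n * B) * (k n)^-1 = e / (B + 1) * B by field; rewrite kn0 gt_eqF.
  rewrite mulrAC ler_pdivrMr// ler_pM2l//; lra.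
Qed.

(** The weak derivative is tested with smooth approximations of the indicator of []y1, y2]]: one
    side tends to a difference of values by [bump_lim], the other to the integral by dominated
    convergence. *)
Lemma weak_ftc (u h : R -> R) y1 y2 : l2 mu I u -> l2 mu I h -> {in I, continuous u} ->
  weak_deriv_1d I u h -> - a < y1 -> y1 <= y2 -> y2 < a ->
  u y2 - u y1 = \int[mu]_(y in `]y1, y2]%classic) h y.
Proof.
move=> hu hh cu hw ay1 y12 y2a.
pose e0 := (a - y2) / 2.
have e00 : 0 < e0 by rewrite divr_gt0// subr_gt0.
have c2 : y2 + e0 < a by rewrite /e0; lra.
have c1 : y1 + e0 < a by apply: le_lt_trans c2; rewrite lerD2r.
pose k n : R := n.+1%:R / e0.
have k0 n : 0 < k n by rewrite divr_gt0.
pose eta n y := bump (k n) y1 y - bump (k n) y2 y.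
have kV n : (k n)^-1 <= e0.
  by rewrite /k invf_div ler_pdivrMr// ler_peMr ?(ltW e00)// ler1n.
have eta_out n y : ~ (y1 <= y <= y2 + e0) -> eta n y = 0.
  move=> hy; rewrite /eta /bump -!mulrBr; have [yy|yy] := ltP y y1.
    rewrite !stp0 ?subrr// pmulr_rle0//; lra.
  have {}yy : y2 + e0 < y by rewrite ltNge; apply/negP => h'; apply: hy; rewrite yy.
  have st c : c <= y2 -> 1 <= k n * (y - c).
    move=> cy; rewrite mulrC -ler_pdivrMr// div1r; apply: le_trans (kV n) _; lra.
  by rewrite !stp1 ?subrr// st.
have teta n : test_function I (eta n).
  split; first by apply: smooth_sub; exact: smooth_bump.
  exists `[y1, y2 + e0]%classic; split; first exact: segment_compact.
    by move=> y; rewrite /= in_itv/= /fiber/= => /andP[h1 h2]; lra.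
  by move=> y hy; apply: eta_out; move: hy; rewrite /= in_itv.
have lb n c : l2 mu I ('D_1 (bump (k n) c)).
  have [B B0 hB] := @dstp_bounded R.
  have mb : measurable_fun I ('D_1 (bump (k n) c)).
    by apply: measurable_funS (continuous_measurable_fun _) => //; apply/smooth_continuous/smooth_D/smooth_bump.
  apply: (@l2_bounded _ _ _ mu I mI ('D_1 (bump (k n) c)) (k n * B) fI mb).
  by move=> y _; rewrite derive_bump normrM gtr0_norm// ler_pM2l.
have L1 : \int[mu]_(y in I) (u y * derive1 (eta n) y) @[n --> \oo] --> u y1 - u y2.
  have h1 := bump_lim hu cu ay1 e00 c1.
  have h2 := bump_lim hu cu (lt_le_trans ay1 y12) e00 c2.
  have h3 : \int[mu]_(y in I) (u y * 'D_1 (bump (k n) y1) y) - \int[mu]_(y in I) (u y * 'D_1 (bump (k n) y2) y)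
     @[n --> \oo] --> u y1 - u y2 by exact: cvgB.
  apply: cvg_trans h3; apply: near_eq_cvg; apply: nearW => n.
  rewrite -RintegralB//; [|exact: l2_mul_int|exact: l2_mul_int].
  apply: eq_Rintegral => y _; rewrite derive1E -mulrBr; congr (_ * _).
  by rewrite /eta (@deriveB _ _ _ (bump (k n) y1) (bump (k n) y2))//; apply: smooth_derivable; exact: smooth_bump.
have l1 : l2 mu I (fun=> 1) by apply: (@l2_bounded _ _ _ _ _ mI _ 1) => // y _; rewrite normr1.
have ih : mu.-integrable I (EFin \o h).
  by have := l2_mul_int mI hh l1; apply: eq_integrable => // y _ /=; rewrite mulr1.
have sub : `]y1, y2]%classic `<=` I.
  by move=> y; rewrite /= in_itv/= /fiber/= => /andP[z1 z2]; lra.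
have bumpP c y : bump (k n) c y @[n --> \oo] --> (if c < y then 1 else 0 : R).
  case: ltP => cy; last first.
    rewrite (_ : (fun n => _) = cst 0); first exact: cvg_cst.
    by apply/funext => n; rewrite /bump -mulrBr stp0// pmulr_rle0// subr_le0.
  have yc : 0 < y - c by rewrite subr_gt0.
  apply: cvg_near_cst; exists (Num.Def.archi_bound (e0 / (y - c))) => // n /= Nn.
  rewrite /bump -mulrBr stp1// /k mulrAC ler_pdivlMr// mul1r -ler_pdivrMr//.
  apply: le_trans (ltW (archi_boundP _)) _; first by rewrite divr_ge0// ltW.
  by rewrite ler_nat (leq_trans Nn).
have L2 : \int[mu]_(y in I) (h y * eta n y) @[n --> \oo] --> \int[mu]_(y in I) (h y * \1_(`]y1, y2]%classic) y).
  apply: (@int_dct _ _ _ mu I mI _ _ (fun y => 2 * `|h y|)).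
  - move=> n; apply: measurable_funM; first exact: l2_meas hh.
    by apply: measurable_funS (continuous_measurable_fun _) => //; apply/smooth_continuous/(test_smooth (teta n)).
  - apply: measurable_funM; first exact: l2_meas hh.
    by apply: measurable_indic; exact: measurable_itv.
  - move=> y Iy; apply: cvgM; first exact: cvg_cst.
    have -> : \1_(`]y1, y2]%classic) y = (if y1 < y then 1 else 0) - (if y2 < y then 1 else 0) :> R.
      rewrite indicE; have -> : (y \in `]y1, y2]%classic) = (y1 < y <= y2).
        by apply/idP/idP => [/set_mem|h1]; [|apply: mem_set]; rewrite /= in_itv.
      case: (ltP y1 y) => h1 /=; case: (ltP y2 y) => h2 /=; rewrite ?subr0 ?subrr//.
      by move: (lt_le_trans h2 (le_trans h1 y12)); rewrite ltxx.
    exact: cvgB.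
  - move=> n y _; rewrite normrM mulrC ler_wpM2r//.
    have b1 := stp_le1 (k n * y + - (k n * y1)); have b2 := stp_ge0 (k n * y + - (k n * y1)).
    have b3 := stp_le1 (k n * y + - (k n * y2)); have b4 := stp_ge0 (k n * y + - (k n * y2)).
    rewrite ler_norml /eta /bump; apply/andP; split; lra.
  - apply: int_scale => //; apply: (int_le_integrable mI _ _ (g := fun y => `|h y|)).
    + by apply: measurableT_comp => //; exact: l2_meas hh.
    + by move=> y _; rewrite normr_id.
    + have /integrableP[mh fh] := ih; apply/integrableP; split.
        by apply/measurable_EFinP; apply: measurableT_comp => //; exact: l2_meas hh.
      by under eq_integral do rewrite /= normr_id.
have e n : \int[mu]_(y in I) (u y * derive1 (eta n) y) = - \int[mu]_(y in I) (h y * eta n y).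
  exact: hw.
have L3 : \int[mu]_(y in I) (u y * derive1 (eta n) y) @[n --> \oo] -->
    - \int[mu]_(y in I) (h y * \1_(`]y1, y2]%classic) y).
  by under eq_fun do rewrite e; apply: cvgN.
have hL : u y1 - u y2 = - \int[mu]_(y in I) (h y * \1_(`]y1, y2]%classic) y).
  exact: (cvg_unique _ L1 L3).
have eI : \int[mu]_(y in I) (h y * \1_(`]y1, y2]%classic) y) = \int[mu]_(y in `]y1, y2]%classic) h y.
  rewrite [LHS]Rintegral_mkcond [RHS]Rintegral_mkcond; apply: eq_Rintegral => y _.
  rewrite !patchE indicE; have [z|z] := boolP (y \in `]y1, y2]%classic).
    by rewrite ifT ?mulr1//; apply: mem_set; apply: sub; exact: set_mem.
  by rewrite mulr0 if_same.
by rewrite -eI -[RHS]opprK -hL opprB.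
Qed.

Lemma weak_lip (u h : R -> R) b B : l2 mu I u -> l2 mu I h -> {in I, continuous u} ->
  weak_deriv_1d I u h -> b < a -> 0 <= B -> {ae mu, forall y, - b <= y <= b -> `|h y| <= B} ->
  forall s t, - b <= s <= b -> - b <= t <= b -> `|u t - u s| <= B * `|t - s|.
Proof.
move=> hu hh cu hw ba B0 hB.
have key s t : - b <= s -> s <= t -> t <= b -> `|u t - u s| <= B * (t - s).
  move=> bs st tb; rewrite (weak_ftc hu hh cu hw)//; [|lra|lra].
  have mJ : measurable_for mu `]s, t]%classic by exact: measurable_itv.
  have lJ : fine (mu `]s, t]%classic) = t - s.
    rewrite lebesgue_measure_itv/= lte_fin; case: ltP => // ts.
    have -> : t = s by apply/eqP; rewrite eq_le ts st.
    by rewrite subrr.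
  rewrite -lJ; apply: (int_abs_le mJ B0).
  - by apply: (@itv_finite _ s t) => y; rewrite /= !in_itv/= => /andP[/ltW -> ->].
  - have l1 : l2 mu I (fun=> 1) by apply: (@l2_bounded _ _ _ _ _ mI _ 1) => // y _; rewrite normr1.
    have ih : mu.-integrable I (EFin \o h).
      by have := l2_mul_int mI hh l1; apply: eq_integrable => // y _ /=; rewrite mulr1.
    apply: integrableS ih => //.
    by move=> y; rewrite /= in_itv/= /fiber/= => /andP[h1 h2]; lra.
  - apply: (ae_imp _ hB) => y hy; rewrite /= in_itv/= => /andP[h1 h2]; apply: hy.
    by rewrite (le_trans bs (ltW h1)) (le_trans h2 tb).
move=> s t /andP[s1 s2] /andP[t1 t2]; have [st|ts] := leP s t.
  by rewrite [`|t - s|]ger0_norm ?subr_ge0//; exact: key.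
by rewrite distrC [`|t - s|]distrC [`|s - t|]ger0_norm ?subr_ge0 ?(ltW ts)//; apply: key => //; exact: ltW.
Qed.

(** * The Jacobi equation on one fiber *)

Section Jacobi1D.
Variables (g u1 u2 k : R -> R).
Hypotheses (a0 : 0 < a) (hg : H2_1d I g u1 u2)
  (eg : ae_eq mu I (fun y => u2 y + k y * g y) (cst 0)) (g0 : g 0 = 1) (u10 : u1 0 = 0).

(** The equation [g'' = - k g] is integrated twice from 0, over lengths at most [a]. A compact
    interval [[- b, b]] is used because no bound of [g] up to the ends is known yet. *)
Lemma jac_bound b S kap : b < a -> 0 <= kap -> 0 <= S ->
  (forall y, - b <= y <= b -> `|g y| <= S) -> {ae mu, forall y, I y -> `|k y| <= kap} ->
  forall y, - b <= y <= b -> `|g y - 1| <= kap * S * a ^+ 2.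
Proof.
move=> ba k0 S0 hS hk y hy.
have [[lg l1 l2] wg w1 cg c1] := hg.
have b0 : 0 <= b by move: hy => /andP[h1 h2]; lra.
have kS0 : 0 <= kap * S by exact: mulr_ge0.
have hb z : - b <= z <= b -> `|z| <= a.
  by rewrite -ler_norml => h; apply: le_trans h (ltW ba).
have in0 : - b <= 0 <= b by rewrite oppr_le0 b0.
have bu1 s : - b <= s <= b -> `|u1 s| <= kap * S * a.
  move=> hs; have -> : u1 s = u1 s - u1 0 by rewrite u10 subr0.
  have L2 : {ae mu, forall y, - b <= y <= b -> `|u2 y| <= kap * S}.
    apply: (ae_imp2 _ hk eg) => z kz ez hz.
    have Iz : I z by move: hz => /andP[h1 h2]; rewrite /fiber /=; apply/andP; split; lra.
    have -> : u2 z = - (k z * g z) by have := ez Iz; rewrite /cst => /eqP; rewrite addr_eq0 => /eqP.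
    by rewrite normrN normrM ler_pM ?kz// hS.
  apply: le_trans (weak_lip l1 l2 c1 w1 ba kS0 L2 in0 hs) _.
  by rewrite subr0 ler_wpM2l// hb.
have kSa : 0 <= kap * S * a by rewrite mulr_ge0// ltW.
rewrite -g0; apply: le_trans (weak_lip lg l1 cg wg ba kSa _ in0 hy) _.
  by apply: aeW => z hz; exact: bu1.
by rewrite subr0 expr2 mulrA ler_wpM2l// hb.
Qed.

(** At a maximum point [z] of the absolute value over a compact interval, [jac_bound] gives
    [|g z| <= 1 + |g z| / 2]. *)
Lemma jac_sup kap : 0 <= kap -> kap * a ^+ 2 <= 2^-1 ->
  {ae mu, forall y, I y -> `|k y| <= kap} -> forall y, I y -> `|g y| <= 2.
Proof.
move=> k0 ka hk y; rewrite /fiber/= => /andP[y1 y2].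
pose b := (`|y| + a) / 2.
have ya : `|y| < a by rewrite ltr_norml y1.
have ba : b < a by rewrite /b; lra.
have yb : `|y| <= b by rewrite /b; lra.
have bb : - b <= b by have := normr_ge0 y; lra.
have [_ _ _ cg _] := hg.
have cg' : {within `[- b, b], continuous (fun y => `|g y|)}.
  apply: continuous_in_subspaceT => z; rewrite inE/= in_itv/= => /andP[z1 z2].
  apply: (@cvg_norm _ R _ _ _ g); apply: cg; apply: mem_set; rewrite /fiber /=; lra.
have [z zb hz] := EVT_max bb cg'.
have h1 := @jac_bound b `|g z| kap ba k0 (normr_ge0 _) (fun t ht => hz t ht) hk z zb.
have h2 : `|g z| <= 1 + `|g z - 1|.
  by have := ler_normD 1 (g z - 1); rewrite normr1 addrC subrK.
have h3 : kap * `|g z| * a ^+ 2 <= 2^-1 * `|g z| by rewrite mulrAC ler_wpM2r.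
have h4 : `|g z| <= 2 by lra.
by apply: le_trans h4; apply: hz; rewrite in_itv/= -ler_norml.
Qed.

(** The global bound [M] provides [|g| <= 2]; the deviation from 1 is then measured by the bound
    [kap] of the single slice, which becomes small far out in the strip. *)
Lemma jac_near1 kap M : 0 <= kap -> 0 <= M -> M * a ^+ 2 <= 2^-1 ->
  {ae mu, forall y, I y -> `|k y| <= M} -> {ae mu, forall y, I y -> `|k y| <= kap} ->
  forall y, I y -> `|g y - 1| <= 2 * kap * a ^+ 2.
Proof.
move=> k0 M0 Ma hM hk y; rewrite /fiber/= => /andP[y1 y2].
have ya : `|y| < a by rewrite ltr_norml y1.
have -> : 2 * kap = kap * 2 by rewrite mulrC.
apply: (@jac_bound `|y| 2 kap) => //.
  move=> z; rewrite -ler_norml => hz; apply: (jac_sup M0 Ma hM).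
  by rewrite /fiber /= -ltr_norml (le_lt_trans hz).
by rewrite -ler_norml.
Qed.

Lemma jac_weak (eta : R -> R) : measurable_fun I k -> test_function I eta ->
  \int[mu]_(y in I) (g y * 'D_1 ('D_1 eta) y) = - \int[mu]_(y in I) (k y * g y * eta y).
Proof.
move=> mk te; have [[lg l1 l2] wg w1 cg c1] := hg.
have td : test_function I ('D_1 eta) by apply: test_D => //; exact: line_hausdorff.
have h1 := wg _ td; have h2 := w1 _ te.
have dE (z : R -> R) : derive1 z = 'D_1 z by apply/funext => y; exact: derive1E.
rewrite dE in h1; rewrite dE in h2; rewrite h1 h2 opprK.
have [mg _] := lg; have [m2 _] := l2.
have meta : measurable_fun I eta.
  by apply: measurable_funS (continuous_measurable_fun _) => //; apply/smooth_continuous/(test_smooth te).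
have ir : mu.-integrable I (EFin \o (fun y => u2 y * eta y)).
  apply: l2_mul_int => //; have cte := smooth_continuous (test_smooth te).
  have [M M0 hM] : exists2 M, 0 <= M & forall y, `|eta y| <= M.
    have [_ [A [cA AI eA]]] := te; apply: (@continuous_supp_bounded _ _ (- a) a) => // y hy; apply: eA => Ay; apply: hy.
    by have := AI y Ay; rewrite /fiber/= => /andP[z1 z2]; rewrite !ltW.
  exact: (@l2_bounded _ _ _ mu I mI eta M).
rewrite -[RHS]mulN1r -RintegralZl//; last first.
  apply/integrableP; split.
    by apply/measurable_EFinP; apply: measurable_funM => //; exact: measurable_funM.
  have /integrableP[_] := ir; apply: le_lt_trans; rewrite le_eqVlt; apply/orP; left; apply/eqP.
  apply: ae_eq_integral => //.
  - apply: measurableT_comp => //; apply/measurable_EFinP; apply: measurable_funM => //; exact: measurable_funM.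
  - by apply: measurableT_comp => //; apply/measurable_EFinP; exact: measurable_funM.
  - apply: (ae_imp _ eg) => y ey Iy /=.
    have -> : u2 y = - (k y * g y) by have := ey Iy; rewrite /cst => /eqP; rewrite addr_eq0 => /eqP.
    by rewrite mulNr normrN.
rewrite /Rintegral; congr fine; apply: ae_eq_integral => //.
- by apply/measurable_EFinP; exact: measurable_funM.
- by apply/measurable_EFinP; do 3 (apply: measurable_funM => //).
- apply: (ae_imp _ eg) => y ey Iy /=.
  have -> : u2 y = - (k y * g y) by have := ey Iy; rewrite /cst => /eqP; rewrite addr_eq0 => /eqP.
  by rewrite mulN1r mulNr.
Qed.

End Jacobi1D.

End WeakDerivative.

(** * Bounds and measurability of f *)

Section Primitive.
Context {R : realType}.
Local Notation plane := (R * R)%type.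
Local Notation mu := (@lebesgue_measure R).

(* A kernel for the primitive vanishing at 0, so that Fubini gives joint measurability. *)
Definition pker (y s : R) : R := if 0 < s <= y then 1 else if y < s <= 0 then - 1 else 0.
Definition prim1 (h : R -> R) (y : R) : R := \int[mu]_s (pker y s * h s).
Definition prim (h : plane -> R) (x : plane) : R := prim1 (fun s => h (x.1, s)) x.2.

Lemma measurable_pker y : measurable_fun setT (pker y).
Proof.
apply: measurable_fun_ifT => //.
  by apply: measurable_and; [exact: measurable_fun_ltr|exact: measurable_fun_ler].
apply: measurable_fun_ifT => //.
by apply: measurable_and; [exact: measurable_fun_ltr|exact: measurable_fun_ler].
Qed.

Lemma measurable_prim (h : plane -> R) : measurable_fun setT h -> measurable_fun setT (prim h).
Proof.
move=> mh; apply: measurableT_comp => //.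
pose H (z : plane * R) : \bar R := (pker z.1.2 z.2 * h (z.1.1, z.2))%:E.
have m11 : measurable_fun setT (fun z : plane * R => z.1.1).
  by apply: measurableT_comp measurable_fst measurable_fst.
have m12 : measurable_fun setT (fun z : plane * R => z.1.2).
  by apply: measurableT_comp measurable_snd measurable_fst.
have m2 : measurable_fun setT (fun z : plane * R => z.2) by exact: measurable_snd.
have mH : measurable_fun setT H.
  apply/measurable_EFinP; apply: measurable_funM; last first.
    by apply: (measurableT_comp mh); exact/measurable_fun_pairP.
  apply: measurable_fun_ifT => //.
    by apply: measurable_and; [exact: measurable_fun_ltr|exact: measurable_fun_ler].
  apply: measurable_fun_ifT => //.
  by apply: measurable_and; [exact: measurable_fun_ltr|exact: measurable_fun_ler].
have -> : (fun x : plane => \int[mu]_s (pker x.2 s * h (x.1, s))%:E)%E =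
   (fun x => \int[mu]_s (H^\+ (x, s)) - \int[mu]_s (H^\- (x, s)))%E.
  apply/funext => x; rewrite integralE; congr (_ - _)%E; apply: eq_integral => s _.
    by rewrite funepos.unlock.
  by rewrite funeneg.unlock.
apply: emeasurable_funB.
  apply: measurable_fun_fubini_tonelli_F => //; exact: measurable_funepos.
apply: measurable_fun_fubini_tonelli_F => //; exact: measurable_funeneg.
Qed.

Lemma pker_abs (y s : R) : `|pker y s| = \1_([set` if 0 <= y then `]0, y] else `]y, 0]]) s.
Proof.
rewrite /pker indicE; case: ifP => [s1|s1].
  rewrite normr1; have y0 : 0 <= y by move: s1 => /andP[h1 h2]; lra.
  by rewrite y0 mem_set//= in_itv/=.
case: ifP => [s2|s2].
  have y0 : (0 <= y) = false by apply/negbTE; rewrite -ltNge; move: s2 => /andP[h1 h2]; lra.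
  by rewrite normrN normr1 y0 mem_set//= in_itv/=.
rewrite normr0; case: ifP => _; rewrite memNset//=; rewrite in_itv/= ?s1 ?s2//.
Qed.

Lemma pker_int y : mu.-integrable setT (EFin \o (fun s => `|pker y s|)) /\
  \int[mu]_s `|pker y s| = `|y|.
Proof.
set i := if 0 <= y then `]0, y] else `]y, 0].
have e : (fun s => `|pker y s|) = \1_[set` i] by apply/funext => s; exact: pker_abs.
have mi : measurable_for mu [set` i] by exact: measurable_itv.
have mui : mu [set` i] = `|y|%:E.
  rewrite /i; case: ifPn => y0; rewrite lebesgue_measure_itv/= lte_fin.
    rewrite ger0_norm//; case: ltP => [_|y0']; first by rewrite -EFinB subr0.
    by have -> : y = 0 by apply/eqP; rewrite eq_le y0 y0'.
  by rewrite -ltNge in y0; rewrite y0 -EFinB sub0r ltr0_norm.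
rewrite e; split.
  apply/integrableP; split; first by apply/measurable_EFinP; exact: measurable_indic.
  under eq_integral do rewrite /= ger0_norm ?indicE//.
  have := @integral_indic _ _ _ mu setT measurableT _ mi; rewrite setIT => h.
  by move: h; under eq_integral do rewrite indicE; move=> ->; rewrite [X in (X < _)%E]mui ltry.
rewrite /Rintegral (@integral_indic _ _ _ mu setT measurableT _ mi) setIT.
by have /(congr1 fine) := mui.
Qed.

Lemma prim1_int (h : R -> R) C y : measurable_fun setT h -> (forall s, `|h s| <= C) ->
  mu.-integrable setT (EFin \o (fun s => pker y s * h s)).
Proof.
move=> mh hC; have [i _] := pker_int y.
apply: (@int_le_integrable _ _ _ mu setT measurableT _ (fun s => C * `|pker y s|)).
- by apply: measurable_funM => //; exact: measurable_pker.
- by move=> s _; rewrite normrM mulrC ler_wpM2r.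
- exact: int_scale.
Qed.

Lemma prim1_diff (h h' : R -> R) C B y : measurable_fun setT h -> measurable_fun setT h' ->
  (forall s, `|h s| <= C) -> (forall s, `|h' s| <= C) -> (forall s, `|h s - h' s| <= B) ->
  `|prim1 h y - prim1 h' y| <= B * `|y|.
Proof.
move=> mh mh' hC hC' hB.
have i1 := prim1_int y mh hC; have i2 := prim1_int y mh' hC'; have [ip ep] := pker_int y.
rewrite /prim1 -RintegralB//; apply: le_trans (le_normr_Rintegral _ _) _ => //.
  exact: int_sub.
rewrite -ep -RintegralZl//; apply: le_Rintegral => //.
- have /integrableP[m12 _] := int_sub measurableT i1 i2.
  apply: (le_integrable _ _ _ (int_sub measurableT i1 i2)) => //.
    by apply/measurable_EFinP; apply: measurableT_comp => //; exact/measurable_EFinP.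
  by move=> s _ /=; rewrite normr_id.
- exact: int_scale.
- by move=> s _; rewrite -mulrBr normrM mulrC ler_wpM2r.
Qed.

Lemma prim1_itv (h : R -> R) y : (y < 0 -> mu.-integrable `]y, 0]%classic (EFin \o h)) -> prim1 h y =
  if 0 <= y then \int[mu]_(s in `]0, y]%classic) h s else - \int[mu]_(s in `]y, 0]%classic) h s.
Proof.
move=> ih; case: ifPn => y0.
  rewrite /prim1 [RHS]Rintegral_mkcond; apply: eq_Rintegral => s _.
  rewrite patchE /pker; have [z|z] := boolP (0 < s <= y).
    by rewrite mem_set ?mul1r//= in_itv.
  rewrite memNset ?ifF ?mul0r//; last by rewrite /= in_itv/=; exact/negP.
  by apply/negbTE; rewrite negb_and -!ltNge -leNgt; lra.
rewrite -ltNge in y0.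
have -> : prim1 h y = \int[mu]_(s in `]y, 0]%classic) (-1 * h s).
  rewrite /prim1 [RHS]Rintegral_mkcond; apply: eq_Rintegral => s _.
  rewrite patchE /pker ifF; last by apply/negbTE; rewrite negb_and -leNgt -ltNge; lra.
  have [z|z] := boolP (y < s <= 0); first by rewrite mem_set//= in_itv.
  by rewrite memNset ?mul0r//= in_itv/=; exact/negP.
by rewrite RintegralZl// ?mulN1r//; exact: ih.
Qed.

Lemma prim1_ae (h h' : R -> R) y : measurable_fun setT h -> measurable_fun setT h' ->
  {ae mu, forall s, h s = h' s} -> prim1 h y = prim1 h' y.
Proof.
move=> mh mh' hh; rewrite /prim1 /Rintegral; congr fine; apply: ae_eq_integral => //.
- by apply/measurable_EFinP; apply: measurable_funM => //; exact: measurable_pker.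
- by apply/measurable_EFinP; apply: measurable_funM => //; exact: measurable_pker.
- by apply: (ae_imp _ hh) => s e _ /=; rewrite e.
Qed.

Lemma prim1N (h : R -> R) C y : measurable_fun setT h -> (forall s, `|h s| <= C) ->
  prim1 (fun s => - h s) y = - prim1 h y.
Proof.
move=> mh hC; rewrite -mulN1r -RintegralZl//; last exact: (prim1_int y mh hC).
by apply: eq_Rintegral => s _; ring.
Qed.

Lemma prim1_bound (h : R -> R) C y : measurable_fun setT h -> (forall s, `|h s| <= C) ->
  `|prim1 h y| <= C * `|y|.
Proof.
move=> mh hC; have C0 : 0 <= C := le_trans (normr_ge0 _) (hC 0).
have := @prim1_diff h (fun=> 0) C C y mh (measurable_cst _) hC (fun=> ltac:(by rewrite normr0)).
have -> : prim1 (fun=> 0) y = 0.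
  by rewrite /prim1; under eq_Rintegral do rewrite mulr0; rewrite /Rintegral integral0.
by rewrite subr0; apply => s; rewrite subr0.
Qed.

Section Fiber.
Variable a : R.
Local Notation I := (fiber a).

Lemma prim1_restr (h h' : R -> R) y : I y -> 0 < a -> (forall s, I s -> h s = h' s) ->
  prim1 h y = prim1 h' y.
Proof.
move=> /andP[y1 y2] a0 hh; apply: eq_Rintegral => s _; rewrite /pker.
case: ifP => [/andP[s1 s2]|_]; first by rewrite hh// /fiber/=; apply/andP; split; lra.
case: ifP => [/andP[s1 s2]|_]; first by rewrite hh// /fiber/=; apply/andP; split; lra.
by rewrite !mul0r.
Qed.

Lemma weak_prim (u h : R -> R) y : 0 < a -> l2 mu I u -> l2 mu I h -> {in I, continuous u} ->
  weak_deriv_1d I u h -> I y -> u y = u 0 + prim1 h y.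
Proof.
move=> a0 hu hh cu hw /andP[y1 y2].
have ih : mu.-integrable I (EFin \o h).
  have mI : measurable_for mu I := fiber_measurable a.
  have fI : (mu I < +oo)%E.
    rewrite fiberE; apply: (@itv_finite _ _ (- a) a) => x.
    by rewrite /= !in_itv/= => /andP[h1 h2]; rewrite !ltW.
  have l1 : l2 mu I (fun=> 1) by apply: (@l2_bounded _ _ _ mu I mI _ 1 fI) => // z _; rewrite normr1.
  by have := l2_mul_int mI hh l1; apply: eq_integrable => // z _ /=; rewrite mulr1.
rewrite prim1_itv; last first.
  move=> y0; apply: integrableS ih; [exact: fiber_measurable|exact: measurable_itv|].
  by move=> s; rewrite /= in_itv/= /fiber/= => /andP[s1 s2]; apply/andP; split; lra.
case: ifPn => y0.
  by rewrite -(weak_ftc hu hh cu hw)//; [ring|lra].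
rewrite -ltNge in y0.
by rewrite -(weak_ftc hu hh cu hw)//; [ring|exact: ltW].
Qed.

End Fiber.

End Primitive.

Section Jacobi2D.
Context {R : realType}.
Variables (a : R) (K f : R * R -> R).
Local Notation plane := (R * R)%type.
Local Notation mu := (@lebesgue_measure R).
Local Notation I := (fiber a).
Local Notation D := (strip a).
Hypotheses (a0 : 0 < a) (mK : measurable_fun D K)
  (bK : forall x, D x -> (`|K x|%:E <= Linfty_strip a K)%E)
  (sK : (Linfty_strip a K * (a ^+ 2)%:E < (2^-1)%:E)%E)
  (hf : jacobi_solution a K f).

Definition supK := fine (Linfty_strip a K).

Lemma supK_prop : [/\ 0 <= supK, supK * a ^+ 2 < 2^-1 & forall x, D x -> `|K x| <= supK].
Proof.
have L0 : (0 <= Linfty_strip a K)%E by exact: Lnorm_ge0.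
have a2 : 0 < a ^+ 2 by rewrite exprn_gt0.
have fin : Linfty_strip a K \is a fin_num.
  rewrite ge0_fin_numE// ltNge; apply/negP; rewrite leye_eq => /eqP e.
  by move: sK; rewrite e gt0_mulye ?lte_fin.
split.
- exact: fine_ge0.
- by rewrite -lte_fin EFinM fineK.
- by move=> x Dx; rewrite -lee_fin fineK//; exact: bK.
Qed.

Lemma slice_sup_ae x1 : (slice_sup a K x1 < +oo)%E -> 0 <= fine (slice_sup a K x1) /\
  {ae mu, forall y, I y -> `|K (x1, y)| <= fine (slice_sup a K x1)}.
Proof.
move=> fin; have L0 : (0 <= slice_sup a K x1)%E by exact: Lnorm_ge0.
split; first exact: fine_ge0.
have fn : slice_sup a K x1 \is a fin_num by rewrite ge0_fin_numE.
have h := @ess_sup_ge _ _ _ mu (abse \o (EFin \o patch (cst (0 : R)%R) (fiber a) (fun x2 => K (x1, x2)))).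
apply: (ae_imp _ h) => y hy Iy.
rewrite -lee_fin fineK//; apply: le_trans (le_trans hy _); first by rewrite /= patchE mem_set.
rewrite /slice_sup unlock /= ifT//.
apply: (@lt_le_trans _ _ (mu `[0, 1]%classic)).
  by rewrite lebesgue_measure_itv/= lte_fin ltr01 oppr0 adde0 lte_fin.
by apply: le_measure; rewrite ?inE//; exact: measurable_itv.
Qed.

Let sup0 : 0 <= supK. Proof. by have [] := supK_prop. Qed.
Let sup2 : supK * a ^+ 2 <= 2^-1. Proof. by have [_ /ltW] := supK_prop. Qed.
Let supae x1 : {ae mu, forall y, I y -> `|K (x1, y)| <= supK}.
Proof. by apply: aeW => y Iy; have [_ _] := supK_prop; exact. Qed.

Lemma f_bounds x : D x -> 1 - 2 * supK * a ^+ 2 <= f x <= 2.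
Proof.
case: x => x1 y Dx; have [u1 [u2 [hg eg g0 u10]]] := hf x1.
have h1 := jac_sup a0 hg eg g0 u10 sup0 sup2 (supae x1) Dx.
have h2 := jac_near1 a0 hg eg g0 u10 sup0 sup0 sup2 (supae x1) (supae x1) Dx.
by move: h2; rewrite ler_norml (le_trans (ler_norm _) h1) andbT => /andP[h2 _]; lra.
Qed.

Lemma f_lower : 0 < 1 - 2 * supK * a ^+ 2.
Proof. by have [_ h _] := supK_prop; lra. Qed.

Lemma f_near1 x : (slice_sup a K x.1 < +oo)%E -> D x ->
  `|f x - 1| <= 2 * fine (slice_sup a K x.1) * a ^+ 2.
Proof.
case: x => x1 y /= fin Dx; have [u1 [u2 [hg eg g0 u10]]] := hf x1.
have [k0 kae] := slice_sup_ae fin.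
exact: (jac_near1 a0 hg eg g0 u10 k0 sup0 sup2 (supae x1) kae Dx).
Qed.

Lemma restr_slice (h : plane -> R) x1 s : (h \_ D) (x1, s) = ((fun s => h (x1, s)) \_ I) s.
Proof. by rewrite !patchE. Qed.

Lemma restr_meas (h : R -> R) : measurable_fun I h -> measurable_fun setT (h \_ I).
Proof. by move=> mh; apply/(measurable_restrictT _ _).1 => //; exact: fiber_measurable. Qed.
Lemma restrD_meas (h : plane -> R) : measurable_fun D h -> measurable_fun setT (h \_ D).
Proof. by move=> mh; apply/(measurable_restrictT _ _).1 => //; exact: strip_measurable. Qed.
Lemma slice_meas (h : plane -> R) x1 : measurable_fun setT h -> measurable_fun setT (fun s => h (x1, s)).
Proof. by move=> mh; apply: measurableT_comp mh _; exact: measurable_pair1. Qed.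
Lemma restr_le (h : R -> R) (C : R) : 0 <= C -> (forall s, I s -> `|h s| <= C) -> forall s, `|(h \_ I) s| <= C.
Proof. by move=> C0 hC s; rewrite patchE; case: ifPn => [/set_mem/hC//|_]; rewrite normr0. Qed.

(** Iteration for the integrated equation: [f] is 1 minus the double primitive of [K f]. Each
    iterate is jointly measurable, which is not clear for [f], given slice by slice; restriction to
    [D] keeps the integrands measurable on the whole plane. *)
Fixpoint picard (n : nat) : plane -> R :=
  if n is n'.+1 then fun x => 1 + prim ((fun z => - prim ((fun w => K w * picard n' w) \_ D) z) \_ D) x
  else cst 1.

(** The double primitive contracts by [supK * a ^+ 2 <= 2^-1], uniformly over the slices. The
    constants 3 and 5 are crude bounds of the initial error and of the iterates. *)
Lemma picardP n : measurable_fun setT (picard n) /\ forall x, D x -> `|f x - picard n x| <= 3 / 2 ^+ n.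
Proof.
elim: n => [|n [mG hG]] /=.
  split=> // x Dx; have /andP[h1 h2] := f_bounds Dx; have := f_lower.
  by rewrite expr0 divr1 ler_norml => h3; apply/andP; split; lra.
have mKG : measurable_fun setT ((fun w => K w * picard n w) \_ D).
  apply: restrD_meas; apply: measurable_funM => //; exact: measurable_funS mG.
have mp := measurable_prim mKG.
have mW : measurable_fun setT ((fun z => - prim ((fun w => K w * picard n w) \_ D) z) \_ D).
  by apply: restrD_meas; apply: measurable_funS (_ : measurable_fun setT _) => //; exact: measurableT_comp.
split; first by apply: measurable_funD => //; exact: measurable_prim.
move=> [x1 y] Dx; have Iy : I y := Dx.
have [u1 [u2 [[[lg l1 l2_] wg w1 cg c1] eg g0 u10]]] := hf x1.
have fE : f (x1, y) = 1 + prim1 u1 y by rewrite -g0; exact: (weak_prim a0 lg l1 cg wg Iy).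
have uE s : I s -> u1 s = prim1 u2 s.
  by move=> Is; have := weak_prim a0 l1 l2_ c1 w1 Is; rewrite u10 add0r.
pose e : R := 3 / 2 ^+ n.
have e0 : 0 <= e by rewrite divr_ge0// exprn_ge0.
have e3 : e <= 3 by rewrite ler_pdivrMr ?exprn_gt0// ler_peMr// exprn_ege1// ler1n.
have Kb s : I s -> `|K (x1, s)| <= supK by move=> Is; have [_ _] := supK_prop; exact.
have Gb s : I s -> `|picard n (x1, s)| <= 5.
  move=> Is; have h1 := hG (x1, s) Is; have /andP[h2 h3] := f_bounds (x := (x1, s)) Is; have h4 := f_lower.
  have h5 : `|f (x1, s)| <= 2 by rewrite ger0_norm; lra.
  have := ler_normB (f (x1, s)) (f (x1, s) - picard n (x1, s)).
  rewrite opprB addrC subrK => h6; apply: le_trans h6 _; rewrite -/e in h1; lra.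
have fb s : I s -> `|f (x1, s)| <= 5.
  by move=> Is; have /andP[h2 h3] := f_bounds (x := (x1, s)) Is; have h4 := f_lower; rewrite ger0_norm; lra.
have mKs : measurable_fun I (fun s => K (x1, s)).
  have h := slice_meas x1 (restrD_meas mK).
  apply: (eq_measurable_fun (fun s => (K \_ D) (x1, s))); last exact: measurable_funS h.
  by move=> s /set_mem Is; rewrite restr_slice patchE mem_set.
have mfs : measurable_fun I (fun s => f (x1, s)) by have [] := lg.
have mhf : measurable_fun setT ((fun s => K (x1, s) * f (x1, s)) \_ I).
  by apply: restr_meas; exact: measurable_funM.
have mhG : measurable_fun setT ((fun s => K (x1, s) * picard n (x1, s)) \_ I).
  apply: restr_meas; apply: measurable_funM => //; apply: measurable_funS (slice_meas x1 mG) => //.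
have bhf : forall s, `|((fun s => K (x1, s) * f (x1, s)) \_ I) s| <= supK * 5.
  apply: restr_le; first by rewrite mulr_ge0.
  by move=> s Is; rewrite normrM ler_pM ?Kb ?fb.
have bhG : forall s, `|((fun s => K (x1, s) * picard n (x1, s)) \_ I) s| <= supK * 5.
  apply: restr_le; first by rewrite mulr_ge0.
  by move=> s Is; rewrite normrM ler_pM ?Kb ?Gb.
have u1E s : I s -> u1 s = - prim1 ((fun s => K (x1, s) * f (x1, s)) \_ I) s.
  move=> Is; rewrite uE// -(prim1N s mhf bhf) (@prim1_restr _ a _ (u2 \_ I))//; last first.
    by move=> t It; rewrite patchE mem_set.
  apply: prim1_ae.
  - by apply: restr_meas; have [] := l2_.
  - exact: measurableT_comp.
  - apply: (ae_imp _ eg) => t et; rewrite !patchE; case: ifPn => [/set_mem It|_].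
      by have := et It; rewrite /cst => /eqP; rewrite addr_eq0 => /eqP.
    by rewrite oppr0.
have pE s : I s -> prim ((fun w => K w * picard n w) \_ D) (x1, s) =
    prim1 ((fun s => K (x1, s) * picard n (x1, s)) \_ I) s.
  by move=> Is; apply: (prim1_restr Is a0) => t It; rewrite restr_slice.
have sa s : I s -> `|s| <= a by move=> /andP[s1 s2]; rewrite ler_norml !ltW.
pose h1 := u1 \_ I.
pose h2 := (fun s => - prim ((fun w => K w * picard n w) \_ D) (x1, s)) \_ I.
have -> : f (x1, y) = 1 + prim1 h1 y.
  by rewrite fE; congr (_ + _); apply: (prim1_restr Iy a0) => s Is; rewrite /h1 patchE mem_set.
have -> : prim ((fun z => - prim ((fun w => K w * picard n w) \_ D) z) \_ D) (x1, y) = prim1 h2 y.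
  by apply: (prim1_restr Iy a0) => s Is; rewrite restr_slice.
rewrite opprD addrACA subrr add0r.
have C0 : 0 <= supK * 5 * a by rewrite !mulr_ge0// ltW.
have k0 : 0 <= supK * e * a by rewrite !mulr_ge0// ltW.
have B : forall s, `|h1 s - h2 s| <= supK * e * a.
  move=> s; rewrite /h1 /h2 !patchE; case: ifPn => [/set_mem Is|_]; last by rewrite subrr normr0.
  rewrite u1E// pE// -opprD normrN.
  apply: le_trans (@prim1_diff _ _ _ (supK * 5) (supK * e) s mhf mhG bhf bhG _) _.
    move=> t; rewrite !patchE; case: ifPn => [/set_mem It|_]; last by rewrite subrr normr0 mulr_ge0.
    by rewrite -mulrBr normrM ler_pM ?Kb//; exact: hG.
  by rewrite ler_wpM2l ?sa// mulr_ge0.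
have m1 : measurable_fun setT h1 by apply: restr_meas; have [] := l1.
have m2 : measurable_fun setT h2.
  apply: restr_meas; apply: measurable_funS (_ : measurable_fun setT _) => //.
  by apply: measurableT_comp => //; exact: slice_meas.
have b1 : forall s, `|h1 s| <= supK * 5 * a.
  apply: restr_le => // s Is; rewrite u1E// normrN; apply: le_trans (prim1_bound s mhf bhf) _.
  by rewrite ler_wpM2l ?sa// mulr_ge0.
have b2 : forall s, `|h2 s| <= supK * 5 * a.
  apply: restr_le => // s Is; rewrite pE// normrN; apply: le_trans (prim1_bound s mhG bhG) _.
  by rewrite ler_wpM2l ?sa// mulr_ge0.
apply: le_trans (prim1_diff y m1 m2 b1 b2 B) _.
apply: le_trans (ler_wpM2l k0 (sa y Iy)) _.
have -> : supK * e * a * a = supK * a ^+ 2 * e by ring.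
apply: le_trans (ler_wpM2r e0 sup2) _.
by rewrite /e exprS invfM mulrCA.
Qed.

Lemma f_measurable : measurable_fun D f.
Proof.
apply: (measurable_fun_cvg (h := picard)).
- by move=> n; apply: measurable_funS (proj1 (picardP n)).
- move=> x Dx; apply/cvgrPdist_le => e e0.
  have [N hN] : exists N : nat, 3 / e < N%:R.
    by exists (Num.Def.archi_bound (3 / e)); apply: archi_boundP; rewrite divr_ge0// ltW.
  exists N => // n /= Nn; apply: le_trans (proj2 (picardP n) x Dx) _.
  rewrite ler_pdivrMr ?exprn_gt0// -ler_pdivrMl// mulrC; apply: le_trans (ltW hN) _.
  apply: (@le_trans _ _ n%:R); first by rewrite ler_nat.
  by rewrite -natrX ler_nat ltnW// ltn_expl.
Qed.

End Jacobi2D.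

(** * The trial function *)

Lemma int_abs d (T : measurableType d) (R : realType) (mu : {measure set T -> \bar R}) (D : set T)
  (g : T -> R) : mu.-integrable D (EFin \o g) -> mu.-integrable D (EFin \o (fun x => `|g x|)).
Proof.
move=> /integrableP[mg fg]; apply/integrableP; split.
  by apply/measurable_EFinP; apply: measurableT_comp => //; exact/measurable_EFinP.
by under eq_integral do rewrite /= normr_id.
Qed.

Lemma trial_arith (R : realFieldType) (A B C E G Q : R) : 2 * B + 2 * G = - Q ->
  A + B - E * C = A - (2^-1 * Q + (E * C + G)).
Proof. lra. Qed.

Lemma limit_arith (R : realFieldType) (Q V : R) : 0 < Q -> - (Q / 4) <= 0 - 2^-1 * Q - V -> V < 0.
Proof. lra. Qed.

Section FubiniStrip.
Context {R : realType}.
Variable a : R.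
Local Notation plane := (R * R)%type.
Local Notation mu := (leb2 R).
Local Notation I := (fiber a).
Local Notation D := (strip a).

Lemma fubini_ge0 (G : plane -> R) : mu.-integrable D (EFin \o G) ->
  (forall x1, (leb R).-integrable I (EFin \o (fun y => G (x1, y)))) ->
  (forall x1, 0 <= \int[leb R]_(y in I) G (x1, y)) -> 0 <= \int[mu]_(x in D) G x.
Proof.
move=> iG iS hS; apply: fine_ge0.
have mD : measurable_for mu D := strip_measurable a.
have mI : measurable_for (leb R) I := fiber_measurable a.
rewrite integral_mkcond.
have iR : mu.-integrable setT ((EFin \o G) \_ D) by apply/(integrable_mkcond _ _).1.
rewrite -(integral12_prod_meas1 iR); apply: integral_ge0 => x1 _; rewrite /fubini_F.
have -> : (\int[leb R]_y ((EFin \o G) \_ D) (x1, y) = \int[leb R]_(y in I) (G (x1, y))%:E)%E.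
  by rewrite [RHS]integral_mkcond; apply: eq_integral => y _; rewrite !patchE.
by rewrite (EFin_int mI (iS x1)) lee_fin.
Qed.

Lemma fubini_eq (G H : plane -> R) : mu.-integrable D (EFin \o G) -> mu.-integrable D (EFin \o H) ->
  (forall x1, (leb R).-integrable I (EFin \o (fun y => G (x1, y)))) ->
  (forall x1, (leb R).-integrable I (EFin \o (fun y => H (x1, y)))) ->
  (forall x1, \int[leb R]_(y in I) G (x1, y) = \int[leb R]_(y in I) H (x1, y)) ->
  \int[mu]_(x in D) G x = \int[mu]_(x in D) H x.
Proof.
move=> iG iH sG sH e.
have mD : measurable_for mu D := strip_measurable a.
have mI : measurable_for (leb R) I := fiber_measurable a.
have key (A B : plane -> R) : mu.-integrable D (EFin \o A) -> mu.-integrable D (EFin \o B) ->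
  (forall x1, (leb R).-integrable I (EFin \o (fun y => A (x1, y)))) ->
  (forall x1, (leb R).-integrable I (EFin \o (fun y => B (x1, y)))) ->
  (forall x1, \int[leb R]_(y in I) A (x1, y) = \int[leb R]_(y in I) B (x1, y)) ->
  \int[mu]_(x in D) B x <= \int[mu]_(x in D) A x.
  move=> iA iB sA sB h; rewrite -subr_ge0 -RintegralB//; apply: fubini_ge0.
  - exact: int_sub.
  - by move=> x1; exact: (int_sub mI (sA x1) (sB x1)).
  - by move=> x1; rewrite RintegralB// h subrr.
by apply/eqP; rewrite eq_le !key.
Qed.

End FubiniStrip.

Section Trial.
Context {R : realType}.
Variables (a : R) (K f : R * R -> R).
Local Notation plane := (R * R)%type.
Local Notation mu := (leb2 R).
Local Notation I := (fiber a).
Local Notation D := (strip a).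
Hypotheses (a0 : 0 < a) (mK : measurable_fun D K)
  (bK : forall x, D x -> (`|K x|%:E <= Linfty_strip a K)%E)
  (sK : (Linfty_strip a K * (a ^+ 2)%:E < (2^-1)%:E)%E)
  (hf : jacobi_solution a K f).

Let c : R := 1 - 2 * supK a K * a ^+ 2.
Let c0 : 0 < c. Proof. exact: (f_lower a0 bK sK). Qed.
Let hfc x : D x -> c <= f x <= 2. Proof. exact: f_bounds. Qed.
Let mf : measurable_fun D f. Proof. exact: (f_measurable a0 mK bK sK hf). Qed.
Let mD := (fun d (T : measurableType d) (_ : {measure set T -> \bar R}) (A : set T)
  (h : measurable A) => h) _ _ mu D (strip_measurable a).
Let mI := (fun d (T : measurableType d) (_ : {measure set T -> \bar R}) (A : set T)
  (h : measurable A) => h) _ _ (leb R) I (fiber_measurable a).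

Lemma fiber_finite : (leb R I < +oo)%E.
Proof.
rewrite fiberE; apply: (@itv_finite _ _ (- a) a) => x.
by rewrite /= !in_itv/= => /andP[h1 h2]; rewrite !ltW.
Qed.

Lemma slice_measD (h : plane -> R) x1 : measurable_fun D h -> measurable_fun I (fun s => h (x1, s)).
Proof.
move=> mh; have h1 : measurable_fun setT (fun s => (h \_ D) (x1, s)).
  by apply: slice_meas; exact: restrD_meas.
apply: (eq_measurable_fun (fun s => (h \_ D) (x1, s))); last exact: measurable_funS h1.
by move=> s /set_mem Is; rewrite restr_slice patchE mem_set.
Qed.

Lemma test_bounded1 (t : R -> R) : test_function I t -> exists2 M, 0 <= M & forall y, `|t y| <= M.
Proof.
move=> [st [A [cA AI eA]]]; apply: (@continuous_supp_bounded _ _ (- a) a); first exact: smooth_continuous.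
by move=> y hy; apply: eA => Ay; apply: hy; have /andP[h1 h2] := AI y Ay; rewrite !ltW.
Qed.

Lemma slice_int (w : plane -> R) (M : R) t x1 : measurable_fun D w -> (forall x, D x -> `|w x| <= M) ->
  test_function I t -> (leb R).-integrable I (EFin \o (fun y => w (x1, y) * t y)).
Proof.
move=> mw hw tt; have [B B0 hB] := test_bounded1 tt.
apply: (@int_bounded _ _ _ (leb R) I mI _ (M * B)); first exact: fiber_finite.
- apply: measurable_funM; first exact: slice_measD.
  by apply: measurable_funS (continuous_measurable_fun _) => //; apply/smooth_continuous/(test_smooth tt).
- by move=> y Iy; rewrite normrM; apply: ler_pM => //; exact: (hw (x1, y)).
Qed.

Section Separated.
Variables (z t : R -> R).
Hypotheses (tz : test_function setT z) (tt : test_function I t).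

Lemma test_sep : test_function D (fun x => z x.1 * t x.2).
Proof.
split.
  apply: smooth_mul; apply: smooth_comp; [exact: test_smooth tz|exact: smooth_fst|exact: test_smooth tt|exact: smooth_snd].
have [_ [A [cA _ eA]]] := tz; have [_ [B [cB BI eB]]] := tt.
exists (A `*` B); split; first exact: compact_setX.
  by move=> x [_ /BI].
by move=> x /not_andP[/eA -> | /eB ->]; rewrite ?mul0r ?mulr0.
Qed.

Lemma derive_sep1 x : 'D_e1 (fun x : plane => z x.1 * t x.2) x = 'D_1 z x.1 * t x.2.
Proof.
case: x => s y; rewrite -derive_slice1 /= (@deriveM _ _ z (cst (t y)))//.
- by rewrite derive_cst scaler0 add0r /GRing.scale/= mulrC.
- by apply: smooth_derivable; exact: test_smooth tz.
Qed.
Lemma derive_sep2 x : 'D_e2 (fun x : plane => z x.1 * t x.2) x = z x.1 * 'D_1 t x.2.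
Proof.
case: x => s y; rewrite -derive_slice2 /= (@deriveZ _ _ _ t)//.
by apply: smooth_derivable; exact: test_smooth tt.
Qed.

Lemma sep_int (w : plane -> R) (M : R) : measurable_fun D w -> (forall x, D x -> `|w x| <= M) ->
  mu.-integrable D (EFin \o (fun x => w x * (z x.1 * t x.2))) /\
  forall x1, (leb R).-integrable I (EFin \o (fun y => w (x1, y) * (z x1 * t y))).
Proof.
move=> mw hw; have ts := test_sep.
have ms : measurable_fun D (fun x => z x.1 * t x.2).
  by apply: measurable_continuous; [exact: strip_measurable|exact/smooth_continuous/(test_smooth ts)].
split.
  have := int_scale mD M (int_abs (test_int (strip_measurable a) ts)).
  apply: (int_le_integrable mD); first exact: measurable_funM.
  by move=> x Dx; rewrite normrM ler_wpM2r// hw.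
move=> x1; have [b [B [_ _ hB _]]] := test_box ts.
apply: (@int_bounded _ _ _ (leb R) I mI _ (M * B)); first exact: fiber_finite.
- by have := slice_measD x1 (measurable_funM mw ms).
- by move=> y Iy; rewrite normrM; apply: ler_pM => //; [exact: (hw (x1, y))|exact: (hB (x1, y))].
Qed.

End Separated.

Definition SI (w : plane -> R) (z t : R -> R) := \int[mu]_(x in D) (w x * (z x.1 * t x.2)).

Lemma SI_lin (w : plane -> R) (M : R) z k t t' : measurable_fun D w -> (forall x, D x -> `|w x| <= M) ->
  test_function setT z -> test_function I t -> test_function I t' ->
  SI w z (fun y => k * t y + t' y) = k * SI w z t + SI w z t'.
Proof.
move=> mw hw tz tt tt'; have [i1 _] := sep_int tz tt mw hw; have [i2 _] := sep_int tz tt' mw hw.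
rewrite /SI -RintegralZl// -RintegralD//; last exact: int_scale.
by apply: eq_Rintegral => x _; ring.
Qed.

Let fM x : D x -> `|f x| <= 2.
Proof. by move=> Dx; have /andP[h1 h2] := hfc Dx; rewrite ger0_norm// (le_trans (ltW c0)). Qed.
Let KfM x : D x -> `|K x * f x| <= supK a K * 2.
Proof. by move=> Dx; rewrite normrM ler_pM ?fM//; have [_ _] := supK_prop a0 bK sK; exact. Qed.
Let mKf : measurable_fun D (fun x => K x * f x). Proof. exact: measurable_funM. Qed.

(** The weak Jacobi equation holds on each slice with [x1] frozen; [fubini_eq] integrates it in
    [x1]. *)
Lemma SI_jacobi z t : test_function setT z -> test_function I t ->
  SI f z ('D_1 ('D_1 t)) = - SI (fun x => K x * f x) z t.
Proof.
move=> tz tt.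
have td : test_function I ('D_1 ('D_1 t)).
  by apply: test_D; [exact: line_hausdorff|apply: test_D => //; exact: line_hausdorff].
have [i1 s1] := sep_int tz td mf fM; have [i2 s2] := sep_int tz tt mKf KfM.
rewrite -mulN1r /SI -RintegralZl//; apply: fubini_eq => //.
- exact: int_scale.
- by move=> x1; exact: (int_scale mI (-1) (s2 x1)).
move=> x1; have [u1 [u2 [hg eg _ _]]] := hf x1.
have := jac_weak hg eg (slice_measD x1 mK) tt.
move=> e.
have j1 := slice_int x1 mf fM td; have j2 := slice_int x1 mKf KfM tt.
transitivity (z x1 * \int[leb R]_(y in I) (f (x1, y) * 'D_1 ('D_1 t) y)).
  by rewrite -RintegralZl//; apply: eq_Rintegral => y _ /=; ring.
rewrite e mulrN -RintegralZl// -mulN1r -RintegralZl//.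
  by apply: eq_Rintegral => y _ /=; ring.
exact: int_scale.
Qed.

(** By (t^2)'' = 2 t'^2 + 2 t t'' and f'' = - K f, the transverse energy is minus half of the
    curvature integral minus the integral of f z^2 t t''. What remains is the longitudinal energy,
    the curvature term and the defect of [t] as an eigenfunction. *)
Lemma trial_identity z t (x : H10r a) : test_function setT z -> test_function I t ->
  l2val (Hpi x) = (fun x => z x.1 * t x.2) ->
  l2val (Hd1 x) = (fun x => 'D_1 z x.1 * t x.2) -> l2val (Hd2 x) = (fun x => z x.1 * 'D_1 t x.2) ->
  qf f x x - E1 a * ipw f (Hpi x) (Hpi x) =
  \int[mu]_(x in D) ((f x)^-1 * ('D_1 z x.1 * t x.2) ^+ 2) -
  (2^-1 * SI (fun x => K x * f x) (fun s => z s * z s) (fun y => t y * t y) +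
  SI f (fun s => z s * z s) (fun y => t y * ('D_1 ('D_1 t) y + E1 a * t y))).
Proof.
move=> tz tt e0 e1 e2; rewrite /qf /ipw /wip e0 e1 e2.
have hl := @line_hausdorff R.
have td : test_function I ('D_1 t) by exact: test_D.
have tdd : test_function I ('D_1 ('D_1 t)) by exact: test_D.
have tzz : test_function setT (fun s => z s * z s) by apply: test_mul => //; exact: test_smooth tz.
have ttt : test_function I (fun y => t y * t y) by apply: test_mul => //; exact: test_smooth tt.
have tdt : test_function I (fun y => 'D_1 t y * 'D_1 t y) by apply: test_mul => //; exact: test_smooth td.
have ttd : test_function I (fun y => t y * 'D_1 ('D_1 t) y) by apply: test_mul => //; exact: test_smooth tdd.
have dt2 : 'D_1 ('D_1 (fun y => t y * t y)) = fun y => 2 * ('D_1 t y * 'D_1 t y) + 2 * (t y * 'D_1 ('D_1 t) y).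
  have d1 : 'D_1 (fun y => t y * t y) = fun y => 2 * (t y * 'D_1 t y).
    apply/funext => y; have st : derivable t y 1 := smooth_derivable (test_smooth tt).
    by rewrite (@deriveM _ _ t t)// /GRing.scale/=; ring.
  rewrite d1; apply/funext => y.
  have st : derivable t y 1 := smooth_derivable (test_smooth tt).
  have sd : derivable ('D_1 t) y 1 := smooth_derivable (test_smooth td).
  rewrite (@deriveZ _ _ _ (fun y => t y * 'D_1 t y)); last first.
    by apply: smooth_derivable; apply: smooth_mul; [exact: test_smooth tt|exact: test_smooth td].
  by rewrite (@deriveM _ _ t ('D_1 t) y 1 st sd) /GRing.scale/=; ring.
have hj := SI_jacobi tzz ttt.
have tsc k p : test_function I p -> test_function I (fun y => k * p y).
  move=> tp; have := test_mul tp (@smooth_cst _ _ k); congr test_function; apply/funext => y; exact: mulrC.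
have t2 := tsc 2 _ ttd.
rewrite dt2 (SI_lin 2 mf fM tzz tdt t2) in hj.
have zero : SI f (fun s => z s * z s) (fun y => 2 * (t y * 'D_1 ('D_1 t) y)) =
    2 * SI f (fun s => z s * z s) (fun y => t y * 'D_1 ('D_1 t) y).
  have [i1 _] := sep_int tzz ttd mf fM.
  by rewrite /SI -RintegralZl//; apply: eq_Rintegral => y _; ring.
rewrite zero in hj.
have hE : SI f (fun s => z s * z s) (fun y => t y * ('D_1 ('D_1 t) y + E1 a * t y)) =
    E1 a * SI f (fun s => z s * z s) (fun y => t y * t y) + SI f (fun s => z s * z s) (fun y => t y * 'D_1 ('D_1 t) y).
  rewrite -(SI_lin _ mf fM tzz ttt ttd); apply: eq_Rintegral => y _.
  by congr (_ * (_ * _)); ring.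
rewrite hE.
have -> : \int[mu]_(x in D) ('D_1 z x.1 * t x.2 * ('D_1 z x.1 * t x.2) * (f x)^-1) =
    \int[mu]_(x in D) ((f x)^-1 * ('D_1 z x.1 * t x.2) ^+ 2) by apply: eq_Rintegral => y _; ring.
have -> : \int[mu]_(x in D) (z x.1 * 'D_1 t x.2 * (z x.1 * 'D_1 t x.2) * f x) =
    SI f (fun s => z s * z s) (fun y => 'D_1 t y * 'D_1 t y) by apply: eq_Rintegral => y _; ring.
have -> : \int[mu]_(x in D) (z x.1 * t x.2 * (z x.1 * t x.2) * f x) =
    SI f (fun s => z s * z s) (fun y => t y * t y) by apply: eq_Rintegral => y _; ring.
move: hj; set B := SI f _ (fun y => 'D_1 t y * 'D_1 t y); set G := SI f _ (fun y => t y * 'D_1 ('D_1 t) y).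
set C := SI f _ _; set Q := SI _ _ _; set A := \int[mu]_(x in D) _.
exact: trial_arith.
Qed.

Lemma z_l2 z : test_function setT z -> l2 mu D (fun x => z x.1).
Proof.
move=> [sz [A [cA _ eA]]].
have [b0 [_ hb0]] := compact_bounded cA.
pose b := `|b0| + 1 + a.
have hb s : ~ (`|s| <= b) -> z s = 0.
  move=> hs; apply: eA => As; apply: hs; have := hb0 (`|b0| + 1) _ s As.
  rewrite /= => h; apply: le_trans (h _) _; last by rewrite /b lerDl ltW.
  by apply: le_lt_trans (ler_norm _) _; rewrite ltrDl.
have [M M0 hM] : exists2 M, 0 <= M & forall y, `|z y| <= M.
  apply: (@continuous_supp_bounded _ _ (- b) b); first exact: smooth_continuous.
  by move=> y hy; apply: hb; rewrite ler_norml.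
apply: (@l2_box R D (fun x => z x.1) b M) => //.
- apply: measurable_continuous; first exact: strip_measurable.
  by move=> x; apply: continuous_comp; [exact: fst_continuous|exact: smooth_continuous].
- move=> x Dx hx; apply: hb => h; apply: hx; split => //.
  have /andP[h1 h2] := Dx; rewrite ler_norml /b; have := normr_ge0 b0 => h3; apply/andP; split; lra.
Qed.

(** * The transverse eigenfunction *)

Let k : R := Num.sqrt (E1 a).
Let A : R := (Num.sqrt a)^-1.
Definition J1d (y : R) := A * k * cos (k * (y + a)).

Lemma kE : k = pi / (2 * a).
Proof. by rewrite /k /E1 sqrtr_sqr ger0_norm// divr_ge0 ?pi_ge0// mulr_ge0// ltW. Qed.
Let k0 : 0 < k. Proof. by rewrite kE divr_gt0 ?pi_gt0// mulr_gt0. Qed.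
Let A0 : 0 < A. Proof. by rewrite invr_gt0 sqrtr_gt0. Qed.
Let kk : k ^+ 2 = E1 a. Proof. by rewrite kE. Qed.

Lemma smooth_J1 : smooth (J1 a).
Proof.
have := smooth_trig A 0 k (k * a); congr smooth; apply/funext => y.
by rewrite /J1 -/k -/A mul0r addr0 mulrDr.
Qed.

Lemma derive_J1 : 'D_1 (J1 a) = J1d.
Proof.
apply/funext => y.
have h1 : is_derive y (1 : R) (fun y => k * y + k * a) k by exact: is_derive_affine.
have h2 : is_derive (k * y + k * a) (1 : R) sin (cos (k * y + k * a)) by exact: is_derive_sin.
have h3 : is_derive y (1 : R) (sin \o (fun y => k * y + k * a)) (cos (k * y + k * a) *: k) by exact: is_derive1_comp.
have -> : J1 a = A \*: (sin \o (fun y => k * y + k * a)).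
  by apply/funext => z; rewrite /J1 /= -/k -/A mulrDr.
rewrite deriveZ//; have [_ ->] := h3.
by rewrite /J1d /GRing.scale/= mulrDr; ring.
Qed.

Lemma derive_J1d : 'D_1 J1d = fun y => - E1 a * J1 a y.
Proof.
apply/funext => y.
have h1 : is_derive y (1 : R) (fun y => k * y + k * a) k by exact: is_derive_affine.
have h2 : is_derive (k * y + k * a) (1 : R) cos (- sin (k * y + k * a)) by exact: is_derive_cos.
have h3 : is_derive y (1 : R) (cos \o (fun y => k * y + k * a)) (- sin (k * y + k * a) *: k) by exact: is_derive1_comp.
have -> : J1d = (A * k) \*: (cos \o (fun y => k * y + k * a)).
  by apply/funext => z; rewrite /J1d /= mulrDr.
rewrite deriveZ//; have [_ ->] := h3.
by rewrite -kk /J1 -/k -/A /GRing.scale/= mulrDr; ring.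
Qed.

Lemma J1_le y : `|J1 a y| <= A.
Proof. by rewrite /J1 -/k -/A normrM gtr0_norm// ger_pMr// ler_norml sin_geN1 sin_le1. Qed.
Lemma J1d_le y : `|J1d y| <= A * k.
Proof. by rewrite /J1d normrM gtr0_norm ?mulr_gt0// ger_pMr ?mulr_gt0// ler_norml cos_geN1 cos_le1. Qed.

Lemma sin_le_id (t : R) : 0 <= t -> sin t <= t.
Proof.
move=> t0; have := @mvt_le R sin cos t 1 t0 (fun s _ => is_derive_sin s) (fun s _ => cos_le1 s).
by rewrite sin0 subr0 mul1r.
Qed.

(** [J1] vanishes linearly at both ends: [sin s <= s] is used from the nearer end, and
    [a ^+ 2 - y ^+ 2] is a polynomial substitute for the distance to the ends. *)
Lemma J1_dist y : I y -> `|J1 a y| <= A * (k / a) * (a ^+ 2 - y ^+ 2).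
Proof.
move=> /andP[y1 y2].
have ya : 0 < y + a by lra.
have ay : 0 < a - y by lra.
have kpi : k * (y + a) + k * (a - y) = pi by rewrite kE; field; rewrite gt_eqF.
have s0 : 0 <= sin (k * (y + a)).
  apply: sin_ge0_pi; rewrite ?mulr_ge0 ?(ltW k0) ?(ltW ya)//=.
  by rewrite -kpi lerDl mulr_ge0// ltW.
have h1 : sin (k * (y + a)) <= k * (y + a) by apply: sin_le_id; rewrite mulr_ge0// ltW.
have h2 : sin (k * (y + a)) <= k * (a - y).
  have -> : k * (y + a) = pi - k * (a - y) by rewrite -kpi; ring.
  by rewrite sinB sinpi cospi mul0r sub0r mulN1r opprK; apply: sin_le_id; rewrite mulr_ge0// ltW.
rewrite /J1 -/k -/A normrM gtr0_norm// (ger0_norm s0) -mulrA ler_wpM2l ?(ltW A0)//.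
have -> : k / a * (a ^+ 2 - y ^+ 2) = k * (y + a) * (a - y) / a by field; rewrite gt_eqF.
rewrite ler_pdivlMr//; have [y0|y0] := leP 0 y.
- apply: le_trans (ler_wpM2r (ltW a0) h2) _.
  by rewrite -!mulrA ler_wpM2l ?(ltW k0)// mulrC ler_wpM2r ?(ltW ay)//; lra.
- apply: le_trans (ler_wpM2r (ltW a0) h1) _.
  by rewrite ler_wpM2l ?mulr_ge0 ?(ltW k0) ?(ltW ya)//; lra.
Qed.

(** * Cutting off the eigenfunction near the walls *)

Section Cutoff.
Variable M : R.
Hypothesis M1 : 1 <= M.

(** A polynomial in [y], so that [cut] is smooth: [cut] is 0 where [a ^+ 2 - y ^+ 2 <= M^-1] and 1
    where it is at least [2 * M^-1]. *)
Definition cutp (y : R) := M * (a ^+ 2 - y ^+ 2) - 1.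
Definition cut (y : R) := stp (cutp y).
Let M0 : 0 < M. Proof. exact: lt_le_trans ltr01 M1. Qed.

Lemma smooth_cutp : smooth cutp.
Proof.
apply: smooth_sub; last exact: smooth_cst.
apply: smooth_scale; apply: smooth_sub; first exact: smooth_cst.
by apply: smooth_exp; exact: smooth_id.
Qed.

Lemma derive_cutp : 'D_1 cutp = fun y => - (2 * M) * y.
Proof.
apply/funext => y.
have -> : cutp = (fun y => - M * (y * y) + (M * a ^+ 2 - 1)).
  by apply/funext => z; rewrite /cutp; ring.
have si : smooth (fun y : R => y) by exact: smooth_id.
rewrite (@deriveD _ _ _ (fun y : R => - M * (y * y)) (fun=> M * a ^+ 2 - 1)); last 2 first.
- by apply: smooth_derivable; apply: smooth_scale; exact: smooth_mul.
- exact: derivable_cst.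
rewrite derive_cst addr0 (@deriveZ _ _ _ (fun y : R => y * y)); last by apply: smooth_derivable; exact: smooth_mul.
rewrite (@deriveM _ _ (fun y : R => y) (fun y : R => y)); [|exact: smooth_derivable|exact: smooth_derivable].
by rewrite derive_id /GRing.scale/=; ring.
Qed.

Lemma test_cut : test_function I cut.
Proof.
split; first exact: smooth_comp smooth_stp smooth_cutp.
pose r := Num.sqrt (a ^+ 2 - M^-1).
have ra : r < a.
  rewrite -[X in _ < X](ger0_norm (ltW a0)) -sqrtr_sqr ltr_sqrt ?exprn_gt0//.
  by rewrite ltrBlDr ltrDl invr_gt0 M0.
exists `[- r, r]%classic; split; first exact: segment_compact.
  by move=> y; rewrite /= in_itv/= /fiber/= => /andP[h1 h2]; apply/andP; split; lra.
move=> y; rewrite /= in_itv/= => /negP; rewrite -ler_norml -ltNge => ry.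
rewrite /cut /cutp stp0// subr_le0 mulrC -ler_pdivlMr// div1r.
have h : a ^+ 2 - M^-1 <= y ^+ 2.
  rewrite -[y ^+ 2]real_normK ?num_real//.
  apply: le_trans (_ : r ^+ 2 <= _); last by rewrite ler_pXn2r ?nnegrE ?sqrtr_ge0// ltW.
  have [h0|h0] := leP 0 (a ^+ 2 - M^-1); first by rewrite sqr_sqrtr.
  by apply: le_trans (ltW h0) _; exact: sqr_ge0.
lra.
Qed.

Let d2 : R -> R := 'D_1 dstp.

Lemma derive_cut : 'D_1 cut = fun y => dstp (cutp y) * (- (2 * M) * y).
Proof.
apply/funext => y; rewrite /cut derive_comp1.
- by rewrite [X in _ * X](congr1 (fun g : R -> R => g y) derive_cutp).
- exact: smooth_diff smooth_cutp.
- exact: smooth_derivable smooth_stp.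
Qed.

Lemma derive2_cut : 'D_1 ('D_1 cut) = fun y =>
  d2 (cutp y) * (4 * M ^+ 2 * y ^+ 2) - 2 * M * dstp (cutp y).
Proof.
rewrite derive_cut; apply/funext => y.
have e1 : (fun y : R => dstp (cutp y) * (- (2 * M) * y)) = (fun y => - (2 * M) * (dstp (cutp y) * y)).
  by apply/funext => z; ring.
have sd : smooth (fun y => dstp (cutp y)) by apply: smooth_comp smooth_cutp; exact/smooth_D/smooth_stp.
rewrite e1 (@deriveZ _ _ _ (fun y => dstp (cutp y) * y)); last first.
  by apply: smooth_derivable; apply: smooth_mul => //; exact: smooth_id.
rewrite (@deriveM _ _ (fun y => dstp (cutp y)) (fun y => y)); last 2 first.
- exact: smooth_derivable.
- exact: smooth_derivable (@smooth_id R).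
rewrite derive_id derive_comp1; last 2 first.
- exact: smooth_diff smooth_cutp.
- by apply: smooth_derivable; exact/smooth_D/smooth_stp.
have dd : 'D_1 dstp (cutp y) = d2 (cutp y) by [].
rewrite ['D_1 cutp y](congr1 (fun g : R -> R => g y) derive_cutp) ['D_1 dstp _]dd.
by rewrite /GRing.scale/=; ring.
Qed.

Lemma cut_far y : ~ (M^-1 <= a ^+ 2 - y ^+ 2 <= 2 * M^-1) -> dstp (cutp y) = 0 /\ d2 (cutp y) = 0.
Proof.
move=> h; have h' : ~ (0 <= cutp y <= 1).
  move=> /andP[h1 h2]; apply: h; rewrite /cutp subr_ge0 in h1.
  have {}h2 : M * (a ^+ 2 - y ^+ 2) <= 2 by move: h2; rewrite /cutp; lra.
  by apply/andP; split; [rewrite -div1r ler_pdivrMr// mulrC|rewrite ler_pdivlMr// mulrC].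
split; first exact: dstp_out.
apply: (@smooth_supp_derive R _ dstp [set t | 0 <= t <= 1]) => //.
  rewrite (_ : [set t : R | 0 <= t <= 1] = `[0, 1]%classic); first exact: interval_closed.
  by apply/seteqP; split => t; rewrite /= in_itv.
by move=> t; exact: dstp_out.
Qed.

Definition theta (y : R) := J1 a y * cut y.
(** The defect of [theta] as an eigenfunction, times [theta]; only terms with a derivative of the
    cutoff survive in it. *)
Definition remainder (y : R) := theta y * ('D_1 ('D_1 theta) y + E1 a * theta y).

Lemma test_theta : test_function I theta.
Proof.
have := test_mul test_cut smooth_J1; congr test_function; apply/funext => y; exact: mulrC.
Qed.

Lemma remainderE y : remainder y = J1 a y * cut y *
  (2 * J1d y * (dstp (cutp y) * (- (2 * M) * y)) +
   J1 a y * (d2 (cutp y) * (4 * M ^+ 2 * y ^+ 2) - 2 * M * dstp (cutp y))).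
Proof.
have sJ := smooth_J1; have sc := test_smooth test_cut.
have sJd : smooth J1d by rewrite -derive_J1; exact: smooth_D.
have scd : smooth ('D_1 cut) by exact: smooth_D.
have d1 : 'D_1 theta = fun y => J1 a y * 'D_1 cut y + J1d y * cut y.
  apply/funext => t; rewrite (@deriveM _ _ (J1 a) cut); [|exact: smooth_derivable|exact: smooth_derivable].
  by rewrite [X in _ + _ *: X](congr1 (fun g : R -> R => g t) derive_J1) /GRing.scale/=; ring.
rewrite /remainder d1 (@deriveD _ _ _ (fun y => J1 a y * 'D_1 cut y) (fun y => J1d y * cut y)); last 2 first.
- by apply: smooth_derivable; exact: smooth_mul.
- by apply: smooth_derivable; exact: smooth_mul.
rewrite (@deriveM _ _ (J1 a) ('D_1 cut)); [|exact: smooth_derivable|exact: smooth_derivable].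
rewrite (@deriveM _ _ J1d cut); [|exact: smooth_derivable|exact: smooth_derivable].
rewrite ['D_1 (J1 a) y](congr1 (fun g : R -> R => g y) derive_J1).
rewrite ['D_1 J1d y](congr1 (fun g : R -> R => g y) derive_J1d).
rewrite ['D_1 ('D_1 cut) y](congr1 (fun g : R -> R => g y) derive2_cut).
rewrite ['D_1 cut y](congr1 (fun g : R -> R => g y) derive_cut) /theta /GRing.scale/=.
ring.
Qed.

(** In the layer where the cutoff varies [J1] is of order [1 / M], while the first two derivatives
    of the cutoff are of order [M] and [M ^+ 2]. The orders balance, so the bound does not depend on
    [M]. *)
Lemma remainder_bound B B2 y : (forall t, `|dstp t| <= B) -> (forall t, `|d2 t| <= B2) -> I y ->
  `|remainder y| <= (A * (k / a)) * 2 * (2 * (A * k) * (B * (2 * a)) +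
     A * (k / a) * 2 * (B2 * (4 * a ^+ 2) + 2 * B)).
Proof.
move=> hB hB2 Iy; have B0 : 0 <= B := le_trans (normr_ge0 _) (hB 0).
have B20 : 0 <= B2 := le_trans (normr_ge0 _) (hB2 0).
set E := A * (k / a); have E0 : 0 <= E by rewrite mulr_ge0 ?divr_ge0 ?(ltW A0) ?(ltW k0) ?(ltW a0).
have Ak : 0 <= A * k by rewrite mulr_ge0 ?(ltW A0) ?(ltW k0).
have rhs0 : 0 <= E * 2 * (2 * (A * k) * (B * (2 * a)) + E * 2 * (B2 * (4 * a ^+ 2) + 2 * B)).
  have a0' := ltW a0; have := sqr_ge0 a => a2.
  by repeat first [exact: a2 | exact: ler0n | assumption | apply: mulr_ge0 | apply: addr_ge0].
rewrite remainderE; have [h|h] := boolP (M^-1 <= a ^+ 2 - y ^+ 2 <= 2 * M^-1); last first.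
  by have [-> ->] := cut_far (negP h); rewrite !mul0r !mulr0 subrr mulr0 addr0 mulr0 normr0.
have /andP[h1 h2] := h.
have Jy : `|J1 a y| <= E * (2 * M^-1).
  by apply: le_trans (J1_dist Iy) _; rewrite -/E ler_wpM2l.
have ya : `|y| <= a by move: Iy => /andP[y1 y2]; rewrite ler_norml !ltW.
have cy : `|cut y| <= 1 by rewrite ger0_norm ?stp_ge0 ?stp_le1.
have Mi : M^-1 <= 1 by rewrite invf_le1.
have Mi0 : 0 < M^-1 by rewrite invr_gt0.
have EM0 : 0 <= E * (2 * M^-1) by apply: mulr_ge0 => //; apply: mulr_ge0 => //; exact: ltW.
have y2 : `|y ^+ 2| <= a ^+ 2 by rewrite normrX ler_pXn2r ?nnegrE ?(ltW a0).
have t1 : `|2 * J1d y * (dstp (cutp y) * (- (2 * M) * y))| <= 2 * (A * k) * (B * (2 * M * a)).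
  rewrite normrM; apply: ler_pM => //; first by rewrite normrM ger0_norm// ler_wpM2l// J1d_le.
  rewrite normrM; apply: ler_pM => //.
  by rewrite normrM; apply: ler_pM => //; rewrite normrN ger0_norm// mulr_ge0// ltW.
have t2 : `|J1 a y * (d2 (cutp y) * (4 * M ^+ 2 * y ^+ 2) - 2 * M * dstp (cutp y))| <=
    E * (2 * M^-1) * (B2 * (4 * M ^+ 2 * a ^+ 2) + 2 * M * B).
  rewrite normrM; apply: ler_pM => //; apply: le_trans (ler_normB _ _) _; apply: lerD.
    rewrite normrM; apply: ler_pM => //; rewrite normrM; apply: ler_pM => //.
    by rewrite ger0_norm// mulr_ge0// exprn_ge0// ltW.
  by rewrite normrM ger0_norm ?mulr_ge0 ?(ltW M0)// ler_wpM2l ?mulr_ge0 ?(ltW M0).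
rewrite normrM.
apply: le_trans (ler_pM (normr_ge0 _) (normr_ge0 _) (_ : _ <= E * (2 * M^-1))
  (le_trans (ler_normD _ _) (lerD t1 t2))) _.
  by rewrite normrM -[leRHS]mulr1; apply: ler_pM.
have -> : E * (2 * M^-1) * (2 * (A * k) * (B * (2 * M * a)) +
    E * (2 * M^-1) * (B2 * (4 * M ^+ 2 * a ^+ 2) + 2 * M * B)) =
  E * 2 * (2 * (A * k) * (B * (2 * a)) + E * 2 * (B2 * (4 * a ^+ 2) + M^-1 * (2 * B))).
  by field; rewrite gt_eqF.
apply: ler_wpM2l; first by apply: mulr_ge0.
rewrite lerD2l; apply: ler_wpM2l; first by apply: mulr_ge0.
by rewrite lerD2l; apply: ler_piMl; [apply: mulr_ge0|].
Qed.

End Cutoff.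

(** A fixed point leaves the layer for large [n], so the sequence is eventually 0; with the uniform
    bound dominated convergence applies. *)
Lemma remainder_cvg y : I y -> remainder n.+1%:R y @[n --> \oo] --> (0 : R).
Proof.
move=> Iy; have w0 : 0 < a ^+ 2 - y ^+ 2.
  by move: Iy => /andP[y1 y2]; rewrite subr_sqr mulr_gt0//; lra.
apply: cvg_near_cst; exists (Num.Def.archi_bound (2 / (a ^+ 2 - y ^+ 2))) => // n /= Nn.
have n1 : 1 <= n.+1%:R :> R by rewrite ler1n.
have n0 : 0 < n.+1%:R :> R by [].
rewrite remainderE//.
have [-> ->] : dstp (cutp n.+1%:R y) = 0 /\ 'D_1 dstp (cutp n.+1%:R y) = 0.
  apply: cut_far => //; apply/negP; rewrite negb_and -!ltNge; apply/orP; right.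
  rewrite ltr_pdivrMr// mulrC -ltr_pdivrMr//.
  apply: lt_le_trans (archi_boundP _) _; first by rewrite divr_ge0// ltW.
  by rewrite ler_nat (leq_trans Nn).
by rewrite !mul0r !mulr0 subrr mulr0 addr0 mulr0.
Qed.

Lemma cut_cvg y : I y -> cut n.+1%:R y @[n --> \oo] --> (1 : R).
Proof.
move=> Iy; have w0 : 0 < a ^+ 2 - y ^+ 2.
  by move: Iy => /andP[y1 y2]; rewrite subr_sqr mulr_gt0//; lra.
apply: cvg_near_cst; exists (Num.Def.archi_bound (2 / (a ^+ 2 - y ^+ 2))) => // n /= Nn.
rewrite /cut /cutp stp1//.
have : 2 / (a ^+ 2 - y ^+ 2) <= n.+1%:R.
  apply: le_trans (ltW (archi_boundP _)) _; first by rewrite divr_ge0// ltW.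
  by rewrite ler_nat (leq_trans Nn).
rewrite ler_pdivrMr//; lra.
Qed.

Lemma theta_cvg y : I y -> theta n.+1%:R y @[n --> \oo] --> J1 a y.
Proof.
by move=> Iy; rewrite -[X in _ --> X]mulr1; apply: cvgM; [exact: cvg_cst|exact: cut_cvg].
Qed.
Lemma theta_le M y : `|theta M y| <= A.
Proof.
rewrite /theta normrM -[leRHS]mulr1; apply: ler_pM => //; first exact: J1_le.
by rewrite ger0_norm ?stp_ge0 ?stp_le1.
Qed.

Lemma remainder_le : exists B, forall n y, I y -> `|remainder n.+1%:R y| <= B.
Proof.
have [B B0 hB] := @dstp_bounded R.
have [|z|B2 B20 hB2] := @continuous_supp_bounded R ('D_1 dstp) 0 1.
- exact/smooth_continuous/smooth_D/smooth_D/smooth_stp.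
- apply: (@smooth_supp_derive R _ dstp [set t | 0 <= t <= 1]) => //.
    rewrite (_ : [set t : R | 0 <= t <= 1] = `[0, 1]%classic); first exact: interval_closed.
    by apply/seteqP; split => t; rewrite /= in_itv.
  by move=> t; exact: dstp_out.
by eexists => n y Iy; apply: remainder_bound hB hB2 Iy; rewrite ler1n.
Qed.

Local Notation fV := (fun x => (f x)^-1).

Let mfV' : measurable_fun D fV. Proof. exact: mfV mf c0 hfc. Qed.
Let fVM x : D x -> `|(f x)^-1| <= c^-1.
Proof.
move=> Dx; have /andP[h1 _] := hfc Dx; have f0 : 0 < f x := lt_le_trans c0 h1.
by rewrite ger0_norm ?invr_ge0 ?(ltW f0)// lef_pV2 ?posrE.
Qed.

Section Limit.
Variables (z : R -> R) (tz : test_function setT z).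
Let tzz : test_function setT (fun s => z s * z s).
Proof. by apply: test_mul => //; exact: test_smooth tz. Qed.
Let tdz : test_function setT ('D_1 z).
Proof. by apply: test_D => //; exact: line_hausdorff. Qed.

Lemma smooth_sep_meas (g h : R -> R) : smooth g -> smooth h -> measurable_fun D (fun x => g x.1 * h x.2).
Proof.
move=> sg sh; apply: measurable_continuous; first exact: strip_measurable.
apply/smooth_continuous/smooth_mul; apply: smooth_comp => //; [exact: smooth_fst|exact: smooth_snd].
Qed.

Lemma z_sqr_int (g : R -> R) B : test_function setT g -> mu.-integrable D (EFin \o (fun x => B * g x.1 ^+ 2)).
Proof. by move=> tg; apply: int_scale => //; apply: l2_sqr_int; exact: z_l2. Qed.

Lemma limit_kinetic : \int[mu]_(x in D) ((f x)^-1 * ('D_1 z x.1 * theta n.+1%:R x.2) ^+ 2) @[n --> \oo] -->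
  \int[mu]_(x in D) ((f x)^-1 * ('D_1 z x.1 * J1 a x.2) ^+ 2).
Proof.
apply: (int_dct mD (g := fun x => c^-1 * A ^+ 2 * 'D_1 z x.1 ^+ 2)).
- move=> n; apply: measurable_funM => //; apply: measurable_funX.
  apply: (@smooth_sep_meas ('D_1 z) (theta n.+1%:R)); first exact: test_smooth tdz.
  by apply: test_smooth (test_theta _); rewrite ler1n.
- apply: measurable_funM => //; apply: measurable_funX; apply: (@smooth_sep_meas ('D_1 z) (J1 a)); [exact: test_smooth tdz|exact: smooth_J1].
- move=> x Dx; apply: cvgM; first exact: cvg_cst.
  by rewrite expr2; apply: cvgM; (apply: cvgM; [exact: cvg_cst|exact: theta_cvg]).
- move=> n x Dx; rewrite normrM -mulrA; apply: ler_pM => //; first exact: fVM.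
  rewrite ger0_norm ?sqr_ge0// exprMn [leRHS]mulrC; apply: ler_wpM2l; first exact: sqr_ge0.
  by rewrite -[leLHS]real_normK ?num_real// ler_pXn2r ?nnegrE ?(ltW A0)// theta_le.
- exact: (@z_sqr_int ('D_1 z) _ tdz).
Qed.

Lemma limit_SI (w : plane -> R) (M B : R) (t_ : nat -> R -> R) (t : R -> R) :
  measurable_fun D w -> (forall x, D x -> `|w x| <= M) ->
  (forall n, smooth (t_ n)) -> smooth t -> (forall y, I y -> t_ n y @[n --> \oo] --> t y) ->
  (forall n y, I y -> `|t_ n y| <= B) ->
  SI w (fun s => z s * z s) (t_ n) @[n --> \oo] --> SI w (fun s => z s * z s) t.
Proof.
move=> mw hw st_ st ct bt; apply: (int_dct mD (g := fun x => M * B * z x.1 ^+ 2)).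
- by move=> n; apply: measurable_funM => //; apply: (@smooth_sep_meas (fun s => z s * z s) (t_ n)) => //; exact: test_smooth tzz.
- by apply: measurable_funM => //; apply: (@smooth_sep_meas (fun s => z s * z s) t) => //; exact: test_smooth tzz.
- move=> x Dx; apply: cvgM; first exact: cvg_cst.
  by apply: cvgM; [exact: cvg_cst|exact: ct].
- move=> n x Dx; rewrite normrM -[leRHS]mulrA; apply: ler_pM => //; first exact: (hw x Dx).
  by rewrite normrM mulrC -expr2 (ger0_norm (sqr_ge0 _)) ler_wpM2r ?sqr_ge0// bt.
- exact: z_sqr_int.
Qed.

(** [J1] has no compact support in the fiber; its cut off versions give test functions, whose values
    of the form minus [E1] times the squared norm tend to the quantity assumed negative. *)
Lemma trial_of_limit : \int[mu]_(x in D) ((f x)^-1 * ('D_1 z x.1 * J1 a x.2) ^+ 2) -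
    2^-1 * SI (fun x => K x * f x) (fun s => z s * z s) (fun y => J1 a y * J1 a y) < 0 ->
  exists x : H10r a, qf f x x < E1 a * ipw f (Hpi x) (Hpi x).
Proof.
set L := _ - _ => L0.
have n1 n : 1 <= n.+1%:R :> R by rewrite ler1n.
have [B hB] := remainder_le.
have sth n : smooth (theta n.+1%:R) by exact: test_smooth (test_theta (n1 n)).
have c2 : SI (fun x => K x * f x) (fun s => z s * z s) (fun y => theta n.+1%:R y * theta n.+1%:R y) @[n --> \oo] -->
    SI (fun x => K x * f x) (fun s => z s * z s) (fun y => J1 a y * J1 a y).
  apply: (limit_SI (B := A ^+ 2) mKf KfM) => //.
  - by move=> n; exact: smooth_mul.
  - by apply: smooth_mul; exact: smooth_J1.
  - by move=> y Iy; apply: cvgM; exact: theta_cvg.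
  - by move=> n y Iy; rewrite normrM expr2 ler_pM ?theta_le.
have c3 : SI f (fun s => z s * z s) (remainder n.+1%:R) @[n --> \oo] --> SI f (fun s => z s * z s) (fun=> 0).
  apply: (limit_SI (B := B) mf fM) => //.
  - move=> n; apply: smooth_mul => //; apply: smooth_add; first exact/smooth_D/smooth_D.
    exact: smooth_scale.
  - exact: smooth_cst.
  - by move=> y Iy; exact: remainder_cvg.
have z0 : SI f (fun s => z s * z s) (fun=> 0) = 0.
  by rewrite /SI; under eq_Rintegral do rewrite !mulr0; exact: Rint0.
rewrite z0 in c3.
have cL : \int[mu]_(x in D) ((f x)^-1 * ('D_1 z x.1 * theta n.+1%:R x.2) ^+ 2) -
   (2^-1 * SI (fun x => K x * f x) (fun s => z s * z s) (fun y => theta n.+1%:R y * theta n.+1%:R y) +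
    SI f (fun s => z s * z s) (remainder n.+1%:R)) @[n --> \oo] --> L.
  rewrite /L -[X in _ --> _ - X]addr0; apply: cvgB; first exact: limit_kinetic.
  by apply: cvgD => //; apply: cvgM => //; exact: cvg_cst.
have [n hn] : exists n, \int[mu]_(x in D) ((f x)^-1 * ('D_1 z x.1 * theta n.+1%:R x.2) ^+ 2) -
   (2^-1 * SI (fun x => K x * f x) (fun s => z s * z s) (fun y => theta n.+1%:R y * theta n.+1%:R y) +
    SI f (fun s => z s * z s) (remainder n.+1%:R)) < 0.
  have L2 : 0 < - L / 2 by lra.
  have [N _ /(_ N (leqnn N))] := (proj1 (cvgrPdist_le _ _)) cL _ L2.
  by rewrite /= ler_norml => /andP[h1 h2]; exists N; lra.
have tt := test_theta (n1 n).
pose x := mkH (h10_test (test_sep tz tt)); exists x.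
have e1 : l2val (Hd1 x) = (fun x => 'D_1 z x.1 * theta n.+1%:R x.2).
  by apply/funext => y; exact: derive_sep1.
have e2 : l2val (Hd2 x) = (fun x => z x.1 * 'D_1 (theta n.+1%:R) x.2).
  by apply/funext => y; exact: derive_sep2.
by rewrite -subr_lt0 (trial_identity tz tt _ e1 e2).
Qed.

End Limit.

(** * Cutting off along the strip *)

Section ZCutoff.
Variable N : R.
Hypothesis N1 : 1 <= N.
Let N0 : 0 < N. Proof. exact: lt_le_trans ltr01 N1. Qed.

(** Equal to 1 on [[- N, N]] and to 0 off [[- (2 * N), 2 * N]]; the negative parameter makes the
    second factor a falling step. *)
Definition zcut (s : R) := bump N^-1 (- (2 * N)) s * bump (- N^-1) (2 * N) s.

Lemma zcut_ge0 s : 0 <= zcut s. Proof. by apply: mulr_ge0; exact: stp_ge0. Qed.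
Lemma zcut_le1 s : zcut s <= 1.
Proof. by rewrite -[leRHS]mulr1; apply: ler_pM; rewrite ?stp_ge0 ?stp_le1. Qed.

Lemma zcut_out s : ~ (- (2 * N) <= s <= 2 * N) -> zcut s = 0.
Proof.
move=> /negP; rewrite negb_and -!ltNge => /orP[h|h]; rewrite /zcut /bump.
  rewrite stp0 ?mul0r// -mulrBr pmulr_rle0 ?invr_gt0//; lra.
rewrite mulrC stp0 ?mul0r// -mulrBr mulNr oppr_le0 pmulr_rge0 ?invr_gt0//; lra.
Qed.

Lemma zcut_in s : `|s| <= N -> zcut s = 1.
Proof.
rewrite ler_norml => /andP[h1 h2]; rewrite /zcut /bump -!mulrBr !stp1 ?mulr1//.
  by rewrite mulNr -mulrN mulrC ler_pdivlMr//; lra.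
by rewrite mulrC ler_pdivlMr//; lra.
Qed.

Lemma test_zcut : test_function setT zcut.
Proof.
split; first by apply: smooth_mul; exact: smooth_bump.
exists `[- (2 * N), 2 * N]%classic; split=> //; first exact: segment_compact.
by move=> s; rewrite /= in_itv /=; exact: zcut_out.
Qed.

Lemma derive_zcut B s : (forall t, `|dstp t| <= B) -> `|'D_1 zcut s| <= 2 * B / N.
Proof.
move=> hB; rewrite (@deriveM _ _ (bump N^-1 (- (2 * N))) (bump (- N^-1) (2 * N))); last 2 first.
- exact/smooth_derivable/smooth_bump.
- exact/smooth_derivable/smooth_bump.
have -> : 2 * B / N = B / N + B / N by ring.
rewrite !derive_bump /GRing.scale/=; apply: le_trans (ler_normD _ _) _.
have B0 : 0 <= B := le_trans (normr_ge0 _) (hB 0).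
have N0' : 0 <= N^-1 by rewrite invr_ge0 ltW.
apply: lerD; rewrite -[leRHS]mul1r normrM; apply: ler_pM => //.
- by rewrite ger0_norm ?stp_ge0 ?stp_le1.
- by rewrite normrM normrN (ger0_norm N0') [leRHS]mulrC; apply: ler_wpM2l.
- by rewrite ger0_norm ?stp_ge0 ?stp_le1.
- by rewrite normrM (ger0_norm N0') [leRHS]mulrC; apply: ler_wpM2l.
Qed.

End ZCutoff.

Lemma zcut_cvg s : zcut n.+1%:R s @[n --> \oo] --> (1 : R).
Proof.
apply: cvg_near_cst; exists (Num.Def.archi_bound `|s|) => // n /= Nn.
apply: zcut_in => //; first by rewrite ler1n.
by apply: le_trans (ltW (archi_boundP _)) _ => //; rewrite ler_nat (leq_trans Nn).
Qed.

(** The longitudinal energy of the cutoff is of order [1 / N], a squared slope of order [1 / N ^ 2]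
    on a support of length [4 N], while the curvature term tends to half of a positive integral. *)
Lemma trial_exists : mu.-integrable D (EFin \o K) ->
  0 < \int[mu]_(x in D) (K x * J1 a x.2 ^+ 2 * f x) ->
  exists x : H10r a, qf f x x < E1 a * ipw f (Hpi x) (Hpi x).
Proof.
move=> iK hpos; have [B B0 hB] := @dstp_bounded R.
have n1 n : 1 <= n.+1%:R :> R by rewrite ler1n.
pose zn n := zcut n.+1%:R.
have tz n : test_function setT (zn n) by exact: test_zcut.
have c1 : SI (fun x => K x * f x) (fun s => zn n s * zn n s) (fun y => J1 a y * J1 a y) @[n --> \oo] -->
    \int[mu]_(x in D) (K x * J1 a x.2 ^+ 2 * f x).
  apply: (int_dct mD (g := fun x => A ^+ 2 * 2 * `|K x|)).
  - move=> n; apply: measurable_funM => //; 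
    apply: (@smooth_sep_meas (fun s => zn n s * zn n s) (fun y => J1 a y * J1 a y)); apply: smooth_mul;
      by [exact: smooth_J1|exact: test_smooth (tz n)].
  - apply: measurable_funM => //; apply: measurable_funM => //; apply: measurable_funX.
    have := smooth_sep_meas (smooth_cst (V := R) (1 : R)) smooth_J1.
    by under eq_fun do rewrite mul1r.
  - move=> x Dx.
    have -> : K x * J1 a x.2 ^+ 2 * f x = K x * f x * (1 * 1 * (J1 a x.2 * J1 a x.2)) by ring.
    apply: cvgM; first exact: cvg_cst.
    apply: cvgM; last exact: cvg_cst.
    by apply: cvgM; exact: zcut_cvg.
  - move=> n x Dx; have h1 := J1_le x.2; have h2 := fM Dx; have h3 : `|zn n x.1| <= 1 by rewrite ger0_norm ?zcut_ge0 ?zcut_le1.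
    have -> : A ^+ 2 * 2 * `|K x| = `|K x| * 2 * (1 * 1 * (A * A)) by ring.
    move: (zn n x.1) (J1 a x.2) (f x) (K x) h1 h2 h3 => p q r s h1 h2 h3; rewrite !normrM.
    by apply: ler_pM; rewrite ?mulr_ge0// ?ler_wpM2l//; apply: ler_pM; rewrite ?mulr_ge0//; apply: ler_pM.
  - by apply: int_scale => //; exact: int_abs.
have c2 : \int[mu]_(x in D) ((f x)^-1 * ('D_1 (zn n) x.1 * J1 a x.2) ^+ 2) @[n --> \oo] --> (0 : R).
  pose bd n : R := (2 * B / n.+1%:R * A) ^+ 2 * c^-1 * (4 * n.+1%:R * (2 * a)).
  have hbd n : 0 <= \int[mu]_(x in D) ((f x)^-1 * ('D_1 (zn n) x.1 * J1 a x.2) ^+ 2) <= bd n.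
    have [N0 N1] : 0 < n.+1%:R :> R /\ 0 <= n.+1%:R :> R by rewrite ltr0n ler0n.
    have G0 x : D x -> 0 <= (f x)^-1 * ('D_1 (zn n) x.1 * J1 a x.2) ^+ 2.
      move=> Dx; have /andP[h1 _] := hfc Dx; apply: mulr_ge0 (sqr_ge0 _).
      by rewrite invr_ge0 (le_trans (ltW c0) h1).
    rewrite Rintegral_ge0//=.
    pose Q : set plane := `[- (2 * n.+1%:R), 2 * n.+1%:R]%classic `*` I.
    have mQ : measurable_for mu Q by apply: measurableX; [exact: measurable_itv|exact: fiber_measurable].
    have QD : Q `<=` D by move=> x [].
    have zz s : ~ (- (2 * n.+1%:R) <= s <= 2 * n.+1%:R) -> 'D_1 (zn n) s = 0.
      apply: (@smooth_supp_derive R _ (zn n) [set s | - (2 * n.+1%:R) <= s <= 2 * n.+1%:R]).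
        rewrite (_ : [set s : R | _] = `[- (2 * n.+1%:R), 2 * n.+1%:R]%classic); first exact: interval_closed.
        by apply/seteqP; split => t; rewrite /= in_itv.
      by move=> hs; exact: zcut_out.
    have -> : \int[mu]_(x in D) ((f x)^-1 * ('D_1 (zn n) x.1 * J1 a x.2) ^+ 2) =
        \int[mu]_(x in Q) ((f x)^-1 * ('D_1 (zn n) x.1 * J1 a x.2) ^+ 2).
      rewrite [LHS]Rintegral_mkcond [RHS]Rintegral_mkcond; apply: eq_Rintegral => x _.
      rewrite !patchE; have [xQ|xQ] := boolP (x \in Q).
        by rewrite ifT//; apply: mem_set; apply: QD; exact: set_mem.
      case: ifPn => [/set_mem Dx|//]; rewrite zz ?mul0r ?expr0n ?mulr0// => h.
      by move/negP: xQ; apply; apply: mem_set; split => //=; rewrite in_itv.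
    have muQ : mu Q = (4 * n.+1%:R * (2 * a))%:E.
      rewrite /Q product_measure1E; [|exact: measurable_itv|exact: fiber_measurable].
      have m1 : leb R `[- (2 * n.+1%:R), 2 * n.+1%:R]%classic = (4 * n.+1%:R)%:E.
        rewrite lebesgue_measure_itv/= lte_fin ifT; last by lra.
        by rewrite -EFinB; congr EFin; ring.
      have m2 : leb R I = (2 * a)%:E.
        rewrite fiberE lebesgue_measure_itv/= lte_fin ifT; last by rewrite gtrN.
        by rewrite -EFinB; congr EFin; ring.
      by rewrite [X in (X * _)%E]m1 [X in (_ * X)%E]m2 -EFinM.
    have fQ : (mu Q < +oo)%E by rewrite muQ ltry.
    have bG x : Q x -> `|(f x)^-1 * ('D_1 (zn n) x.1 * J1 a x.2) ^+ 2| <= (2 * B / n.+1%:R * A) ^+ 2 * c^-1.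
      move=> Qx; have Dx := QD x Qx; rewrite normrM mulrC; apply: ler_pM => //; last exact: fVM.
      rewrite ger0_norm ?sqr_ge0// -[leLHS]real_normK ?num_real// ler_pXn2r ?nnegrE//; last first.
        by rewrite !mulr_ge0// ?invr_ge0// ltW.
      by rewrite normrM; apply: ler_pM => //; [exact: derive_zcut|exact: J1_le].
    have mG : measurable_fun Q (fun x => (f x)^-1 * ('D_1 (zn n) x.1 * J1 a x.2) ^+ 2).
      apply: (measurable_funS mD QD); apply: measurable_funM => //; apply: measurable_funX.
      apply: (@smooth_sep_meas ('D_1 (zn n)) (J1 a)); last exact: smooth_J1.
      by apply: smooth_D; exact: test_smooth (tz n).
    have Bd0 : 0 <= (2 * B / n.+1%:R * A) ^+ 2 * c^-1 by rewrite mulr_ge0 ?sqr_ge0// invr_ge0 ltW.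
    have h : `|\int[mu]_(x in Q) ((f x)^-1 * ('D_1 (zn n) x.1 * J1 a x.2) ^+ 2)| <=
        (2 * B / n.+1%:R * A) ^+ 2 * c^-1 * fine (mu Q).
      by apply: (int_abs_le mQ Bd0 fQ (int_bounded mQ fQ mG bG)); apply: aeW; exact: bG.
    have fm : fine (mu Q) = 4 * n.+1%:R * (2 * a) by rewrite muQ.
    by rewrite [fine _]fm in h; exact: le_trans (ler_norm _) h.
  have cb : bd n @[n --> \oo] --> (0 : R).
    have -> : bd = (fun n => 32 * B ^+ 2 * A ^+ 2 * c^-1 * a * n.+1%:R^-1).
      by apply/funext => n; rewrite /bd; field; rewrite gt_eqF//= gt_eqF.
    rewrite -[X in _ --> X](mulr0 (32 * B ^+ 2 * A ^+ 2 * c^-1 * a)).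
    apply: cvgM; first exact: cvg_cst.
    exact: cvg_harmonic.
  by apply: (squeeze_cvgr _ (cvg_cst 0) cb); apply: nearW.
set Q := \int[mu]_(x in D) (K x * J1 a x.2 ^+ 2 * f x) in hpos c1.
have cL : \int[mu]_(x in D) ((f x)^-1 * ('D_1 (zn n) x.1 * J1 a x.2) ^+ 2) -
    2^-1 * SI (fun x => K x * f x) (fun s => zn n s * zn n s) (fun y => J1 a y * J1 a y) @[n --> \oo] --> 0 - 2^-1 * Q.
  by apply: cvgB => //; apply: cvgM => //; exact: cvg_cst.
have Q4 : 0 < Q / 4 by rewrite divr_gt0.
have [N _ /(_ N (leqnn N))] := (proj1 (cvgrPdist_le _ _)) cL _ Q4.
rewrite /= ler_norml => /andP[h1 h2]; apply: (trial_of_limit (tz N)).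
exact: limit_arith hpos h1.
Qed.

End Trial.

(** * Poincare and Nash inequalities for the form *)

Section Poincare1D.
Context {R : realType}.
Variable a : R.
Local Notation I := (fiber a).
Hypothesis a0 : 0 < a.
Let mI := (fun d (T : measurableType d) (_ : {measure set T -> \bar R}) (A : set T)
  (h : measurable A) => h) _ _ (leb R) I (fiber_measurable a).

Lemma test_sqr_int (p : R -> R) : test_function I p -> (leb R).-integrable I (EFin \o (fun y => p y ^+ 2)).
Proof.
move=> tp; have [M M0 hM] := test_bounded1 tp; apply: l2_sqr_int.
apply: (@l2_bounded _ _ _ (leb R) I mI _ M (fiber_finite a)) => //.
by apply: measurable_funS (continuous_measurable_fun _) => //; apply/smooth_continuous/(test_smooth tp).
Qed.

(* (p' + p t)^2 >= 0 for t = k tan (k y), which satisfies t' = k^2 + t^2 *)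
Lemma poincare_lt (p : R -> R) (k : R) : test_function I p -> 0 < k -> k < pi / (2 * a) ->
  k ^+ 2 * \int[leb R]_(y in I) (p y ^+ 2) <= \int[leb R]_(y in I) ('D_1 p y ^+ 2).
Proof.
move=> tp k0 ka; have sp := test_smooth tp.
have cosp y : - a <= y <= a -> cos (k * y) != 0.
  move=> hy; rewrite gt_eqF// cos_gt0_pihalf//.
  have h : `|k * y| < pi / 2.
    rewrite normrM gtr0_norm//; apply: (@le_lt_trans _ _ (k * a)).
      by rewrite ler_wpM2l ?(ltW k0)// ler_norml.
    have -> : pi / 2 = pi / (2 * a) * a :> R by field; rewrite gt_eqF.
    by rewrite ltr_pM2r.
  by move: h; rewrite ltr_norml.
pose t y := k * tan (k * y).
pose F y := p y ^+ 2 * t y.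
pose dF y := 2 * p y * 'D_1 p y * t y + p y ^+ 2 * (k ^+ 2 + t y ^+ 2).
have dFP y : - a <= y <= a -> is_derive y (1 : R) F (dF y).
  move=> hy; have h1 : is_derive y (1 : R) (fun y => k * y + 0) k by exact: is_derive_affine.
  have h2 : is_derive (k * y + 0) (1 : R) tan ((cos (k * y + 0)) ^- 2).
    by apply: is_derive_tan; rewrite addr0 cosp.
  have h3 : is_derive y (1 : R) (tan \o (fun y => k * y + 0)) ((cos (k * y + 0)) ^- 2 *: k) by exact: is_derive1_comp.
  have h4 : is_derive y (1 : R) p ('D_1 p y) by exact: smooth_is_derive.
  have -> : F = (p * p) * (k \*: (tan \o (fun y => k * y + 0))).
    by apply/funext => z; rewrite /F /t expr2 -[in LHS](addr0 (k * z)).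
  apply: is_derive_eq; rewrite /GRing.scale/= addr0 cos2_tan2 ?cosp// /dF /t /=.
  change (p y * p y * (k * ((1 + tan (k * y) ^+ 2) * k)) + k * tan (k * y) * (p y * 'D_1 p y + p y * 'D_1 p y) =
    2 * p y * 'D_1 p y * (k * tan (k * y)) + p y ^+ 2 * (k ^+ 2 + (k * tan (k * y)) ^+ 2)).
  ring.
have ct y : - a <= y <= a -> {for y, continuous t}.
  move=> hy; apply: cvgM; first exact: cvg_cst.
  apply: continuous_comp; last by apply: continuous_tan; exact: cosp.
  by apply: cvgM; [exact: cvg_cst|exact: cvg_id].
have sdp : smooth ('D_1 p) by exact: smooth_D.
have cp := smooth_continuous sp; have cdp := smooth_continuous sdp.
have pa y : ~ I y -> p y = 0 by have [_ [A [_ AI eA]]] := tp; move=> Iy; apply: eA => /AI.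
have cdF : {within `[- a, a], continuous dF}.
  apply: continuous_in_subspaceT => y; rewrite inE/= in_itv/= => hy.
  apply: cvgD; [apply: cvgM; last exact: ct|apply: cvgM].
  - apply: cvgM; last exact: cdp.
    by apply: cvgM; [exact: cvg_cst|exact: cp].
  - by rewrite expr2; apply: cvgM; exact: cp.
  - apply: cvgD; first exact: cvg_cst.
    by rewrite expr2; apply: cvgM; exact: ct.
have J0 : (\int[leb R]_(y in `[(- a)%R, a]) (dF y)%:E = 0)%E.
  rewrite (@continuous_FTC2 _ _ F).
  - have na : ~ I a by rewrite /fiber /= ltxx andbF.
    have nna : ~ I (- a) by rewrite /fiber /= ltxx.
    have Fz z : ~ I z -> F z = 0 by move=> Iz; rewrite /F pa// expr0n/= mul0r.
    by rewrite !Fz// -EFinB subrr.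
  - by rewrite gtrN.
  - exact: cdF.
  - split.
    + by move=> y; rewrite in_itv/= => /andP[y1 y2]; have [] := dFP y ltac:(by rewrite !ltW).
    + apply: cvg_at_right_filter; apply: differentiable_continuous; apply/derivable1_diffP.
      by have [] := dFP (- a) ltac:(by rewrite lexx/= ge0_cp// ltW).
    + apply: cvg_at_left_filter; apply: differentiable_continuous; apply/derivable1_diffP.
      by have [] := dFP a ltac:(by rewrite lexx andbT ge0_cp// ltW).
  - by move=> y; rewrite in_itv/= => /andP[y1 y2]; rewrite derive1E; have [_ ->] := dFP y ltac:(by rewrite !ltW).
have idF : (leb R).-integrable `[- a, a] (EFin \o dF).
  by apply: continuous_compact_integrable => //; exact: segment_compact.
have idI : (leb R).-integrable I (EFin \o dF).
  apply: integrableS idF; [exact: measurable_itv|exact: fiber_measurable|].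
  by move=> y /andP[y1 y2]; rewrite /= in_itv/= !ltW.
have JI : \int[leb R]_(y in I) dF y = 0.
  rewrite fiberE Rintegral_itv_bndo_bndc; last by rewrite -fiberE.
  rewrite Rintegral_itv_obnd_cbnd; first by rewrite /Rintegral J0.
  by apply: integrableS idF => //; exact: subset_itv_oc_cc.
have tdp : test_function I ('D_1 p) by apply: test_D => //; exact: line_hausdorff.
have i1 := test_sqr_int tp; have i2 := test_sqr_int tdp.
rewrite -RintegralZl// -[leLHS]subr0 -JI -RintegralB//; last exact: int_scale.
apply: le_Rintegral => //; first by apply: int_sub => //; exact: int_scale.
move=> y Iy; rewrite /dF; have := sqr_ge0 ('D_1 p y + p y * t y).
by rewrite sqrrD exprMn; move: ('D_1 p y) (p y) (t y) => u v z; lra.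
Qed.

(** At [k = pi / (2 * a)] the tangent is infinite at the ends, so the strict inequality is applied
    to [th * k] with [th < 1]. *)
Lemma poincare1 (p : R -> R) : test_function I p ->
  E1 a * \int[leb R]_(y in I) (p y ^+ 2) <= \int[leb R]_(y in I) ('D_1 p y ^+ 2).
Proof.
move=> tp; set X := \int[leb R]_(y in I) ('D_1 p y ^+ 2); set Y := \int[leb R]_(y in I) (p y ^+ 2).
have Y0 : 0 <= Y by apply: Rintegral_ge0 => y _; exact: sqr_ge0.
set k := pi / (2 * a); have k0 : 0 < k by rewrite divr_gt0 ?pi_gt0// mulr_gt0.
have h (th : R) : 0 < th < 1 -> (th * k) ^+ 2 * Y <= X.
  move=> /andP[t0 t1]; apply: poincare_lt => //; first exact: mulr_gt0.
  by rewrite -/k -[ltRHS]mul1r ltr_pM2r.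
have hE : E1 a * Y = k ^+ 2 * Y by [].
rewrite hE leNgt; apply/negP => XY.
have P0 : 0 < k ^+ 2 * Y by apply: le_lt_trans XY; apply: Rintegral_ge0 => y _; exact: sqr_ge0.
have X0 : 0 <= X by apply: Rintegral_ge0 => y _; exact: sqr_ge0.
set q := X / (k ^+ 2 * Y); have q0 : 0 <= q by rewrite divr_ge0// ltW.
have q1 : q < 1 by rewrite ltr_pdivrMr// mul1r.
(* If the quotient [q] of the two sides were below 1, [th = (1 + q) / 2] would give a contradiction:
   [th ^+ 2 - q = (1 - q) ^+ 2 / 4 > 0]. *)
have := h ((1 + q) / 2) ltac:(apply/andP; split; lra).
have -> : X = q * (k ^+ 2 * Y) by rewrite /q divfK// gt_eqF.
rewrite exprMn -mulrA ler_pM2r// => h1.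
have := sqr_ge0 (1 - q); rewrite sqrrB expr1n mul1r => h2.
have : ((1 + q) / 2) ^+ 2 = (1 + 2 * q + q ^+ 2) / 4 by field.
by move=> e; rewrite e in h1; nra.
Qed.

End Poincare1D.

Section RintegralCombination.
Context {d} {T : measurableType d} {R : realType} (mu : {measure set T -> \bar R}) (A : set T) (mA : measurable A).
Lemma Rint_sub2 (u v : T -> R) (p q : R) : mu.-integrable A (EFin \o u) -> mu.-integrable A (EFin \o v) ->
  \int[mu]_(x in A) (p * u x - q * v x) = p * \int[mu]_(x in A) u x - q * \int[mu]_(x in A) v x.
Proof.
move=> iu iv; rewrite RintegralB//; [|exact: (int_scale mA)|exact: (int_scale mA)].
by rewrite !RintegralZl.
Qed.
Lemma Rint_scale (c : R) (u : T -> R) : mu.-integrable A (EFin \o u) ->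
  \int[mu]_(x in A) (c * u x) = c * \int[mu]_(x in A) u x.
Proof. by move=> iu; rewrite RintegralZl. Qed.
Lemma le_Rint (u v : T -> R) : mu.-integrable A (EFin \o u) -> mu.-integrable A (EFin \o v) ->
  (forall x, A x -> u x <= v x) -> \int[mu]_(x in A) u x <= \int[mu]_(x in A) v x.
Proof. by move=> iu iv h; apply: le_Rintegral. Qed.
Local Open Scope ereal_scope.
Lemma ge0_sub_int (g : T -> \bar R) : measurable_fun setT g -> (forall x, 0 <= g x) ->
  \int[mu]_(x in A) g x <= \int[mu]_x g x.
Proof. by move=> mg g0; apply: ge0_subset_integral. Qed.
Lemma ge0_intZl (g : T -> \bar R) k : measurable_fun setT g -> (forall x, 0 <= g x) -> 0 <= k ->
  \int[mu]_x (k * g x) = k * \int[mu]_x g x.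
Proof. by move=> mg g0 k0; rewrite ge0_integralZl. Qed.
Lemma ge0_intZr (g : T -> \bar R) k : measurable_fun setT g -> (forall x, 0 <= g x) -> 0 <= k ->
  \int[mu]_x (g x * k) = (\int[mu]_x g x) * k.
Proof. by move=> mg g0 k0; rewrite ge0_integralZr. Qed.
End RintegralCombination.

(** * An interpolation inequality in the plane *)

Section Gagliardo.
Context {R : realType}.
Local Notation plane := (R * R)%type.
Local Notation mu := (leb2 R).

Lemma tonelli1 (g : plane -> \bar R) : measurable_fun setT g -> (forall x, (0 <= g x)%E) ->
  (\int[mu]_x g x = \int[leb R]_s \int[leb R]_y g (s, y))%E.
Proof.
by move=> mg g0; have h := @fubini_tonelli1 _ _ _ _ R (leb R) (leb R) g mg g0.
Qed.
Lemma tonelli2 (g : plane -> \bar R) : measurable_fun setT g -> (forall x, (0 <= g x)%E) ->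
  (\int[mu]_x g x = \int[leb R]_y \int[leb R]_s g (s, y))%E.
Proof.
by move=> mg g0; have h := @fubini_tonelli2 _ _ _ _ R (leb R) (leb R) g mg g0.
Qed.
Lemma abse_int (A : set R) (g : R -> R) : measurable_for (leb R) A -> measurable_fun A g ->
  (`|\int[leb R]_(t in A) (g t)%:E| <= \int[leb R]_(t in A) `|g t|%:E)%E.
Proof.
move=> mA mg; have h := @le_abse_integral _ _ _ (leb R) A (EFin \o g) mA.
exact: (h (proj2 (measurable_EFinP _ _) mg)).
Qed.

Lemma ftc_le (g : R -> R) b s : smooth g -> (forall s, ~ (`|s| <= b) -> g s = 0) ->
  (`|g s|%:E <= \int[leb R]_t `|'D_1 g t|%:E)%E.
Proof.
move=> sg g0; have [sb|sb] := leP `|s| b; last first.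
  by rewrite g0 ?normr0 ?integral_ge0// => h; move: (lt_le_trans sb h); rewrite ltxx.
have b0 : 0 <= b := le_trans (normr_ge0 _) sb.
have sd : smooth ('D_1 g) by exact: smooth_D.
have cg := smooth_continuous sg; have cd := smooth_continuous sd.
have bs : - (b + 1) < s by move: sb; rewrite ler_norml => /andP[h1 h2]; lra.
have J : (\int[leb R]_(t in `[(- (b + 1))%R, s]) ('D_1 g t)%:E = (g s)%:E)%E.
  rewrite (@continuous_FTC2 _ _ g)//.
  - rewrite (g0 (- (b + 1))) ?sube0// normrN ger0_norm ?addr_ge0// => h; lra.
  - exact: continuous_subspaceT.
  - split; [by move=> t _; exact: smooth_derivable|by apply: cvg_at_right_filter; exact: cg|
      by apply: cvg_at_left_filter; exact: cg].
  - by move=> t _; rewrite derive1E.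
have md A : measurable_fun A ('D_1 g) by apply: measurable_funS (continuous_measurable_fun cd).
have -> : `|g s|%:E = `|(g s)%:E|%E by [].
rewrite -J; apply: (@le_trans _ _ (\int[leb R]_(t in `[(- (b + 1))%R, s]) `|('D_1 g t)%:E|)%E).
  exact: abse_int (measurable_itv _) (md _).
apply: (ge0_sub_int (leb R) (measurable_itv _)); last by move=> t; rewrite lee_fin.
have mg : measurable_fun setT (fun t => `|'D_1 g t|%:E).
  by apply/measurable_EFinP; apply: measurableT_comp => //; exact: md.
exact: mg.
Qed.

Lemma smooth_slice1 (p : plane -> R) y : smooth p -> smooth (fun s : R => p (s, y)).
Proof.
move=> sp; apply: (@smooth_coind1 R (fun g => exists q, smooth q /\ g = fun s : R => q (s, y))); last by exists p.
- move=> _ [q [sq ->]]; exists (fun s => 'D_e1 q (s, y)).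
    by exists ('D_e1 q); split => //; exact: smooth_D.
  move=> s; split; last exact: derive_slice1.
  by apply: derivable_slice1; exact: smooth_derivable.
- by move=> c _ [q [sq ->]]; exists (fun x => c * q x); split => //; exact: smooth_scale.
Qed.
Lemma smooth_slice2 (p : plane -> R) s : smooth p -> smooth (fun y : R => p (s, y)).
Proof.
move=> sp; apply: (@smooth_coind1 R (fun g => exists q, smooth q /\ g = fun y : R => q (s, y))); last by exists p.
- move=> _ [q [sq ->]]; exists (fun y => 'D_e2 q (s, y)).
    by exists ('D_e2 q); split => //; exact: smooth_D.
  move=> y; split; last exact: derive_slice2.
  by apply: derivable_slice2; exact: smooth_derivable.
- by move=> c _ [q [sq ->]]; exists (fun x => c * q x); split => //; exact: smooth_scale.
Qed.

(** [|u (s, y)|] is at most [A y], the integral of the first partial derivative along its row, and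
    at most [B s], that of the second along its column; [A y * B s] integrates to the product of the
    two integrals. *)
Lemma gagliardo (u : plane -> R) b : smooth u -> (forall x, ~ (`|x.1| <= b /\ `|x.2| <= b) -> u x = 0) ->
  (\int[mu]_x (u x ^+ 2)%:E <= (\int[mu]_x `|'D_e1 u x|%:E) * (\int[mu]_x `|'D_e2 u x|%:E))%E.
Proof.
move=> su u0.
pose F1 (x : plane) : \bar R := `|'D_e1 u x|%:E; pose F2 (x : plane) : \bar R := `|'D_e2 u x|%:E.
have mabs v : measurable_fun setT (fun x : plane => `|'D_v u x|%:E).
  apply/measurable_EFinP; apply: measurableT_comp => //; apply: measurable_continuous => //.
  exact/smooth_continuous/smooth_D.
have m1 : measurable_fun setT F1 by exact: mabs.
have m2 : measurable_fun setT F2 by exact: mabs.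
have p1 x : (0 <= F1 x)%E by rewrite lee_fin.
have p2 x : (0 <= F2 x)%E by rewrite lee_fin.
pose A y := (\int[leb R]_s F1 (s, y))%E; pose B s := (\int[leb R]_y F2 (s, y))%E.
have A0 y : (0 <= A y)%E by apply: integral_ge0.
have B0 s : (0 <= B s)%E by apply: integral_ge0.
have mA : measurable_fun setT A := @measurable_fun_fubini_tonelli_G _ _ _ _ R (leb R) F1 m1 p1.
have mB : measurable_fun setT B := @measurable_fun_fubini_tonelli_F _ _ _ _ R (leb R) F2 m2 p2.
have hA x : (`|u x|%:E <= A x.2)%E.
  case: x => s y /=; have := @ftc_le (fun s => u (s, y)) b s (smooth_slice1 y su) (fun t ht => u0 (t, y) (fun h => ht (proj1 h))).
  by under eq_integral do rewrite derive_slice1.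
have hB x : (`|u x|%:E <= B x.1)%E.
  case: x => s y /=; have := @ftc_le (fun y => u (s, y)) b y (smooth_slice2 s su) (fun t ht => u0 (s, t) (fun h => ht (proj2 h))).
  by under eq_integral do rewrite derive_slice2.
have mAB : measurable_fun setT (fun x : plane => A x.2 * B x.1)%E.
  by apply: emeasurable_funM; [exact: measurableT_comp mA measurable_snd|exact: measurableT_comp mB measurable_fst].
apply: (@le_trans _ _ (\int[mu]_x (A x.2 * B x.1))%E).
  apply: ge0_le_integral => //.
  - by move=> x _; rewrite lee_fin sqr_ge0.
  - by apply/measurable_EFinP; apply: measurable_funX; apply: measurable_continuous => //; exact: smooth_continuous.
  - move=> x _; have -> : (u x ^+ 2)%:E = (`|u x|%:E * `|u x|%:E)%E by rewrite -EFinM -expr2 real_normK ?num_real.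
    by apply: lee_pmul; [rewrite lee_fin|rewrite lee_fin|exact: hA|exact: hB].
have AB0 (x : plane) : (0 <= A x.2 * B x.1)%E by apply: mule_ge0; [exact: A0|exact: B0].
rewrite (tonelli1 mAB AB0) /=.
have e1 s : (\int[leb R]_y (A y * B s) = (\int[leb R]_y A y) * B s)%E by exact: (ge0_intZr (leb R) mA A0 (B0 s)).
under eq_integral do rewrite e1.
have IA0 : (0 <= \int[leb R]_y A y)%E by apply: integral_ge0 => y _; exact: A0.
rewrite (ge0_intZl (leb R) mB B0 IA0).
by rewrite (tonelli2 m1 p1) (tonelli1 m2 p2).
Qed.

End Gagliardo.

(** * Truncation at a fixed height *)

Section Clip.
Context {R : realType}.
Variable k : R.
Hypothesis k0 : 0 < k.

Definition clip (s : R) := Num.max (- k) (Num.min s k).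

Lemma clipP s : [\/ clip s = s /\ - k <= s <= k, clip s = k /\ k <= s | clip s = - k /\ s <= - k].
Proof.
rewrite /clip; have [h1|h1] := leP s k.
  have [h2|h2] := leP (- k) s; first by apply: Or31; split.
  by apply: Or33; rewrite ltW.
have -> : Num.max (- k) k = k by apply/max_idPr; rewrite ge0_cp// ltW.
by apply: Or32; rewrite ltW.
Qed.

Lemma clip_le s : `|clip s| <= k.
Proof.
rewrite ler_norml; have [[-> //]|[-> _]|[-> _]] := clipP s; rewrite lexx ?andbT//.
  by rewrite ge0_cp// ltW.
by rewrite ge0_cp// ltW.
Qed.

Lemma clip_norm s : `|clip s| <= `|s|.
Proof.
have [[-> //]|[-> h]|[-> h]] := clipP s.
  by rewrite !ger0_norm// ?ltW// (lt_le_trans k0).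
rewrite normrN gtr0_norm// ler0_norm; first by rewrite lerNr.
by apply: le_trans h _; rewrite oppr_le0 ltW.
Qed.

Lemma excess_bound (s t r : R) : s - t <= r -> t - s <= r -> 0 <= r ->
  - r <= (s - clip s) - (t - clip t) <= r.
Proof.
move=> r1 r2 r0; have k0' : 0 < k by []; apply/andP.
have [[-> /andP[h1 h1']]|[-> h1]|[-> h1]] := clipP s; have [[-> /andP[h2 h2']]|[-> h2]|[-> h2]] := clipP t;
  split; rewrite ?opprK; lra.
Qed.

Lemma excess_lip s t : `|(s - clip s) - (t - clip t)| <= `|s - t|.
Proof.
rewrite ler_norml; apply: excess_bound; [exact: ler_norm| |exact: normr_ge0].
by rewrite -normrN opprB; exact: ler_norm.
Qed.

(** Reduces to [4 * k * (t - k) <= t ^+ 2], that is [0 <= (t - 2 * k) ^+ 2]. *)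
Lemma excess_quartic s : (s - clip s) ^+ 2 <= s ^+ 4 / (16 * k ^+ 2).
Proof.
have k2 : 0 < 16 * k ^+ 2 by rewrite mulr_gt0// exprn_gt0.
have key t : k <= t -> (t - k) ^+ 2 <= t ^+ 4 / (16 * k ^+ 2).
  move=> kt; rewrite ler_pdivlMr//.
  have h : 0 <= 4 * k * (t - k) <= t ^+ 2.
    apply/andP; split; first by rewrite mulr_ge0 ?mulr_ge0 ?(ltW k0)// subr_ge0.
    by have := sqr_ge0 (t - 2 * k); rewrite sqrrB exprMn; lra.
  have -> : (t - k) ^+ 2 * (16 * k ^+ 2) = (4 * k * (t - k)) ^+ 2 by ring.
  have -> : t ^+ 4 = (t ^+ 2) ^+ 2 by rewrite -exprM.
  by have /andP[h1 h2] := h; rewrite ler_pXn2r ?nnegrE//; exact: le_trans h2.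
have [[-> _]|[-> h]|[-> h]] := clipP s.
- rewrite subrr expr0n/= divr_ge0 ?(ltW k2)//.
  by have -> : s ^+ 4 = (s ^+ 2) ^+ 2; [rewrite -exprM|exact: sqr_ge0].
- exact: key.
- have := key (- s) ltac:(by rewrite lerNr); have -> : (- s) ^+ 4 = s ^+ 4 by ring.
  by have -> : (- s - k) ^+ 2 = (s - - k) ^+ 2 by ring.
Qed.

Lemma measurable_clip d (T : measurableType d) (A : set T) (u : T -> R) :
  measurable_fun A u -> measurable_fun A (fun x => clip (u x)).
Proof.
move=> mu_; apply: (@measurable_maxr _ _ _ A (fun=> - k) (fun x => Num.min (u x) k)); first exact: measurable_cst.
by apply: (@measurable_minr _ _ _ A u (fun=> k)) => //; exact: measurable_cst.
Qed.

Lemma quartic_arith (A B1 B2 n n1 n2 : R) : n = A ^+ 2 -> n1 = B1 ^+ 2 -> n2 = B2 ^+ 2 ->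
  2 * (A * B1) * (2 * (A * B2)) <= 2 * n * (n1 + n2).
Proof. by move=> -> -> ->; have := sqr_ge0 (A * (B1 - B2)); lra. Qed.

Lemma excess_eq (n p q r K i j1 j2 j3 : R) : n = i -> p = j1 -> q = j2 -> r = j3 ->
  n <= p * (q + r) / K -> 0 <= j1 * (j2 + j3) / K - i.
Proof. by move=> -> -> -> ->; rewrite subr_ge0. Qed.

Lemma excess_arith (n X A S q : R) : 0 < q -> n <= (16 * q)^-1 * X -> X <= 2 * A * S -> n <= A * S / (8 * q).
Proof.
move=> q0; rewrite ler_pdivlMl ?mulr_gt0// => h1 h2; rewrite ler_pdivlMr ?mulr_gt0//.
have := le_trans h1 h2; lra.
Qed.

Lemma nash_mass_arith (n P S A E C c b : R) : 0 <= n -> 0 <= P -> 0 <= S -> 0 < C -> 0 < c -> 0 < b ->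
  c * P <= A -> b * S <= E -> n <= P * S / (8 * k ^+ 2) -> C * n <= A * (C / (8 * c * b) * E / k ^+ 2).
Proof.
move=> n0 P0 S0 C0 c0 b0 h1 h2 h3.
have -> : A * (C / (8 * c * b) * E / k ^+ 2) = C * (A / c * (E / b) / (8 * k ^+ 2)).
  by field; rewrite !gt_eqF// exprn_gt0.
apply: ler_wpM2l; first exact: ltW.
apply: le_trans h3 _; apply: ler_wpM2r; first by rewrite invr_ge0 mulr_ge0// sqr_ge0.
by apply: ler_pM => //; rewrite ler_pdivlMr// mulrC.
Qed.

(** The height [k = 2 r] with [r = sqrt (M E)] turns the hypothesis into [A <= 4 r N]; the
    additional [e / (2 * N)] covers the case [r = 0]. *)
Lemma nash_arith (M E N A : R) : 0 <= M -> 0 <= E -> 0 < N -> 0 <= A ->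
  (forall k, 0 < k -> A <= k * N + A * (Num.sqrt (M * E) / k)) -> A ^+ 2 <= 16 * M * N ^+ 2 * E.
Proof.
move=> M0 E0 N0 A0 h; set r := Num.sqrt (M * E) in h; have r0 : 0 <= r by exact: sqrtr_ge0.
have AE : A <= 4 * r * N.
  apply/ler_addgt0Pr => e e0; set t := 2 * r + e / (2 * N).
  have eN : 0 < e / (2 * N) by rewrite divr_gt0// mulr_gt0.
  have t0 : 0 < t by rewrite ltr_wpDl// mulr_ge0.
  have h1 := h t t0; have h2 : A * (r / t) <= A * 2^-1.
    apply: ler_wpM2l => //; rewrite ler_pdivrMr// /t; lra.
  have e3 : t * N = 2 * r * N + e / 2 by rewrite /t mulrDl; congr (_ + _); field; rewrite gt_eqF.
  rewrite e3 in h1; lra.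
have -> : 16 * M * N ^+ 2 * E = (4 * r * N) ^+ 2.
  by rewrite !exprMn /r sqr_sqrtr ?mulr_ge0//; ring.
by rewrite ler_pXn2r ?nnegrE// !mulr_ge0// ltW.
Qed.

End Clip.

Section FormInequalities.
Context {R : realType}.
Variables (a : R) (f : R * R -> R) (c C : R).
Local Notation plane := (R * R)%type.
Local Notation mu := (leb2 R).
Local Notation I := (fiber a).
Local Notation D := (strip a).
Hypotheses (a0 : 0 < a) (mf : measurable_fun D f) (c0 : 0 < c)
  (hf : forall x, D x -> c <= f x <= C) (C0 : 0 < C).
Let mD := (fun d (T : measurableType d) (_ : {measure set T -> \bar R}) (A : set T)
  (h : measurable A) => h) _ _ mu D (strip_measurable a).
Let mI := (fun d (T : measurableType d) (_ : {measure set T -> \bar R}) (A : set T)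
  (h : measurable A) => h) _ _ (leb R) I (fiber_measurable a).
Let H := hilbert_ipw mf c0 hf.
Let F := jacobi_formP mf c0 hf C0.
Local Notation nrm1 := (ipn (ipw (a := a) (cst 1))).
Local Notation L := (L2r a).

Definition testH (p : plane -> R) (tp : test_function D p) : H10r a := mkH (h10_test tp).

Lemma h10_seq (x : H10r a) : exists (p_ : nat -> plane -> R) (tp : forall n, test_function D (p_ n)),
  [/\ nrm1 (Hpi (testH (tp n)) - Hpi x) @[n --> \oo] --> (0 : R),
     nrm1 (Hd1 (testH (tp n)) - Hd1 x) @[n --> \oo] --> (0 : R) &
     nrm1 (Hd2 (testH (tp n)) - Hd2 x) @[n --> \oo] --> (0 : R)].
Proof.
have [_ ap] := H10rP x.
have e0 n : 0 < n.+1%:R^-1 :> R by rewrite invr_gt0.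
have /choice[p_ hp] n : exists p, test_function D p /\
    n2 a (fun y => Hpi x y - p y) + n2 a (fun y => Hd1 x y - 'D_e1 p y) + n2 a (fun y => Hd2 x y - 'D_e2 p y) <= n.+1%:R^-1.
  by have [p tp h] := ap _ (e0 n); exists p.
exists p_, (fun n => proj1 (hp n)).
have key (u_ : nat -> L) (u : L) : (forall n, n2 a (fun y => u y - u_ n y) <= n.+1%:R^-1) ->
    nrm1 (u_ n - u) @[n --> \oo] --> (0 : R).
  move=> h; apply: cvg_sqrt0.
  apply: (squeeze_cvgr _ (cvg_cst 0) (@cvg_harmonic R)); apply: nearW => n.
  rewrite (ip_ge0 (@hilbert1 R a))/=; apply: le_trans (h n); rewrite -n2_ip le_eqVlt; apply/orP; left; apply/eqP.
  by apply: eq_Rintegral => y _; rewrite L2rB -sqrrN opprB.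
have g0 := n2_ge0 a.
split; apply: key => n; apply: le_trans (proj2 (hp n)).
- exact: le_sum1 (g0 _) (g0 _).
- exact: le_sum2 (g0 _) (g0 _).
- exact: le_sum3 (g0 _) (g0 _).
Qed.

Lemma nrm_cvg (w : plane -> R) (b B : R) (u_ : nat -> L) (u : L) : measurable_fun D w -> 0 < b ->
  (forall x, D x -> b <= w x <= B) -> nrm1 (u_ n - u) @[n --> \oo] --> (0 : R) ->
  ipw w (u_ n) (u_ n) @[n --> \oo] --> ipw w u u.
Proof.
move=> mw b0 hw hu; have Hw := hilbert_ipw mw b0 hw.
have h1 : ipn (ipw w) (u_ n - u) @[n --> \oo] --> (0 : R).
  have h2 : Num.sqrt B * nrm1 (u_ n - u) @[n --> \oo] --> (Num.sqrt B * 0 : R) by apply: cvgM => //; exact: cvg_cst.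
  rewrite mulr0 in h2; apply: (squeeze_cvgr _ (cvg_cst 0) h2); apply: nearW => n.
  rewrite ipn_ge0/= /ipn; have [B0|B0] := leP 0 B.
    rewrite -sqrtrM// ler_sqrt ?mulr_ge0 ?(ip_ge0 (@hilbert1 R a))// -n2_ip.
    exact: (ipw_ub mw b0 hw).
  rewrite [X in X <= _]ler0_sqrtr ?mulr_ge0 ?sqrtr_ge0//.
  by apply: le_trans (ipw_ub mw b0 hw _) _; rewrite nmulr_rle0// n2_ge0.
have h3 : ipn (ipw w) (u_ n) @[n --> \oo] --> ipn (ipw w) u by exact: (cvg_ipn Hw).
have : ipn (ipw w) (u_ n) * ipn (ipw w) (u_ n) @[n --> \oo] --> ipn (ipw w) u * ipn (ipw w) u by exact: cvgM.
by rewrite -expr2 (sqr_ipn Hw); under eq_fun do rewrite -expr2 (sqr_ipn Hw).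
Qed.

Lemma exterior_arith (dl E F0 P0 P1 : R) : 0 <= dl -> dl < 1 -> 0 <= E -> 0 <= P0 -> 0 <= P1 ->
  - dl <= F0 - 1 -> F0 - 1 <= dl ->
  (1 - dl) * P0 - (1 - dl) * E * P1 <= F0 * P0 - (1 - dl) / (1 + dl) * E * (F0 * P1).
Proof.
move=> d0 d1 E0 P00 P10 f1 f2; apply: lerB; first by apply: ler_wpM2r => //; lra.
rewrite -(mulrA (1 - dl)) -mulrA -(mulrA (1 - dl) E); apply: ler_wpM2l; first by rewrite subr_ge0 ltW.
have d1' : 0 < 1 + dl by rewrite ltr_pwDl.
rewrite (mulrC (1 + dl)^-1) -mulrA; apply: ler_wpM2l => //; rewrite ler_pdivrMl//.
by apply: ler_wpM2r => //; lra.
Qed.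

(** * Lower bound of the form far out in the strip *)

Section Exterior.
Variables (Rad dl : R).
Hypotheses (d0 : 0 <= dl) (d1 : dl < 1)
  (far : forall x, D x -> Rad < `|x.1| -> `|f x - 1| <= dl).

Local Notation Q := [set x : plane | `|x.1| <= Rad].
Definition inner_mass (u : L) := \int[mu]_(x in D) (u x * u x * (f x * \1_Q x)).

(** The weight [f * \1_Q] has zeros, whereas [w2] is bounded below: the inner mass becomes a
    difference of two admissible inner products, which pass to limits. *)
Let w2 (x : plane) := f x * (1 + \1_Q x).
Let mQ : measurable_for mu Q.
Proof.
have -> : Q = `[- Rad, Rad]%classic `*` setT.
  by apply/seteqP; split => x; rewrite /= in_itv/= ler_norml//; case.
by apply: measurableX => //; exact: measurable_itv.
Qed.
Let m1Q : measurable_fun D (\1_Q : plane -> R).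
Proof. exact: measurable_indic. Qed.
Let mw2 : measurable_fun D w2.
Proof. by apply: measurable_funM => //; apply: measurable_funD. Qed.
Let ind01 (x : plane) : 0 <= (\1_Q x : R) <= 1.
Proof. by rewrite indicE; case: (x \in Q); rewrite ?lexx ?ler01. Qed.
Let hw2 x : D x -> c <= w2 x <= 2 * C.
Proof.
move=> Dx; have /andP[h1 h2] := hf Dx; have /andP[i0 i1] := ind01 x; rewrite /w2.
have f0 : 0 <= f x := le_trans (ltW c0) h1.
have t0 := mulr_ge0 f0 i0; have t1 : f x * \1_Q x <= f x * 1 by exact: ler_wpM2l.
rewrite mulr1 in t1; rewrite mulrDr mulr1; move: (f x * \1_Q x) t0 t1 h1 h2 => t t0 t1 h1 h2.
by apply/andP; split; [apply: le_trans h1 _; rewrite lerDl|apply: le_trans (lerD h2 (le_trans t1 h2)) _; rewrite mulrDl mul1r].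
Qed.

Lemma inner_massE u : inner_mass u = ipw w2 u u - ipw f u u.
Proof.
have i1 := wip_int mD mw2 c0 hw2 (L2rP u) (L2rP u); have i2 := wip_int mD mf c0 hf (L2rP u) (L2rP u).
rewrite /ipw /wip -RintegralB//; apply: eq_Rintegral => x _; rewrite /w2.
by move: (u x) (f x) (\1_Q x : R) => p q r; ring.
Qed.

Lemma test_slice2 (p : plane -> R) x1 : test_function D p -> test_function I (fun y => p (x1, y)).
Proof.
move=> [sp [A [cA AD eA]]]; split; last first.
  exists (snd @` A); split.
  - by apply: continuous_compact cA; apply: continuous_subspaceT; exact: snd_continuous.
  - by move=> _ [x Ax <-]; exact: AD.
  - by move=> y hy; apply: eA => Ax; apply: hy; exists (x1, y).
exact: smooth_slice2.
Qed.

Let th := (1 - dl) / (1 + dl) * E1 a.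

(** On slices beyond [Rad] the Poincare inequality is used with [f >= 1 - dl] in the energy and
    [f <= 1 + dl] in the mass, whence the factor in [th]; on the other slices no mass is counted and
    the energy is nonnegative. *)
Lemma exterior_test (p : plane -> R) (tp : test_function D p) (x := testH tp) :
  th * (2 * ipw f (Hpi x) (Hpi x) - ipw w2 (Hpi x) (Hpi x)) <= ipw f (Hd2 x) (Hd2 x).
Proof.
have E0 : 0 <= E1 a by exact: sqr_ge0.
have th0 : 0 <= th by rewrite mulr_ge0// divr_ge0// ?subr_ge0 ?(ltW d1)// addr_ge0.
have fM y : D y -> `|f y| <= C.
  by move=> Dy; have /andP[h1 h2] := hf Dy; rewrite ger0_norm// (le_trans (ltW c0)).
have wM y : D y -> `|f y * (1 - \1_Q y)| <= C.
  move=> Dy; rewrite normrM -[leRHS]mulr1; apply: ler_pM => //; first exact: fM.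
  by have /andP[i0 i1] := ind01 y; rewrite ger0_norm; lra.
have mw : measurable_fun D (fun y => f y * (1 - \1_Q y)).
  by apply: measurable_funM => //; apply: measurable_funB.
have tpp : test_function D (fun y => p y * p y) by apply: test_mul => //; exact: test_smooth tp.
have td : test_function D ('D_e2 p) by apply: test_D => //; exact: plane_hausdorff.
have tdd : test_function D (fun y => 'D_e2 p y * 'D_e2 p y) by apply: test_mul => //; exact: test_smooth td.
have int (w q : plane -> R) : measurable_fun D w -> (forall y, D y -> `|w y| <= C) -> test_function D q ->
    mu.-integrable D (EFin \o (fun y => w y * q y)).
  move=> mw' hw tq; apply: (int_le_integrable mD _ _ (int_scale mD C (int_abs (test_int (strip_measurable a) tq)))).
    apply: measurable_funM => //; apply: measurable_continuous; first exact: strip_measurable.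
    exact/smooth_continuous/(test_smooth tq).
  by move=> y Dy; rewrite normrM ler_wpM2r// hw.
have i1 := int _ _ mf fM tdd; have i2 := int _ _ mw wM tpp.
have s1 x1 := slice_int x1 mf fM (test_slice2 x1 tdd).
have s2 x1 := slice_int x1 mw wM (test_slice2 x1 tpp).
have := @fubini_ge0 _ a (fun y => f y * ('D_e2 p y * 'D_e2 p y) - th * (f y * (1 - \1_Q y) * (p y * p y))).
have -> : \int[mu]_(y in D) (f y * ('D_e2 p y * 'D_e2 p y) - th * (f y * (1 - \1_Q y) * (p y * p y))) =
    ipw f (Hd2 x) (Hd2 x) - th * (2 * ipw f (Hpi x) (Hpi x) - ipw w2 (Hpi x) (Hpi x)).
  rewrite RintegralB//; last exact: int_scale.
  rewrite RintegralZl//; congr (_ - _ * _); first by apply: eq_Rintegral => y _ /=; ring.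
  have j1 := wip_int mD mw2 c0 hw2 (L2rP (Hpi x)) (L2rP (Hpi x)).
  have j2 := wip_int mD mf c0 hf (L2rP (Hpi x)) (L2rP (Hpi x)).
  rewrite /ipw /wip -RintegralZl// -RintegralB//; last exact: int_scale.
  apply: eq_Rintegral => y _ /=; rewrite /w2.
  by move: (p y) (f y) (\1_Q y : R) => u v z; ring.
rewrite subr_ge0; apply.
- by apply: int_sub => //; exact: int_scale.
- by move=> x1; apply: (int_sub mI (s1 x1)); exact: int_scale.
move=> x1; have tps := test_slice2 x1 tp.
have ds : 'D_1 (fun y => p (x1, y)) = fun y => 'D_e2 p (x1, y) by apply/funext => y; exact: derive_slice2.
have pc := poincare1 a0 tps.
have e : \int[leb R]_(y in I) ('D_1 (fun y => p (x1, y)) y ^+ 2) = \int[leb R]_(y in I) ('D_e2 p (x1, y) ^+ 2).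
  by apply: eq_Rintegral => y _; congr (_ ^+ 2); exact: (congr1 (fun g : R -> R => g y) ds).
rewrite [X in _ <= X]e in pc.
have [xQ|xQ] := leP `|x1| Rad.
  have iq y : \1_Q (x1, y) = 1 :> R by rewrite indicE mem_set.
  apply: Rintegral_ge0 => y Iy; rewrite iq subrr mulr0 mul0r mulr0 subr0.
  have /andP[h1 _] := hf (x := (x1, y)) Iy.
  by apply: mulr_ge0; [exact: le_trans (ltW c0) h1|rewrite -expr2; exact: sqr_ge0].
have k1 := test_sqr_int (test_slice2 x1 td); have k2 := test_sqr_int tps.
have m0 : 0 <= \int[leb R]_(y in I) ((1 - dl) * 'D_e2 p (x1, y) ^+ 2 - ((1 - dl) * E1 a) * p (x1, y) ^+ 2).
  rewrite (Rint_sub2 mI (1 - dl) ((1 - dl) * E1 a) k1 k2) -mulrA -mulrBr.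
  by apply: mulr_ge0; rewrite subr_ge0 ?(ltW d1).
apply: (le_trans m0); apply: (le_Rint mI (int_sub mI (int_scale mI (1 - dl) k1) (int_scale mI ((1 - dl) * E1 a) k2))
  (int_sub mI (s1 x1) (int_scale mI th (s2 x1)))).
move=> y Iy /=; have nQ : ((x1, y) \in Q) = false by apply/negbTE/negP => /set_mem /=; rewrite leNgt xQ.
have := far (x := (x1, y)) Iy xQ; rewrite ler_norml => /andP[f1 f2].
rewrite indicE nQ subr0 mulr1 -!expr2.
exact: (exterior_arith d0 d1 (sqr_ge0 (pi / (2 * a))) (sqr_ge0 ('D_e2 p (x1, y))) (sqr_ge0 (p (x1, y))) f1 f2).
Qed.

Lemma exterior_form (x : H10r a) : th * (ipw f (Hpi x) (Hpi x) - inner_mass (Hpi x)) <= qf f x x.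
Proof.
have -> : ipw f (Hpi x) (Hpi x) - inner_mass (Hpi x) = 2 * ipw f (Hpi x) (Hpi x) - ipw w2 (Hpi x) (Hpi x).
  by rewrite inner_massE; ring.
have [p_ [tp [c1 _ c2]]] := h10_seq x.
have l1 := nrm_cvg mf c0 hf c1; have l2 := nrm_cvg mw2 c0 hw2 c1; have l3 := nrm_cvg mf c0 hf c2.
have hV : 0 <= ipw (fun x => (f x)^-1) (Hd1 x) (Hd1 x).
  by apply: (ip_ge0 (hilbert_ipw (mfV mf c0 hf) _ (hfV c0 hf))); rewrite invr_gt0.
apply: (@le_trans _ _ (ipw f (Hd2 x) (Hd2 x))); last by rewrite /qf lerDr.
have l4 : ipw f (Hd2 (testH (tp n))) (Hd2 (testH (tp n))) - th * (2 * ipw f (Hpi (testH (tp n))) (Hpi (testH (tp n))) -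
     ipw w2 (Hpi (testH (tp n))) (Hpi (testH (tp n)))) @[n --> \oo] -->
   ipw f (Hd2 x) (Hd2 x) - th * (2 * ipw f (Hpi x) (Hpi x) - ipw w2 (Hpi x) (Hpi x)).
  apply: cvgB => //; apply: cvgM; first exact: cvg_cst.
  by apply: cvgB => //; apply: cvgM => //; exact: cvg_cst.
rewrite -subr_ge0; apply: (cvgr_to_ge l4); apply: nearW => n.
by rewrite subr_ge0; exact: exterior_test.
Qed.

End Exterior.

(** * The Nash inequality *)

Section Nash.

Lemma supp_integral (g : plane -> R) : (forall x, ~ D x -> g x = 0) ->
  (\int[mu]_x (g x)%:E = \int[mu]_(x in D) (g x)%:E)%E.
Proof.
move=> g0; rewrite [RHS]integral_mkcond; apply: eq_integral => x _; rewrite patchE; case: ifPn => // /negP xD.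
by rewrite g0// => Dx; apply: xD; exact: mem_set.
Qed.

Lemma l2_abs (u : L) : l2 mu D (fun x => `|u x|).
Proof.
have mu_ := l2_meas (L2rP u); apply: (l2_le mD _ (L2rP u)); first exact: measurableT_comp.
by move=> x _; rewrite normr_id.
Qed.

Lemma test_CS (u v : L) : \int[mu]_(x in D) (`|u x| * `|v x|) <= nrm1 u * nrm1 v.
Proof.
have e (z : L) : nrm1 (mkL (l2_abs z)) = nrm1 z.
  rewrite /ipn -!n2_ip; congr (Num.sqrt _); apply: eq_Rintegral => x _ /=.
  by rewrite real_normK ?num_real.
have := ip_le (hilbert1 a) (mkL (l2_abs u)) (mkL (l2_abs v)); rewrite !e; apply: le_trans.
by rewrite le_eqVlt; apply/orP; left; apply/eqP; apply: eq_Rintegral => x _ /=; rewrite mulr1.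
Qed.

(** [gagliardo] for the square of [p], whose partial derivatives are [2 p] times those of [p],
    followed by Cauchy-Schwarz. *)
Lemma test_quartic (p : plane -> R) (tp : test_function D p) (x := testH tp) :
  \int[mu]_(y in D) (p y ^+ 4) <= 2 * n2 a (Hpi x) * (n2 a (Hd1 x) + n2 a (Hd2 x)).
Proof.
have tu : test_function D (fun y => p y * p y) by apply: test_mul => //; exact: test_smooth tp.
have su := test_smooth tu; have [b [_ [_ _ _ hb]]] := test_box tu.
have pa y : ~ D y -> p y = 0 by have [_ [A [_ AD eA]]] := tp; move=> Dy; apply: eA => /AD.
have dE v y : 'D_v (fun y => p y * p y) y = 2 * (p y * 'D_v p y).
  rewrite (@deriveM _ _ p p); last 2 first; [exact/smooth_derivable/(test_smooth tp)|exact/smooth_derivable/(test_smooth tp)|].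
  by rewrite /GRing.scale/=; ring.
have hG := gagliardo su hb.
have i4 : mu.-integrable D (EFin \o (fun y => (p y * p y) ^+ 2)).
  exact: (l2_sqr_int (test_l2 (strip_measurable a) tu)).
have e4 : (\int[mu]_y ((p y * p y) ^+ 2)%:E = (\int[mu]_(y in D) (p y ^+ 4))%:E)%E.
  rewrite (supp_integral (g := fun y => (p y * p y) ^+ 2)); last by move=> y /pa ->; rewrite mul0r expr0n.
  by rewrite (EFin_int mD i4); congr (_%:E); apply: eq_Rintegral => y _; rewrite -expr2 -exprM.
have ev v (u : L) : (u : plane -> R) = 'D_v p -> (\int[mu]_y `|'D_v (fun y => p y * p y) y|%:E <= (2 * (nrm1 (Hpi x) * nrm1 u))%:E)%E.
  move=> eu; have ia : mu.-integrable D (EFin \o (fun y => `|Hpi x y| * `|u y|)).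
    exact: (l2_mul_int mD (l2_abs (Hpi x)) (l2_abs u)).
  have e y : `|'D_v (fun y => p y * p y) y| = 2 * (`|Hpi x y| * `|u y|).
    by rewrite dE eu !normrM ger0_norm.
  under eq_integral do rewrite e.
  rewrite (supp_integral (g := fun y => 2 * (`|Hpi x y| * `|u y|))); last first.
    by move=> y /pa; rewrite /= => ->; rewrite normr0 mul0r mulr0.
  rewrite (EFin_int mD (int_scale mD 2 ia)) lee_fin (Rint_scale mD 2 ia).
  by apply: ler_wpM2l => //; exact: test_CS.
have h0 v : (0 <= \int[mu]_y `|'D_v (fun y => (p y * p y)%R) y|%:E)%E by apply: integral_ge0 => y _; rewrite lee_fin.
have := le_trans hG (lee_pmul (h0 e1) (h0 e2) (ev e1 (Hd1 x) erefl) (ev e2 (Hd2 x) erefl)).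
rewrite e4 -EFinM lee_fin => /le_trans; apply.
have nn (u : L) : n2 a u = nrm1 u ^+ 2 by rewrite n2_ip (sqr_ipn (hilbert1 a)).
exact: (quartic_arith (nn (Hpi x)) (nn (Hd1 x)) (nn (Hd2 x))).
Qed.

Variable k : R.
Hypothesis k0 : 0 < k.

Lemma l2_clip (u : L) : l2 mu D (fun x => clip k (u x)).
Proof.
apply: (l2_le mD _ (L2rP u)); first by apply: measurable_clip; exact: l2_meas (L2rP u).
by move=> x _; exact: clip_norm.
Qed.
Definition clipL (u : L) : L := mkL (l2_clip u).
Definition excL (u : L) : L := u - clipL u.

Lemma excess_test (p : plane -> R) (tp : test_function D p) (x := testH tp) :
  n2 a (excL (Hpi x)) <= n2 a (Hpi x) * (n2 a (Hd1 x) + n2 a (Hd2 x)) / (8 * k ^+ 2).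
Proof.
have tu : test_function D (fun y => p y * p y) by apply: test_mul => //; exact: test_smooth tp.
have i4 : mu.-integrable D (EFin \o (fun y => p y ^+ 4)).
  have := l2_sqr_int (test_l2 (strip_measurable a) tu).
  by congr (mu.-integrable D _); apply/funext => y /=; rewrite -expr2 -exprM.
apply: (excess_arith (exprn_gt0 2 k0) _ (test_quartic tp)).
rewrite -(Rint_scale mD _ i4); apply: (le_Rint mD).
- exact: (l2_sqr_int (L2rP (excL (Hpi x)))).
- exact: (int_scale mD _ i4).
- by move=> y _; rewrite L2rB /= mulrC; exact: (excess_quartic k0).
Qed.

(** Fourth powers occur for test functions only: the excess over height [k] is a Lipschitz function
    of [u], so its L^2 norm passes to the limit directly. *)
Lemma excess_form (x : H10r a) :
  n2 a (excL (Hpi x)) <= n2 a (Hpi x) * (n2 a (Hd1 x) + n2 a (Hd2 x)) / (8 * k ^+ 2).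
Proof.
have [p_ [tp [c1 c2 c3]]] := h10_seq x.
have m1 : measurable_fun D (cst 1 : plane -> R) by exact: measurable_cst.
have h1 y : D y -> (1 : R) <= (cst 1 : plane -> R) y <= 1 by move=> _; rewrite lexx.
have c4 : nrm1 (excL (Hpi (testH (tp n))) - excL (Hpi x)) @[n --> \oo] --> (0 : R).
  apply: (squeeze_cvgr _ (cvg_cst 0) c1); apply: nearW => n; rewrite ipn_ge0/= /ipn ler_sqrt ?(ip_ge0 (hilbert1 a))//.
  rewrite -!n2_ip; apply: le_Rintegral => //; [exact: (l2_sqr_int (L2rP _))|exact: (l2_sqr_int (L2rP _))|].
  move=> y _; rewrite !L2rB/= -[leLHS](real_normK (num_real _)) -[leRHS](real_normK (num_real _)).
  by rewrite ler_pXn2r ?nnegrE//; exact: (excess_lip k0).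
have l1 := nrm_cvg m1 ltr01 h1 c1; have l2 := nrm_cvg m1 ltr01 h1 c2; have l3 := nrm_cvg m1 ltr01 h1 c3.
have l4 := nrm_cvg m1 ltr01 h1 c4; rewrite (n2_ip (Hpi x)) (n2_ip (Hd1 x)) (n2_ip (Hd2 x)) (n2_ip (excL (Hpi x))) -subr_ge0.
have l5 : ipw (cst 1) (Hpi (testH (tp n))) (Hpi (testH (tp n))) * (ipw (cst 1) (Hd1 (testH (tp n))) (Hd1 (testH (tp n))) +
    ipw (cst 1) (Hd2 (testH (tp n))) (Hd2 (testH (tp n)))) / (8 * k ^+ 2) -
    ipw (cst 1) (excL (Hpi (testH (tp n)))) (excL (Hpi (testH (tp n)))) @[n --> \oo] -->
    ipw (cst 1) (Hpi x) (Hpi x) * (ipw (cst 1) (Hd1 x) (Hd1 x) + ipw (cst 1) (Hd2 x) (Hd2 x)) / (8 * k ^+ 2) -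
    ipw (cst 1) (excL (Hpi x)) (excL (Hpi x)).
  by apply: cvgB => //; apply: cvgM; [apply: cvgM => //; exact: cvgD|exact: cvg_cst].
apply: (cvgr_to_ge l5); apply: nearW => n.
pose X := testH (tp n).
exact: (excess_eq (n2_ip (excL (Hpi X))) (n2_ip (Hpi X)) (n2_ip (Hd1 X)) (n2_ip (Hd2 X)) (excess_test (tp n))).
Qed.

End Nash.

(** Bounds on pairings with these functions stand for bounds on the weighted L^1 norm, with no
    integrability to be checked. *)
Definition unit_ball : set L := [set g | forall x, D x -> `|g x| <= 1].

(** [u] is split into its truncation at height [k], whose pairing with [u] is at most [k N], and the
    excess, whose norm is controlled by the quartic inequality; [nash_arith] then chooses [k]. *)
Lemma nash (N : R) : 0 < N -> exists2 kap, 0 < kap & forall x : H10r a,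
  (forall g, unit_ball g -> ipw f (Hpi x) g <= N) -> kap * ipw f (Hpi x) (Hpi x) ^+ 2 <= qf f x x.
Proof.
move=> N0; set b := Num.min C^-1 c; have b0 : 0 < b by rewrite lt_min invr_gt0 C0.
set M := C / (8 * c * b); have M0 : 0 < M by rewrite divr_gt0// !mulr_gt0.
have q0 : 0 < 16 * M * N ^+ 2 by apply: mulr_gt0; [exact: mulr_gt0|exact: exprn_gt0].
exists (16 * M * N ^+ 2)^-1; first by rewrite invr_gt0.
move=> x hx; set A := ipw f (Hpi x) (Hpi x); set E := qf f x x.
have A0 : 0 <= A by exact: (ip_ge0 H).
have g0 := n2_ge0 a.
have EE : b * (n2 a (Hd1 x) + n2 a (Hd2 x)) <= E.
  rewrite mulrDr; apply: lerD.
    apply: le_trans _ (ipw_lb (mfV mf c0 hf) _ (hfV c0 hf) (Hd1 x)); last by rewrite invr_gt0.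
    by apply: ler_wpM2r; [exact: g0|rewrite ge_min lexx].
  apply: le_trans _ (ipw_lb mf c0 hf (Hd2 x)).
  by apply: ler_wpM2r; [exact: g0|rewrite ge_min lexx orbT].
have AA : c * n2 a (Hpi x) <= A by exact: (ipw_lb mf c0 hf).
have E0 : 0 <= E by apply: le_trans EE; rewrite mulr_ge0 ?(ltW b0)// addr_ge0.
rewrite (ler_pdivrMl _ _ q0); apply: nash_arith => //; first exact: ltW.
move=> k k0; have lg : l2 mu D (fun y => k^-1 * clip k (Hpi x y)) by exact: (l2_scale mD _ (l2_clip k0 (Hpi x))).
have ug : unit_ball (mkL lg).
  by move=> y _; rewrite /= normrM gtr0_norm ?invr_gt0// ler_pdivrMl// mulr1 clip_le.
have h1 : ipw f (Hpi x) (clipL k0 (Hpi x)) <= k * N.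
  have -> : ipw f (Hpi x) (clipL k0 (Hpi x)) = k * ipw f (Hpi x) (mkL lg).
    rewrite -(Rint_scale mD k (wip_int mD mf c0 hf (L2rP (Hpi x)) (L2rP (mkL lg)))).
    by apply: eq_Rintegral => y _ /=; field; rewrite gt_eqF.
  by rewrite ler_pM2l//; exact: hx.
have h2 : ipw f (Hpi x) (excL k0 (Hpi x)) <= A * (Num.sqrt (M * E) / k).
  apply: le_trans (ip_le H _ _) _.
    have e2 : ipw f (excL k0 (Hpi x)) (excL k0 (Hpi x)) <= A * (Num.sqrt (M * E) / k) ^+ 2.
    apply: le_trans (ipw_ub mf c0 hf _) _; have := excess_form k0 x.
    have ME : 0 <= M * E by rewrite mulr_ge0// ltW.
    rewrite expr_div_n (sqr_sqrtr ME) /M.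
    by move=> h; apply: (nash_mass_arith k0 _ _ _ C0 c0 b0 AA EE h); [exact: g0|exact: g0|exact: addr_ge0 (g0 _) (g0 _)].
  have -> : A * (Num.sqrt (M * E) / k) = ipn (ipw f) (Hpi x) * (ipn (ipw f) (Hpi x) * (Num.sqrt (M * E) / k)).
    by rewrite mulrA -expr2 (sqr_ipn H).
  apply: ler_wpM2l; first exact: ipn_ge0.
  have r0 : 0 <= Num.sqrt (M * E) / k by rewrite divr_ge0 ?sqrtr_ge0// ltW.
  have r1 : 0 <= ipn (ipw f) (Hpi x) * (Num.sqrt (M * E) / k) by apply: mulr_ge0 => //; exact: ipn_ge0.
  rewrite -(@ler_pXn2r _ 2) ?nnegrE ?r1 ?ipn_ge0//.
  by rewrite exprMn !(sqr_ipn H).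
have := lerD h1 h2; rewrite -(ipDr H).
by have -> : clipL k0 (Hpi x) + excL k0 (Hpi x) = Hpi x by rewrite addrC subrK.
Qed.
End FormInequalities.

(** * Ultracontractivity and the ground state *)

Section AlmostEverywhereOrder.
Context {d} {T : measurableType d} {R : realType} (mu : {measure set T -> \bar R}).
Variables (D : set T) (mD : measurable D).
Implicit Type h : T -> R.

Lemma ae_and (P Q : T -> Prop) : {ae mu, forall x, P x} -> {ae mu, forall x, Q x} -> {ae mu, forall x, P x /\ Q x}.
Proof. exact: ae_imp2. Qed.

Lemma Rint_ge0_ae h : mu.-integrable D (EFin \o h) -> {ae mu, forall x, D x -> 0 <= h x} ->
  0 <= \int[mu]_(x in D) h x.
Proof.
move=> ih h0; have mh := measurable_int _ ih.
have -> : \int[mu]_(x in D) h x = \int[mu]_(x in D) `|h x|.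
  congr fine; apply: ae_eq_integral => //.
    by apply/measurable_EFinP; apply: measurableT_comp => //; exact/measurable_EFinP.
  by apply: (ae_imp _ h0) => x hx Dx /=; rewrite ger0_norm// hx.
by apply: Rintegral_ge0.
Qed.

Lemma Rint0_ae h : mu.-integrable D (EFin \o h) -> (forall x, D x -> 0 <= h x) ->
  \int[mu]_(x in D) h x <= 0 -> {ae mu, forall x, D x -> h x = 0}.
Proof.
move=> ih h0 hI; have mh := measurable_int _ ih.
have e : (\int[mu]_(x in D) `|(h x)%:E| = 0)%E.
  transitivity (\int[mu]_(x in D) h x)%:E; last first.
    by congr (_%:E); apply/eqP; rewrite eq_le hI Rintegral_ge0.
  rewrite -(EFin_int mD ih); apply: eq_integral => x /set_mem Dx.
  by rewrite gee0_abs// lee_fin h0.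
have [h1 _] := ae_eq_integral_abs mu mD mh.
by apply: (ae_imp _ (h1 e)) => x hx /hx [].
Qed.

End AlmostEverywhereOrder.

Section Plane.
Context {R : realType}.
Local Notation plane := (R * R)%type.
Local Notation mu := (leb2 R).

Lemma itv_mass (x e : R) : 0 < e -> (0 < leb R (`](x - e)%R, (x + e)%R[%classic : set R))%E.
Proof.
move=> e0; rewrite lebesgue_measure_itv/= lte_fin ltrD2l gtrN// -EFinD lte_fin.
by rewrite opprD opprK addrACA subrr add0r addr_gt0.
Qed.

Lemma ae_open_exists (O : set plane) (x : plane) (Q : plane -> Prop) : nbhs x O ->
  {ae mu, forall y, Q y} -> exists2 y, O y & Q y.
Proof.
move=> /nbhs_ballP[e /= e0 hO] [N [mN N0 hN]].
pose B : set plane := `](x.1 - e)%R, (x.1 + e)%R[%classic `*` `](x.2 - e)%R, (x.2 + e)%R[%classic.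
have BO : B `<=` O.
  move=> y [/=]; rewrite !in_itv/= => /andP[h1 h2] /andP[h3 h4]; apply: hO; split; rewrite /ball/= ltr_norml;
    apply/andP; split; lra.
have Bm : (0 < mu B)%E.
  rewrite product_measure1E; [|exact: measurable_itv|exact: measurable_itv].
  by apply: mule_gt0; exact: itv_mass.
apply: contrapT => h; have BN : B `<=` N.
  by move=> y By; apply: hN => Qy; apply: h; exists y => //; exact: BO.
have mB : measurable_for mu B by apply: measurableX; exact: measurable_itv.
have h1 : (mu B <= 0)%E by rewrite -N0; apply: le_measure => //; rewrite inE.
by move: (lt_le_trans Bm h1); rewrite ltxx.
Qed.

Lemma cont_le_ae (O : set plane) (u v : plane -> R) : open O ->
  {in O, continuous u} -> {in O, continuous v} ->
  {ae mu, forall x, O x -> u x <= v x} -> forall x, O x -> u x <= v x.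
Proof.
move=> oO cu cv h x Ox; rewrite leNgt; apply/negP => vu.
have cw : (u y - v y) @[y --> x] --> (u x - v x).
  by apply: cvgB; [apply: cu|apply: cv]; exact: mem_set.
have p0 : 0 < u x - v x by rewrite subr_gt0.
have n1 : \forall y \near x, 0 < u y - v y by exact: cvgr_gt cw _ p0.
have n2 : nbhs x [set y | O y /\ 0 < u y - v y].
  by apply: filterI => //; exact: open_nbhs_nbhs.
have [y [Oy uvy] hy] := ae_open_exists n2 h.
by have := hy Oy; rewrite -subr_le0 leNgt uvy.
Qed.

Lemma plane_norm_le (x : plane) (r : R) : (`|x| <= r) = (`|x.1| <= r) && (`|x.2| <= r).
Proof. by rewrite prod_normE/= ge_max. Qed.

Lemma bounded_box (B : set plane) : bounded_set B -> exists2 b, 0 < b & B `<=` box b.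
Proof.
move=> /ex_strict_bound_gt0[b b0 hb]; exists b => // x Bx.
by have := ltW (hb x Bx); rewrite plane_norm_le => /andP[].
Qed.

Lemma bounded_sub (B B' : set plane) : bounded_set B -> B' `<=` B -> bounded_set B'.
Proof. by move=> [M [rM hM]] h; exists M; split => // r Mr x /h; exact: hM. Qed.

Lemma box_bounded (b : R) : bounded_set (box b : set plane).
Proof.
exists b; split; first exact: num_real.
move=> r br x [h1 h2]; have -> : [set x0 : plane | `|x0| <= r] x = (`|x| <= r) by [].
by rewrite plane_norm_le (le_trans h1 (ltW br)) (le_trans h2 (ltW br)).
Qed.

Lemma box_measurable (b : R) : measurable_for mu (box b).
Proof.
have -> : box b = `[- b, b]%classic `*` `[- b, b]%classic.
  by apply/seteqP; split => x; rewrite /box /= !in_itv/= !ler_norml => -[].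
by apply: measurableX; exact: measurable_itv.
Qed.

Lemma in_some_box (x : plane) : exists N : nat, forall n : nat, (N <= n)%N -> box n%:R x.
Proof.
exists (Num.truncn `|x|).+1 => n hn; have : `|x| <= n%:R.
  by apply: le_trans (ltW (truncnS_gt _)) _; rewrite ler_nat.
by rewrite plane_norm_le => /andP[].
Qed.

Lemma gt0_preimage (g : plane -> R) : [set y | 0 < g y] = g @^-1` `]0, +oo[%classic.
Proof. by apply/funext => y; apply/propext; rewrite /= in_itv/= andbT. Qed.

End Plane.

Section UniformLimit.
Context {R : realType} {T : topologicalType}.
Variable D : set T.
Hypothesis oD : open D.

Lemma uniform_limit (W_ : nat -> T -> R) (e_ : nat -> R) : e_ n @[n --> \oo] --> (0 : R) ->
  (forall n, {in D, continuous (W_ n)}) ->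
  (forall n m x, D x -> `|W_ n x - W_ m x| <= e_ n + e_ m) ->
  exists W : T -> R, {in D, continuous W} /\ forall n x, D x -> `|W_ n x - W x| <= e_ n.
Proof.
move=> e0 cW hW; pose W x := lim (W_ n x @[n --> \oo]).
have small (d : R) : 0 < d -> exists N : nat, forall n, (N <= n)%N -> e_ n < d.
  by move=> d0; have [N _ hN] := cvgr_lt (0 : R) e0 _ d0; exists N.
have cvgW x : D x -> W_ n x @[n --> \oo] --> W x.
  move=> Dx; apply/cauchy_cvgP/cauchy_exP => d d0.
  have d2 : 0 < d / 2 by rewrite divr_gt0.
  have [N hN] := small _ d2; exists (W_ N x); exists N => // n /= Nn.
  apply: le_lt_trans (hW _ _ _ Dx) _; have := hN _ Nn; have := hN _ (leqnn N); lra.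
have hl n x : D x -> `|W_ n x - W x| <= e_ n.
  move=> Dx; have c1 : (e_ n + e_ m - `|W_ n x - W_ m x|) @[m --> \oo] --> e_ n + 0 - `|W_ n x - W x|.
    by apply: cvgB; [apply: cvgD => //; exact: cvg_cst|apply: cvg_norm; apply: cvgB; [exact: cvg_cst|exact: cvgW]].
  rewrite addr0 in c1; rewrite -subr_ge0; apply: (cvgr_to_ge c1); apply: nearW => m.
  by rewrite subr_ge0 hW.
exists W; split => // x /set_mem Dx; apply/cvgrPdist_lt => d d0.
have d3 : 0 < d / 3 by rewrite divr_gt0.
have [N hN] := small _ d3; have eN := hN _ (leqnn N).
have n1 : \forall y \near x, `|W_ N x - W_ N y| < d / 3.
  by have := cW N x (mem_set Dx) => /cvgrPdist_lt/(_ _ d3).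
have n2 : \forall y \near x, D y by exact: open_nbhs_nbhs.
apply: filterS2 n1 n2 => y h1 Dy; have h2 := hl N _ Dx; have h3 := hl N _ Dy; rewrite distrC in h2.
have -> : W x - W y = (W x - W_ N x) + ((W_ N x - W_ N y) + (W_ N y - W y)) by ring.
apply: le_lt_trans (ler_normD _ _) _; apply: le_lt_trans (lerD (lexx _) (ler_normD _ _)) _.
move: h2 eN h1 h3; move: (e_ N) => e h2 eN h1 h3; lra.
Qed.

End UniformLimit.

(** * The semigroup on real functions: positivity and smoothing *)

Section RealSemigroup.
Context {R : realType}.
Variables (a : R) (f : R * R -> R) (c C : R).
Local Notation plane := (R * R)%type.
Local Notation mu := (leb2 R).
Local Notation D := (strip a).
Hypotheses (a0 : 0 < a) (mf : measurable_fun D f) (c0 : 0 < c)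
  (hf : forall x, D x -> c <= f x <= C) (C0 : 0 < C).
Let mD := (fun d (T : measurableType d) (_ : {measure set T -> \bar R}) (A : set T)
  (h : measurable A) => h) _ _ mu D (strip_measurable a).
Local Notation ip := (ipw (a := a) f).
Local Notation nrm := (ipn ip).
Local Notation L := (L2r a).
Let H := hilbert_ipw mf c0 hf.

Lemma f_gt0 x : D x -> 0 < f x.
Proof. by move=> Dx; have /andP[h _] := hf Dx; exact: lt_le_trans h. Qed.

Definition okB (B : set plane) := [/\ measurable_for mu B, bounded_set B & B `<=` D].

Definition ind (B : set plane) : L := insubd 0 (\1_B).

Lemma l2_ind B : okB B -> l2 mu D (\1_B : plane -> R).
Proof.
move=> [mB bB BD]; have [b b0 hb] := bounded_box bB.
apply: (@l2_box _ D _ b 1 (strip_measurable a)); first exact: measurable_indic.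
  by move=> x _; rewrite indicE; case: (x \in B); rewrite ?normr1 ?normr0.
by move=> x _ xb; rewrite indicE memNset// => /hb.
Qed.

Lemma indE B : okB B -> (ind B : plane -> R) = \1_B.
Proof. by move=> hB; rewrite -[l2val _]/(\val _) insubdK//; exact/l2predP/l2_ind. Qed.

Lemma int_ind (g : plane -> R) B : okB B ->
  \int[mu]_(y in B) (g y * f y) = \int[mu]_(y in D) (g y * ind B y * f y).
Proof.
move=> hB; have [_ _ BD] := hB; rewrite (indE hB) -[in LHS](setIidr BD) Rintegral_mkcond [RHS]Rintegral_mkcond.
apply: eq_Rintegral => y _; rewrite !patchE in_setI indicE; case: (y \in D) => //=; case: (y \in B) => /=.
  by rewrite mulr1.
by rewrite mulr0 mul0r.
Qed.

Lemma okB_sub (B B' : set plane) : okB B -> measurable_for mu B' -> B' `<=` B -> okB B'.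
Proof.
move=> [mB bB BD] mB' h; split => //; last exact: subset_trans BD.
exact: bounded_sub bB h.
Qed.

Lemma okB_box (b : R) : okB (D `&` box b).
Proof.
split; [exact: measurableI (strip_measurable a) (box_measurable b)| |exact: subIsetl].
by apply: bounded_sub (box_bounded b) _; exact: subIsetr.
Qed.

Lemma ip_int (u v : L) : mu.-integrable D (EFin \o (fun x => u x * v x * f x)).
Proof. exact: (wip_int mD mf c0 hf (L2rP u) (L2rP v)). Qed.

Lemma ip_le_ae (u v u' v' : L) : {ae mu, forall x, D x -> u x * v x <= u' x * v' x} -> ip u v <= ip u' v'.
Proof.
move=> h; rewrite -subr_ge0.
have -> : ip u' v' - ip u v = \int[mu]_(x in D) (u' x * v' x * f x - u x * v x * f x).
  by rewrite RintegralB//; [exact: ip_int|exact: ip_int].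
apply: Rint_ge0_ae => //; first exact: (int_sub mD (ip_int _ _) (ip_int _ _)).
apply: (ae_imp _ h) => x hx Dx; rewrite -mulrBl; apply: mulr_ge0; last exact/ltW/f_gt0.
by rewrite subr_ge0 hx.
Qed.

Lemma null_ae (u v : L) : nrm (u - v) = 0 -> {ae mu, forall x, D x -> u x = v x}.
Proof. exact: (ipw0_ae mf c0 hf). Qed.

Lemma ip_ae_eq (u v : L) : (forall g, ip u g = ip v g) -> {ae mu, forall x, D x -> u x = v x}.
Proof. by move=> h; apply: null_ae; apply: (ipn_eq0 (ip := ip)) => g; rewrite (ipBl H) h subrr. Qed.

(** Tested with the indicator of the part of [{g > k}] in a box, on which [g - k] is positive with
    nonpositive weighted integral. Pointwise bounds are obtained from pairings in this way. *)
Lemma pair_le (g : L) (k : R) : (forall B, okB B -> ip g (ind B) <= k * ip (ind B) (ind B)) ->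
  {ae mu, forall x, D x -> g x <= k}.
Proof.
move=> hg; pose A (n : nat) := (D `&` box n%:R) `&` (D `&` g @^-1` `]k, +oo[%classic).
have okA n : okB (A n).
  apply: (okB_sub (okB_box n%:R)); last exact: subIsetl.
  apply: measurableI; first by have [] := okB_box n%:R.
  by apply: (l2_meas (L2rP g)); [exact: mD|exact: measurable_itv].
have hA n : {ae mu, forall x, D x -> (g x - k) * \1_(A n) x * f x = 0}.
  have e : \int[mu]_(x in D) ((g x - k) * \1_(A n) x * f x) = ip g (ind (A n)) - k * ip (ind (A n)) (ind (A n)).
    rewrite /ipw /wip -(Rint_scale mD k (ip_int (ind (A n)) (ind (A n)))).
    rewrite -RintegralB//; [|exact: ip_int|exact: (int_scale mD k (ip_int _ _))].
    apply: eq_Rintegral => x _; rewrite (indE (okA n)) indicE; case: (x \in A n); rewrite ?mulr1 ?mulr0 ?mul0r ?mulr0 ?mul1r; ring.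
  have ii : mu.-integrable D (EFin \o (fun x => (g x - k) * \1_(A n) x * f x)).
    have := int_sub mD (ip_int g (ind (A n))) (int_scale mD k (ip_int (ind (A n)) (ind (A n)))).
    congr (mu.-integrable D _); apply/funext => x /=; congr (_%:E).
    rewrite (indE (okA n)) indicE; case: (x \in A n); rewrite ?mulr1 ?mulr0 ?mul0r ?mulr0 ?mul1r; ring.
  apply: (Rint0_ae mD ii); last by rewrite e subr_le0 hg.
  move=> x Dx; rewrite indicE; case: (boolP (x \in A n)) => [/set_mem [_ [_ /=]]|_]; last by rewrite mulr0 mul0r.
  rewrite in_itv/= andbT => h; apply: mulr_ge0; last exact/ltW/f_gt0.
  by rewrite mulr1 subr_ge0 ltW.
have := ae_foralln hA; apply: ae_imp => x hx Dx; rewrite leNgt; apply/negP => kg.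
have [N hN] := in_some_box x; have := hx N Dx; rewrite indicE mem_set; last first.
  by split; split => //; [exact: hN|rewrite /= in_itv/= kg].
move/eqP; rewrite mulr1 mulf_eq0 subr_eq0 !gt_eqF//; exact: f_gt0.
Qed.

Lemma pair_ge (g : L) (k : R) : (forall B, okB B -> k * ip (ind B) (ind B) <= ip g (ind B)) ->
  {ae mu, forall x, D x -> k <= g x}.
Proof.
move=> hg; have : {ae mu, forall x, D x -> (- g : L) x <= - k}.
  by apply: pair_le => B hB; rewrite (ipNl H) mulNr lerN2 hg.
apply: ae_imp => x hx Dx; have := hx Dx.
have -> : (- g : L) x = - g x by have := congr1 (fun h => h x) (L2rB 0 g); rewrite sub0r => ->; rewrite sub0r.
by rewrite lerN2.
Qed.

Definition absL (u : L) : L := mkL (l2_abs u).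

Lemma l2_trunc n (u : L) : l2 mu D (fun x => clip n.+1%:R (u x) * \1_(D `&` box n%:R) x).
Proof.
apply: (l2_le mD _ (L2rP u)).
  apply: measurable_funM; first by apply: measurable_clip; exact: l2_meas (L2rP u).
  by apply: measurable_indic; have [] := okB_box n%:R.
move=> x _; apply: le_trans (clip_norm (ltr0Sn _ n) (u x)); rewrite normrM indicE.
by case: (x \in _); rewrite ?normr1 ?normr0 ?mulr1 ?mulr0.
Qed.
Definition truncL n (u : L) : L := mkL (l2_trunc n u).

Lemma trunc_le n (u : L) x : `|truncL n u x| <= `|u x|.
Proof.
apply: le_trans (clip_norm (ltr0Sn _ n) (u x)); rewrite /= normrM indicE.
by case: (x \in _); rewrite ?normr1 ?normr0 ?mulr1 ?mulr0.
Qed.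

Lemma trunc_cvg (u : L) : nrm (truncL n u - u) @[n --> \oo] --> (0 : R).
Proof.
have iu : mu.-integrable D (EFin \o (fun x => 4 * (u x * u x * f x))).
  exact: (int_scale mD 4 (ip_int u u)).
have hn : ip (truncL n u - u) (truncL n u - u) @[n --> \oo] --> \int[mu]_(x in D) (0 : R).
  apply: (int_dct mD _ _ _ _ iu).
  - by move=> n; apply/measurable_EFinP; exact: (measurable_int _ (ip_int (truncL n u - u) (truncL n u - u))).
  - exact: measurable_cst.
  - move=> x Dx; apply: cvg_near_cst.
    have [N hN] := in_some_box x; have [M hM] := in_some_box (u x, 0).
    have key n : (maxn N M <= n)%N -> (truncL n u - u : L) x * (truncL n u - u : L) x * f x = 0.
      rewrite geq_max => /andP[Nn Mn]; rewrite L2rB /= indicE mem_set ?mulr1; last by split => //; exact: hN.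
      have [h1 _] := hM _ Mn; have h2 : `|u x| <= n.+1%:R by apply: le_trans h1 _; rewrite ler_nat.
      have -> : clip n.+1%:R (u x) = u x.
        move: h2; rewrite ler_norml => /andP[h2 h3]; rewrite /clip; move/min_idPl: h3 => ->; exact/max_idPr.
      by rewrite subrr !mul0r.
    by exists (maxn N M) => // n hn; apply/eqP; exact: key n hn.
  - move=> n x Dx; have f0 := f_gt0 Dx; rewrite normrM (gtr0_norm f0) mulrA; apply: ler_wpM2r; first exact: ltW.
    rewrite normrM !L2rB; have h := trunc_le n u x.
    have h1 : `|truncL n u x - u x| <= 2 * `|u x|.
      by apply: le_trans (ler_normB _ _) _; move: h; move: (`|u x|) (`|_|) => r r' h; lra.
    apply: le_trans (ler_pM _ _ h1 h1) _ => //.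
    have e : `|u x| * `|u x| = u x * u x by rewrite -expr2 real_normK ?num_real// expr2.
    by rewrite mulrACA e -natrM.
by have := cvg_sqrt0 _; rewrite Rint0 in hn; apply.
Qed.

Lemma box_cvg_ip (u v : L) : ip (truncL n u) v @[n --> \oo] --> ip u v.
Proof. by apply: (cvg_ipl H); exact: trunc_cvg. Qed.

Variables (T : R -> L -> L) (G : L -> L -> Prop).
Hypothesis S : sgroup ip T G.
Hypothesis Gsym : forall u v u' v', G u v -> G u' v' -> ip v u' = ip u v'.
Hypothesis Gform : forall u v, G u v -> exists2 w, u = Hpi w & ip v u = qf f w w.
(** [U t B] is a continuous version of [T t (ind B)]. It will be the survival probability, which is
    the origin of the hypotheses on it. *)
Variable U : R -> set plane -> plane -> R.
Hypothesis Uc : forall t B, 0 < t -> okB B -> {in D, continuous (U t B)}.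
Hypothesis U01 : forall t B x, 0 < t -> okB B -> D x -> 0 <= U t B x <= 1.
Hypothesis Uae : forall t B, 0 < t -> okB B -> {ae mu, forall x, D x -> U t B x = T t (ind B) x}.
Hypothesis Upos : forall x, D x -> exists t B, [/\ 0 < t, okB B & 0 < U t B x].

Lemma Gpos u v : G u v -> 0 <= ip v u.
Proof. by move=> /Gform[w _ ->]; exact: (form_ge0 (jacobi_formP mf c0 hf C0)). Qed.

Lemma T_lin_ae t k u v : 0 <= t -> {ae mu, forall x, D x -> T t (k *: u + v) x = k * T t u x + T t v x}.
Proof.
move=> t0; have h : {ae mu, forall x, D x -> T t (k *: u + v) x = (k *: T t u + T t v : L) x}.
  by apply: ip_ae_eq => g; rewrite (sgL S)// (ipDl H) (ipZl H).
by apply: (ae_imp _ h) => x hx Dx; rewrite hx// L2r_lin.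
Qed.

Lemma T_B_ae t u v : 0 <= t -> {ae mu, forall x, D x -> T t (u - v) x = T t u x - T t v x}.
Proof.
move=> t0; have := T_lin_ae (-1) v u t0; rewrite scaleN1r addrC; apply: ae_imp => x hx Dx.
by rewrite hx// mulN1r addrC.
Qed.

Lemma T_sym t u v : 0 <= t -> ip (T t u) v = ip u (T t v).
Proof. exact: (sg_sym H S Gsym Gpos). Qed.

Lemma T_ind t B : 0 < t -> okB B -> {ae mu, forall x, D x -> 0 <= T t (ind B) x <= 1}.
Proof. by move=> t0 hB; apply: (ae_imp _ (Uae t0 hB)) => x hx Dx; rewrite -hx// U01. Qed.

(** Positivity is given on indicators only; by symmetry, pairing [T t v] with an indicator is
    pairing [v] with a nonnegative function. *)
Lemma T_ge0 t (v : L) : 0 < t -> {ae mu, forall x, D x -> 0 <= v x} -> {ae mu, forall x, D x -> 0 <= T t v x}.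
Proof.
move=> t0 hv; apply: pair_ge => B hB; rewrite mul0r (T_sym _ _ (ltW t0)) -(ip0l H (T t (ind B))).
apply: ip_le_ae; apply: (ae_imp2 _ hv (T_ind t0 hB)) => x h1 h2 Dx.
by rewrite mul0r; apply: mulr_ge0; [exact: h1|have /andP[] := h2 Dx].
Qed.

(** The almost everywhere version of [unit_ball], which the semigroup preserves. *)
Definition Gam (g : L) := {ae mu, forall x, D x -> `|g x| <= 1}.

(** By symmetry and truncation to a box, the pairing of [T t v] with [ind B] is bounded by that of
    the image of the indicator of the box, and images of indicators are at most 1. *)
Lemma T_le1 t (v : L) : 0 < t -> Gam v -> {ae mu, forall x, D x -> T t v x <= 1}.
Proof.
move=> t0 hv; apply: pair_le => B hB; rewrite mul1r (T_sym _ _ (ltW t0)).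
have cl := @box_cvg_ip v (T t (ind B)); apply: (cvgr_to_le cl); apply: nearW => n.
have okQ := okB_box n%:R; apply: (@le_trans _ _ (ip (ind (D `&` box n%:R)) (T t (ind B)))).
  apply: ip_le_ae; apply: (ae_imp2 _ hv (T_ind t0 hB)) => x h1 h2 Dx; have /andP[h3 _] := h2 Dx.
  apply: ler_wpM2r => //; rewrite (indE okQ) /=; have := h1 Dx; have := clip_norm (ltr0Sn _ n) (v x).
  move=> h4 h5; rewrite indicE; case: (x \in _); rewrite ?mulr1 ?mulr0//.
  exact: le_trans (ler_norm _) (le_trans h4 h5).
rewrite -(T_sym _ _ (ltW t0)); apply: ip_le_ae; apply: (ae_imp _ (T_ind t0 okQ)) => x h1 Dx.
have /andP[_ h2] := h1 Dx; rewrite (indE hB) indicE; case: (x \in B); rewrite ?mulr1 ?mulr0//.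
Qed.

Lemma Gam_T t (v : L) : 0 <= t -> Gam v -> Gam (T t v).
Proof.
rewrite le_eqVlt => /orP[/eqP <-|t0] hv.
  have h : {ae mu, forall x, D x -> T 0 v x = v x} by apply: ip_ae_eq => g; rewrite (sg0 S).
  by apply: (ae_imp2 _ h hv) => x h1 h2 Dx; rewrite h1// h2.
have hnv : Gam (0 - v).
  by apply: (ae_imp _ hv) => x hx Dx; rewrite L2rB sub0r normrN hx.
have hB := T_B_ae 0 v (ltW t0); have h0 : {ae mu, forall x, D x -> T t 0 x = 0}.
  have h : {ae mu, forall x, D x -> T t 0 x = (0 : L) x}.
    by apply: ip_ae_eq => g; have := sgBl H S 0 0 g (ltW t0); rewrite !subrr.
  exact: h.
have h1 := T_le1 t0 hv; have h2 := T_le1 t0 hnv.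
have h3 := ae_and hB h0; have h4 := ae_and h1 h2.
apply: (ae_imp2 _ h3 h4) => x [k1 k2] [k3 k4] Dx; rewrite ler_norml k3// andbT.
by have := k4 Dx; rewrite k1// k2// sub0r lerNl.
Qed.

(** The Nash argument bounds [T t] on normalized indicators in L^2, which is a bound from L^1 to
    L^2; by symmetry it is also one from L^2 to L^infinity, read off by [pair_le]. *)
Lemma ultracontractive : exists2 c_ : R -> R, (forall t, 0 < t -> 0 <= c_ t) &
  forall t (v : L), 0 < t -> {ae mu, forall x, D x -> `|T t v x| <= c_ t * nrm v}.
Proof.
have [kap k0 hk] := nash mf c0 hf C0 ltr01.
pose c_ t := Num.sqrt (2 / (kap * t)); exists c_ => [t t0|]; first exact: sqrtr_ge0.
have hB t B : 0 < t -> okB B -> nrm (T t (ind B)) <= c_ t * ip (ind B) (ind B).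
  move=> t0 okB1; set N := ip (ind B) (ind B); have N0 : 0 <= N by exact: (ip_ge0 H).
  have [Nz|Np] := eqVneq N 0.
    have z : nrm (ind B) = 0 by rewrite /ipn -/N Nz sqrtr0.
    rewrite Nz mulr0; apply: le_trans (_ : nrm (ind B) <= _); last by rewrite z.
    exact: (sg_contract H S Gpos (ind B) (ltW t0)).
  have Npos : 0 < N by rewrite lt_def Np.
  (* [N] is the weighted mass of [B], so the normalized indicator has weighted L^1 norm 1. *)
  have hGam g : Gam g -> ip (N^-1 *: ind B) g <= 1.
    move=> hg; rewrite (ipZl H) ler_pdivrMl// mulr1; apply: ip_le_ae; apply: (ae_imp _ hg) => x hx Dx.
    rewrite (indE okB1) indicE; case: (x \in B); rewrite ?mul1r ?mul0r//.
    exact: le_trans (ler_norm _) (hx Dx).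
  have h := sg_nash H S Gsym Gpos k0 (fun g t hg t0' => Gam_T t0' hg) _ hGam t0.
  have hN : nrm (T t (ind B)) = N * nrm (T t (N^-1 *: ind B)).
    have -> : nrm (T t (N^-1 *: ind B)) = nrm (N^-1 *: T t (ind B)).
      by apply: (ipn_ip H) => g; exact: (sgZl H S _ _ _ (ltW t0)).
    by rewrite (ipnZ H) gtr0_norm ?invr_gt0// mulVKf.
  rewrite hN mulrC; apply: ler_wpM2r => //; rewrite /c_ -(@ler_pXn2r _ 2) ?nnegrE ?ipn_ge0 ?sqrtr_ge0//.
  have e : Num.sqrt (2 / (kap * t)) ^+ 2 = 2 / (kap * t) by rewrite sqr_sqrtr// divr_ge0// mulr_ge0// ltW.
  rewrite e; apply: h => B' v' /Gform[w -> ->] hw; apply: hk => g hg; apply: hw; exact: aeW.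
have hle t (v : L) : 0 < t -> {ae mu, forall x, D x -> T t v x <= c_ t * nrm v}.
  move=> t0; apply: pair_le => B okB1; rewrite (T_sym _ _ (ltW t0)).
  apply: le_trans (ip_le H _ _) _; rewrite mulrC -mulrA (mulrC (nrm v)) mulrA.
  by apply: ler_wpM2r; [exact: ipn_ge0|exact: hB].
move=> t v t0; have h1 := hle t v t0; have h2 := hle t (- v) t0.
have h3 : {ae mu, forall x, D x -> T t (- v) x = - T t v x}.
  have := T_lin_ae (-1) v 0 (ltW t0); rewrite scaleN1r addr0 => h.
  have h0 : {ae mu, forall x, D x -> T t 0 x = (0 : L) x}.
    by apply: ip_ae_eq => g; have := sgBl H S 0 0 g (ltW t0); rewrite !subrr.
  apply: (ae_imp2 _ h h0) => x hx hx0 Dx; rewrite hx// hx0// mulN1r.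
  exact: addr0.
apply: (ae_imp2 _ (ae_and h1 h2) h3) => x [k1 k2] k3 Dx; rewrite ler_norml k1// andbT.
by have := k2 Dx; rewrite k3// (ipnN H) lerNl.
Qed.

(** * Continuous versions of smoothed functions *)

Section ContinuousVersions.
Variable c_ : R -> R.
Hypothesis c_ge0 : forall t, 0 < t -> 0 <= c_ t.
Hypothesis ultra : forall t (v : L), 0 < t -> {ae mu, forall x, D x -> `|T t v x| <= c_ t * nrm v}.
Let oD : open D := @strip_open R a.

Definition version t (v : L) := [set W : plane -> R | {in D, continuous W} /\
  {ae mu, forall x, D x -> W x = T t v x}].
Definition has_rep t v := exists W, version t v W.

Lemma nrm_le_ae (u v : L) : {ae mu, forall x, D x -> `|u x| <= `|v x|} -> nrm u <= nrm v.
Proof.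
move=> h; rewrite /ipn ler_sqrt ?(ip_ge0 H)//; apply: ip_le_ae; apply: (ae_imp _ h) => x hx Dx.
by rewrite -!expr2 -[leLHS](real_normK (num_real _)) -[leRHS](real_normK (num_real _)) ler_pXn2r ?nnegrE// hx.
Qed.

Lemma cont_eq_ae (u v : plane -> R) : {in D, continuous u} -> {in D, continuous v} ->
  {ae mu, forall x, D x -> u x = v x} -> forall x, D x -> u x = v x.
Proof.
move=> cu cv h x Dx; apply/eqP; rewrite eq_le; apply/andP; split; apply: (cont_le_ae oD) => //.
  by apply: (ae_imp _ h) => y hy Dy; rewrite hy.
by apply: (ae_imp _ h) => y hy Dy; rewrite hy.
Qed.

Lemma version_lin t k u v W W' : 0 < t -> version t u W -> version t v W' ->
  version t (k *: u + v) (fun x => k * W x + W' x).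
Proof.
move=> t0 [c1 h1] [c2 h2]; split.
  by move=> x Dx; apply: cvgD; [apply: cvgM; [exact: cvg_cst|exact: c1]|exact: c2].
apply: (ae_imp2 _ (ae_and h1 h2) (T_lin_ae k u v (ltW t0))) => x [k1 k2] k3 Dx.
by rewrite k3// k1// k2.
Qed.

Lemma has_rep_lin t k u v : 0 < t -> has_rep t u -> has_rep t v -> has_rep t (k *: u + v).
Proof. by move=> t0 [W hW] [W' hW']; eexists; exact: version_lin hW hW'. Qed.

Lemma version_ind t B : 0 < t -> okB B -> version t (ind B) (U t B).
Proof. by move=> t0 hB; split; [exact: Uc|exact: Uae]. Qed.

Lemma version_bound t u v W W' : 0 < t -> version t u W -> version t v W' ->
  forall x, D x -> `|W x - W' x| <= c_ t * nrm (u - v).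
Proof.
move=> t0 [c1 h1] [c2 h2]; apply: (cont_le_ae oD (v := fun=> _)).
- by move=> x Dx; apply: cvg_norm; apply: cvgB; [exact: c1|exact: c2].
- by move=> x Dx; exact: cvg_cst.
- apply: (ae_imp2 _ (ae_and h1 h2) (ae_and (T_B_ae u v (ltW t0)) (ultra (u - v) t0))) => x [k1 k2] [k3 k4] Dx.
  by rewrite k1// k2// -k3// k4.
Qed.

(** The bound from L^2 to L^infinity turns convergence in L^2 into uniform convergence of the
    continuous versions. *)
Lemma has_rep_lim t (v_ : nat -> L) v : 0 < t -> nrm (v_ n - v) @[n --> \oo] --> (0 : R) ->
  (forall n, has_rep t (v_ n)) -> has_rep t v.
Proof.
move=> t0 cv /choice[W_ hW]; pose e_ n := c_ t * nrm (v_ n - v).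
have e0 : e_ n @[n --> \oo] --> (0 : R).
  by rewrite -(mulr0 (c_ t)); apply: cvgM => //; exact: cvg_cst.
have hWW n k x : D x -> `|W_ n x - W_ k x| <= e_ n + e_ k.
  move=> Dx; apply: le_trans (version_bound t0 (hW n) (hW k) Dx) _; rewrite -mulrDr.
  apply: ler_wpM2l; first exact: c_ge0.
  by rewrite [X in _ <= _ + X](ipnB H); exact: (ipn_triangleB H).
have [W [cW lW]] := uniform_limit oD e0 (fun n => proj1 (hW n)) hWW.
exists W; split => //.
have h n : {ae mu, forall x, D x -> `|W_ n x - T t v x| <= e_ n}.
  apply: (ae_imp2 _ (proj2 (hW n)) (ae_and (T_B_ae (v_ n) v (ltW t0)) (ultra (v_ n - v) t0))) => x k1 [k3 k4] Dx.
  by rewrite k1// -k3// k4.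
apply: (ae_imp _ (ae_foralln h)) => x hx Dx; apply/eqP; rewrite -subr_eq0 -normr_le0.
have c2 : (e_ n + e_ n) @[n --> \oo] --> (0 + 0 : R) by exact: cvgD.
rewrite -[X in _ <= X](addr0 0); apply: (cvgr_to_ge c2); apply: nearW => n.
have -> : W x - T t v x = (W_ n x - T t v x) - (W_ n x - W x) by ring.
by apply: le_trans (ler_normB _ _) _; apply: lerD; [exact: hx|exact: lW].
Qed.

(* Binary expansion of v: r k is the remainder after k digits. *)
Lemma has_rep_unit t (b : R) (v : L) : 0 < t -> (forall x, D x -> 0 <= v x <= 1) ->
  (forall x, D x -> ~ box b x -> v x = 0) -> has_rep t v.
Proof.
move=> t0 v01 vb; pose h (k : nat) : R := 2^-1 ^+ k.
have h0 k : 0 < h k by rewrite exprn_gt0// invr_gt0.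
have hS k : h k = 2 * h k.+1 by rewrite /h exprS mulrA mulfV ?mul1r.
pose B k (g : L) := (D `&` box b) `&` (D `&` g @^-1` `[h k.+1, +oo[%classic).
have okB_B k g : okB (B k g).
  apply: (okB_sub (okB_box b)); last exact: subIsetl.
  apply: measurableI; first by have [] := okB_box b.
  by apply: (l2_meas (L2rP g)); [exact: mD|exact: measurable_itv].
pose fix r k : L := if k is j.+1 then (- h j.+1) *: ind (B j (r j)) + r j else v.
have rE j x : r j.+1 x = - h j.+1 * \1_(B j (r j)) x + r j x.
  by have := congr1 (fun g => g x) (L2r_lin (- h j.+1) (ind (B j (r j))) (r j)); rewrite (indE (okB_B j (r j))).
have rP k : forall x, D x -> 0 <= r k x <= h k /\ (~ box b x -> r k x = 0).
  elim: k => [|k ih] x Dx; first by rewrite /h expr0; split; [exact: v01|exact: vb].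
  have [/andP[p1 p2] p3] := ih x Dx; rewrite rE indicE; have [Bx|Bx] := boolP (x \in B k (r k)).
    have /set_mem[[_ bx] [_ /=]] := Bx; rewrite in_itv/= andbT => hx.
    rewrite mulr1; split; last by move=> /(_ bx).
    move: p2 hx; rewrite (hS k); move: (h k.+1) (r k x) => y z p2 hx; apply/andP; split; lra.
  rewrite mulr0 add0r; split => //; rewrite p1/=.
  have [bx|bx] := pselect (box b x); last by rewrite p3// ltW.
  rewrite leNgt; apply: contra Bx => hx; apply/mem_set; split => //; split => //.
  by rewrite /= in_itv/= andbT ltW.
have rep_r k : has_rep t (v - r k).
  elim: k => [|k ih].
    have := has_rep_lin (-1) t0 (ex_intro _ _ (version_ind t0 (okB_B 0%N v))) (ex_intro _ _ (version_ind t0 (okB_B 0%N v))).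
    by rewrite scaleN1r addNr subrr.
  have := has_rep_lin (h k.+1) t0 (ex_intro _ _ (version_ind t0 (okB_B k (r k)))) ih.
  by rewrite /= scaleNr opprD opprK addrCA.
apply: (has_rep_lim t0 _ rep_r).
have cb : h k * nrm (ind (D `&` box b)) @[k --> \oo] --> (0 * nrm (ind (D `&` box b)) : R).
  by apply: cvgM; [apply: cvg_expr; rewrite ger0_norm ?invr_ge0// invf_lt1// ltr1n|exact: cvg_cst].
rewrite mul0r in cb; apply: (squeeze_cvgr _ (cvg_cst 0) cb); apply: nearW => k.
rewrite ipn_ge0/= addrAC subrr add0r (ipnN H).
have -> : h k * nrm (ind (D `&` box b)) = nrm (h k *: ind (D `&` box b)).
  by rewrite (ipnZ H) gtr0_norm.
apply: nrm_le_ae; apply: aeW => x Dx; have [/andP[p1 p2] p3] := rP k x Dx.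
have -> : (h k *: ind (D `&` box b) : L) x = h k * \1_(D `&` box b) x.
  by have := congr1 (fun g => g x) (L2r_lin (h k) (ind (D `&` box b)) 0); rewrite addr0 (indE (okB_box b)) => ->; exact: addr0.
rewrite indicE; have [bx|bx] := pselect (box b x); last by rewrite p3// normr0.
by rewrite mem_set// mulr1 !ger0_norm// ltW.
Qed.

(** Truncations approximate [v], and a truncation is a linear combination of the indicator [ind Q]
    and a function [w] with values in [[0, 1]], to which the binary expansion applies. *)
Lemma has_repT t (v : L) : 0 < t -> has_rep t v.
Proof.
move=> t0; apply: (has_rep_lim t0 (trunc_cvg v)) => n.
have N0 : 0 < n.+1%:R :> R by rewrite ltr0Sn.
set Q := D `&` box n%:R; have okQ : okB Q := okB_box n%:R.
pose w : L := (2 * n.+1%:R)^-1 *: (n.+1%:R *: ind Q + truncL n v).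
have wE x : w x = (2 * n.+1%:R)^-1 * (n.+1%:R * \1_Q x + clip n.+1%:R (v x) * \1_Q x).
  have := congr1 (fun g => g x) (L2r_lin (2 * n.+1%:R)^-1 (n.+1%:R *: ind Q + truncL n v) 0).
  rewrite addr0 -/w L2r_lin (indE okQ) => ->; exact: addr0.
have rw : has_rep t w.
  apply: (@has_rep_unit _ n%:R) => // x Dx; last first.
    by move=> xb; rewrite wE indicE memNset ?mulr0 ?addr0 ?mulr0// => -[].
  rewrite wE indicE; case: (x \in Q); rewrite ?mulr1 ?mulr0 ?addr0 ?mulr0 ?lexx ?ler01//.
  have := clip_le N0 (v x); rewrite ler_norml => /andP[h1 h2].
  rewrite mulrC divr_ge0 ?mulr_ge0 ?(ltW N0)//=; last by lra.
  by rewrite ler_pdivrMr ?mulr_gt0// mul1r; lra.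
(* With N = n + 1, [truncL n v] is 2 N times [w] minus N times [ind Q]; the innermost combinations
   only represent the zero function. *)
have := has_rep_lin (2 * n.+1%:R) t0 rw (has_rep_lin (- n.+1%:R) t0 (ex_intro _ _ (version_ind t0 okQ))
  (has_rep_lin 0 t0 rw (has_rep_lin (-1) t0 rw rw))).
rewrite scale0r add0r scaleN1r addNr addr0 scalerA mulfV ?scale1r; last by rewrite gt_eqF// mulr_gt0.
by rewrite scaleNr addrAC subrr add0r.
Qed.

(** For [t > 0] a version exists by [has_repT], so the default 0 is not reached. *)
Definition rep t v : plane -> R := xget (fun=> 0) (version t v).

Lemma repP t v : 0 < t -> version t v (rep t v).
Proof. by move=> t0; have [W hW] := has_repT v t0; exact: (xgetI _ hW). Qed.

Lemma rep_uniq t v W x : 0 < t -> version t v W -> D x -> rep t v x = W x.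
Proof.
move=> t0 [c1 h1]; have [c2 h2] := repP v t0; apply: cont_eq_ae => //.
by apply: (ae_imp2 _ h1 h2) => y k1 k2 Dy; rewrite k1// k2.
Qed.

Lemma rep_lin t k u v x : 0 < t -> D x -> rep t (k *: u + v) x = k * rep t u x + rep t v x.
Proof. by move=> t0 Dx; exact: (rep_uniq t0 (version_lin k t0 (repP u t0) (repP v t0)) Dx). Qed.

Lemma rep_dist t u v x : 0 < t -> D x -> `|rep t u x - rep t v x| <= c_ t * nrm (u - v).
Proof. by move=> t0 Dx; apply: version_bound Dx => //; exact: repP. Qed.

Lemma rep0 t x : 0 < t -> D x -> rep t 0 x = 0.
Proof. by move=> t0 Dx; have := rep_lin 1 0 0 t0 Dx; rewrite scaler0 addr0 mul1r; lra. Qed.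

Lemma repZ t k u x : 0 < t -> D x -> rep t (k *: u) x = k * rep t u x.
Proof. by move=> t0 Dx; have := rep_lin k u 0 t0 Dx; rewrite addr0 rep0// addr0. Qed.

Lemma rep_bound t u x : 0 < t -> D x -> `|rep t u x| <= c_ t * nrm u.
Proof. by move=> t0 Dx; have := rep_dist u 0 t0 Dx; rewrite rep0// !subr0. Qed.

Lemma rep_ind t B x : 0 < t -> okB B -> D x -> rep t (ind B) x = U t B x.
Proof. by move=> t0 hB; apply: rep_uniq => //; exact: version_ind. Qed.

Lemma rep_D s t v x : 0 < s -> 0 <= t -> D x -> rep (s + t) v x = rep s (T t v) x.
Proof.
move=> s0 t0 Dx; apply: rep_uniq => //; first by rewrite ltr_wpDr.
have [c1 h1] := repP (T t v) s0; split => //.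
have h : {ae mu, forall x, D x -> T (s + t) v x = T s (T t v) x}.
  by apply: ip_ae_eq => g; exact: (sgD S _ _ (ltW s0) t0).
by apply: (ae_imp2 _ h1 h) => y k1 k2 Dy; rewrite k1// k2.
Qed.

Lemma rep_ge0 t (v : L) x : 0 < t -> {ae mu, forall x, D x -> 0 <= v x} -> D x -> 0 <= rep t v x.
Proof.
move=> t0 v0; have [c1 h1] := repP v t0; apply: (cont_le_ae oD (u := fun=> 0)) => //.
  by move=> y Dy; exact: cvg_cst.
by apply: (ae_imp2 _ h1 (T_ge0 t0 v0)) => y k1 k2 Dy; rewrite k1// k2.
Qed.

(** Evaluation of the smoothed function at a point is bounded on L^2; [r] is the heat kernel at
    [x]. *)
Lemma rep_functional t x : 0 < t -> D x -> exists r, forall v, rep t v x = ip r v.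
Proof.
move=> t0 Dx; apply: (riesz H (c := c_ t)); first by move=> k u v; exact: rep_lin.
by move=> u; exact: rep_bound.
Qed.

(** * Existence, positivity and uniqueness of the ground state *)

Section GroundState.
Variable m : R.
Hypotheses (m0 : 0 <= m) (mE : m < E1 a).
Hypothesis Gbot : forall u v, G u v -> m * ip u u <= ip v u.
Hypothesis Gnear : forall e, 0 < e -> exists u v, [/\ G u v, nrm u = 1 & ip v u <= m + e].
Hypothesis far : forall dl, 0 < dl -> exists Rad, forall x, D x -> Rad < `|x.1| -> `|f x - 1| <= dl.

Definition Tm t (u : L) : L := expR (m * t) *: T t u.
Definition Gm u v := G u (v + m *: u).
Let SP : sgroup ip Tm Gm := sgroup_shift H m S.
Let SPsym u v u' v' : Gm u v -> Gm u' v' -> ip v u' = ip u v'.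
Proof. by move=> h h'; have := Gsym h h'; rewrite (ipDl H) (ipDr H) (ipZl H) (ipZr H); lra. Qed.
Let SPpos u v : Gm u v -> 0 <= ip v u.
Proof. by move=> /Gbot; rewrite (ipDl H) (ipZl H) lerDr. Qed.

(** The squared distance is at most [2 (1 - ip u (Tm t u))], and [ip u (Tm t u) = |Tm (t / 2) u|^2]
    is bounded below by [expR (- (e * t))] through [sg_lower_bound]. *)
Lemma almost_fixed u v e t : G u v -> nrm u = 1 -> ip v u <= m + e -> 0 <= t ->
  nrm (Tm t u - u) ^+ 2 <= 2 * e * t.
Proof.
move=> Gu n1 hv t0; have G' : Gm u (v - m *: u) by rewrite /Gm subrK.
have u1 : ip u u = 1 by rewrite -(sqr_ipn H) n1 expr1n.
have t2 : 0 <= t / 2 by rewrite divr_ge0.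
have h1 := sg_lower_bound H SP SPsym SPpos G' n1 t2.
have h2 := sg_half H SP SPsym SPpos u t0; have h3 := sg_contract H SP SPpos u t0.
have h4 : ip (Tm t u) (Tm t u) <= 1 by rewrite -(sqr_ipn H) expr_le1 ?ipn_ge0// -n1.
have h5 : 1 - e * t <= ip u (Tm t u).
  rewrite -h2; set x := ip (v - m *: u) u in h1.
  have xe : x <= e by rewrite /x (ipBl H) (ipZl H) u1; lra.
  have h6 : expR (- (x * t)) <= nrm (Tm (t / 2) u) ^+ 2.
    have -> : expR (- (x * t)) = expR (- (x * (t / 2))) ^+ 2 by rewrite expr2 -expRD; congr expR; field.
    by rewrite ler_pXn2r ?nnegrE ?ipn_ge0// expR_ge0.
  apply: le_trans h6; apply: le_trans (expR_ge1Dx _); rewrite lerD2l lerN2.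
  exact: ler_wpM2r.
have -> : nrm (Tm t u - u) ^+ 2 = ip (Tm t u) (Tm t u) - 2 * ip u (Tm t u) + 1.
  by rewrite (sqr_ipn H) (ipBl H) !(ipBr H) u1 (ipC H (Tm t u) u); ring.
by move: h4 h5; move: (ip (Tm t u) (Tm t u)) (ip u (Tm t u)) => y z; lra.
Qed.

Definition fixed (th : L) := forall s g, 0 <= s -> ip (Tm s th) g = ip th g.

Lemma limit_fixed u : exists th, nrm (Tm t u - th) @[t --> +oo] --> (0 : R) /\ fixed th.
Proof. exact: (sg_limit H SP SPsym SPpos u). Qed.

(** The value [(E - m) / (4 E)] leaves the threshold of the exterior bound strictly above [m]. *)
Lemma dl_arith (E : R) : m < E -> exists dl : R, [/\ 0 < dl, dl < 1 & m < (1 - dl) / (1 + dl) * E].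
Proof.
move=> mE'; have m0' : 0 <= m by []. have E0 : 0 < E by exact: le_lt_trans mE'.
exists ((E - m) / (4 * E)); set d := _ / _.
have dE : d * (4 * E) = E - m by rewrite /d divfK// gt_eqF// mulr_gt0.
have d0 : 0 < d by rewrite divr_gt0 ?subr_gt0// mulr_gt0.
have d1 : d < 1 by rewrite ltr_pdivrMr ?mulr_gt0// mul1r; lra.
split => //; rewrite mulrAC ltr_pdivlMr ?addr_gt0//.
have : d * m < d * E by rewrite ltr_pM2l.
by lra.
Qed.

(** [u] is [Tm 1 u] up to its defect of invariance, and [Tm 1 u] is [expR m] times the continuous
    version [rep 1 u]: mass near the origin is thus seen by pointwise values. *)
Lemma mass_le Rad b (u : L) : `|Rad| <= b -> a <= b ->
  inner_mass f Rad u <= 2 * expR m ^+ 2 * (\int[mu]_(x in D) (rep 1 u x ^+ 2 * (\1_(D `&` box b) x * f x)))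
    + 2 * nrm (Tm 1 u - u) ^+ 2.
Proof.
move=> Rb ab; have okQ := okB_box b; set Q := D `&` box b in okQ *.
have [cr hr] := repP u (ltr01 : 0 < 1 :> R).
have iR : mu.-integrable D (EFin \o (fun x => rep 1 u x ^+ 2 * (\1_Q x * f x))).
  apply: (int_le_integrable mD _ _ (int_scale mD ((c_ 1 * nrm u) ^+ 2) (ip_int (ind Q) (ind Q)))).
    apply: measurable_funM; last by apply: measurable_funM => //; apply: measurable_indic; case: okQ.
    by apply: measurable_funX; apply: continuous_measurable_plane.
  move=> x Dx; rewrite (indE okQ) normrM normrX; have fx := f_gt0 Dx.
  have -> : `|\1_Q x * f x| = \1_Q x * \1_Q x * f x.
    by rewrite normrM (gtr0_norm fx) indicE; case: (x \in Q); rewrite ?normr1 ?normr0 ?mulr1 ?mulr0 ?mul1r ?mul0r.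
  apply: ler_wpM2r; last by rewrite ler_pXn2r ?nnegrE ?mulr_ge0 ?ipn_ge0 ?c_ge0//; exact: rep_bound.
  by rewrite indicE; case: (x \in Q); rewrite ?mulr0 ?mul0r// !mul1r ltW.
have iM : mu.-integrable D (EFin \o (fun x => u x * u x * (f x * \1_[set x : plane | `|x.1| <= Rad] x))).
  apply: (int_le_integrable mD _ _ (ip_int u u)).
    apply: measurable_funM; first by apply: measurable_funM; exact: l2_meas (L2rP u).
    apply: measurable_funM => //; apply: measurable_indic.
    have -> : [set x : plane | `|x.1| <= Rad] = `[- Rad, Rad]%classic `*` setT.
      by apply/seteqP; split => x; rewrite /= in_itv/= ler_norml//; case.
    by apply: measurableX => //; exact: measurable_itv.
  move=> x Dx; rewrite -expr2 mulrA normrM (ger0_norm (mulr_ge0 (sqr_ge0 _) (ltW (f_gt0 Dx)))).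
  by rewrite indicE; case: (x \in _); rewrite ?normr1 ?normr0 ?mulr1 ?mulr0// mulr_ge0 ?sqr_ge0// ltW// f_gt0.
have e2 : nrm (Tm 1 u - u) ^+ 2 = \int[mu]_(x in D) ((Tm 1 u - u : L) x * (Tm 1 u - u : L) x * f x) by rewrite (sqr_ipn H).
rewrite e2 -(Rint_scale mD _ iR) -(Rint_scale mD 2 (ip_int (Tm 1 u - u) (Tm 1 u - u))).
have i1 := int_scale mD (2 * expR m ^+ 2) iR; have i2 := int_scale mD 2 (ip_int (Tm 1 u - u) (Tm 1 u - u)).
rewrite -RintegralD// -subr_ge0 -RintegralB//; last exact: (int_add mD i1 i2).
apply: (Rint_ge0_ae mD); first exact: (int_sub mD (int_add mD i1 i2) iM).
apply: (ae_imp _ hr) => x hx Dx; have fx := f_gt0 Dx.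
have -> : (Tm 1 u - u : L) x = expR m * rep 1 u x - u x.
  rewrite L2rB hx// /Tm mulr1; have := congr1 (fun g => g x) (L2r_lin (expR m) (T 1 u) 0).
  by rewrite addr0 => ->; congr (_ - _); exact: addr0.
have key (A B F q1 q2 : R) : 0 < F -> 0 <= q1 <= q2 -> q2 <= 1 ->
    0 <= 2 * expR m ^+ 2 * (A ^+ 2 * (q2 * F)) + 2 * ((expR m * A - B) * (expR m * A - B) * F) - B * B * (F * q1).
  move=> F0 /andP[q10 q12] q21.
  have -> : 2 * expR m ^+ 2 * (A ^+ 2 * (q2 * F)) + 2 * ((expR m * A - B) * (expR m * A - B) * F) - B * B * (F * q1) =
    F * (2 * (expR m * A) ^+ 2 * q2 + 2 * (expR m * A - B) ^+ 2 - B ^+ 2 * q1) by ring.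
  apply: mulr_ge0; first exact: ltW.
  have h1 := ler_wpM2l (sqr_ge0 B) q12; have h2 := ler_wpM2l (sqr_ge0 (expR m * A - B)) q21.
  have h3 : 0 <= q2 * (2 * (expR m * A) ^+ 2 + 2 * (expR m * A - B) ^+ 2 - B ^+ 2).
    apply: mulr_ge0; first exact: le_trans q12.
    by have := sqr_ge0 (2 * (expR m * A) - B); lra.
  lra.
apply: key; [exact: fx| |by rewrite indicE; case: (x \in Q); rewrite ?lexx ?ler01].
rewrite !indicE; case: (boolP (x \in [set x | `|x.1| <= Rad])) => [/set_mem /= hx1|_]; last by case: (x \in Q); rewrite ?lexx ?ler01.
rewrite mem_set ?ler01 ?lexx//; split => //; split; first exact: le_trans hx1 (le_trans (ler_norm _) Rb).
by move: Dx => /andP[h1 h2]; apply: le_trans ab; rewrite ler_norml !ltW.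
Qed.

Lemma cvg_inv_nat : n.+1%:R^-1 @[n --> \oo] --> (0 : R).
Proof. exact: cvg_harmonic. Qed.

(* Otherwise near-minimizers would be weakly null, and their images under T 1 would
   tend to 0 pointwise and boundedly, hence in mass near the origin: this is excluded
   by the form inequality at infinity. *)
Lemma ground_exists : exists th, fixed th /\ nrm th <> 0.
Proof.
apply: contrapT => no.
have P0 g : nrm (Tm n%:R g) @[n --> \oo] --> (0 : R).
  have [th [cP fP]] := limit_fixed g.
  have z : nrm th = 0 by apply: contrapT => nz; apply: no; exists th.
  have c1 := cvg_ipn H _ cP; rewrite z in c1.
  exact: (cvg_comp _ _ (@cvgr_idn R) (c1 _)).
(* The square keeps the defect over the long time [n] at most [2 / (n + 1)]. *)
pose e_ n : R := n.+1%:R^-1 * n.+1%:R^-1.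
have e0 n : 0 < e_ n by rewrite mulr_gt0// invr_gt0.
have /choice[u_ hu] n : exists u, exists v, [/\ G u v, nrm u = 1 & ip v u <= m + e_ n].
  by have [u [v h]] := Gnear (e0 n); exists u, v.
have iN (n : nat) : n%:R * n.+1%:R^-1 <= 1 :> R by rewrite ler_pdivrMr// mul1r ler_nat.
have i1 n : e_ n <= n.+1%:R^-1.
  by rewrite -[leRHS]mulr1 ler_pM2l ?invr_gt0// invf_le1// ler1n.
have n1 n : nrm (u_ n) = 1 by have [v []] := hu n.
have af n : nrm (Tm n%:R (u_ n) - u_ n) ^+ 2 <= 2 * n.+1%:R^-1.
  have [v [Gu nu hv]] := hu n; apply: le_trans (almost_fixed Gu nu hv (ler0n _ n)) _.
  rewrite -mulrA; apply: ler_wpM2l => //; rewrite /e_ -mulrA -[leRHS]mulr1; apply: ler_wpM2l; first by rewrite invr_ge0.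
  by rewrite mulrC.
have af1 n : nrm (Tm 1 (u_ n) - u_ n) ^+ 2 <= 2 * n.+1%:R^-1.
  have [v [Gu nu hv]] := hu n; apply: le_trans (almost_fixed Gu nu hv ler01) _.
  by rewrite mulr1; apply: ler_wpM2l.
(* By symmetry the flow over time [n] is moved from [u_ n], which it almost fixes, to [g], which it
   sends to 0 in the absence of a fixed vector. *)
have weak g : ip g (u_ n) @[n --> \oo] --> (0 : R).
  have c1 : Num.sqrt (2 * n.+1%:R^-1) * nrm g + nrm (Tm n%:R g) @[n --> \oo] --> (0 * nrm g + 0 : R).
    apply: cvgD; last exact: P0.
    apply: cvgM; last exact: cvg_cst.
    by apply: cvg_sqrt0; rewrite -(mulr0 2); apply: cvgM; [exact: cvg_cst|exact: cvg_inv_nat].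
  rewrite mul0r addr0 in c1; apply: norm_cvg0; apply: (squeeze_cvgr _ (cvg_cst 0) c1); apply: nearW => n.
  rewrite normr_ge0/=.
  have -> : ip g (u_ n) = - ip (Tm n%:R (u_ n) - u_ n) g + ip (u_ n) (Tm n%:R g).
    by rewrite (ipBl H) (sg_sym H SP SPsym SPpos) ?ler0n// (ipC H g); ring.
  apply: le_trans (ler_normD _ _) _; rewrite normrN; apply: lerD.
    apply: le_trans (ip_CS H _ _) _; apply: ler_wpM2r; first exact: ipn_ge0.
    rewrite -(@ler_pXn2r _ 2) ?nnegrE ?ipn_ge0 ?sqrtr_ge0// [leRHS]sqr_sqrtr; first exact: af.
    by rewrite mulr_ge0// invr_ge0.
  by apply: le_trans (ip_CS H _ _) _; rewrite n1 mul1r.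
have [dl [d0 d1 hdl]] := dl_arith mE; have [Rad hRad] := far d0.
set b := Num.max `|Rad| a; have Rb : `|Rad| <= b by rewrite le_max lexx.
have ab : a <= b by rewrite le_max lexx orbT.
have okQ := okB_box b; set Q := D `&` box b in okQ *.
pose j n := \int[mu]_(x in D) (rep 1 (u_ n) x ^+ 2 * (\1_Q x * f x)).
have j0 : j n @[n --> \oo] --> (0 : R).
  rewrite -(Rint0 D); apply: (int_dct mD _ _ _ _ (int_scale mD (c_ 1 ^+ 2) (ip_int (ind Q) (ind Q)))).
  - move=> n; apply: measurable_funM; last by apply: measurable_funM => //; apply: measurable_indic; case: okQ.
    apply: measurable_funX; have [cr _] := repP (u_ n) (ltr01 : 0 < 1 :> R).
    exact: continuous_measurable_plane.
  - exact: measurable_cst.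
  - move=> x Dx; have [r hr] := rep_functional (ltr01 : 0 < 1 :> R) Dx.
    have -> : (fun n => rep 1 (u_ n) x ^+ 2 * (\1_Q x * f x)) = (fun n => ip r (u_ n) * ip r (u_ n) * (\1_Q x * f x)).
      by apply/funext => n; rewrite expr2 hr.
    rewrite -(mul0r (\1_Q x * f x)) -{1}(mul0r 0).
    by apply: cvgM; [apply: cvgM; exact: weak|exact: cvg_cst].
  - move=> n x Dx; rewrite (indE okQ) normrM normrX; have fx := f_gt0 Dx.
    have -> : `|\1_Q x * f x| = \1_Q x * \1_Q x * f x.
      by rewrite normrM (gtr0_norm fx) indicE; case: (x \in Q); rewrite ?normr1 ?normr0 ?mulr1 ?mulr0 ?mul1r ?mul0r.
    apply: ler_wpM2r; first by rewrite indicE; case: (x \in Q); rewrite ?mulr0 ?mul0r// !mul1r ltW.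
    rewrite ler_pXn2r ?nnegrE ?c_ge0//; have := rep_bound (u_ n) (ltr01 : 0 < 1 :> R) Dx.
    by rewrite n1 mulr1.
set th := (1 - dl) / (1 + dl) * E1 a in hdl.
have th0 : 0 <= th by exact: le_trans (ltW hdl).
(* Letting [n] tend to infinity leaves [th <= m], against the choice of [dl]. *)
have hn n : 0 <= m + n.+1%:R^-1 - th * (1 - (2 * expR m ^+ 2 * j n + 2 * (2 * n.+1%:R^-1))).
  have [v [Gu nu hv]] := hu n; have [w hw eq] := Gform Gu.
  have h1 := exterior_form a0 mf c0 hf C0 (ltW d0) d1 hRad w.
  have h2 := mass_le (u_ n) Rb ab.
  rewrite -/th -hw -eq -(sqr_ipn H) nu expr1n in h1.
  rewrite subr_ge0; apply: le_trans (le_trans h1 (le_trans hv _)); last by rewrite lerD2l.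
  apply: ler_wpM2l => //; rewrite lerD2l lerN2; apply: le_trans h2 _; rewrite lerD2l.
  by apply: ler_wpM2l => //; exact: af1.
have cl : m + n.+1%:R^-1 - th * (1 - (2 * expR m ^+ 2 * j n + 2 * (2 * n.+1%:R^-1))) @[n --> \oo] -->
    m + 0 - th * (1 - (2 * expR m ^+ 2 * 0 + 2 * (2 * 0))).
  apply: cvgB; first by apply: cvgD; [exact: cvg_cst|exact: cvg_inv_nat].
  apply: cvgM; first exact: cvg_cst.
  apply: cvgB; first exact: cvg_cst.
  apply: cvgD; apply: cvgM; try exact: cvg_cst; first exact: j0.
  by apply: cvgM; [exact: cvg_cst|exact: cvg_inv_nat].
have h : 0 <= m - th.
  have -> : m - th = m + 0 - th * (1 - (2 * expR m ^+ 2 * 0 + 2 * (2 * 0))) by ring.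
  by apply: (cvgr_to_ge cl); exact: nearW.
by move: h; rewrite subr_ge0 leNgt hdl.
Qed.

Lemma fixed_lin k u v : fixed u -> fixed v -> fixed (k *: u + v).
Proof. by move=> fu fv s g s0; rewrite (sgL SP)// fu// fv// (ipDl H) (ipZl H). Qed.

Lemma P_fixed_ae s th : 0 <= s -> fixed th -> {ae mu, forall x, D x -> expR (m * s) * T s th x = th x}.
Proof.
move=> s0 fth; have h : {ae mu, forall x, D x -> Tm s th x = th x} by apply: ip_ae_eq => g; exact: fth.
by apply: (ae_imp _ h) => x hx Dx; rewrite -hx.
Qed.

(** Positivity gives [|th| = |Tm s th| <= Tm s |th|], so [Tm s |th|] pairs with [|th|] to at least
    the squared norm of [|th|]. As [Tm s] is a contraction, the squared norm of [Tm s |th| - |th|]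
    is then at most 0. *)
Lemma fixed_abs th : fixed th -> fixed (absL th).
Proof.
move=> fth s g; rewrite le_eqVlt => /orP[/eqP <-|s0]; first by rewrite (sg0 SP).
have s0' := ltW s0.
have p1 : {ae mu, forall x, D x -> 0 <= T s (absL th - th) x}.
  by apply: T_ge0 => //; apply: aeW => x _; rewrite L2rB subr_ge0; exact: ler_norm.
have p2 : {ae mu, forall x, D x -> 0 <= T s (1 *: absL th + th) x}.
  apply: T_ge0 => //; apply: aeW => x _; rewrite L2r_lin mul1r /=.
  by rewrite -lerBlDr sub0r -normrN; exact: ler_norm.
have h1 : ip (absL th) (absL th) <= ip (Tm s (absL th)) (absL th).
  apply: ip_le_ae; apply: (ae_imp2 _ (P_fixed_ae s0' fth) (ae_and (ae_and p1 p2) (ae_and (T_B_ae (absL th) th s0') (T_lin_ae 1 (absL th) th s0')))).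
  move=> x k1 [[k2 k3] [k4 k5]] Dx; apply: ler_wpM2r; first exact: normr_ge0.
  have -> : Tm s (absL th) x = expR (m * s) * T s (absL th) x by [].
  rewrite [leLHS]/= -k1// normrM gtr0_norm ?expR_gt0//; apply: ler_wpM2l; first exact: expR_ge0.
  have := k2 Dx; have := k3 Dx; rewrite k4// k5// mul1r => q1 q2; rewrite ler_norml; apply/andP; split; lra.
have h2 := sg_contract H SP SPpos (absL th) s0'.
have h3 : ip (Tm s (absL th)) (Tm s (absL th)) <= ip (absL th) (absL th).
  by rewrite -!(sqr_ipn H) ler_pXn2r ?nnegrE ?ipn_ge0.
apply: (ipn0_ipB H); apply/eqP; rewrite -sqrf_eq0 (sqr_ipn H) eq_le (ip_ge0 H) andbT.
rewrite (ipBl H) !(ipBr H) (ipC H (absL th)); move: h1 h3.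
by move: (ip (Tm s (absL th)) (absL th)) (ip (Tm s (absL th)) (Tm s (absL th))) (ip (absL th) (absL th)) => y z w; lra.
Qed.

(** For a fixed [th] this is its continuous version, obtained from one unit of smoothing time. *)
Definition vers (th : L) (x : plane) : R := expR m * rep 1 th x.

Lemma vers_continuous th : {in D, continuous (vers th)}.
Proof.
have [cr _] := repP th (ltr01 : 0 < 1 :> R).
by move=> x Dx; apply: cvgM; [exact: cvg_cst|exact: cr].
Qed.

Lemma vers_ae th : fixed th -> {ae mu, forall x, D x -> vers th x = th x}.
Proof.
move=> fth; have [_ hr] := repP th (ltr01 : 0 < 1 :> R).
apply: (ae_imp2 _ hr (P_fixed_ae ler01 fth)) => x k1 k2 Dx.
by rewrite /vers k1// -[in expR m](mulr1 m) k2.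
Qed.

Lemma vers_at th s x : fixed th -> 0 < s -> D x -> vers th x = expR (m * s) * rep s th x.
Proof.
move=> fth s0 Dx; have [cr hr] := repP th s0.
apply: (cont_eq_ae (v := fun y => expR (m * s) * rep s th y) (@vers_continuous th) _ _ Dx).
  by move=> y Dy; apply: cvgM; [exact: cvg_cst|exact: cr].
apply: (ae_imp2 _ (vers_ae fth) (ae_and hr (P_fixed_ae (ltW s0) fth))) => y k1 [k2 k3] Dy.
by rewrite k1// k2// k3.
Qed.

Lemma convex_arith (b z y t : R) : - b < z < b -> - b < y < b -> 0 <= t <= 1 -> - b < z + t * (y - z) < b.
Proof.
move=> /andP[z1 z2] /andP[y1 y2] /andP[t0 t1]; have [zy|/ltW zy] := leP z y.
  have h : 0 <= y - z by rewrite subr_ge0.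
  have h1 := mulr_ge0 t0 h; have h2 := ler_wpM2r h t1; rewrite mul1r in h2.
  by move: (t * (y - z)) h1 h2 => w h1 h2; apply/andP; split; lra.
have h : 0 <= z - y by rewrite subr_ge0.
have h1 := mulr_ge0 t0 h; have h2 := ler_wpM2r h t1; rewrite mul1r in h2.
rewrite -(opprB z y) mulrN; move: (t * (z - y)) h1 h2 => w h1 h2; apply/andP; split; lra.
Qed.

(* The last zero on a segment from a zero to a point of positivity. *)
Lemma boundary_zero (p : plane -> R) z y : {in D, continuous p} -> D z -> D y -> p z = 0 -> 0 < p y ->
  (forall x, D x -> 0 <= p x) ->
  exists x, [/\ D x, p x = 0 & forall O, nbhs x O -> exists2 w, O w & D w /\ 0 < p w].
Proof.
move=> cp Dz Dy pz py p0; pose g (t : R) : plane := (z.1 + t * (y.1 - z.1), z.2 + t * (y.2 - z.2)).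
have Dg t : 0 <= t <= 1 -> D (g t).
  exact: convex_arith.
have cg (t : R) : g @ t --> g t.
  have c1 (b d : R) : b + s * d @[s --> t] --> b + t * d.
    by apply: cvgD; [exact: cvg_cst|apply: cvgM; [exact: cvg_id|exact: cvg_cst]].
  exact: (cvg_pair (c1 _ _) (c1 _ _)).
have cpg (t : R) : 0 <= t <= 1 -> p (g s) @[s --> t] --> p (g t).
  by move=> ht; apply: (cvg_comp _ _ (cg t)); apply: cp; exact/mem_set/Dg.
pose E := [set t : R | 0 <= t <= 1 /\ p (g t) = 0].
have g0 : g 0 = z by rewrite /g !mul0r !addr0; case: (z).
have g1 : g 1 = y by rewrite /g !mul1r !(addrC z.1) !(addrC z.2) !subrK; case: (y).
have E0 : E 0 by split; [rewrite lexx ler01|rewrite g0].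
have ubE : ubound E 1 by move=> t [/andP[]].
have hsE : has_sup E by split; [exists 0|exists 1].
set t := sup E; have t0 : 0 <= t by apply: ub_le_sup => //; exists 1.
have t1 : t <= 1 by apply: ge_sup => //; exists 0.
have ht : 0 <= t <= 1 by rewrite t0.
have pt : p (g t) = 0.
  apply/eqP; rewrite eq_le p0 ?andbT; last exact: Dg.
  rewrite leNgt; apply/negP => pp.
  have /nbhs_ballP[d /= d0 hd] : \forall s \near t, 0 < p (g s) by exact: cvgr_gt (cpg t ht) _ pp.
  have [s [hs ps] st] := sup_adherent d0 hsE.
  have st' : s <= t by apply: ub_le_sup => //; exists 1.
  have bs : ball t d s by rewrite /ball /= ltr_norml -/t in st *; apply/andP; split; lra.
  by have := hd s bs; rewrite /= ps ltxx.
have tn1 : t < 1.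
  by rewrite lt_neqAle t1 andbT; apply/eqP => e; move: pt; rewrite e g1 => e2; rewrite e2 ltxx in py.
exists (g t); split => //; first exact: Dg.
move=> O hO; have /nbhs_ballP[d /= d0 hd] : \forall s \near t, O (g s) by exact: (cg t) _ hO.
pose s := Num.min 1 (t + d / 2); have ts : t < s by rewrite lt_min tn1 ltrDl divr_gt0.
have hs : 0 <= s <= 1 by rewrite (le_trans t0 (ltW ts)) ge_min lexx.
have sd : s <= t + d / 2 by rewrite ge_min lexx orbT.
exists (g s); first by apply: hd; rewrite /ball /= ltr_norml; apply/andP; split; lra.
split; first exact: Dg.
rewrite lt_def p0 ?andbT; last exact: Dg.
apply/eqP => ps; have : s <= t by apply: ub_le_sup; [exists 1|].
by rewrite leNgt ts.
Qed.

(** The kernel [r] of [T s] at [x] is nonnegative and pairs to 0 with [th >= 0], because [th] is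
    fixed and vanishes at [x]: it lives on the zero set of [th]. *)
Lemma rep_zero th s x (v : L) : fixed th -> {ae mu, forall y, D y -> 0 <= th y} -> 0 < s -> D x -> vers th x = 0 ->
  (forall y, D y -> vers th y <= 0 -> v y = 0) -> rep s v x = 0.
Proof.
move=> fth th0 s0 Dx zx hv; have [r hr] := rep_functional s0 Dx; rewrite hr.
have r0 : {ae mu, forall y, D y -> 0 <= r y}.
  apply: pair_ge => B hB; rewrite mul0r -hr; rewrite rep_ind//.
  by have /andP[] := U01 s0 hB Dx.
have rth : ip (absL r) (absL th) = 0.
  have := vers_at fth s0 Dx; rewrite zx hr => /esym/eqP; rewrite mulf_eq0 gt_eqF ?expR_gt0//= => /eqP <-.
  apply/eqP; rewrite eq_le; apply/andP; split; apply: ip_le_ae; apply: (ae_imp2 _ r0 th0) => y k1 k2 Dy /=;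
    by rewrite !ger0_norm ?k1 ?k2.
have h0 := Rint0_ae mD (ip_int (absL r) (absL th)) (fun y Dy => mulr_ge0 (mulr_ge0 (normr_ge0 _) (normr_ge0 _)) (ltW (f_gt0 Dy))).
have rth0 : ip (absL r) (absL th) <= 0 by rewrite rth.
have {}h0 := h0 rth0.
apply/eqP; rewrite -(ip0l H 0) eq_le; apply/andP; split; apply: ip_le_ae;
  apply: (ae_imp2 _ h0 (vers_ae fth)) => y k1 k2 Dy.
  rewrite mul0r; have [pv|pv] := leP (vers th y) 0; first by rewrite hv// mulr0.
  have /eqP := k1 Dy; rewrite /= mulf_eq0 (gt_eqF (f_gt0 Dy)) orbF mulf_eq0 !normr_eq0 -(k2 Dy) (gt_eqF pv) orbF => /eqP ->.
  by rewrite mul0r.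
rewrite mul0r; have [pv|pv] := leP (vers th y) 0; first by rewrite hv// mulr0.
have /eqP := k1 Dy; rewrite /= mulf_eq0 (gt_eqF (f_gt0 Dy)) orbF mulf_eq0 !normr_eq0 -(k2 Dy) (gt_eqF pv) orbF => /eqP ->.
by rewrite mul0r.
Qed.

(* At a zero x of th, the kernel of T s at x only sees the zero set; by symmetry points
   of positivity do not see it. At a zero which is a limit of points of positivity the
   kernel would vanish, which continuity of paths excludes. *)
Lemma fixed_pos th : fixed th -> {ae mu, forall y, D y -> 0 <= th y} -> nrm th <> 0 -> forall x, D x -> 0 < vers th x.
Proof.
move=> fth th0 nth z Dz; rewrite ltNge; apply/negP => zz.
have p0 x : D x -> 0 <= vers th x by move=> Dx; apply: mulr_ge0; [exact: expR_ge0|exact: rep_ge0].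
have [y [Dy py]] : exists y, D y /\ 0 < vers th y.
  apply: contrapT => no; apply: nth; have : nrm th <= nrm 0.
    apply: nrm_le_ae; apply: (ae_imp _ (vers_ae fth)) => x hx Dx; rewrite -hx//.
    have -> : vers th x = 0.
      by apply/eqP; rewrite eq_le p0// andbT leNgt; apply/negP => h; apply: no; exists x.
    by rewrite normr0.
  by rewrite (ipn0 H) => h; apply/eqP; rewrite eq_le h ipn_ge0.
have pz : vers th z = 0 by apply/eqP; rewrite eq_le zz p0.
have [x [Dx px near_x]] := boundary_zero (@vers_continuous th) Dz Dy pz py p0.
have [s [B [s0 hB]]] := Upos Dx; rewrite -rep_ind// => /lt_eqF/negP; apply; apply/eqP/esym.
have mv : measurable_fun D (vers th) by exact: (continuous_measurable_plane oD (@vers_continuous th)).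
(* At the zero [x] the kernel does not see the part of [B] where [th] is positive, so [B] can be
   replaced by its part in the zero set. *)
set BZ := B `&` (D `&` vers th @^-1` `]-oo, 0]%classic).
have okZ : okB BZ.
  apply: (okB_sub hB); last exact: subIsetl.
  by apply: measurableI; [case: hB|apply: mv; [exact: mD|exact: measurable_itv]].
have BZE y' : D y' -> vers th y' <= 0 -> \1_BZ y' = \1_B y' :> R.
  move=> Dy' h; rewrite !indicE; congr ((_ : bool)%:R); apply/idP/idP => [/set_mem[h1 _]|/set_mem h1]; apply/mem_set => //.
have BZ0 y' : D y' -> 0 < vers th y' -> \1_BZ y' = 0 :> R.
  move=> Dy' h; rewrite indicE memNset// => -[_ [_ /=]]; rewrite in_itv/= => h'.
  by move: (lt_le_trans h h'); rewrite ltxx.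
have e1 : rep s (ind B) x = rep s (ind BZ) x.
  apply/eqP; rewrite -subr_eq0; apply/eqP; rewrite -mulN1r addrC -rep_lin//.
  apply: (rep_zero fth th0 s0 Dx px) => y' Dy' hy'.
  by rewrite L2r_lin (indE okZ) (indE hB) BZE// mulN1r addNr.
set A := D `&` [set y | 0 < vers th y].
have mA : measurable_for mu A.
  by rewrite /A gt0_preimage; apply: mv; [exact: mD|exact: measurable_itv].
have inA y' : D y' -> (y' \in A) = (0 < vers th y').
  by move=> Dy'; apply/idP/idP => [/set_mem[_ h]|h]; [exact: h|exact: mem_set (conj Dy' h)].
(* The restriction of [w] to the positivity set [A] is null: by symmetry its squared norm pairs
   [ind BZ] with the image of a function supported in [A], which vanishes at every zero of [th]. *)
set w := T s (ind BZ).
have lw : l2 mu D (fun y => w y * \1_A y).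
  apply: (l2_le mD _ (L2rP w)).
    by apply: measurable_funM; [exact: l2_meas (L2rP w)|exact: measurable_indic].
  by move=> y' _; rewrite normrM indicE; case: (y' \in A); rewrite ?normr1 ?normr0 ?mulr1 ?mulr0.
have nw : nrm (mkL lw) = 0.
  apply/eqP; rewrite -sqrf_eq0 (sqr_ipn H).
  have -> : ip (mkL lw) (mkL lw) = ip w (mkL lw).
    apply: eq_Rintegral => y' _ /=; rewrite indicE; case: (y' \in A); rewrite ?mulr1 ?mulr0 ?mul0r//.
  rewrite (T_sym _ _ (ltW s0)) -(ip0l H 0).
  have [_ hr] := repP (mkL lw) s0.
  have rz y' : D y' -> vers th y' <= 0 -> rep s (mkL lw) y' = 0.
    move=> Dy' h; apply: (rep_zero fth th0 s0 Dy'); first by apply/eqP; rewrite eq_le h p0.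
    by move=> y2 Dy2 h2; rewrite /= indicE (inA _ Dy2) ltNge h2 mulr0.
  have h : {ae mu, forall y, D y -> ind BZ y * T s (mkL lw) y = 0}.
    apply: (ae_imp _ hr) => y' hy' Dy'; rewrite -(hy' Dy'); have [h|h] := leP (vers th y') 0.
      by rewrite (rz y' Dy' h) mulr0.
    by rewrite (indE okZ) (BZ0 y' Dy' h) mul0r.
  rewrite eq_le; apply/andP; split; apply: ip_le_ae; apply: (ae_imp _ h) => y' hy' Dy'.
    by rewrite (hy' Dy') mul0r.
  by rewrite (hy' Dy') mul0r.
have wA : {ae mu, forall y, A y -> rep s (ind BZ) y <= 0}.
  have hz : {ae mu, forall y, D y -> mkL lw y = (0 : L) y} by apply: null_ae; rewrite subr0.
  have [_ hr] := repP (ind BZ) s0.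
  apply: (ae_imp2 _ hz hr) => y' k1 k2 Ay'; have [Dy' _] := Ay'; rewrite (k2 Dy') -/w.
  have Ain : y' \in A := mem_set Ay'.
  have := k1 Dy'; rewrite /= indicE Ain mulr1 => ->.
  exact: lexx.
have oA : open A.
  rewrite openE => y' [Dy' h]; apply: filterI; first exact: (open_nbhs_nbhs (conj oD Dy')).
  have cy : vers th w @[w --> y'] --> vers th y' by apply: vers_continuous; exact: mem_set.
  exact: cvgr_gt cy _ h.
have [cr _] := repP (ind BZ) s0.
have hA y' : A y' -> rep s (ind BZ) y' <= 0.
  move=> Ay'; apply: (cont_le_ae oA (v := fun=> 0) _ _ wA Ay'); last by move=> ? _; exact: cvg_cst.
  by move=> y2 /set_mem[Dy2 _]; apply: cr; exact: mem_set.
have rZ0 : 0 <= rep s (ind BZ) x.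
  by apply: (rep_ge0 s0 _ Dx); apply: aeW => y' _; rewrite (indE okZ).
(* A positive value at [x] would persist at nearby points of [A], which exist by the choice of [x],
   while the continuous version is at most 0 on [A]. *)
rewrite e1; apply/eqP; rewrite eq_le; apply/andP; split; last exact: rZ0.
rewrite leNgt; apply/negP => h.
have cx : rep s (ind BZ) y @[y --> x] --> rep s (ind BZ) x by apply: cr; exact: mem_set.
have nx : \forall y \near x, 0 < rep s (ind BZ) y by exact: cvgr_gt cx _ h.
have [w' h1 [Dw h2]] := near_x _ nx.
have Aw : A w' := conj Dw h2.
by have := hA _ Aw; rewrite leNgt h1.
Qed.

Lemma null_ip0 (g th : L) : {ae mu, forall y, D y -> 0 <= g y} -> {ae mu, forall y, D y -> 0 < th y} ->
  ip g th <= 0 -> nrm g = 0.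
Proof.
move=> g0 th0 h.
have h1 : ip (absL g) (absL th) <= 0.
  apply: le_trans h; apply: ip_le_ae; apply: (ae_imp2 _ g0 th0) => y k1 k2 Dy /=.
  by rewrite !ger0_norm ?k1// ltW// k2.
have h2 := Rint0_ae mD (ip_int (absL g) (absL th)) (fun y Dy => mulr_ge0 (mulr_ge0 (normr_ge0 _) (normr_ge0 _)) (ltW (f_gt0 Dy))) h1.
apply/eqP; rewrite eq_le ipn_ge0 andbT -(ipn0 H); apply: nrm_le_ae; apply: (ae_imp2 _ h2 th0) => y k1 k2 Dy.
have /eqP := k1 Dy; rewrite /= mulf_eq0 (gt_eqF (f_gt0 Dy)) orbF mulf_eq0 !normr_eq0 (gt_eqF (k2 Dy)) orbF => /eqP ->.
by rewrite normr0.
Qed.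

(** For a fixed [psi] orthogonal to [phi], both [|psi| + psi] and [|psi| - psi] are fixed and
    nonnegative, with the same pairing with [phi]. If the first is not null it is positive almost
    everywhere, which makes the second null; the common pairing is then 0 and forces the first to be
    null too, a contradiction. Hence both are null. *)
Lemma ground_state : exists phi, [/\ fixed phi, nrm phi = 1, {ae mu, forall y, D y -> 0 < phi y} &
  forall th, fixed th -> nrm (th - ip th phi *: phi) = 0].
Proof.
have [th [fth nth]] := ground_exists.
have pos u : fixed u -> {ae mu, forall y, D y -> 0 <= u y} -> nrm u <> 0 -> {ae mu, forall y, D y -> 0 < u y}.
  move=> fu u0 nu; apply: (ae_imp _ (vers_ae fu)) => y hy Dy; rewrite -hy//; exact: fixed_pos.
have fixedZ k u : fixed u -> fixed (k *: u).
  move=> fu; have := fixed_lin (k - 1) fu fu.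
  by rewrite -[X in _ + X]scale1r -scalerDl subrK.
have nrmA u : nrm (absL u) = nrm u.
  by apply/eqP; rewrite eq_le; apply/andP; split; apply: nrm_le_ae; apply: aeW => x _; rewrite /= normr_id.
pose phi := (nrm th)^-1 *: absL th.
have nth0 : 0 < nrm th by rewrite lt_def ipn_ge0 andbT; apply/eqP.
have fphi : fixed phi by apply: fixedZ; exact: fixed_abs.
have n1 : nrm phi = 1 by rewrite (ipnZ H) nrmA gtr0_norm ?invr_gt0// mulVf// gt_eqF.
have p1 : {ae mu, forall y, D y -> 0 < phi y}.
  apply: pos => //; last by rewrite n1; exact/eqP/oner_neq0.
  apply: aeW => y _; have -> : phi y = (nrm th)^-1 * `|th y| by [].
  by rewrite mulr_ge0// invr_ge0 ltW.
exists phi; split => // u fu; set k := ip u phi; set psi := u - k *: phi.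
have fpsi : fixed psi by rewrite /psi -scaleNr addrC; exact: fixed_lin.
have o : ip psi phi = 0 by rewrite (ipBl H) (ipZl H) -(sqr_ipn H) n1 expr1n mulr1 subrr.
pose pp := 1 *: absL psi + psi; pose pm := (-1) *: psi + absL psi.
have fpp : fixed pp by apply: fixed_lin => //; exact: fixed_abs.
have fpm : fixed pm by apply: fixed_lin => //; exact: fixed_abs.
have ppE y : pp y = `|psi y| + psi y by rewrite L2r_lin mul1r.
have pmE y : pm y = `|psi y| - psi y by rewrite L2r_lin mulN1r addrC.
have pp0 : {ae mu, forall y, D y -> 0 <= pp y}.
  by apply: aeW => y _; rewrite ppE -lerBlDr sub0r -normrN; exact: ler_norm.
have pm0 : {ae mu, forall y, D y -> 0 <= pm y}.
  by apply: aeW => y _; rewrite pmE subr_ge0; exact: ler_norm.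
have e1 : ip pp phi = ip (absL psi) phi by rewrite (ipDl H) (ipZl H) mul1r o addr0.
have e2 : ip pm phi = ip (absL psi) phi by rewrite (ipDl H) (ipZl H) o mulr0 add0r.
have zero (w w' : L) : {ae mu, forall y, D y -> 0 <= w y} -> ip w phi = ip (absL psi) phi -> nrm w' = 0 ->
    ip w' phi = ip (absL psi) phi -> nrm w = 0.
  by move=> w0 ew z' ew'; apply: (null_ip0 w0 p1); rewrite ew -ew' (ipn0_ip H).
have [z|/eqP z] := eqVneq (nrm pp) 0.
  have zm := zero pm pp pm0 e2 z e1.
  have a1 : {ae mu, forall y, D y -> pp y = (0 : L) y} by apply: null_ae; rewrite subr0.
  have a2 : {ae mu, forall y, D y -> pm y = (0 : L) y} by apply: null_ae; rewrite subr0.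
  apply/eqP; rewrite eq_le ipn_ge0 andbT -(ipn0 H); apply: nrm_le_ae; apply: (ae_imp2 _ a1 a2) => y k1 k2 Dy.
  have : psi y = 0 by have h1 := k1 Dy; have h2 := k2 Dy; rewrite ppE in h1; rewrite pmE in h2; lra.
  by move=> ->; rewrite normr0.
have ppos := pos _ fpp pp0 z.
have zm : nrm pm = 0.
  apply/eqP; rewrite eq_le ipn_ge0 andbT -(ipn0 H); apply: nrm_le_ae; apply: (ae_imp _ ppos) => y k1 Dy.
  have := k1 Dy; rewrite ppE pmE => h; have [p0|p0] := leP 0 (psi y); first by rewrite (ger0_norm p0) subrr normr0.
  by move: h; rewrite (ltr0_norm p0) addNr ltxx.
by case: z; exact: (zero pp pm pp0 e1 zm e2).
Qed.

(** The strong limit of [Tm t (ind B)] is a multiple of the ground state; pairing with the invariant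
    ground state identifies the factor as its weighted integral over [B]. *)
Theorem ground_profile : exists phi : plane -> R,
  [/\ {in D, continuous phi}, forall x, D x -> 0 < phi x, l2 mu D phi,
      \int[mu]_(x in D) (phi x ^+ 2 * f x) = 1 &
      forall B x, okB B -> D x ->
        expR (m * t) * U t B x @[t --> +oo] --> phi x * \int[mu]_(y in B) (phi y * f y)].
Proof.
have [phi [fphi n1 ppos one]] := ground_state.
have vae := vers_ae fphi; have cv := @vers_continuous phi.
have mv : measurable_fun D (vers phi) by exact: (continuous_measurable_plane oD cv).
have i2 : \int[mu]_(x in D) (vers phi x ^+ 2 * f x) = 1 /\ mu.-integrable D (EFin \o (fun x => vers phi x ^+ 2)).
  have ml : mu.-integrable D (EFin \o (fun x => phi x ^+ 2)) := l2_sqr_int (L2rP phi).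
  split.
    rewrite -[RHS](expr1n _ 2) -n1 (sqr_ipn H); congr fine; apply: ae_eq_integral => //.
    - by apply/measurable_EFinP; apply: measurable_funM => //; exact: measurable_funX.
    - exact: (measurable_int _ (ip_int phi phi)).
    - by apply: (ae_imp _ vae) => x hx Dx /=; rewrite hx// expr2.
  have me : measurable_fun D (EFin \o (fun x => vers phi x ^+ 2)) by apply/measurable_EFinP; exact: measurable_funX.
  have /integrableP[mp fin] := ml; apply/integrableP; split => //.
  rewrite (_ : (\int[mu]_(x in D) _ = \int[mu]_(x in D) `|(phi x ^+ 2)%:E|)%E)//.
  apply: ae_eq_integral => //; [exact: measurableT_comp|exact: measurableT_comp|].
  by apply: (ae_imp _ vae) => x hx Dx /=; rewrite hx.
exists (vers phi); split => //.
- apply: fixed_pos => //; last by rewrite n1; exact/eqP/oner_neq0.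
  by apply: (ae_imp _ ppos) => y hy Dy; exact/ltW/hy.
- by apply: l2P => //; have [] := i2.
- by have [] := i2.
move=> B x okB1 Dx; set lam := ip phi (ind B).
have hlam : \int[mu]_(y in B) (vers phi y * f y) = lam.
  have iB : mu.-integrable D (EFin \o (fun y => phi y * ind B y * f y)) := ip_int phi (ind B).
  have -> : lam = \int[mu]_(y in D) (vers phi y * ind B y * f y).
    congr fine; apply: ae_eq_integral => //.
    - exact: (measurable_int _ iB).
    - by apply/measurable_EFinP; apply: measurable_funM => //; apply: measurable_funM => //; exact: l2_meas (L2rP (ind B)).
    - by apply: (ae_imp _ vae) => y hy Dy /=; rewrite hy.
  exact: int_ind.
rewrite hlam; have [th [cth fth]] := limit_fixed (ind B).
have tl : ip th phi = lam.
  have c1 : ip (Tm t (ind B)) phi @[t --> +oo] --> ip th phi by apply: (cvg_ipl H).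
  have c2 : ip (Tm t (ind B)) phi @[t --> +oo] --> lam.
    apply: cvg_near_cst; exists 0; split; first exact: num_real.
    move=> t t0; apply/eqP; rewrite (sg_sym H SP SPsym SPpos _ _ (ltW t0)) (ipC H) fphi ?ltW//.
  exact: (cvg_unique _ c1 c2).
have hv : vers th x = lam * vers phi x.
  have : `|rep 1 th x - rep 1 (lam *: phi) x| <= c_ 1 * nrm (th - lam *: phi) by exact: rep_dist.
  rewrite -tl (one _ fth) mulr0 normr_le0 subr_eq0 => /eqP e; rewrite /vers e repZ//; ring.
rewrite mulrC -hv.
have key t : 1 < t -> `|expR (m * t) * U t B x - vers th x| <= expR m * (c_ 1 * nrm (Tm (t - 1) (ind B) - th)).
  move=> t1; have t10 : 0 <= t - 1 by rewrite subr_ge0 ltW.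
  have t0 : 0 < t by exact: lt_trans t1.
  have -> : expR (m * t) * U t B x = expR m * rep 1 (Tm (t - 1) (ind B)) x.
    rewrite -rep_ind// -{2}(subrK 1 t) addrC rep_D// /Tm repZ// mulrA -expRD; congr (expR _ * _); ring.
  rewrite /vers -mulrBr normrM gtr0_norm ?expR_gt0//; apply: ler_wpM2l; first exact: expR_ge0.
  exact: rep_dist.
have c0' : expR m * (c_ 1 * nrm (Tm (t - 1) (ind B) - th)) @[t --> +oo] --> (expR m * (c_ 1 * 0) : R).
  apply: cvgM; first exact: cvg_cst.
  apply: cvgM; first exact: cvg_cst.
  by apply: (cvg_comp (fun t => t - 1) (fun s => nrm (Tm s (ind B) - th)) _ cth); exact: cvg_addrr.
rewrite !mulr0 in c0'; apply/cvgrPdist_le => e e0.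
have /cvgrPdist_le/(_ e e0) n2 := c0'.
have n3 : \forall t \near +oo, (1 : R) < t by exists 1; split; [exact: num_real|].
apply: filterS2 n2 n3 => t k1 t1; rewrite distrC; apply: le_trans (key t t1) _.
by apply: le_trans k1; rewrite sub0r normrN; exact: ler_norm.
Qed.

End GroundState.
End ContinuousVersions.
End RealSemigroup.

(** * The killed process *)

Section Killing.
Context {R : realType} {d : measure_display} {W : measurableType d}.
Local Notation plane := (R * R)%type.
Variables (P : R.-pker plane ~> W) (X : R -> W -> plane) (a : R).
Hypotheses (a0 : 0 < a) (cX : continuous_strong_markov P X).
Local Notation D := (strip a).
Local Notation C := (boundary (strip a)).

(** A continuous function that vanishes exactly on the boundary of the strip; it turns the hitting
    time into a condition on a real valued path. *)
Definition gap (x : plane) : R := `| `|x.2| - a |.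

Lemma gap_continuous : continuous gap.
Proof.
move=> x; apply: cvg_norm; apply: cvgB; last exact: cvg_cst.
by apply: cvg_norm; exact: cvg_snd.
Qed.

Lemma boundary_strip (x : plane) : C x <-> gap x = 0.
Proof.
have -> : (gap x = 0) <-> (`|x.2| = a) by rewrite /gap; split => [/eqP|->]; rewrite ?subrr ?normr0// normr_eq0 subr_eq0 => /eqP.
have oD : open D := @strip_open R a.
split => [[cl /= ni]|e].
  apply/eqP; rewrite eq_le; apply/andP; split; rewrite leNgt; apply/negP => h.
    have cn : `|y.2| @[y --> x] --> `|x.2| by apply: cvg_norm; exact: cvg_snd.
    have /cl[y [/= Dy hy]] : nbhs x [set y : plane | a < `|y.2|] by exact: cvgr_gt cn _ h.
    by move: Dy; rewrite /strip /= -ltr_norml ltNge (ltW hy).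
  by apply: ni; apply: open_nbhs_nbhs; split => //; rewrite /strip /= -ltr_norml.
split => [V /nbhs_ballP[r /= r0 hO]|/interior_subset h]; last first.
  by move: h; rewrite /strip /= -ltr_norml e ltxx.
pose t := Num.min 1 (r / (2 * a)); have t0 : 0 < t by rewrite lt_min ltr01 divr_gt0// mulr_gt0.
have t1 : t <= 1 by rewrite ge_min lexx.
have ta : t * a < r.
  have : t <= r / (2 * a) by rewrite ge_min lexx orbT.
  by rewrite ler_pdivlMr ?mulr_gt0// mulrCA; move: (t * a) (mulr_gt0 t0 a0) => q; lra.
exists (x.1, (1 - t) * x.2); split.
  rewrite /strip /= -ltr_norml normrM e ger0_norm ?subr_ge0//.
  by rewrite gtr_pMl// ltrBlDr ltrDl.
apply: hO; split; rewrite /ball /= ?subrr ?normr0//.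
by have -> : x.2 - (1 - t) * x.2 = t * x.2; [ring|rewrite normrM e gtr0_norm].
Qed.

(** Testing rational times only keeps the event measurable; for continuous paths they decide all
    times up to [t]. *)
Definition far_until (t : R) (n : nat) : set W :=
  [set w | forall q : rat, 0 <= (ratr q : R) <= t -> n.+1%:R^-1 <= gap (X ((ratr q : R)) w)].

Lemma far_until_measurable t n : measurable (far_until t n).
Proof.
pose F k : set W := if unpickle k is Some q then
   if 0 <= (ratr q : R) <= t then X ((ratr q : R)) @^-1` (gap @^-1` `[n.+1%:R^-1, +oo[%classic) else setT else setT.
have -> : far_until t n = \bigcap_k F k.
  apply/seteqP; split => w.
    move=> h k _; rewrite /F; case: (unpickle k) => // q; case: ifP => // hq.
    by rewrite /= in_itv/= andbT; exact: h.
  by move=> h q hq; have := h (pickle q) I; rewrite /F pickleK hq /= in_itv/= andbT.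
apply: bigcap_measurable => // k _; rewrite /F; case: (unpickle k) => // q; case: ifP => // /andP[q0 _].
rewrite -[X in measurable X]setTI; apply: (process_measurable cX q0) => //.
have mg : measurable_fun setT gap by apply: measurable_continuous => //; exact: gap_continuous.
by rewrite -[X in measurable X]setTI; apply: mg => //; exact: measurable_itv.
Qed.

Let path w (s : R) : 0 <= s -> forall e, 0 < e -> exists2 r, 0 < r & forall u, 0 <= u -> `|u - s| < r ->
  `|gap (X s w) - gap (X u w)| < e.
Proof.
move=> s0 e e0; have cw := process_continuous cX (w := w).
have sI : `[0, +oo[%classic s by rewrite /= in_itv/= s0.
have /subspace_continuousP/(_ s sI) cs := cw.
have cg : gap (X u w) @[u --> within `[0, +oo[%classic (nbhs s)] --> gap (X s w).
  by apply: (cvg_comp (X ^~ w) gap cs); exact: gap_continuous.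
have /cvgrPdist_lt/(_ e e0)/nbhs_ballP[r /= r0 hr] := cg.
exists r => // u u0 us; apply: hr => //=; last by rewrite in_itv/= u0.
by rewrite /ball /= distrC.
Qed.

(** A path that has not met the boundary by time [t] keeps a positive gap on [[0, t]] by
    compactness. Conversely the gap at time [t] persists for a short while, which makes the infimum
    of the hitting times strictly larger than [t]. *)
Lemma survivalE t w : 0 < t -> (t%:E < hitting_time X C w)%E <-> exists n, far_until t n w.
Proof.
move=> t0; split.
  move=> ht; have pos s : 0 <= s <= t -> 0 < gap (X s w).
    move=> /andP[s0 st]; rewrite lt_def normr_ge0 andbT; apply/eqP => h.
    have : (hitting_time X C w <= s%:E)%E.
      by apply: ereal_inf_lbound; exists s => //; split => //; exact/boundary_strip.
    by move=> h'; move: (lt_le_trans ht h'); rewrite lte_fin ltNge st.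
  have cf : {within `[0, t], continuous (fun s => gap (X s w))}.
    have sub : (`[0, t]%classic : set R) `<=` `[0, +oo[%classic by move=> s; rewrite /= !in_itv/= => /andP[->].
    have cw : {within `[0, +oo[, continuous (fun s => gap (X s w))}.
      have cX' : {within `[0, +oo[, continuous (X ^~ w)} := process_continuous cX (w := w).
      by move=> s; apply: (cvg_comp _ gap (cX' s)); exact: gap_continuous.
    exact: continuous_subspaceW sub cw.
  have [s] := EVT_min (ltW t0) cf; rewrite in_itv/= => hs hmin.
  have gs := pos s hs; exists (Num.truncn (gap (X s w))^-1) => q hq.
  apply: (@le_trans _ _ (gap (X s w))); last by apply: hmin; rewrite in_itv.
  by rewrite -[leRHS]invrK lef_pV2 ?posrE ?invr_gt0//; exact/ltW/truncnS_gt.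
move=> [n hn']; pose e : R := n.+1%:R^-1; have e0 : 0 < e by rewrite invr_gt0.
have hn (q : rat) : 0 <= (ratr q : R) <= t -> e <= gap (X (ratr q) w) := hn' q.
have ge s : 0 <= s <= t -> e <= gap (X s w).
  move=> /andP[s0 st]; apply/ler_addgt0Pr => z z0; have [r r0 hr] := path w s0 z0.
  have lo : Num.max 0 (s - r) < Num.min t (s + r).
    by rewrite lt_min !gt_max; apply/andP; split; apply/andP; split; lra.
  have [q] := rat_in_itvoo lo; rewrite in_itv/= gt_max lt_min => /andP[/andP[q0 qs] /andP[qt qr]].
  have h1 := hn q ltac:(by rewrite !ltW).
  have h2 : `|(ratr q : R) - s| < r by rewrite ltr_norml; apply/andP; split; lra.
  have := hr ((ratr q : R)) (ltW q0) h2; rewrite ltr_norml => /andP[h3 _]; lra.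
have [r r0 hr] := path w (ltW t0) e0.
apply: (@lt_le_trans _ _ (t + r)%:E); first by rewrite lte_fin ltrDl.
apply: le_ereal_inf_tmp => _ [s [s0 /boundary_strip hs] <-]; rewrite lee_fin leNgt; apply/negP => sr.
have [st|ts] := leP s t.
  by have := ge s ltac:(by rewrite s0); rewrite hs leNgt e0.
have h1 := ge t ltac:(by rewrite (ltW t0) lexx).
have d1 : `|s - t| < r by rewrite gtr0_norm ?subr_gt0//; lra.
by have := hr s s0 d1; rewrite hs subr0 ger0_norm ?normr_ge0// ltNge h1.
Qed.

Definition alive t (B : set plane) : set W := [set w | B (X t w) /\ (t%:E < hitting_time X C w)%E].

Lemma alive_measurable t B : 0 < t -> measurable B -> measurable (alive t B).
Proof.
move=> t0 mB; have -> : alive t B = (X t @^-1` B) `&` \bigcup_n far_until t n.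
  apply/seteqP; split => w [h1 h2]; split => //.
    by have [n hn] := (survivalE w t0).1 h2; exists n.
  by apply/(survivalE w t0); have [n _ hn] := h2; exists n.
apply: measurableI; last by apply: bigcup_measurable => n _; exact: far_until_measurable.
by rewrite -[X in measurable X]setTI; exact: (process_measurable cX (ltW t0)).
Qed.

Lemma survival_le1 t B x : 0 < t -> measurable B -> (0 <= survival_prob P X a t B x <= 1)%E.
Proof.
move=> t0 mB; rewrite /survival_prob measure_ge0/=.
rewrite -(@prob_kernel _ _ _ _ _ P x); apply: le_measure; rewrite ?inE//; exact: (alive_measurable t0 mB).
Qed.

(** If all these probabilities vanished, so would that of the union of the events over the times
    [1 / (n + 1)]; by continuity every path starting at [x] belongs to this union. *)
Lemma survival_gt0 x : D x -> exists t B, [/\ 0 < t, okB a B & (0 < survival_prob P X a t B x)%E].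
Proof.
move=> Dx; pose b := `|x| + 1; pose B := D `&` box b; have okB1 : okB a B := okB_box a b.
pose t (n : nat) : R := n.+1%:R^-1; have t0 n : 0 < t n by rewrite invr_gt0.
have [mB _ _] := okB1; apply: contrapT => no.
have z n : P x (alive (t n) B) = 0%E.
  apply/eqP; rewrite eq_le measure_ge0 andbT leNgt; apply/negP => h; apply: no.
  by exists (t n), B.
have zU : P x (\bigcup_n alive (t n) B) = 0%E.
  apply/negligibleP; first by apply: bigcup_measurable => n _; exact: (alive_measurable (t0 n) mB).
  by apply: negligible_bigcup => n; apply/negligibleP; [exact: (alive_measurable (t0 n) mB)|exact: z].
have sub : [set w | X 0 w = x] `<=` \bigcup_n alive (t n) B.
  move=> w /= X0.
  have cw := process_continuous cX (w := w).
  have I0 : `[0, +oo[%classic (0 : R) by rewrite /= in_itv/= lexx.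
  have /subspace_continuousP/(_ 0 I0) cs := cw.
  have nB : nbhs x [set y : plane | D y /\ `|y| < b].
    apply: filterI; first by apply: open_nbhs_nbhs; split => //; exact: strip_open.
    have cn : `|y| @[y --> x] --> `|x| by apply: cvg_norm; exact: cvg_id.
    by apply: (cvgr_lt _ cn); rewrite ltrDl.
  have {}cs : X s w @[s --> within `[0, +oo[%classic (nbhs (0 : R))] --> x by rewrite -X0; exact: cs.
  have /nbhs_ballP[r /= r0 hr] := cs _ nB.
  have near s : 0 <= s < r -> D (X s w) /\ `|X s w| < b.
    move=> /andP[s0 sr]; apply: hr; last by rewrite /= in_itv/= s0.
    by rewrite /ball /= sub0r normrN ger0_norm.
  have [n nr] : exists n, t n < r.
    by exists (Num.truncn r^-1); rewrite /t -[ltRHS]invrK ltf_pV2 ?posrE ?invr_gt0//; exact: truncnS_gt.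
  exists n => //; have [h1 h2] := near (t n) ltac:(by rewrite ltW).
  split; first by split => //; have := ltW h2; rewrite plane_norm_le => /andP[].
  apply: (@lt_le_trans _ _ r%:E); first by rewrite lte_fin.
  apply: le_ereal_inf_tmp => _ [s [s0 hs] <-]; rewrite lee_fin leNgt; apply/negP => sr.
  have [Ds _] := near s ltac:(by rewrite s0); move: hs => [_]; apply.
  by apply: open_nbhs_nbhs; split => //; exact: strip_open.
have m0 : measurable [set w | X 0 w = x].
  have -> : [set w | X 0 w = x] = setT `&` X 0 @^-1` ([set x.1] `*` [set x.2]).
    by apply/seteqP; split => w /= => [->|[_ [/= h1 h2]]]//; case: (X 0 w) h1 h2 => ? ? /= -> ->; case: (x).
  by apply: (process_measurable cX (lexx 0)) => //; apply: measurableX; exact: measurable_set1.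
have := process_start cX x; have : (P x [set w | X 0 w = x] <= 0)%E.
  rewrite -zU; apply: le_measure; rewrite ?inE//.
  by apply: bigcup_measurable => n _; exact: (alive_measurable (t0 n) mB).
by move=> h e; rewrite e leNgt lte01 in h.
Qed.

End Killing.

(** * Restricting the complex semigroup to real functions *)

Section RealPart.
Context {R : realType}.
Variables (a : R) (f : R * R -> R) (c C : R).
Local Notation plane := (R * R)%type.
Local Notation mu := (leb2 R).
Local Notation D := (strip a).
Local Notation ip := (ipw (a := a) f).
Local Notation ipc := (ip2 ip).
Local Notation nrm := (ipn ip).
Local Notation L := (L2r a).
Hypotheses (a0 : 0 < a) (mf : measurable_fun D f) (c0 : 0 < c)
  (hf : forall x, D x -> c <= f x <= C) (C0 : 0 < C).
Let H := hilbert_ipw mf c0 hf.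
Let H2 := hilbert_ip2 H.
Variable T : R -> (plane -> R[i]) -> plane -> R[i].
Hypothesis hT : semigroup_exp D f (H_K a f) T.
Hypothesis realT : forall t B, 0 < t -> okB a B ->
  {ae mu, forall x, D x -> complex.Im (T t (cindic B) x) = 0}.
Let S := sgroup_T2 mf c0 hf hT.
Local Notation T2 := (T2 T).

Definition Tr t (v : L) : L := (T2 t (v, 0)).1.

Lemma toF_ind B : okB a B -> toF (ind a B, 0 : L) = cindic B.
Proof. by move=> hB; apply/funext => x; rewrite /toF /= (indE hB). Qed.

Lemma T2_rot t u g : 0 <= t -> ipc (T2 t (rot u)) g = ipc (rot (T2 t u)) g.
Proof.
move=> t0; apply: (ip2_ae mf); rewrite (T2K mf c0 hf hT)// !toF_rot (T2K mf c0 hf hT)//.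
have u2 := toF_L2 u mf c0 hf; have z2 := toF_L2 (0 : L * L) mf c0 hf.
have h1 := semigroup_linear hT (Complex 0 1) t0 u2 z2.
have h2 := semigroup_linear hT (-1) t0 z2 z2.
have z0 : (fun x => -1 * toF (0 : L * L) x + toF (0 : L * L) x) = toF (0 : L * L).
  by apply/funext => x; rewrite mulN1r addNr.
have z1 : (fun x => Complex 0 1 * toF u x + toF (0 : L * L) x) = (fun x => Complex 0 1 * toF u x).
  by apply/funext => x; rewrite -[RHS]addr0.
rewrite z0 in h2; rewrite z1 in h1; apply: (ae_imp2 _ h1 h2) => x k1 k2 Dx.
by rewrite k1// k2// mulN1r addNr addr0.
Qed.

Lemma T2_sym t u v : 0 <= t -> ipc (T2 t u) v = ipc u (T2 t v).
Proof. exact: (sg_sym H2 S (G2_sym mf c0 hf C0) (G2_pos mf c0 hf C0)). Qed.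

(** By symmetry and complex linearity, pairing the imaginary part with an indicator is, up to sign,
    pairing [v] with the imaginary part of the image of that indicator, which vanishes. *)
Lemma imag0 t (v : L) : 0 <= t -> nrm (T2 t (v, 0)).2 = 0.
Proof.
rewrite le_eqVlt => /orP[/eqP <-|t0].
  by apply: (ipn_eq0 (ip := ip)) => g; have := sg0 S (v, 0) (0, g); rewrite /ip2 /= !(ip0r H) (ip0l H) !add0r.
have h B : okB a B -> ip (T2 t (v, 0)).2 (ind a B) = 0.
  move=> hB; have iz g : ip (T2 t (ind a B, 0)).2 g = 0.
    rewrite -(ip0l H g); apply: (ipw_ae mf); apply: (ae_imp _ (realT t0 hB)) => x hx Dx.
    by have := congr1 (fun F => complex.Im (F x)) (T2K mf c0 hf hT (ind a B, 0) (ltW t0)); rewrite toF_ind// hx.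
  have e : ipc (T2 t (v, 0)) (rot (ind a B, 0)) = 0.
    rewrite T2_sym ?ltW// (ipC H2) T2_rot ?ltW// /ip2 /= (ipNl H) iz (ip0r H); ring.
  by move: e; rewrite /ip2 /= oppr0 (ip0r H) add0r.
have p1 : {ae mu, forall x, D x -> (T2 t (v, 0)).2 x <= 0}.
  by apply: (pair_le mf c0 hf) => B hB; rewrite h// mul0r.
have p2 : {ae mu, forall x, D x -> 0 <= (T2 t (v, 0)).2 x}.
  by apply: (pair_ge mf c0 hf) => B hB; rewrite h// mul0r.
apply/eqP; rewrite eq_le ipn_ge0 andbT -(ipn0 H); apply: (nrm_le_ae mf c0 hf).
by apply: (ae_imp2 _ p1 p2) => x k1 k2 Dx; rewrite (_ : (T2 t (v, 0)).2 x = 0) ?normr0//; apply/eqP; rewrite eq_le k1// k2.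
Qed.

Lemma Tr_ip t v z : 0 <= t -> ipc (T2 t (v, 0)) z = ip (Tr t v) z.1.
Proof. by move=> t0; rewrite /ip2 (ipn0_ip H _ (imag0 v t0)) addr0. Qed.

Lemma nrm_real (z : L * L) : nrm z.2 = 0 -> ipn ipc z = nrm z.1.
Proof. by move=> z0; rewrite /ipn /ip2 -[ip z.2 z.2](sqr_ipn H) z0 expr0n addr0. Qed.

Definition Gr (u v : L) := G2 f (u, 0) (v, 0).

Lemma sgroup_Tr : sgroup ip Tr Gr.
Proof.
have pairD k (u v : L) : ((k *: u + v, 0) : L * L) = k *: ((u, 0) : L * L) + (v, 0).
  by congr pair; rewrite /= scaler0 addr0.
split.
- move=> t k u v g t0; rewrite -!(Tr_ip _ (g, 0) t0) pairD; exact: (sgL S).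
- move=> t t0; have [k hk] := sgB S t0; exists k => u; have := hk (u, 0).
  rewrite (nrm_real (imag0 u t0)) (nrm_real (z := (u, 0)))//; exact: ipn0 H.
- by move=> u g; rewrite -(Tr_ip u (g, 0) (lexx 0)) (sg0 S) /ip2 /= (ip0l H) addr0.
- move=> s t u g s0 t0; apply: (etrans (esym (Tr_ip u (g, 0) (addr_ge0 s0 t0)))).
  apply: (etrans _ (Tr_ip (Tr t u) (g, 0) s0)); apply: (etrans (sgD S (u, 0) (g, 0) s0 t0)).
  by apply: (sg_eqv H2 S) => // z; rewrite Tr_ip// /ip2 /= (ip0l H) addr0.
- move=> u; apply: (squeeze_cvgr _ (cvg_cst 0) (sgC S (u, 0))).
  apply/near_rightP; exists 1 => // t _; rewrite ipn_ge0/= /ipn ler_sqrt ?(ip_ge0 H2)//.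
  by rewrite /ip2 lerDl (ip_ge0 H).
move=> u v; rewrite /Gr (sgG S).
have e t : 0 < t -> ipn ipc (t^-1 *: ((u, 0) - T2 t (u, 0)) - (v, 0)) = nrm (t^-1 *: (u - Tr t u) - v).
  move=> t0; apply: nrm_real; rewrite /= subr0 sub0r (ipnZ H) (ipnN H) imag0 ?mulr0// ltW//.
by split; apply: cvg_trans; apply: near_eq_cvg; apply/near_rightP; exists 1 => // t /andP[t0 _]; rewrite e.
Qed.

Lemma Gr_sym u v u' v' : Gr u v -> Gr u' v' -> ip v u' = ip u v'.
Proof. by move=> h h'; have := G2_sym mf c0 hf C0 h h'; rewrite /ip2 /= !(ip0l H) !addr0. Qed.

Let F := jacobi_formP mf c0 hf C0.

Lemma Gr_form u v : Gr u v -> exists2 w, u = Hpi w & ip v u = qf f w w.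
Proof.
move=> /(G2P mf c0 hf C0)[[w w'] [-> ew] hw]; exists w => //.
have := hw (w, 0); rewrite /q2 /pi2 /ip2 /= (ip0l H) addr0.
by rewrite (formC F w' 0) (_ : qf f 0 w' = 0) ?addr0// -(scale0r (0 : H10r a)) (formZl F) mul0r.
Qed.

Lemma form_op_Gr w v : form_op ip (@Hpi R a) (qf f) w v -> Gr (Hpi w) v.
Proof.
move=> hw; apply/(G2P mf c0 hf C0); exists (w, 0).
  by congr pair; rewrite -(scale0r (0 : H10r a)) (form_piZ F) scale0r.
move=> y; rewrite /q2 /ip2 /= hw (ip0l H).
by rewrite -(scale0r (0 : H10r a)) (formZl F) mul0r.
Qed.

End RealPart.

(** * The spectral bound, the limit and its uniqueness *)

Section Conclusion.
Context {R : realType}.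
Variables (a : R) (K f : R * R -> R) (T : R -> (R * R -> R[i]) -> R * R -> R[i]).
Local Notation plane := (R * R)%type.
Local Notation mu := (leb2 R).
Local Notation D := (strip a).
Hypotheses (a0 : 0 < a) (mK : measurable_fun D K)
  (bK : forall x, D x -> (`|K x|%:E <= Linfty_strip a K)%E)
  (sK : (Linfty_strip a K * (a ^+ 2)%:E < (2^-1)%:E)%E)
  (hf : jacobi_solution a K f) (hT : semigroup_exp D f (H_K a f) T).
Let c0 := f_lower a0 bK sK.
Let mf := f_measurable a0 mK bK sK hf.
Let fb x (Dx : D x) := f_bounds a0 bK sK hf Dx.
Let C0 : 0 < 2 :> R := ltr0n _ 2.
Let H := hilbert_ipw mf c0 fb.
Let F := jacobi_formP mf c0 fb C0.

Lemma bottom_below : mu.-integrable D (EFin \o K) ->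
  0 < \int[mu]_(x in D) (K x * J1 a x.2 ^+ 2 * f x) ->
  exists m, [/\ 0 <= m, m < E1 a & form_bottom (ipw f) (@Hpi R a) (qf f) m].
Proof.
move=> iK hpos; have [x hx] := trial_exists a0 mK bK sK hf iK hpos.
have i0 : 0 < ipw f (Hpi x) (Hpi x).
  rewrite lt_def (ip_ge0 H) andbT; apply/eqP => e; move: hx; rewrite e mulr0 ltNge.
  by rewrite (form_ge0 F).
have [m m0 hm] := form_bottom_exists H F (ex_intro _ x i0); exists m; split => //.
have [h _] := hm; have := le_lt_trans (h x) hx; by rewrite ltr_pM2r.
Qed.

Lemma far_near1 : slice_sup a K x1 @[x1 --> +oo] --> 0%E -> slice_sup a K x1 @[x1 --> -oo] --> 0%E ->
  forall dl, 0 < dl -> exists Rad, forall x, D x -> Rad < `|x.1| -> `|f x - 1| <= dl.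
Proof.
(* On a slice where [K] is bounded by kappa, [f] differs from 1 by at most 2 kappa a^2. *)
move=> cp cn dl d0; set e := dl / (2 * a ^+ 2).
have a2 : 0 < 2 * a ^+ 2 by rewrite mulr_gt0// exprn_gt0.
have e0 : 0 < e by rewrite divr_gt0.
have small x : D x -> (slice_sup a K x.1 < e%:E)%E -> `|f x - 1| <= dl.
  move=> Dx hx; have fin : (slice_sup a K x.1 < +oo)%E by apply: lt_trans hx _; exact: ltry.
  apply: le_trans (f_near1 a0 bK sK hf fin Dx) _.
  have h : fine (slice_sup a K x.1) <= e.
    by move: hx; case: (slice_sup a K x.1) => [r| |]//=; rewrite ?lte_fin => h; exact: ltW.
  have -> : dl = e * (2 * a ^+ 2) by rewrite /e divfK// gt_eqF.
  by rewrite [leLHS]mulrAC [leLHS]mulrC; apply: ler_wpM2r => //; exact: ltW.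
have nE : nbhs 0%E [set y : \bar R | (y < e%:E)%E].
  by apply: open_nbhs_nbhs; split; [exact: open_ereal_lt_ereal|rewrite /= lte_fin].
have [M1 [_ h1]] := cp _ nE; have [M2 [_ h2]] := cn _ nE.
exists (Num.max `|M1| `|M2|) => x Dx; rewrite gt_max => /andP[x1 x2]; apply: small => //.
have [p|n] := leP 0 x.1.
  by apply: h1; rewrite (ger0_norm p) in x1; exact: le_lt_trans (ler_norm _) x1.
apply: h2; rewrite (ltr0_norm n) in x2.
by rewrite -(opprK M2) ltrNr; apply: le_lt_trans x2; rewrite -normrN; exact: ler_norm.
Qed.

Lemma norm2_real (phi : plane -> R) : norm2 D f (fun x => ((phi x)%:C)%C) = Num.sqrt (\int[mu]_(x in D) (phi x ^+ 2 * f x)).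
Proof.
by rewrite /norm2; congr Num.sqrt; apply: eq_Rintegral => x _; rewrite /sqnormc /= expr0n addr0.
Qed.

Variables (d : measure_display) (W : measurableType d) (P : R.-pker plane ~> W) (X : R -> W -> plane).
Hypotheses (cX : continuous_strong_markov P X) (kX : killed_semigroup P X a T).

Let V t B := [set u : plane -> R | [/\ {in D, continuous u},
  ae_eq mu D (fun x => ((u x)%:C)%C) (T t (cindic B)) &
  forall x, D x -> survival_prob P X a t B x = (u x)%:E]].
Let U t B : plane -> R := xget (fun=> 0) (V t B).
Let UP t B : 0 < t -> okB a B -> V t B (U t B).
Proof. by move=> t0 [mB bB BD]; have [u hu] := kX t0 mB bB BD; exact: (@xgetI _ _ (V t B) u hu). Qed.

(** The survival probabilities provide the continuous versions [U], their values in [[0, 1]] and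
    their positivity for suitable times and sets; the semigroup is read on real functions through
    [Tr]. *)
Lemma survival_profile (m : R) : 0 <= m -> m < E1 a -> form_bottom (ipw f) (@Hpi R a) (qf f) m ->
  (forall dl, 0 < dl -> exists Rad, forall x, D x -> Rad < `|x.1| -> `|f x - 1| <= dl) ->
  exists phi : plane -> R, limit_profile P X a f (- m) phi /\ forall x, D x -> 0 < phi x.
Proof.
move=> m0 mE hm far.
have realT t B : 0 < t -> okB a B -> {ae mu, forall x, D x -> complex.Im (T t (cindic B) x) = 0}.
  by move=> t0 hB; have [_ h _] := UP t0 hB; apply: (ae_imp _ h) => x hx Dx; rewrite -hx.
have S := sgroup_Tr mf c0 fb C0 hT realT.
have Gs := Gr_sym mf c0 fb C0; have Gf := Gr_form mf c0 fb C0.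
have Uc t B : 0 < t -> okB a B -> {in D, continuous (U t B)} by move=> t0 hB; have [] := UP t0 hB.
have U01 t B x : 0 < t -> okB a B -> D x -> 0 <= U t B x <= 1.
  move=> t0 hB Dx; have [_ _ h] := UP t0 hB; have [mB _ _] := hB.
  by have := survival_le1 a0 cX x t0 mB; rewrite h// !lee_fin.
have Uae t B : 0 < t -> okB a B -> {ae mu, forall x, D x -> U t B x = Tr T t (ind a B) x}.
  move=> t0 hB; have [_ h _] := UP t0 hB; apply: (ae_imp _ h) => x hx Dx.
  have := congr1 (fun G => complex.Re (G x)) (T2K mf c0 fb hT (ind a B, 0) (ltW t0)).
  by rewrite toF_ind// -hx.
have Upos x : D x -> exists t B, [/\ 0 < t, okB a B & 0 < U t B x].
  move=> Dx; have [t [B [t0 hB h]]] := survival_gt0 a0 cX Dx; exists t, B; split => //.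
  by have [_ _ e] := UP t0 hB; rewrite e// lte_fin in h.
have Gb (u v : L2r a) : Gr f u v -> m * ipw f u u <= ipw f v u by move=> guv; have [w -> ->] := Gf _ _ guv; exact: (proj1 hm w).
have Gn e : 0 < e -> exists u v : L2r a, [/\ Gr f u v, ipn (ipw f) u = 1 & ipw f v u <= m + e].
  move=> e0; have [w [v [h1 h2 h3]]] := form_op_bottom H F m0 hm e0; exists (Hpi w), v; split => //.
    exact: (form_op_Gr mf c0 fb C0).
  by rewrite -h1.
have [c_ c_ge0 ultra] := ultracontractive mf c0 fb C0 S Gs Gf U01 Uae.
have [phi [cphi ppos l2phi nphi lim]] := ground_profile a0 mf c0 fb C0 S Gs Gf Uc U01 Uae Upos c_ge0 ultra m0 mE Gb Gn far.
exists phi; split => //; split => //.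
- by move=> x Dx; exact/ltW/ppos.
- apply/(L2_l2 _ mf c0 fb); split => //; rewrite /imF; exact: l2_0.
- by rewrite norm2_real nphi sqrtr1.
move=> B x mB bB BD Dx; have hB : okB a B by split.
apply: cvg_trans (lim B x hB Dx); apply: near_eq_cvg; exists 0; split; first exact: num_real.
by move=> t t0; have [_ _ e] := UP t0 hB; rewrite e// opprK.
Qed.

(** For the single set [Q] the two limits give [psi x * be = phi x * al] with nonzero factors, so
    the profiles are proportional; the signs and the norms make the ratio 1. *)
Lemma limit_profile_unique r phi psi : limit_profile P X a f r phi -> (forall x, D x -> 0 < phi x) ->
  limit_profile P X a f r psi -> forall x, D x -> psi x = phi x.
Proof.
move=> [cp p0 lp np limp] ppos [cq q0 lq nq limq].
have okQ := okB_box a 1; set Q := D `&` box 1 in okQ *; have [mQ bQ QD] := okQ.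
pose al := \int[mu]_(y in Q) (phi y * f y); pose be := \int[mu]_(y in Q) (psi y * f y).
have e x : D x -> psi x * be = phi x * al.
  by move=> Dx; exact: (cvg_unique _ (limq Q x mQ bQ QD Dx) (limp Q x mQ bQ QD Dx)).
have D0 : D 0 by rewrite /strip /= oppr_lt0 a0.
have fp x : D x -> 0 < f x by move=> Dx; have /andP[h _] := fb Dx; exact: lt_le_trans h.
have [lphi _] := (L2_l2 _ mf c0 fb).1 lp; pose Phi := mkL lphi.
have al0 : al != 0.
  have eal : al = ipw f (ind a Q) Phi by rewrite (ipC H) /al (int_ind f phi okQ).
  apply/eqP => z; have n0 : ipn (ipw f) (ind a Q - 0) = 0.
    rewrite subr0; apply: (null_ip0 mf c0 fb (th := Phi)).
    - by apply: aeW => y _; rewrite (indE okQ).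
    - by apply: aeW => y Dy; exact: ppos.
    - by rewrite -eal z.
  have nQ : nbhs (0 : plane) [set y : plane | D y /\ `|y| < 1].
    apply: filterI; first by apply: open_nbhs_nbhs; split => //; exact: strip_open.
    have cn : `|y| @[y --> (0 : plane)] --> `|0 : plane| by apply: cvg_norm; exact: cvg_id.
    by apply: (cvgr_lt _ cn); rewrite normr0.
  have [y [Dy y1] hy] := ae_open_exists nQ (null_ae mf c0 fb n0).
  have := hy Dy; rewrite (indE okQ) indicE mem_set; last first.
    by split => //; have := ltW y1; rewrite plane_norm_le => /andP[].
  by move/eqP; rewrite oner_eq0.
have be0 : be != 0.
  by apply/eqP => z; have := e 0 D0; rewrite z mulr0 => /esym/eqP; rewrite mulf_eq0 (negPf al0) orbF gt_eqF// ppos.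
set k := al / be; have pk x : D x -> psi x = k * phi x.
  by move=> Dx; rewrite /k mulrAC [al * _]mulrC -e// mulfK.
have k0 : 0 <= k.
  by have := q0 0 D0; rewrite pk// pmulr_lge0// ppos.
have k1 : k = 1.
  move: nq; rewrite norm2_real; have -> : \int[mu]_(x in D) (psi x ^+ 2 * f x) = k ^+ 2 * \int[mu]_(x in D) (phi x ^+ 2 * f x).
    have mD : measurable_for mu D := strip_measurable a.
    have ii := wip_int mD mf c0 fb lphi lphi.
    transitivity (\int[mu]_(x in D) (k ^+ 2 * (phi x * phi x * f x))).
      by apply: eq_Rintegral => x /set_mem Dx; rewrite (pk x Dx) /=; ring.
    by rewrite (Rint_scale mD (k ^+ 2) ii).
  by rewrite sqrtrM ?sqr_ge0// sqrtr_sqr ger0_norm// -norm2_real np mulr1.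
by move=> x Dx; rewrite pk// k1 mul1r.
Qed.

End Conclusion.

Theorem corollary6p1 (R : realType) (a : R) (K f : R * R -> R)
    (T : R -> (R * R -> R[i]) -> R * R -> R[i])
    (ha : 0 < a)
    (hKmeas : measurable_fun (strip a) K)
    (hKbound : forall x, strip a x -> (`|K x|%:E <= Linfty_strip a K)%E)
    (hKsmall : (Linfty_strip a K * (a ^+ 2)%:E < (2^-1)%:E)%E)
    (hKint : (leb2 R).-integrable (strip a) (EFin \o K))
    (hf : jacobi_solution a K f)
    (hT : semigroup_exp (strip a) f (H_K a f) T)
    (hpos : 0 < \int[leb2 R]_(x in strip a) (K x * J1 a x.2 ^+ 2 * f x)) :
  let gamma := E1 a - inf_spectrum (strip a) f (H_K a f) in
  [/\ 0 < gamma,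
      forall t, 0 <= t ->
        operator_norm (strip a) f (T t) =
        (expR (gamma * t) * expR (- E1 a * t))%:E &
      slice_sup a K x1 @[x1 --> +oo] --> 0%E ->
      slice_sup a K x1 @[x1 --> -oo] --> 0%E ->
      forall (d : measure_display) (W : measurableType d)
        (P : R.-pker (R * R)%type ~> W) (X : R -> W -> R * R),
        continuous_strong_markov P X ->
        associated_process P X a f ->
        killed_semigroup P X a T ->
        exists phi0 : R * R -> R,
          limit_profile P X a f (gamma - E1 a) phi0 /\
          forall phi, limit_profile P X a f (gamma - E1 a) phi ->
            forall x, strip a x -> phi x = phi0 x].
Proof.
have [m [m0 mE hm]] := bottom_below ha hKmeas hKbound hKsmall hf hKint hpos.
have c0 := f_lower ha hKbound hKsmall; have mf := f_measurable ha hKmeas hKbound hKsmall hf.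
have fb x (Dx : strip a x) := f_bounds ha hKbound hKsmall hf Dx; have C0 : 0 < 2 :> R := ltr0n _ 2.
move=> gamma; have eg : gamma = E1 a - m by rewrite /gamma (bottom_spectrum mf c0 fb C0 m0 hm).
split; first by rewrite eg subr_gt0.
  move=> t t0; rewrite (operator_norm_T mf c0 fb C0 m0 hm hT t0) -expRD eg; congr (expR _)%:E; ring.
move=> cp cn d W P X cX _ kX; have -> : gamma - E1 a = - m by rewrite eg; ring.
have far := far_near1 ha hKbound hKsmall hf cp cn.
have [phi [lp pp]] := survival_profile ha hKmeas hKbound hKsmall hf hT cX kX m0 mE hm far.
exists phi; split => // psi lpsi; exact: (limit_profile_unique ha hKmeas hKbound hKsmall hf lp pp lpsi).
Qed.
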